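(* Let $n\ge 1$, let $\mathcal U\subset\mathbb R^n$ be a domain, $T>0$, $Q=\mathcal U\times]0,T]$, let $\alpha<\beta$ and $M>1$. Let $u$ be a (strong) solution of $\Delta u-\partial_t u=h[u]$ in $Q$, where $h$ is the hysteresis operator with thresholds $\alpha,\beta$, such that $\sup_Q|u|\le M$. Let $z\in Q\setminus\Gamma(u)$. Then $$|\partial_t u(z)|+|D^2u(z)|\le C(\rho_0,\epsilon,M,\beta-\alpha).$$ Here $\rho_0:=\mathrm{dist}_p(z,\Gamma_v)$ and $\epsilon:=\mathrm{dist}_p(z,\partial'Q)$, and the constant $C$ depends only on the listed quantities (and on $n$).
   Context: **Hysteresis operator.** Fix $\alpha<\beta$. Let $f(s)=-1$ for $s\le\alpha$, $f(s)=1$ for $s\ge\beta$, and let $f(s)$ be two-valued ($-1$ or $1$) for $\alpha<s<\beta$. For $u\in C(\overline Q)$ the initial values of $u$ and of $h[u](x,0):=f(u(x,0))\in\{\pm1\}$ are prescribed on the bottom of $Q$. Put $E=\{z\in Q:u(z)\le\alpha\}\cup\{z\in Q:u(z)\ge\beta\}\cup(\mathcal U\times\{0\})$. For $z\in E$ set $h[u](z)=f(u(z))$ (the prescribed value if $z\in\mathcal U\times\{0\}$); for $(x,t)\in Q$ with $\alpha<u(x,t)<\beta$ set $h[u](x,t)=h[u](x,\hat t(x))$ with $\hat t(x)=\max\{s\le t:(x,s)\in E\}$. **Strong solution.** $u\in W^{2,1}_q(Q)$ with $q>n+2$ (and $u\in C(\overline Q)$, the domain of $h$), and $\Delta u-\partial_tu=h[u]$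 a.e. in $Q$. Here $W^{2,1}_q$ is the anisotropic Sobolev space with norm $\|\partial_tu\|_q+\|D^2u\|_q+\|u\|_q$; $D$ and $D^2$ denote the spatial gradient and spatial Hessian. **Free boundary.** $\Omega_\pm(u)=\{z\in Q:h[u](z)=\pm1\}$; the free boundary is $\Gamma(u)=\partial\Omega_+\cap\partial\Omega_-$, i.e. the set where $h[u]$ has a jump; $\Gamma_\alpha=\Gamma(u)\cap\{u=\alpha\}$, $\Gamma_\beta=\Gamma(u)\cap\{u=\beta\}$. If the level set $\{u=\alpha\}$ is locally not a $t$-graph, a part of it may occur inside $\Omega_-$, and then $\Gamma(u)$ may contain several components of $\Gamma_\alpha$ connected by cylindrical surfaces with generatrices parallel to the $t$-axis; the situation for $\{u=\beta\}$ is similar. $\Gamma_v$ denotes the set of all points lying in such vertical parts of $\Gamma(u)$ (in general $\Gamma_v$ is contained neither in $\{u=\alpha\}$ nor in $\{u=\beta\}$). Thus $\Gamma(u)=\Gamma_\alpha\cup\Gamma_\beta\cup\Gamma_v$. The function $u$ is $C^\infty$ in the interior of $\Omega_\pm$. **Cylinders and distance.** For $z^0=(x^0,t^0)$, $Q_r^-(z^0)=B_r(x^0)\times]t^0-r^2,t^0[$. $\partial'Q$ is the parabolic boundary of $Q$ (topological boundary minus the top). For a set $\mathcal D\subset\mathbb R^{n+1}$, $\mathrm{dist}_p(z,\mathcal D)=\sup\{r>0:Q_r^-(z)\cap\mathcal D=\emptyset\}$. *)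

(* Defs.v *)
From HB Require Import structures.
From mathcomp Require Import all_boot all_order all_algebra.
From mathcomp Require Import all_classical all_reals all_analysis.

Set Implicit Arguments.
Unset Strict Implicit.
Unset Printing Implicit Defensive.

Import Order.TTheory GRing.Theory Num.Theory.
Import numFieldNormedType.Exports.

Local Open Scope classical_set_scope.
Local Open Scope ring_scope.

(* The sigma-algebra generated by the coordinates is the Borel one. *)

Definition rV_display : measure_display -> measure_display.
Proof. exact. Qed.

Section measurable_rV.
Context {R : realType} (n : nat).

Let coord : 'I_n -> 'rV[R]_n -> measurableTypeR R := fun i x => x ord0 i.

Let rV_set0 : g_sigma_preimage coord set0.
Proof. exact: sigma_algebra0. Qed.

Let rV_setC A : g_sigma_preimage coord A -> g_sigma_preimage coord (~` A).
Proof. exact: sigma_algebraC. Qed.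

Let rV_bigcup (F : _^nat) : (forall i, g_sigma_preimage coord (F i)) ->
  g_sigma_preimage coord (\bigcup_i (F i)).
Proof. exact: sigma_algebra_bigcup. Qed.

HB.instance Definition _ := @isMeasurable.Build
  (rV_display default_measure_display) 'rV[R]_n (g_sigma_preimage coord)
  rV_set0 rV_setC rV_bigcup.

End measurable_rV.

Section lebesgue_rV.
Context {R : realType}.

Definition rVcons n (p : measurableTypeR R * 'rV[R]_n) : 'rV[R]_n.+1 :=
  row_mx (p.1%:M : 'rV[R]_1) p.2.

Definition rVuncons n (x : 'rV[R]_n.+1) : measurableTypeR R * 'rV[R]_n :=
  (lsubmx (x : 'rV[R]_(1 + n)) ord0 ord0, rsubmx (x : 'rV[R]_(1 + n))).

Fixpoint lebesgue_rV n : set 'rV[R]_n -> \bar R :=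
  match n return set 'rV[R]_n -> \bar R with
  | 0 => @dirac _ 'rV[R]_0 (0 : 'rV[R]_0) R
  | m.+1 => pushforward (lebesgue_measure \x @lebesgue_rV m)%E (@rVcons m)
  end.

Lemma measurable_coord n (i : 'I_n) :
  measurable_fun [set: 'rV[R]_n]
    (fun x : 'rV[R]_n => x ord0 i : measurableTypeR R).
Proof.
move=> _ Y mY; rewrite setTI; apply: sub_sigma_algebra => /=.
rewrite -bigcup_seq/=; exists i => /=; first by rewrite mem_index_enum.
by exists Y => //; rewrite setTI.
Qed.

Lemma measurable_fun_rVP d (T : measurableType d) n (f : T -> 'rV[R]_n) :
  (forall i, measurable_fun [set: T] (fun t => f t ord0 i : measurableTypeR R)) ->
  measurable_fun [set: T] f.
Proof.
move=> mf.
pose coord i (x : 'rV[R]_n) : measurableTypeR R := x ord0 i.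
have prefS : g_sigma_preimage (fun i => coord i \o f) `<=` measurable.
  apply: smallest_sub; first exact: sigma_algebra_measurable.
  elim/big_ind : _ => // [A B hA hB C [/hA|/hB]//|i _ A [B mB <-]].
  exact: mf.
move=> _ A mA; apply: prefS; rewrite g_sigma_preimage_comp.
by exists A.
Qed.

Lemma rVconsK n : cancel (@rVcons n) (@rVuncons n).
Proof.
by case=> r v; rewrite /rVcons /rVuncons row_mxKl row_mxKr mxE eqxx mulr1n.
Qed.

Lemma rVunconsK n : cancel (@rVuncons n) (@rVcons n).
Proof.
move=> x; rewrite /rVcons /rVuncons/= -[RHS](@hsubmxK _ 1 1 n) -mx11_scalar.
by [].
Qed.

Lemma measurable_rVcons n : measurable_fun setT (@rVcons n).
Proof.
apply: measurable_fun_rVP => i.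
case: (split_ordP (i : 'I_(1 + n))) => j ->.
  rewrite (_ : (fun _ => _) = fst) //.
  by apply/funext => -[r v]; rewrite /rVcons/= (@row_mxEl R 1 1 n) mxE !ord1 eqxx mulr1n.
rewrite (_ : (fun _ => _) = (fun x : 'rV[R]_n => x ord0 j) \o snd).
  exact: measurableT_comp (measurable_coord j) measurable_snd.
by apply/funext => -[r v]; rewrite /rVcons/= (@row_mxEr R 1 1 n).
Qed.

Lemma measurable_rVuncons n : measurable_fun setT (@rVuncons n).
Proof.
apply: measurable_fun_pair => /=.
  rewrite (_ : (fun _ => _) =
    (fun x : 'rV[R]_n.+1 => x ord0 (lshift n (ord0 : 'I_1)))).
    exact: measurable_coord.
  by apply/funext => x; rewrite mxE.
apply: measurable_fun_rVP => i.
rewrite (_ : (fun _ => _) = (fun x : 'rV[R]_n.+1 => x ord0 (rshift 1 i))).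
  exact: measurable_coord.
by apply/funext => x; rewrite mxE.
Qed.

Lemma lebesgue_rV_sigma_finite_measure n :
  exists mu : {sigma_finite_measure set 'rV[R]_n -> \bar R},
    lebesgue_rV (n := n) = mu.
Proof.
elim: n => [|n [mu muE]] /=; first by exists (\d_ (0 : 'rV[R]_0)).
rewrite muE.
pose lam : {sigma_finite_measure set (measurableTypeR R) -> \bar R} :=
  @lebesgue_measure R.
have [F [UF mF]] : exists F : nat -> set (measurableTypeR R * 'rV[R]_n),
    setT = \bigcup_k F k /\
    forall k, measurable (F k) /\ ((lam \x mu) (F k) < +oo)%E.
  have /sigma_finiteP[F [TF ndF Foo]] := sigma_finiteT lam.
  have /sigma_finiteP[G [TG ndG Goo]] := sigma_finiteT mu.
  exists (fun k => F k `*` G k); split.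
    rewrite -setXTT TF TG predeqE => -[x y]; split.
      move=> [/= [k _ Fkx] [l _ Gly]]; exists (maxn k l) => //; split.
      - by move: x Fkx; exact/subsetPset/ndF/leq_maxl.
      - by move: y Gly; exact/subsetPset/ndG/leq_maxr.
    by move=> [k _ []/= ? ?]; split; exists k.
  move=> k; have [? ?] := Foo k; have [? ?] := Goo k.
  split; first exact: measurableX.
  by rewrite product_measure1E// lte_mul_pinfty// ge0_fin_numE.
have sf : sigma_finite setT (pushforward (lam \x mu)%E (@rVcons n)).
  exists (fun k => @rVuncons n @^-1` F k).
    by rewrite -preimage_bigcup -UF preimage_setT.
  move=> k; have [mFk Fkoo] := mF k; split.
    by rewrite -[X in measurable X]setTI; exact: measurable_rVuncons.
  rewrite /pushforward -comp_preimage (_ : _ \o _ = id)//.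
  by apply/funext => p /=; rewrite rVconsK.
pose m : {measure set 'rV[R]_n.+1 -> \bar R} :=
  @measure_function_pushforward__canonical__measure_function_Measure
    _ _ _ _ _ (lam \x mu)%E _ (@measurable_rVcons n).
by exists (HB.pack_for {sigma_finite_measure set 'rV[R]_n.+1 -> \bar R}
  (m : set _ -> _) (Measure.class m) (Measure_isSigmaFinite.Build _ _ _ m sf)).
Qed.

Section instances.
Variable n : nat.

Let lebesgue_rV0 : @lebesgue_rV n set0 = 0%E.
Proof. by have [mu ->] := lebesgue_rV_sigma_finite_measure n. Qed.

Let lebesgue_rV_ge0 A : (0 <= @lebesgue_rV n A)%E.
Proof.
by have [mu ->] := lebesgue_rV_sigma_finite_measure n; exact: measure_ge0.
Qed.

Let lebesgue_rV_sigma_additive : semi_sigma_additive (@lebesgue_rV n).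
Proof.
have [mu ->] := lebesgue_rV_sigma_finite_measure n.
exact: measure_semi_sigma_additive.
Qed.

HB.instance Definition _ := isMeasure.Build _ _ _ (@lebesgue_rV n)
  lebesgue_rV0 lebesgue_rV_ge0 lebesgue_rV_sigma_additive.

Let lebesgue_rV_sigma_finite : sigma_finite setT (@lebesgue_rV n).
Proof.
by have [mu ->] := lebesgue_rV_sigma_finite_measure n; exact: sigma_finiteT.
Qed.

HB.instance Definition _ := Measure_isSigmaFinite.Build _ _ _ (@lebesgue_rV n)
  lebesgue_rV_sigma_finite.

End instances.

End lebesgue_rV.

Section definitions.
Context {R : realType} {n : nat}.

Local Notation ST := ('rV[R]_n * R)%type.

Implicit Types (U : set 'rV[R]_n) (D E : set ST) (u g phi : ST -> R) (z : ST).

(* Euclidean (Frobenius) norm; the library norm on matrices is the sup norm. *)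
Definition norm2 m k (A : 'M[R]_(m, k)) : R :=
  Num.sqrt (\sum_i \sum_j A i j ^+ 2).

Definition domain U := [/\ U !=set0, open U & connected U].

Definition boundary D : set ST := closure D `\` D°.

Definition cylinder U (T : R) : set ST := [set z | U z.1 /\ 0 < z.2 <= T].

Definition top U (T : R) : set ST := [set z | U z.1 /\ z.2 = T].

Definition bottom U : set ST := [set z | U z.1 /\ z.2 = 0].

Definition parabolic_boundary U T : set ST :=
  boundary (cylinder U T) `\` top U T.

Definition backward_cylinder (r : R) z : set ST :=
  [set w | norm2 (w.1 - z.1) < r /\ z.2 - r ^+ 2 < w.2 < z.2].

Definition dist_p z D : \bar R :=
  ereal_sup [set r%:E | r in
    [set r : R | 0 < r /\ backward_cylinder r z `&` D = set0]].

Definition xdir (i : 'I_n) : ST := (delta_mx ord0 i, 0).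

Definition tdir : ST := (0, 1).

Definition spacetime_measure :
    {measure set ('rV[R]_n * measurableTypeR R) -> \bar R} :=
  (@lebesgue_rV R n \x @lebesgue_measure R)%E.

Local Notation mu := spacetime_measure.

(* C^oo: all iterated directional derivatives are differentiable. *)
Definition smooth phi :=
  forall (vs : seq ST) z,
    differentiable (foldr (fun v f => 'D_v f) phi vs) z.

Definition test_function D phi :=
  smooth phi /\
  exists K, [/\ compact K, K `<=` D° & forall z, ~ K z -> phi z = 0].

Definition Lq D (q : R) g := g \_ D \in Lfun mu q%:E.

Definition weak_dt D u g := forall phi, test_function D phi ->
  \int[mu]_(z in D) (u z * 'D_tdir phi z) =
    - \int[mu]_(z in D) (g z * phi z).

Definition weak_dxx D (i j : 'I_n) u g := forall phi, test_function D phi ->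
  \int[mu]_(z in D) (u z * 'D_(xdir i) ('D_(xdir j) phi) z) =
    \int[mu]_(z in D) (g z * phi z).

(* u is in W^{2,1}_q(D), with weak derivatives ut and D2u. *)
Definition W21 D (q : R) u (ut : ST -> R) (D2u : 'I_n -> 'I_n -> ST -> R) :=
  [/\ Lq D q u, Lq D q ut, forall i j, Lq D q (D2u i j),
      weak_dt D u ut & forall i j, weak_dxx D i j u (D2u i j)].

(* The values allowed for the two-valued function f at s. *)
Definition relay (alpha beta s : R) : set R :=
  [set v | [/\ v = -1 \/ v = 1, s <= alpha -> v = -1 & beta <= s -> v = 1]].

Definition switching_set U T (alpha beta : R) u : set ST :=
  [set z | cylinder U T z /\ u z <= alpha] `|`
  [set z | cylinder U T z /\ beta <= u z] `|` bottom U.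

(* The supremum is attained when u is continuous on the closed cylinder:
   the set is then closed, and it contains 0. *)
Definition switching_time E z : R := sup [set s | s <= z.2 /\ E (z.1, s)].

(* h0 x is the prescribed value of h[u] at (x, 0). *)
Definition hysteresis U T (alpha beta : R) (h0 : 'rV[R]_n -> R) u z : R :=
  let E := switching_set U T alpha beta u in
  let hE w := if w.2 == 0 then h0 w.1 else if u w <= alpha then -1 else 1 in
  if `[< E z >] then hE z else hE (z.1, switching_time E z).

Definition strong_solution U T (alpha beta q : R) (h0 : 'rV[R]_n -> R) u :=
  let Q := cylinder U T in
  [/\ {within closure Q, continuous u},
      forall x, U x -> relay alpha beta (u (x, 0)) (h0 x) &
      exists ut D2u, W21 Q q u ut D2u /\
        {ae mu, forall z, Q z ->
          \sum_i D2u i i z - ut z = hysteresis U T alpha beta h0 u z}].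

Definition phase U T alpha beta h0 u (v : R) : set ST :=
  [set z | cylinder U T z /\ hysteresis U T alpha beta h0 u z = v].

Definition free_boundary U T alpha beta h0 u : set ST :=
  boundary (phase U T alpha beta h0 u 1) `&`
  boundary (phase U T alpha beta h0 u (-1)).

(* The points of D lying on a nondegenerate t-parallel segment contained in D,
   i.e. on a generatrix of a cylindrical part of D. *)
Definition vertical_part D : set ST :=
  [set z | exists s1 s2 : R, [/\ s1 < s2, s1 <= z.2 <= s2 &
    forall s, s1 <= s <= s2 -> D (z.1, s)]].

(* Classical derivatives at z in D.  The t-derivative is relative to D, i.e.
   one-sided on the top of the cylinder; outside D the values of u are
   meaningless. *)
Definition tquotient u z (s : R) : R := (u (z.1, s) - u z) / (s - z.2).

Definition tpunctured D z : set_system R :=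
  within [set s | D (z.1, s)] z.2^'.

Definition dt D u z : R := lim (tquotient u z @ tpunctured D z).

Definition hessian u z : 'M[R]_n :=
  \matrix_(i, j) 'D_(delta_mx ord0 i) ('D_(delta_mx ord0 j)
    (fun x : 'rV[R]_n => u (x, z.2))) z.1.

Definition has_dt_hessian D u z :=
  let f (x : 'rV[R]_n) := u (x, z.2) in
  [/\ cvg (tquotient u z @ tpunctured D z),
      \forall x \near z.1, differentiable f x &
      forall j, differentiable ('D_(delta_mx ord0 j) f) z.1].

End definitions.

(* Main.v *)
(** The backward rescalings [v_k (x, t) = 4^k v (2^-k x, 4^-k t)] solve the same equation,
and the Taylor data of [v_k] are read off by convolution with the derivatives of a
smooth kernel [kap] supported in negative times.  From [k] to [k + 1] the Hessian [P_k] changes by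
[int g_k D^2 psi], which for a general bounded right-hand side [g] adds up to a logarithm.

Since [u] has a modulus of continuity, only one threshold is active in a small box; after
subtracting it, [v > 0] on the phase [A], [v <= 0] on the boundary of [A] (otherwise the free
boundary would be vertical there) and [g = 2 1_A - 1].  At a free boundary point [P_k] then
stays bounded.  Let [a_k] be the mass of [A] at scale [k].  As [v >= 0] on [A], the quadratic
form [P_k] is bounded below there, so [|P_k|^2] grows by at most [C a_k], and decreases if [P_k] is
large and [a_k] is not small.  If [a_k] is small, a maximum principle halves [sup v_k] on [A], which
nondegeneracy bounds from below: there are boundedly many such scales.  If the gradient of [v_k]
is large, [A] is nearly a half space and the increments of [P_k] are summable.

For a point off the free boundary, the bound is taken at a free boundary point of the last box
that meets both phases, and transferred by second differences; from the next scales on [g] is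
constant, [P_k] no longer changes, and it equals the Hessian of [u]. *)

(* All tools look only backward in time, as the point may lie on the top of the cylinder. Singular
   integrals are replaced by one dyadic annulus at a time: the heat kernel is cut by [eta] at scales
   1 and 1/2, and the commutators of the two cutoffs are rescalings of each other, so that they
   telescope. Without this telescoping part the Hessian changes by [2 * I (f * Th)], where [Th] is a
   nonnegative weight times a matrix; contracted with [P] it is twice that weight times the caloric
   polynomial [pt P]. So the growth of [|P|^2] is governed by the sign of [pt P] on the phase. The
   regimes do not alternate. Zooming doubles the gradient up to a bounded error; once large, it
   stays large and grows geometrically. A potential argument is run up to that scale, a summation
   after it. Small [a_k] at a single scale does not make the phase thin, as its mass may sit nearer
   to the origin. A weighted sum of the masses of the following scales is therefore carried along:
   if it is small the phase is thin and [sup v_k] is halved, and if not, it pays for the step. *)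
From HB Require Import structures.
Require Import Defs.
From mathcomp Require Import all_boot all_order all_algebra.
From mathcomp Require Import all_classical all_reals all_analysis.
From mathcomp Require Import measurable_realfun ring lra.

Set Implicit Arguments.
Unset Strict Implicit.
Unset Printing Implicit Defensive.

Import Order.TTheory GRing.Theory Num.Theory.
Import numFieldNormedType.Exports.

Local Open Scope classical_set_scope.
Local Open Scope ring_scope.

(* [lra] inspects all hypotheses, which is slow in a large context. *)
Ltac fast_lra := solve [repeat match goal with
  | H : ?T |- _ => lazymatch T with is_true _ => fail | _ = _ => fail | _ => clear H end
  end; lra] || lra.

(** * Affine changes of variables *)

Section affine_measure.
Context {R : realType}.

Lemma measurable_affine (l t : R) :
  measurable_fun [set: measurableTypeR R]
    (fun x : measurableTypeR R => l * x + t : measurableTypeR R).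
Proof. by apply: measurable_funD => //; apply: measurable_funM. Qed.

(** Uniqueness of Lebesgue measure: the image measure multiplied by [|l|] gives half-open intervals
    their length. A negative [l] moves the closed end to the other side, which does not change the
    length. *)
Lemma lebesgue_affine (l t : R) (B : set (measurableTypeR R)) :
  l != 0 -> measurable B ->
  lebesgue_measure ((fun x : measurableTypeR R => l * x + t : measurableTypeR R) @^-1` B) =
  (`|l|^-1%:E * lebesgue_measure B)%E.
Proof.
move=> l0 mB.
pose phi := (fun x : measurableTypeR R => l * x + t : measurableTypeR R).
have mphi : measurable_fun setT phi by exact: measurable_affine.
have al : 0 < `|l| by rewrite normr_gt0.
pose nl : {nonneg R} := NngNum (normr_ge0 l).
pose m := mscale nl
  (@measure_function_pushforward__canonical__measure_function_Measure
    _ _ _ _ _ (@lebesgue_measure R) _ mphi).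
suff -> : lebesgue_measure B = m B.
  by rewrite /m/= /mscale/= muleA -EFinM mulVf ?mul1e// gt_eqF.
apply: lebesgue_measure_unique => // X [[a b] /= _ <-].
rewrite /m/= /mscale/= /pushforward.
have [l_gt0|l_lt0|l_eq0] := ltgtP 0 l; last by rewrite l_eq0 eqxx in l0.
- have -> : phi @^-1` [set` `]a, b]] = [set` `](a - t) / l, (b - t) / l]].
    by apply/seteqP; split => x /=; rewrite !in_itv/= ltr_pdivrMr// ler_pdivlMr// ltrBlDr lerBrDr mulrC.
  rewrite !lebesgue_measure_itv/= !lte_fin ltr_pM2r ?invr_gt0// ltrD2r.
  case: ifP => ab; last by rewrite mule0.
  rewrite -!EFinB -EFinM; congr (_%:E); rewrite gtr0_norm//.
  by field; rewrite gt_eqF.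
- have -> : phi @^-1` [set` `]a, b]] = [set` `[(b - t) / l, (a - t) / l[].
    apply/seteqP; split => x /=; rewrite !in_itv/= ler_ndivrMr// ltr_ndivlMr// ltrBlDr lerBrDr [x * l]mulrC;
    by rewrite andbC.
  rewrite !lebesgue_measure_itv/= !lte_fin ltr_nM2r ?invr_lt0// ltrD2r.
  case: ifP => ab; last by rewrite mule0.
  rewrite -!EFinB -EFinM; congr (_%:E); rewrite ltr0_norm//.
  by field; rewrite lt_eqF.
Qed.

(** The section of a preimage is the preimage of a section, so the factor of [m2] leaves the inner
    integral, and that of [m1] comes from a pushforward. Applied along [rVcons], and then to space
    and time, it gives all Jacobians. *)
Lemma product_scaling d1 d2 (T1 : measurableType d1) (T2 : measurableType d2)
  (m1 : {sigma_finite_measure set T1 -> \bar R})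
  (m2 : {sigma_finite_measure set T2 -> \bar R})
  (h1 : T1 -> T1) (h2 : T2 -> T2) (c1 c2 : R) :
  measurable_fun setT h1 -> measurable_fun setT h2 -> 0 <= c1 -> 0 <= c2 ->
  (forall B, measurable B -> m1 (h1 @^-1` B) = (c1%:E * m1 B)%E) ->
  (forall B, measurable B -> m2 (h2 @^-1` B) = (c2%:E * m2 B)%E) ->
  forall B, measurable B ->
  (m1 \x m2)%E ((fun z => (h1 z.1, h2 z.2)) @^-1` B) = ((c1 * c2)%:E * (m1 \x m2)%E B)%E.
Proof.
move=> mh1 mh2 c10 c20 H1 H2 B mB.
rewrite /product_measure1/=.
have mF : measurable_fun setT (fun x => m2 (xsection B x)).
  exact: measurable_fun_xsection.
transitivity (\int[m1]_x (c2%:E * m2 (xsection B (h1 x))))%E.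
  apply: eq_integral => x _ /=.
  rewrite -H2; last exact: measurable_xsection.
  congr (m2 _); apply/seteqP; split=> y; rewrite /xsection/= !inE//=.
rewrite ge0_integralZl//; last first.
  exact: (measurableT_comp mF mh1).
have := @ge0_integral_pushforward _ _ _ _ _ _ mh1 m1 setT (fun x => m2 (xsection B x)) measurableT mF (fun _ _ => measure_ge0 _ _).
rewrite preimage_setT /comp => <-.
pose nc1 : {nonneg R} := NngNum c10.
transitivity (c2%:E * \int[mscale nc1 m1]_x m2 (xsection B x))%E.
  congr (_ * _)%E; apply: eq_measure_integral => C mC _.
  exact: H1.
by rewrite ge0_integral_mscale//= muleA -EFinM [c1 * _]mulrC.
Qed.

Lemma measurable_affine_rV n (l : R) (v : 'rV[R]_n) :
  measurable_fun setT (fun x : 'rV[R]_n => l *: x + v).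
Proof.
apply: measurable_fun_rVP => i.
rewrite (_ : (fun _ => _) =
  (fun y : measurableTypeR R => l * y + v ord0 i : measurableTypeR R) \o
  (fun x : 'rV[R]_n => x ord0 i : measurableTypeR R)).
  exact: measurableT_comp (measurable_affine _ _) (measurable_coord i).
by apply/funext => x; rewrite !mxE.
Qed.

Lemma lebesgue_rV_affine n (l : R) (v : 'rV[R]_n) (B : set 'rV[R]_n) :
  l != 0 -> measurable B ->
  lebesgue_rV ((fun x => l *: x + v) @^-1` B) =
  ((`|l|^-1 ^+ n)%:E * lebesgue_rV B)%E.
Proof.
move=> l0; elim: n v B => [|n IH] v B mB /=.
  rewrite expr0 mul1e; congr (_ _); apply/seteqP.
  by split => x /=; rewrite (_ : l *: x + v = x)//; apply/rowP => -[].
rewrite /pushforward.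
pose v0 := v ord0 ord0; pose v1 : 'rV[R]_n := @rsubmx R 1 1 n v.
pose h1 := fun x : measurableTypeR R => l * x + v0 : measurableTypeR R.
pose h2 := fun x : 'rV[R]_n => l *: x + v1.
have E p : l *: @rVcons R n p + v = @rVcons R n (h1 p.1, h2 p.2).
  case: p => r x; rewrite /rVcons /h1 /h2 /=; apply/rowP => i.
  case: (split_ordP (i : 'I_(1 + n))) => j ->.
    rewrite mxE mxE !(@row_mxEl R 1 1 n) !mxE !ord1 eqxx !mulr1n; congr (_ + v _ _).
    by apply/val_inj.
  by rewrite mxE mxE !(@row_mxEr R 1 1 n) !mxE.
have -> : (@rVcons R n @^-1` ((fun x => l *: x + v) @^-1` B)) =
  ((fun z => (h1 z.1, h2 z.2)) @^-1` (@rVcons R n @^-1` B)).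
  by apply/seteqP; split => p /=; rewrite E.
rewrite exprS; apply: product_scaling.
- exact: measurable_affine.
- exact: measurable_affine_rV.
- by rewrite invr_ge0.
- by rewrite exprn_ge0// invr_ge0.
- by move=> C mC; exact: lebesgue_affine.
- by move=> C mC; exact: IH.
- by rewrite -[X in measurable X]setTI; exact: measurable_rVcons.
Qed.

(** Mostly used with [m = l ^+ 2]: the parabolic dilation carrying the unit scale at the origin to
    scale [l] at [z0]. Other factors make it a translation or the spatial reflection. *)
Definition affV n (l m : R) (z0 z : 'rV[R]_n * R) : 'rV[R]_n * R :=
  (l *: z.1 + z0.1, m * z.2 + z0.2).

Lemma measurable_affV n (l m : R) (z0 : 'rV[R]_n * R) :
  measurable_fun setT (affV l m z0 :
    'rV[R]_n * measurableTypeR R -> 'rV[R]_n * measurableTypeR R).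
Proof.
apply: measurable_fun_pair => /=.
  exact: measurableT_comp (measurable_affine_rV _ _) measurable_fst.
exact: measurableT_comp (measurable_affine m z0.2) measurable_snd.
Qed.

Lemma spacetime_affine n (l m : R) (z0 : 'rV[R]_n * R)
    (B : set ('rV[R]_n * measurableTypeR R)) :
  l != 0 -> m != 0 -> measurable B ->
  spacetime_measure (affV l m z0 @^-1` B) =
  ((`|l|^-1 ^+ n * `|m|^-1)%:E * spacetime_measure B)%E.
Proof.
move=> l0 m0 mB.
pose h1 := fun x : 'rV[R]_n => l *: x + z0.1.
pose h2 := fun x : measurableTypeR R => m * x + z0.2 : measurableTypeR R.
rewrite [X in spacetime_measure X](_ : _ = (fun z => (h1 z.1, h2 z.2)) @^-1` B)//.
apply: product_scaling.
- exact: measurable_affine_rV.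
- exact: measurable_affine.
- by rewrite exprn_ge0// invr_ge0.
- by rewrite invr_ge0.
- by move=> C mC; exact: lebesgue_rV_affine.
- by move=> C mC; exact: lebesgue_affine.
- exact: mB.
Qed.

Definition cube n (r : R) : set 'rV[R]_n := [set x | forall i, `|x ord0 i| <= r].

Lemma measurable_cube n (r : R) : measurable (@cube n r).
Proof.
rewrite (_ : cube r = \big[setI/setT]_(i : 'I_n)
   ((fun x : 'rV[R]_n => x ord0 i : measurableTypeR R) @^-1` `[- r, r])).
  apply: bigsetI_measurable => i _.
  rewrite -[X in measurable X]setTI; apply: measurable_coord => //.
rewrite -bigcap_seq; apply/seteqP; split=> x /= H i.
  by move=> _ /=; rewrite in_itv/= -ler_norml; exact: H.
by have /= := H i (mem_index_enum _); rewrite in_itv/= -ler_norml.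
Qed.

Lemma lebesgue_cube n (r : R) : 0 <= r -> lebesgue_rV (@cube n r) = ((2 * r) ^+ n)%:E.
Proof.
move=> r0; elim: n => [|n IH] /=.
  by rewrite diracE expr0 mem_set// => -[].
rewrite /pushforward.
rewrite (_ : _ @^-1` _ = `[- r, r] `*` @cube n r).
  rewrite product_measure1E//; last exact: measurable_cube.
  rewrite [X in (_ * X)%E](_ : _ = ((2 * r) ^+ n)%:E); last exact: IH.
  rewrite exprS EFinM; congr (_ * _)%E.
  apply: (etrans (lebesgue_measure_itv `[- r, r])); rewrite /= lte_fin.
  case: ltP => h; first by rewrite -EFinB; congr (_%:E); ring.
  by congr (_%:E); lra.
apply/seteqP; split=> -[t x] /=.
  move=> H; split; rewrite ?in_itv/=.
    by have := H (lshift n (ord0 : 'I_1)); rewrite /rVcons (@row_mxEl R 1 1 n) !mxE eqxx mulr1n -ler_norml.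
  by move=> i /=; have := H (rshift 1 i); rewrite /rVcons (@row_mxEr R 1 1 n).
rewrite in_itv/= -ler_norml => -[H1 H2] i.
case: (split_ordP (i : 'I_(1 + n))) => j ->.
  by rewrite /rVcons (@row_mxEl R 1 1 n) mxE !ord1 eqxx mulr1n.
by rewrite /rVcons (@row_mxEr R 1 1 n); exact: H2.
Qed.

End affine_measure.

(** * Integrals of bounded functions with bounded support *)

Section compactly_supported_integrals.
Context {R : realType} {n : nat}.
Local Notation V := ('rV[R]_n * R)%type.
Local Notation mV := ('rV[R]_n * measurableTypeR R)%type.
Local Notation mu := (@spacetime_measure R n).

Lemma rV_norm_leP (x : 'rV[R]_n) (r : R) : 0 <= r ->
  (`|x| <= r) <-> (forall i, `|x ord0 i| <= r).
Proof.
move=> r0; rewrite /Num.norm/= mx_normrE; split.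
  by move=> /Order.TotalTheory.bigmax_leP[_ H] i; exact: (H (ord0, i)).
move=> H; apply/Order.TotalTheory.bigmax_leP; split=> // -[i j] _ /=.
by rewrite [i]ord1; exact: H.
Qed.

Lemma rV_coord_le (x : 'rV[R]_n) i : `|x ord0 i| <= `|x|.
Proof. by have /(_ (lexx _)) := (rV_norm_leP x (normr_ge0 x)).1; apply. Qed.

Definition mfun (k : V -> R) := measurable_fun [set: mV] (k : mV -> R).
Definition inb (r : R) (z : V) := `|z.1| <= r /\ `|z.2| <= r.
Definition bm (k : V -> R) := mfun k /\ exists M, forall z, `|k z| <= M.
(** One [M] bounds both the values and the support. The class is stable under sums, affine changes
    of variables and products with bounded measurable functions, so that linearity of [I] on it
    comes without integrability conditions. *)
Definition nice (k : V -> R) :=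
  mfun k /\ exists M, forall z, `|k z| <= M /\ (k z != 0 -> inb M z).
Definition I (k : V -> R) : R := \int[mu]_(z in setT) k z.

Lemma inbW r r' z : r <= r' -> inb r z -> inb r' z.
Proof. by move=> rr [a b]; split; apply: le_trans rr. Qed.

Lemma nice_bm k : nice k -> bm k.
Proof. by move=> [mk [M H]]; split => //; exists M => z; have [] := H z. Qed.

Lemma bm_cst c : bm (fun=> c).
Proof. by split; [exact: measurable_cst|exists `|c|]. Qed.

Lemma mfunD f g : mfun f -> mfun g -> mfun (fun z => f z + g z).
Proof. by move=> *; apply: measurable_funD. Qed.
Lemma mfunM f g : mfun f -> mfun g -> mfun (fun z => f z * g z).
Proof. by move=> *; apply: measurable_funM. Qed.
Lemma mfun_norm f : mfun f -> mfun (fun z => `|f z|).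
Proof. by move=> mf; apply: measurableT_comp. Qed.
Lemma mfun_affV f l m z0 : mfun f -> mfun (fun z => f (affV l m z0 z)).
Proof. by move=> mf; apply: (measurableT_comp mf (measurable_affV l m z0)). Qed.

Lemma bmD f g : bm f -> bm g -> bm (fun z => f z + g z).
Proof.
move=> [mf [M HM]] [mg [N HN]]; split; first exact: mfunD.
by exists (M + N) => z; apply: le_trans (ler_normD _ _) _; exact: lerD.
Qed.
Lemma bmM f g : bm f -> bm g -> bm (fun z => f z * g z).
Proof.
move=> [mf [M HM]] [mg [N HN]]; split; first exact: mfunM.
by exists (M * N) => z; rewrite normrM ler_pM.
Qed.

Lemma bm_affV f l m z0 : bm f -> bm (fun z => f (affV l m z0 z)).
Proof. by move=> [mf [M HM]]; split; [exact: mfun_affV|exists M]. Qed.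

Lemma nice_mul f k : bm f -> nice k -> nice (fun z => f z * k z).
Proof.
move=> [mf [M HM]] [mk [N HN]]; split; first exact: mfunM.
have N0 : 0 <= N by apply: le_trans (HN (0, 0)).1.
exists (M * N + N) => z; have [H1 H2] := HN z; have M0 := le_trans (normr_ge0 _) (HM z).
split; first by rewrite normrM -[leLHS]addr0 lerD// ler_pM.
rewrite mulf_eq0 negb_or => /andP[_ /H2]; apply: inbW.
by rewrite lerDr mulr_ge0.
Qed.

Lemma niceD f g : nice f -> nice g -> nice (fun z => f z + g z).
Proof.
move=> [mf [M HM]] [mg [N HN]]; split; first exact: mfunD.
have N0 : 0 <= N by apply: le_trans (HN (0, 0)).1.
have M0 : 0 <= M by apply: le_trans (HM (0, 0)).1.
exists (M + N) => z; have [H1 H2] := HN z; have [H3 H4] := HM z.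
split; first by apply: le_trans (ler_normD _ _) _; exact: lerD.
have [fz|/H4] := eqVneq (f z) 0.
  by rewrite fz add0r => /H2; apply: inbW; rewrite lerDr.
by move=> h _; apply: inbW h; rewrite lerDl.
Qed.

Lemma niceZ c k : nice k -> nice (fun z => c * k z).
Proof. exact: nice_mul (bm_cst c). Qed.

Lemma niceN k : nice k -> nice (fun z => - k z).
Proof.
by move=> /(niceZ (-1)); rewrite (_ : (fun z => _) = (fun z => - k z))//; apply/funext => z; rewrite mulN1r.
Qed.

Lemma niceB f g : nice f -> nice g -> nice (fun z => f z - g z).
Proof. by move=> nf /niceN; exact: niceD. Qed.

Lemma nice0 : nice (fun=> 0).
Proof. by split; [exact: measurable_cst|exists 0 => z; rewrite normr0 eqxx]. Qed.

Lemma nice_sum (J : finType) (F : J -> V -> R) :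
  (forall j, nice (F j)) -> nice (fun z => \sum_j F j z).
Proof.
move=> H; rewrite (_ : (fun z => _) = \sum_j (F j : V -> R)); last first.
  by apply/funext => z; rewrite fct_sumE.
by elim/big_ind : _ => [|f g| j _] //; [exact: nice0|exact: niceD].
Qed.

Lemma nice_norm k : nice k -> nice (fun z => `|k z|).
Proof.
move=> [mk [M H]]; split; first exact: mfun_norm.
by exists M => z; rewrite normr_id normr_eq0; exact: H.
Qed.

Lemma nice_affV k l m z0 : l != 0 -> m != 0 -> nice k ->
  nice (fun z => k (affV l m z0 z)).
Proof.
move=> l0 m0 [mk [M H]]; split; first exact: mfun_affV.
have M0 : 0 <= M by apply: le_trans (H (0, 0)).1.
have a1 : 0 <= `|l|^-1 * (M + `|z0.1|) by rewrite mulr_ge0 ?invr_ge0 ?addr_ge0.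
have a2 : 0 <= `|m|^-1 * (M + `|z0.2|) by rewrite mulr_ge0 ?invr_ge0 ?addr_ge0.
exists (M + `|l|^-1 * (M + `|z0.1|) + `|m|^-1 * (M + `|z0.2|)) => z.
have [H1 H2] := H (affV l m z0 z); split; first by lra.
move=> /H2[/= h1 h2]; split.
  suff : `|z.1| <= `|l|^-1 * (M + `|z0.1|) by fast_lra.
  rewrite ler_pdivlMl ?normr_gt0// -normrZ.
  by rewrite -[l *: z.1](addrK z0.1) (le_trans (ler_normB _ _))// lerD2r.
suff : `|z.2| <= `|m|^-1 * (M + `|z0.2|) by fast_lra.
rewrite ler_pdivlMl ?normr_gt0// -normrM.
by rewrite -[m * z.2](addrK z0.2) (le_trans (ler_normB _ _))// lerD2r.
Qed.

Definition box (r : R) : set mV := [set z | inb r z].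

Lemma boxE r : 0 <= r -> box r = @cube R n r `*` `[- r, r].
Proof.
move=> r0; apply/seteqP; split=> z /= [h1 h2]; split => //.
- by rewrite /cube/=; exact/rV_norm_leP.
- by rewrite /= in_itv/= -ler_norml.
- exact/rV_norm_leP.
- by move: h2; rewrite /= in_itv/= -ler_norml.
Qed.

Lemma measurable_box r : 0 <= r -> measurable (box r).
Proof.
by move=> r0; rewrite boxE//; apply: measurableX => //; exact: measurable_cube.
Qed.

Lemma mu_rect (r a b : R) : 0 <= r -> a <= b ->
  mu (@cube R n r `*` `[a, b]) = ((2 * r) ^+ n * (b - a))%:E.
Proof.
move=> r0 ab; apply: (etrans (product_measure1E _ _ _ _)) => //.
  exact: measurable_cube.
rewrite EFinM; congr (_ * _)%E; first exact: lebesgue_cube.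
apply: (etrans (lebesgue_measure_itv `[a, b])); rewrite /= lte_fin.
by case: ltP => h; [rewrite -EFinB|congr (_%:E); lra].
Qed.

Lemma mu_box r : 0 <= r -> mu (box r) = ((2 * r) ^+ n.+1)%:E.
Proof.
move=> r0; rewrite boxE// mu_rect//; last by lra.
by congr (_%:E); rewrite exprSr; congr (_ * _); lra.
Qed.

Lemma nice_integrable k : nice k -> mu.-integrable setT (EFin \o (k : mV -> R)).
Proof.
move=> [mk [M H]].
have M0 : 0 <= M by apply: le_trans (H (0, 0)).1.
have -> : EFin \o (k : mV -> R) = (EFin \o (k : mV -> R)) \_ (box M).
  apply/funext => z; rewrite patchE; case: ifPn => // /negP zM /=.
  congr (_%:E); apply/eqP; apply: contrapT => /negP/(H z).2 h; apply: zM.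
  by rewrite inE.
apply: (@integrable_mkcond _ mV R mu (box M) (EFin \o (k : mV -> R)) _).1; first exact: measurable_box.
apply: measurable_bounded_integrable.
- exact: measurable_box.
- by rewrite mu_box// ltry.
- exact: measurable_funTS.
- exists M; split; first by rewrite num_real.
  by move=> x Mx y _; apply: le_trans (ltW Mx); have [] := H y.
Qed.

Lemma I_D f g : nice f -> nice g -> I (fun z => f z + g z) = I f + I g.
Proof. by move=> /nice_integrable ? /nice_integrable ?; exact: RintegralD. Qed.
Lemma I_B f g : nice f -> nice g -> I (fun z => f z - g z) = I f - I g.
Proof. by move=> /nice_integrable ? /nice_integrable ?; exact: RintegralB. Qed.
Lemma I_Z c f : nice f -> I (fun z => c * f z) = c * I f.
Proof. by move=> /nice_integrable ?; exact: RintegralZl. Qed.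
Lemma I_N f : nice f -> I (fun z => - f z) = - I f.
Proof.
by move=> nf; rewrite -mulN1r -I_Z//; congr I; apply/funext => z; rewrite mulN1r.
Qed.
Lemma I_0 : I (fun=> 0) = 0.
Proof. by rewrite /I Rintegral_cst// mul0r. Qed.
Lemma I_sum (J : finType) (F : J -> V -> R) :
  (forall j, nice (F j)) -> I (fun z => \sum_j F j z) = \sum_j I (F j).
Proof.
move=> H; rewrite (_ : (fun z => _) = \sum_j (F j : V -> R)); last first.
  by apply/funext => z; rewrite fct_sumE.
suff [] : nice (\sum_j F j) /\ I (\sum_j F j) = \sum_j I (F j) by [].
elim/big_rec2 : _ => [|j y x _ [nx Ix]]; first by split; [exact: nice0|exact: I_0].
by split; [exact: niceD|rewrite -Ix; exact: I_D].
Qed.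

Lemma ae_S (P Q : V -> Prop) : (forall z, P z -> Q z) ->
  {ae mu, forall z, P z} -> {ae mu, forall z, Q z}.
Proof. by move=> PQ; apply: (@filterS _ _ (ae_filter_ringOfSetsType mu)). Qed.

Lemma I_ae f g : nice f -> nice g -> {ae mu, forall z, f z = g z} -> I f = I g.
Proof.
move=> [mf _] [mg _] H; rewrite /I /Rintegral; congr fine.
apply: ae_eq_integral => //.
- exact/measurable_EFinP.
- exact/measurable_EFinP.
- by apply: ae_S H => z /= -> _.
Qed.

Lemma I_le f g : nice f -> nice g -> (forall z, f z <= g z) -> I f <= I g.
Proof. by move=> /nice_integrable ? /nice_integrable ? H; apply: le_Rintegral. Qed.

Lemma nice_min f g : nice f -> nice g -> nice (fun z => Num.min (f z) (g z)).
Proof.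
move=> nf ng.
have : nice (fun z => 2^-1 * (f z + g z - `|f z - g z|)).
  by apply: niceZ; apply: niceB; [exact: niceD|apply/nice_norm/niceB].
by rewrite (_ : (fun z => _) = fun z => Num.min (f z) (g z))//; apply/funext => z;
  rewrite minr_absE mulrC.
Qed.

(** The inequality almost everywhere becomes the equality almost everywhere of [f] with the minimum
    of [f] and [g], to which [I_ae] applies. *)
Lemma I_le_ae f g : nice f -> nice g -> {ae mu, forall z, f z <= g z} -> I f <= I g.
Proof.
move=> nf ng H; rewrite (@I_ae f (fun z => Num.min (f z) (g z)))//; last 2 first.
- exact: nice_min.
- by apply: ae_S H => z ?; rewrite min_l.
by apply: I_le => //; [exact: nice_min|move=> z; rewrite ge_min lexx orbT].
Qed.

Lemma I_norm f : nice f -> `|I f| <= I (fun z => `|f z|).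
Proof. by move=> /nice_integrable ?; exact: le_normr_Rintegral. Qed.

Lemma I_ge0 f : (forall z, 0 <= f z) -> 0 <= I f.
Proof. by move=> H; apply: Rintegral_ge0. Qed.

Lemma nice_indic (A : set mV) r : measurable A -> (forall z, A z -> inb r z) -> nice (\1_A).
Proof.
move=> mA H; split; first exact: measurable_indic.
exists (1 + `|r|) => z; split.
  rewrite indicE; case: (_ \in _) => //=; rewrite ?normr1 ?normr0; have := normr_ge0 r; lra.
rewrite indicE; have [|] := boolP (z \in A); rewrite ?eqxx// inE => /H h _.
by apply: inbW h; have := ler_norm r; lra.
Qed.

Lemma I_indic (A : set mV) : measurable A -> I (\1_A) = fine (mu A).
Proof.
move=> mA; rewrite /I /Rintegral; congr fine.
transitivity (\int[mu]_x (\1_A x)%:E)%E => //.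
by rewrite integral_indic// setIT.
Qed.

Lemma I_bound f c r : mfun f -> 0 <= r -> (forall z, `|f z| <= c) ->
  (forall z, f z != 0 -> inb r z) -> `|I f| <= c * (2 * r) ^+ n.+1.
Proof.
move=> mf r0 H1 H2.
have nf : nice f.
  split => //; exists (c + r) => z; split.
    by apply: (le_trans (H1 z)); rewrite lerDl.
  by move=> /H2; apply: inbW; rewrite lerDr (le_trans _ (H1 z)).
have nb : nice (\1_(box r)).
  by apply: (@nice_indic _ r) => //; exact: measurable_box.
have -> : c * (2 * r) ^+ n.+1 = I (fun z => c * \1_(box r) z).
  by rewrite I_Z// I_indic ?mu_box//; exact: measurable_box.
apply: (le_trans (I_norm nf)); apply: I_le; first exact: nice_norm.
  exact: niceZ.
move=> z; rewrite indicE; have [_|/negP zr] := boolP (z \in _); rewrite ?mulr1//= mulr0.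
rewrite normr_le0; apply/eqP; apply: contrapT => /eqP/H2 h; apply: zr.
by rewrite inE.
Qed.

Lemma I_affV k l m z0 : l != 0 -> m != 0 -> nice k ->
  I (fun z => k (affV l m z0 z)) = `|l|^-1 ^+ n * `|m|^-1 * I k.
Proof.
move=> l0 m0 nk; pose phi := affV l m z0 : mV -> mV.
have mphi : measurable_fun setT phi by exact: measurable_affV.
have ik' := nice_integrable (nice_affV z0 l0 m0 nk).
have cge0 : 0 <= `|l|^-1 ^+ n * `|m|^-1.
  by rewrite mulr_ge0 ?invr_ge0// exprn_ge0 ?invr_ge0.
have mk : measurable_fun setT (EFin \o (k : mV -> R)).
  by apply/measurable_EFinP; case: nk.
rewrite /I /Rintegral.
have := @integral_pushforward _ _ _ _ _ _ mphi mu setT (EFin \o k) mk ik' measurableT.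
rewrite preimage_setT /comp => <-.
pose nc : {nonneg R} := NngNum cge0.
transitivity (fine (\int[mscale nc mu]_x (k x)%:E)%E).
  congr fine; apply: eq_measure_integral => C mC _.
  exact: spacetime_affine.
have ik := nice_integrable nk.
rewrite [in LHS]integralE [in X in _ = _ * X]integralE !ge0_integral_mscale//; last 2 first.
- exact: measurable_funeneg.
- exact: measurable_funepos.
rewrite -(fineK (integrable_pos_fin_num measurableT ik)).
rewrite -(fineK (integrable_neg_fin_num measurableT ik)).
by rewrite /= mulrBr.
Qed.

Lemma I_shift k z0 : nice k -> I (fun z => k (z.1 + z0.1, z.2 + z0.2)) = I k.
Proof.
move=> nk; have := @I_affV k 1 1 z0 (oner_neq0 _) (oner_neq0 _) nk.
rewrite normr1 invr1 expr1n !mul1r => <-; congr I; apply/funext => z.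
by rewrite /affV scale1r mul1r.
Qed.

End compactly_supported_integrals.

(** * Smooth functions *)

Section differentiability.
Context {R : realType}.

(** A bounded linear [L] is continuous, hence the differential by uniqueness. Differentiability and
    all directional derivatives come out together, the form used throughout. *)
Lemma eps_diff (W : normedModType R) (f L : W -> R) (z : W) (C : R) :
  linear (L : W -> R^o) -> (forall h, `|L h| <= C * `|h|) ->
  (forall e, 0 < e -> exists2 d, 0 < d &
    forall h, `|h| < d -> `|f (z + h) - f z - L h| <= e * `|h|) ->
  differentiable f z /\ forall v, 'D_v f z = L v.
Proof.
move=> Ll LC H.
pose L' : {linear W -> R^o} := HB.pack L (GRing.isLinear.Build _ _ _ _ L Ll).
have cL : continuous (L' : W -> R).
  move=> x; apply/cvgrPdist_lt => e e0.
  have d0 : 0 < e / (`|C| + 1) by rewrite divr_gt0// ltr_wpDl.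
  apply: filterS (nbhsx_ballx x _ d0) => y; rewrite -ball_normE /= => xy.
  rewrite -(linearB L') /=.
  apply: (@le_lt_trans _ _ (`|C| * `|x - y|)).
    by apply: le_trans (LC _) _; rewrite ler_wpM2r// ler_norm.
  apply: (@le_lt_trans _ _ ((`|C| + 1) * `|x - y|)); first by rewrite ler_wpM2r// lerDl.
  by rewrite mulrC -ltr_pdivlMr ?ltr_wpDl.
have E : f \o shift z = cst (f z) + (L' : W -> R) +o_ (0 : W) id.
  apply/eqaddoP => e e0; have [d d0 Hd] := H e e0.
  near=> h.
  have -> : (f \o shift z - (cst (f z) + (L' : W -> R))) h = f (z + h) - f z - L h.
    by rewrite /GRing.add/= /GRing.opp/= [h + z]addrC opprD addrA.
  apply: Hd; near: h; apply: nbhs0_lt; exact: d0.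
have dE := diff_unique cL E.
have df : differentiable f z.
  by apply/diff_locallyP; rewrite dE; split.
by split => // v; rewrite (deriveE _ df) dE.
Unshelve. all: by end_near. Qed.

Lemma diff_eps (W : normedModType R) (f : W -> R) (z : W) :
  differentiable f z -> forall e, 0 < e -> exists2 d, 0 < d &
    forall h, `|h| < d -> `|f (z + h) - f z - 'd f z h| <= e * `|h|.
Proof.
move=> /diff_locally /eqaddoP H e /H/= /nbhs0P/nbhs_ex[d Hd].
exists d%:num => // h hd; have := Hd h; rewrite -ball_normE /= sub0r normrN => /(_ hd)/=.
rewrite add0r; have -> // : (f \o shift z - (cst (f z) + 'd f z)) h = f (z + h) - f z - 'd f z h.
by rewrite /GRing.add/= /GRing.opp/= [h + z]addrC opprD addrA.
Qed.

Lemma chain1 (W : normedModType R) (g : W -> R) (f : R -> R) (z : W) (df : R) :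
  is_derive (g z) 1 f df -> differentiable g z ->
  differentiable (fun w => f (g w)) z /\ forall v, 'D_v (fun w => f (g w)) z = df * 'D_v g z.
Proof.
move=> [derf defdf] dg.
have dff : differentiable f (g z) by apply/derivable1_diffP.
have dfg : differentiable (f \o g) z by exact: differentiable_comp.
split => // v.
rewrite (_ : (fun w => _) = f \o g)// deriveE// diff_comp//= deriveE//.
by rewrite diff1E// derive1E defdf /= mulrC.
Qed.

Lemma near_diff (W : normedModType R) (f g : W -> R) (z : W) :
  (exists2 d, 0 < d & forall h, `|h| < d -> f (z + h) = g (z + h)) ->
  differentiable g z ->
  differentiable f z /\ forall v, 'D_v f z = 'D_v g z.
Proof.
move=> [d d0 fg] dg.
have cont : continuous ('d g z) by exact: diff_continuous.
have fz : f z = g z by have := fg 0; rewrite normr0 addr0; apply.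
have E : f \o shift z = cst (f z) + 'd g z +o_ (0 : W) id.
  apply/eqaddoP => e e0; have [d' d'0 Hd] := diff_eps dg e0.
  near=> h.
  have -> : (f \o shift z - (cst (f z) + 'd g z)) h = f (z + h) - f z - 'd g z h.
    by rewrite /GRing.add/= /GRing.opp/= [h + z]addrC opprD addrA.
  rewrite fz fg; last by near: h; apply: nbhs0_lt.
  by apply: Hd; near: h; apply: nbhs0_lt.
have dE := diff_unique cont E.
have df : differentiable f z by apply/diff_locallyP; rewrite dE; split.
by split => // v; rewrite (deriveE _ df) (deriveE _ dg) dE.
Unshelve. all: by end_near. Qed.

Lemma quad_diff (W : normedModType R) (f : W -> R) (z : W) (C : R) :
  f z = 0 -> (exists2 d, 0 < d & forall h, `|h| < d -> `|f (z + h)| <= C * `|h| ^+ 2) ->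
  differentiable f z /\ forall v, 'D_v f z = 0.
Proof.
move=> fz [d d0 H].
apply: (@eps_diff W f (fun=> 0) z 0).
- by move=> a x y; rewrite scaler0 addr0.
- by move=> h; rewrite normr0 mul0r.
move=> e e0; exists (Num.min d (e / (`|C| + 1))).
  by rewrite lt_min d0 divr_gt0// ltr_wpDl.
move=> h; rewrite lt_min => /andP[hd he].
rewrite fz !subr0; apply: le_trans (H _ hd) _.
rewrite expr2 mulrA ler_wpM2r//.
apply: (@le_trans _ _ ((`|C| + 1) * `|h|)).
  by rewrite ler_wpM2r// (le_trans (ler_norm _))// lerDl.
by rewrite mulrC -ler_pdivlMr ?ltr_wpDl// ltW.
Qed.

(** The flat function [exp (-1/t)] divided by [t^m]. The index makes the family closed under
    differentiation, which raises it by one and by two. *)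
Definition Eflat (m : nat) (t : R) : R :=
  if 0 < t then t^-1 ^+ m * expR (- t^-1) else 0.

Lemma exprN_expR (m : nat) (x : R) : 0 < x -> x ^+ m * expR (- x) <= m.+1`!%:R / x.
Proof.
move=> x0; have := expR_ge1Dxn m (ltW x0) => H.
rewrite expRN ler_pdivlMr// mulrAC -exprSr ler_pdivrMr ?expR_gt0// mulrC.
by rewrite -ler_pdivrMr ?ltr0n ?fact_gt0//; apply: le_trans H; rewrite lerDr.
Qed.

Lemma Eflat_ge0 m t : 0 <= Eflat m t.
Proof.
by rewrite /Eflat; case: ifP => // t0; rewrite mulr_ge0 ?expR_ge0// exprn_ge0// invr_ge0 ltW.
Qed.

(** [exprN_expR] with exponent [m + 1] bounds [t^-(m+1) exp (-1/t)] by a multiple of [t], and one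
    more factor [t] remains. The quadratic bound gives derivative 0 at the origin. *)
Lemma Eflat_quad m t : Eflat m t <= m.+2`!%:R * `|t| ^+ 2.
Proof.
rewrite /Eflat; case: ifP => t0; last by rewrite mulr_ge0.
have ti : 0 < t^-1 by rewrite invr_gt0.
have := exprN_expR m.+1 ti; rewrite invrK => H.
have -> : t^-1 ^+ m * expR (- t^-1) = (t^-1 ^+ m.+1 * expR (- t^-1)) * t.
  by rewrite exprSr -!mulrA; congr (_ * _); rewrite mulrCA mulVf ?mulr1// gt_eqF.
by rewrite gtr0_norm// expr2 mulrA ler_wpM2r// ltW.
Qed.

Lemma is_derive_Eflat m (t : R) : is_derive t 1 (Eflat m) (Eflat m.+2 t - m%:R * Eflat m.+1 t).
Proof.
have [t0|t0|<-] := ltgtP 0 t.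
- have H : is_derive t 1 (fun t : R => t^-1 ^+ m * expR (- t^-1)) (Eflat m.+2 t - m%:R * Eflat m.+1 t).
    have tn0 : t != 0 by rewrite gt_eqF.
    have dV : is_derive t 1 (fun t : R => t^-1) (- t ^- 2).
      apply: is_derive_eq; first exact: is_deriveV.
      by rewrite /GRing.scale/= mulr1.
    have dE : is_derive t 1 (fun t : R => expR (- t^-1)) (t ^- 2 * expR (- t^-1)).
      have [dN1 dN2] : is_derive t 1 (fun t : R => - t^-1) (t ^- 2).
        by apply: is_derive_eq; rewrite opprK.
      have [d1 d2] := @chain1 _ (fun t : R => - t^-1) expR t _ (is_derive_expR (- t^-1)) ((derivable1_diffP _ _).1 dN1).
      split; first by apply/derivable1_diffP.
      by rewrite d2 dN2 mulrC.
    have dX : is_derive t 1 (fun t : R => t^-1 ^+ m) (- m%:R * t^-1 ^+ m.+1).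
      have -> : (fun t : R => t^-1 ^+ m) = (fun t : R => t^-1) ^+ m by apply/funext => y; rewrite fctE.
      apply: is_derive_eq.
      rewrite /GRing.scale/=; case: m => [|m]; first by rewrite ?mulr0n ?mul0r ?scale0r ?oppr0 ?mul0r.
      rewrite /= -exprVn -mulr_natl; rewrite !exprS; ring.
    apply: is_derive_eq.
    rewrite /Eflat t0 /GRing.scale/= -exprVn !exprS; ring.
  apply: near_eq_is_derive H.
  near=> y; rewrite /Eflat ifT//; near: y; exact: lt_nbhsr.
- have -> : Eflat m.+2 t - m%:R * Eflat m.+1 t = 0.
    by rewrite /Eflat ltNge (ltW t0) /= mulr0 subr0.
  apply: (@near_eq_is_derive _ _ _ (cst 0)).
  near=> y; rewrite /Eflat ifF//; apply/negbTE; rewrite -leNgt ltW//; near: y; exact: lt_nbhsl.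
have -> : Eflat m.+2 0 - m%:R * Eflat m.+1 0 = 0 :> R.
  by rewrite /Eflat ltxx mulr0 subr0.
have [df dv] : differentiable (Eflat m) (0 : R) /\ forall v, 'D_v (Eflat m) (0 : R) = 0.
  apply: (@quad_diff _ _ _ m.+2`!%:R); first by rewrite /Eflat ltxx.
  exists 1 => // h _; rewrite add0r ger0_norm ?Eflat_ge0//; exact: Eflat_quad.
split; first by apply/derivable1_diffP.
exact: dv.
Unshelve. all: by end_near. Qed.

Lemma continuous_Eflat m : continuous (Eflat m).
Proof.
by move=> t; apply: differentiable_continuous; apply/derivable1_diffP; case: (is_derive_Eflat m t).
Qed.

End differentiability.

(** * A class of smooth functions, containing cut-off heat kernels, closed under differentiation *)

Section smooth_class.
Context {R : realType} {n : nat}.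
Local Notation V := ('rV[R]_n * R)%type.

Lemma normV (z : V) : `|z| = Num.max `|z.1| `|z.2|.
Proof. by rewrite prod_normE. Qed.

Lemma normV1 (z : V) : `|z.1| <= `|z|.
Proof. by rewrite normV le_max lexx. Qed.
Lemma normV2 (z : V) : `|z.2| <= `|z|.
Proof. by rewrite normV le_max lexx orbT. Qed.

Lemma lin_diff (L : V -> R) C : linear (L : V -> R^o) -> (forall h, `|L h| <= C * `|h|) ->
  forall z, differentiable L z /\ forall v, 'D_v L z = L v.
Proof.
move=> Ll LC z; apply: (@eps_diff _ _ L L z C) => // e e0; exists 1 => // h _.
have -> : L (z + h) = L z + L h by have := Ll 1 z h; rewrite !scale1r.
by rewrite [L z + L h]addrC addrK subrr normr0 mulr_ge0// ltW.
Qed.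

Lemma co_diff i (z : V) : differentiable (fun w : V => w.1 ord0 i) z /\
  forall v, 'D_v (fun w : V => w.1 ord0 i) z = v.1 ord0 i.
Proof.
apply: (@lin_diff _ 1) => [a x y|h]; first by rewrite !mxE.
by rewrite mul1r (le_trans (rV_coord_le _ _)) ?normV1.
Qed.

Lemma tm_diff (z : V) : differentiable (fun w : V => w.2) z /\
  forall v, 'D_v (fun w : V => w.2) z = v.2.
Proof.
apply: (@lin_diff _ 1) => [a x y|h] //; by rewrite mul1r normV2.
Qed.

Definition rho (z : V) : R := \sum_i z.1 ord0 i ^+ 2.
Definition dotV (y v : V) : R := \sum_i y.1 ord0 i * v.1 ord0 i.

(* The backward heat kernel is [Gm 0], up to a constant; [Gm m] is [(- t)^-m] times it. *)
Definition Gm (m : nat) (z : V) : R :=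
  if z.2 < 0 then
    expR (- (n%:R / 2 + m%:R) * ln (- z.2) + rho z * (4 * z.2)^-1)
  else 0.

(* [Gm] is singular at the origin only, so it needs a factor vanishing near the origin. *)
Inductive Sm : (V -> R) -> Prop :=
| Sm_cst c : Sm (fun=> c)
| Sm_co i : Sm (fun z => z.1 ord0 i)
| Sm_tm : Sm (fun z => z.2)
| Sm_D f g : Sm f -> Sm g -> Sm (fun z => f z + g z)
| Sm_M f g : Sm f -> Sm g -> Sm (fun z => f z * g z)
| Sm_V f : Sm f -> (forall z, 0 < f z) -> Sm (fun z => (f z)^-1)
| Sm_E m f : Sm f -> Sm (fun z => Eflat m (f z))
| Sm_G m f c : 0 < c -> (forall z, inb c z -> f z = 0) -> Sm f ->
    Sm (fun z => f z * Gm m z).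

Lemma Sm_Z c f : Sm f -> Sm (fun z => c * f z).
Proof. by move=> ?; apply: Sm_M => //; exact: Sm_cst. Qed.
Lemma Sm_N f : Sm f -> Sm (fun z => - f z).
Proof.
by move=> /(Sm_Z (-1)); rewrite (_ : (fun z => _) = (fun z => - f z))//; apply/funext => z; rewrite mulN1r.
Qed.
Lemma Sm_B f g : Sm f -> Sm g -> Sm (fun z => f z - g z).
Proof. by move=> ? /Sm_N; exact: Sm_D. Qed.
Lemma Sm_sum (J : finType) (F : J -> V -> R) :
  (forall j, Sm (F j)) -> Sm (fun z => \sum_j F j z).
Proof.
move=> H; rewrite (_ : (fun z => _) = \sum_j (F j : V -> R)); last first.
  by apply/funext => z; rewrite fct_sumE.
by elim/big_ind : _ => [|f g| j _] //; [exact: Sm_cst|exact: Sm_D].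
Qed.
Lemma Sm_rho : Sm rho.
Proof.
by apply: Sm_sum => i; rewrite (_ : (fun z => _) = fun z : V => z.1 ord0 i * z.1 ord0 i)//; apply: Sm_M; exact: Sm_co.
Qed.

Lemma D_add (f g : V -> R) z : differentiable f z -> differentiable g z ->
  differentiable (fun w => f w + g w) z /\
  forall v, 'D_v (fun w => f w + g w) z = 'D_v f z + 'D_v g z.
Proof.
move=> df dg; split; first exact: differentiableD.
by move=> v; apply: deriveD; exact: diff_derivable.
Qed.
Lemma D_mul (f g : V -> R) z : differentiable f z -> differentiable g z ->
  differentiable (fun w => f w * g w) z /\
  forall v, 'D_v (fun w => f w * g w) z = 'D_v f z * g z + f z * 'D_v g z.
Proof.
move=> df dg; split; first exact: differentiableM.
move=> v; apply: (etrans (deriveM _ _)); try exact: diff_derivable.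
by rewrite addrC /GRing.scale/= [g z * _]mulrC.
Qed.
Lemma D_inv (f : V -> R) z : differentiable f z -> f z != 0 ->
  differentiable (fun w => (f w)^-1) z /\
  forall v, 'D_v (fun w => (f w)^-1) z = - ('D_v f z * ((f z)^-1 * (f z)^-1)).
Proof.
move=> df dg; split; first exact: differentiableV.
move=> v; apply: (etrans (deriveV _ _)) => //; try exact: diff_derivable.
by rewrite /GRing.scale/= mulNr -expr2 exprVn mulrC.
Qed.
Lemma D_cst (c : R) z : differentiable (fun _ : V => c) z /\ forall v, 'D_v (fun _ : V => c) z = 0.
Proof. by split => [|v]; [exact: differentiable_cst|exact: derive_cst]. Qed.

Lemma D_sum (J : finType) (F : J -> V -> R) z : (forall j, differentiable (F j) z) ->
  differentiable (fun w => \sum_j F j w) z /\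
  forall v, 'D_v (fun w => \sum_j F j w) z = \sum_j 'D_v (F j) z.
Proof.
move=> H; rewrite (_ : (fun w => _) = \sum_j (F j : V -> R)); last first.
  by apply/funext => w; rewrite fct_sumE.
suff H2 : differentiable (\sum_j (F j : V -> R)) z /\
  forall v, 'D_v (\sum_j (F j : V -> R)) z = (\sum_j (fun v => 'D_v (F j) z : R)) v.
  split; first exact: H2.1.
  by move=> v; rewrite H2.2 fct_sumE.
elim/big_rec2 : _ => [|j f g _ [IH1 IH2]]; first exact: (D_cst 0 z).
have [h1 h2] := D_add (H j) IH1.
by split => // v; rewrite h2 IH2.
Qed.

Lemma D_rho (z : V) : differentiable rho z /\ forall v, 'D_v rho z = 2 * dotV z v.
Proof.
have H i : differentiable (fun w : V => w.1 ord0 i ^+ 2) z /\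
    forall v, 'D_v (fun w : V => w.1 ord0 i ^+ 2) z = 2 * (z.1 ord0 i * v.1 ord0 i).
  have [h1 h2] := co_diff i z; have [h3 h4] := D_mul h1 h1.
  rewrite (_ : (fun w : V => _) = fun w : V => w.1 ord0 i * w.1 ord0 i)//.
  split => // v; rewrite h4 h2; ring.
have [h1 h2] := D_sum (fun i => (H i).1).
split => // v; rewrite h2 /dotV mulr_sumr; apply: eq_bigr => i _; exact: (H i).2.
Qed.

Lemma rho_ge0 (z : V) : 0 <= rho z.
Proof. by apply: sumr_ge0 => i _; exact: sqr_ge0. Qed.

Lemma coord_le_rho (z : V) i : z.1 ord0 i ^+ 2 <= rho z.
Proof. by rewrite /rho (bigD1 i)//= lerDl sumr_ge0// => j _; exact: sqr_ge0. Qed.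

Lemma norm_le_rho (z : V) : `|z.1| ^+ 2 <= rho z.
Proof.
have H : `|z.1| <= Num.sqrt (rho z).
  apply/rV_norm_leP => [|i]; first exact: sqrtr_ge0.
  by rewrite -sqrtr_sqr ler_wsqrtr// coord_le_rho.
by rewrite -(sqr_sqrtr (rho_ge0 z)) lerXn2r ?nnegrE ?sqrtr_ge0.
Qed.

Lemma GmS m (z : V) : z.2 < 0 -> Gm m.+1 z = Gm m z * (- z.2)^-1.
Proof.
move=> z0; rewrite /Gm z0.
have zp : 0 < - z.2 by rewrite oppr_gt0.
rewrite -[in RHS](lnK zp) -expRN -expRD; congr expR.
by rewrite lnK//  -natr1; ring.
Qed.

Lemma cont_eps (f : V -> R) (z : V) : {for z, continuous f} -> forall e, 0 < e ->
  exists2 d, 0 < d & forall h, `|h| < d -> `|f (z + h) - f z| < e.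
Proof.
move=> /cvgrPdist_lt H e e0; have /nbhs_ex[d Hd] := H e e0.
exists d%:num => // h hd; rewrite distrC; apply: Hd.
by rewrite -ball_normE /= opprD addrA subrr sub0r normrN.
Qed.

(** At time 0 away from the spatial origin the Gaussian beats every power of time. With [s = - h.2],
    moving less than [c / 2] keeps [rho] above [c^2 / 4], so the exponent is at most [-1 / (a s)]
    with [a = 16 / c^2]; as [s <= 1], the power of [s] may be rounded to the integer [n + m], and
    [Eflat] at [a s] takes over. *)
Lemma Gm_quad m c (z : V) : 0 < c -> c <= `|z.1| -> z.2 = 0 ->
  exists K, forall h : V, `|h| < c / 2 -> `|h| < 1 -> `|Gm m (z + h)| <= K * `|h| ^+ 2.
Proof.
move=> c0 cz z2; pose a := 16 / c ^+ 2.
have a0 : 0 < a by rewrite divr_gt0// exprn_gt0.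
exists (a ^+ (n + m) * ((n + m).+2`!%:R * a ^+ 2)) => h hc h1.
have K0 : 0 <= a ^+ (n + m) * ((n + m).+2`!%:R * a ^+ 2).
  by apply: mulr_ge0; [|apply: mulr_ge0 => //]; apply: exprn_ge0 (ltW a0).
rewrite /Gm /= z2 add0r; case: ifPn => h0; last first.
  by rewrite normr0 mulr_ge0.
rewrite gtr0_norm ?expR_gt0//.
set s := - h.2; have s0 : 0 < s by rewrite oppr_gt0.
have sh : s <= `|h| by rewrite -(gtr0_norm s0) normrN normV2.
have -> : (4 * h.2)^-1 = - (4 * s)^-1 by rewrite /s mulrN invrN opprK.
have rc : c ^+ 2 / 4 <= rho (z + h).
  apply: le_trans (norm_le_rho _).
  have : c / 2 <= `|(z + h).1|.
    have : `|z.1| - `|h.1| <= `|z.1 + h.1| by rewrite -[h.1]opprK; rewrite opprK lerB_normD.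
    have := le_lt_trans (normV1 h) hc; rewrite /=; lra.
  move=> H; have -> : c ^+ 2 / 4 = (c / 2) ^+ 2 by field.
  by rewrite lerXn2r ?nnegrE// divr_ge0// ltW.
have ls : ln s <= 0 by rewrite ln_le0// (le_trans sh)// ltW.
apply: (@le_trans _ _ (expR (- ((n + m)%:R * ln s) + - (a * s)^-1))).
  rewrite ler_expR; apply: lerD.
    rewrite -mulNr ler_wnM2r// lerN2 natrD lerD2r.
    by rewrite ler_pdivrMr// ler_peMr// ler1n.
  rewrite mulrN lerN2 -ler_pdivrMr ?invr_gt0 ?mulr_gt0// invrK.
  apply: le_trans rc.
  have -> : (a * s)^-1 * (4 * s) = c ^+ 2 / 4.
    by rewrite /a; field; rewrite !gt_eqF.
  exact: lexx.
have as0 : 0 < a * s by rewrite mulr_gt0.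
have -> : expR (- ((n + m)%:R * ln s) + - (a * s)^-1) = a ^+ (n + m) * Eflat (n + m) (a * s).
  rewrite /Eflat as0 mulrA -exprMn invfM mulrA mulfV ?gt_eqF// mul1r expRD; congr (_ * _).
  by rewrite expRN expRM_natl lnK// exprVn.
rewrite -[leRHS]mulrA ler_wpM2l ?exprn_ge0 ?(ltW a0)//.
apply: le_trans (Eflat_quad _ _) _.
rewrite (gtr0_norm as0) exprMn mulrA ler_wpM2l//.
  by rewrite mulr_ge0// exprn_ge0// ltW.
by rewrite lerXn2r ?nnegrE// ltW.
Qed.

(** Only time 0 is delicate. Near the spatial origin the product vanishes with [f]; elsewhere
    [Gm_quad] makes it quadratically small, so its derivative is 0, as is the right-hand side
    there. *)
Lemma D_G m (f : V -> R) c (z : V) : 0 < c -> (forall z, inb c z -> f z = 0) -> differentiable f z ->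
  differentiable (fun w => f w * Gm m w) z /\
  forall v, 'D_v (fun w => f w * Gm m w) z = 'D_v f z * Gm m z
     + (f z * ((n%:R / 2 + m%:R) * v.2 - 2^-1 * dotV z v)) * Gm m.+1 z
     + (f z * (- (v.2 / 4 * rho z))) * Gm m.+2 z.
Proof.
move=> c0 fc df.
have [z0|z0|z0] := ltgtP z.2 0.
- pose g (w : V) := - (n%:R / 2 + m%:R) * ln (- w.2) + rho w * (4 * w.2)^-1.
  have zp : 0 < - z.2 by rewrite oppr_gt0.
  have [t1 t2] := tm_diff z.
  have [nt1 nt2] := D_mul (D_cst (-1) z).1 t1.
  have [ln1 ln2] : differentiable (fun w : V => ln (-1 * w.2)) z /\ forall v, 'D_v (fun w : V => ln (-1 * w.2)) z = (- z.2)^-1 * (- v.2).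
    have dl : is_derive (-1 * z.2) 1 (@ln R) (- z.2)^-1 by rewrite mulN1r; exact: is_derive1_ln.
    have [l1 l2] := @chain1 _ _ (fun w : V => -1 * w.2) (@ln R) z _ dl nt1.
    by split => // v; rewrite l2 nt2 (D_cst _ _).2 t2 mul0r add0r mulN1r.
  have [a1 a2] := D_mul (D_cst (- (n%:R / 2 + m%:R)) z).1 ln1.
  have [b1 b2] := D_mul (D_cst 4 z).1 t1.
  have n0 : 4 * z.2 != 0 by rewrite mulf_eq0 negb_or pnatr_eq0/= lt_eqF.
  have [c1 c2] := D_inv b1 n0.
  have [r1 r2] := D_rho z.
  have [d1 d2] := D_mul r1 c1.
  have [e1 e2] := D_add a1 d1.
  have [g1 g2] := @chain1 _ _ _ expR z _ (is_derive_expR _) e1.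
  have [p1 p2] := D_mul df g1.
  have [q1 q2] : differentiable (fun w => f w * Gm m w) z /\ forall v, 'D_v (fun w => f w * Gm m w) z =
      'D_v (fun w => f w * expR (- (n%:R / 2 + m%:R) * ln (-1 * w.2) + rho w * (4 * w.2)^-1)) z.
    apply: near_diff p1; exists (- z.2) => // h hz; rewrite /Gm ifT; last first.
      by have := le_lt_trans (normV2 h) hz; rewrite ltr_norml /= => /andP[_]; fast_lra.
    by rewrite mulN1r.
  split => // v; rewrite q2 p2 g2 e2 a2 d2 c2 b2 r2 ln2 !(D_cst _ _).2 t2 mulN1r.
  have -> : expR (- (n%:R / 2 + m%:R) * ln (- z.2) + rho z * (4 * z.2)^-1) = Gm m z by rewrite /Gm z0.
  rewrite (GmS m.+1)// (GmS m)//.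
  have zn : z.2 != 0 by rewrite lt_eqF.
  by field.
- have [q1 q2] : differentiable (fun w => f w * Gm m w) z /\ forall v, 'D_v (fun w => f w * Gm m w) z = 'D_v (fun _ : V => 0 : R) z.
    apply: near_diff (D_cst 0 z).1; exists z.2 => // h hz; rewrite /Gm ifF ?mulr0//.
    by apply/negbTE; rewrite -leNgt; have := le_lt_trans (normV2 h) hz; rewrite ltr_norml /= => /andP[+ _]; lra.
  split => // v; rewrite q2 (D_cst _ _).2 /Gm ltNge (ltW z0)/=; ring.
have E k : Gm k z = 0 by rewrite /Gm z0 ltxx.
suff [q1 q2] : differentiable (fun w => f w * Gm m w) z /\ forall v, 'D_v (fun w => f w * Gm m w) z = 0.
  by split => // v; rewrite q2 !E; ring.
have [zc|zc] := ltP `|z.1| c.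
  have [q1 q2] : differentiable (fun w => f w * Gm m w) z /\ forall v, 'D_v (fun w => f w * Gm m w) z = 'D_v (fun _ : V => 0 : R) z.
    apply: near_diff (D_cst 0 z).1; exists (c - `|z.1|); first by rewrite subr_gt0.
    move=> h hz; rewrite fc ?mul0r//; split => /=.
      have := ler_normD z.1 h.1; have := normV1 h; lra.
    rewrite z0 add0r; have := normV2 h; have := normr_ge0 z.1; lra.
  by split => // v; rewrite q2 (D_cst _ _).2.
have [K HK] := Gm_quad m c0 zc z0.
have [d d0 Hd] := cont_eps (differentiable_continuous df) ltr01.
apply: (@quad_diff _ _ _ z ((`|f z| + 1) * K)); first by rewrite E mulr0.
exists (Num.min d (Num.min (c / 2) 1)); first by rewrite !lt_min d0 ltr01 divr_gt0.
move=> h; rewrite !lt_min => /and3P[h1 h2 h3].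
rewrite normrM -mulrA ler_pM//; last exact: HK.
have := Hd h h1; have := ler_normB (f (z + h)) (f z) ; have := lerB_dist (f (z+h)) (f z); fast_lra.
Qed.

Lemma D_E m (f : V -> R) (z : V) : differentiable f z ->
  differentiable (fun w => Eflat m (f w)) z /\
  forall v, 'D_v (fun w => Eflat m (f w)) z = (Eflat m.+2 (f z) - m%:R * Eflat m.+1 (f z)) * 'D_v f z.
Proof. exact: chain1 (is_derive_Eflat m (f z)). Qed.

Lemma vanish_D (f : V -> R) c v : 0 < c -> (forall z, inb c z -> f z = 0) ->
  forall z, inb (c / 2) z -> 'D_v f z = 0.
Proof.
move=> c0 fc z [z1 z2].
have [_ ->] : differentiable f z /\ forall v, 'D_v f z = 'D_v (fun _ : V => 0 : R) z.
  apply: near_diff (D_cst 0 z).1; exists (c / 2); first by rewrite divr_gt0.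
  move=> h hc; apply: fc; split => /=.
    have := ler_normD z.1 h.1; have := normV1 h; lra.
  have := ler_normD z.2 h.2; have := normV2 h; lra.
exact: (D_cst _ _).2.
Qed.

Lemma Sm_dot (v : V) : Sm (fun z => dotV z v).
Proof. by apply: Sm_sum => i; apply: Sm_M; [exact: Sm_co|exact: Sm_cst]. Qed.

(** The reason for having the inductive class. In the case of [Gm] the derivative of the factor
    vanishes on a box of half the size, so that the constructor applies again with larger
    indices. *)
Lemma Sm_closed f : Sm f -> (forall z, differentiable f z) /\ forall v, Sm ('D_v f).
Proof.
elim=> {f} [c|i||f g _ [df Sf] _ [dg Sg]|f g Smf [df Sf] Smg [dg Sg]|f Smf [df Sf] fp|
  m f Smf [df Sf]|m f c c0 fc Smf [df Sf]].
- split=> [z|v]; first exact: (D_cst c z).1.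
  by rewrite (_ : 'D_v _ = fun=> 0); [exact: Sm_cst|apply/funext => z; rewrite (D_cst c z).2].
- split=> [z|v]; first exact: (co_diff i z).1.
  by rewrite (_ : 'D_v _ = fun=> v.1 ord0 i); [exact: Sm_cst|apply/funext => z; rewrite (co_diff i z).2].
- split=> [z|v]; first exact: (tm_diff z).1.
  by rewrite (_ : 'D_v _ = fun=> v.2); [exact: Sm_cst|apply/funext => z; rewrite (tm_diff z).2].
- split=> [z|v]; first exact: (D_add (df z) (dg z)).1.
  rewrite (_ : 'D_v _ = fun z => 'D_v f z + 'D_v g z); first exact: Sm_D.
  by apply/funext => z; rewrite (D_add (df z) (dg z)).2.
- split=> [z|v]; first exact: (D_mul (df z) (dg z)).1.
  rewrite (_ : 'D_v _ = fun z => 'D_v f z * g z + f z * 'D_v g z).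
    by apply: Sm_D; exact: Sm_M.
  by apply/funext => z; rewrite (D_mul (df z) (dg z)).2.
- have f0 z : f z != 0 by rewrite gt_eqF.
  split=> [z|v]; first exact: (D_inv (df z) (f0 z)).1.
  rewrite (_ : 'D_v _ = fun z => - ('D_v f z * ((f z)^-1 * (f z)^-1))).
    by apply/Sm_N/Sm_M => //; apply: Sm_M; exact: Sm_V.
  by apply/funext => z; rewrite (D_inv (df z) (f0 z)).2.
- split=> [z|v]; first exact: (D_E m (df z)).1.
  rewrite (_ : 'D_v _ = fun z => (Eflat m.+2 (f z) - m%:R * Eflat m.+1 (f z)) * 'D_v f z).
    by apply: Sm_M => //; apply: Sm_B; [exact: Sm_E|apply/Sm_Z/Sm_E].
  by apply/funext => z; rewrite (D_E m (df z)).2.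
split=> [z|v]; first exact: (D_G m c0 fc (df z)).1.
rewrite (_ : 'D_v _ = fun z => 'D_v f z * Gm m z
     + (f z * ((n%:R / 2 + m%:R) * v.2 - 2^-1 * dotV z v)) * Gm m.+1 z
     + (f z * (- (v.2 / 4 * rho z))) * Gm m.+2 z); last first.
  by apply/funext => z; rewrite (D_G m c0 fc (df z)).2.
apply: Sm_D; first apply: Sm_D.
- apply: (@Sm_G _ _ (c / 2)) => //; first by rewrite divr_gt0.
  exact: vanish_D.
- apply: (@Sm_G _ _ c) => //; first by move=> z /fc ->; rewrite mul0r.
  by apply: Sm_M => //; apply: Sm_B; [exact: Sm_cst|apply/Sm_Z/Sm_dot].
- apply: (@Sm_G _ _ c) => //; first by move=> z /fc ->; rewrite mul0r.
  by apply: Sm_M => //; apply/Sm_N/Sm_Z/Sm_rho.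
Qed.

Lemma Sm_smooth f : Sm f -> smooth f.
Proof.
move=> Sf vs; suff : Sm (foldr (fun v f => 'D_v f) f vs) by move=> /Sm_closed[].
by elim: vs => //= v vs /Sm_closed[].
Qed.

Lemma Sm_mfun f : Sm f -> mfun f.
Proof.
elim=> {f} [c|i||f g _ mf _ mg|f g _ mf _ mg|f _ mf fp|m f _ mf|m f c _ _ _ mf].
- exact: measurable_cst.
- exact: measurableT_comp (measurable_coord i) measurable_fst.
- exact: measurable_snd.
- exact: mfunD.
- exact: mfunM.
(* For positive [f] the inverse is [expR (- ln f)], a composition of measurable functions. *)
- rewrite /mfun (_ : (fun z => _) = (expR \o (fun x => -1 * ln x)) \o f); last first.
    by apply/funext => z /=; rewrite mulN1r expRN lnK// posrE.
  apply: measurableT_comp mf; apply: measurableT_comp => //.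
  by apply: measurable_funM => //; exact: measurable_ln.
- exact: measurableT_comp (continuous_measurable_fun (@continuous_Eflat R m)) mf.
apply: mfunM => //.
have mt : measurable_fun setT (fun z : 'rV[R]_n * measurableTypeR R => z.2 : R) by exact: measurable_snd.
have mrho : mfun rho.
  rewrite /mfun /rho; apply: measurable_sum => i.
  apply: measurable_funX.
  exact: measurableT_comp (measurable_coord i) measurable_fst.
have -> : Gm m = fun z : V => if z.2 < 0 then
    expR (- (n%:R / 2 + m%:R) * ln (- z.2) + rho z * (- expR (- ln (- (4 * z.2))))) else 0.
  apply/funext => z; rewrite /Gm; case: ifP => // z0; congr (expR (_ + _ * _)).
  have zp : 0 < - (4 * z.2) by lra.
  by rewrite expRN lnK// invrN opprK.
have mln : measurable_fun setT (@ln R) by exact: measurable_ln.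
have mopp : measurable_fun setT (fun x : R => - x) by apply: continuous_measurable_fun; exact: opp_continuous.
apply: measurable_fun_ifT => //; first exact: measurable_fun_ltr.
apply: measurableT_comp => //; apply: measurable_funD.
  apply: measurable_funM => //; apply: measurableT_comp => //.
  exact: measurableT_comp.
apply: measurable_funM => //; apply: measurableT_comp => //.
apply: measurableT_comp => //; apply: measurableT_comp => //.
apply: measurableT_comp => //; apply: measurableT_comp => //.
by apply: measurable_funM.
Qed.

Lemma Sm_continuous f : Sm f -> continuous f.
Proof. by move=> Sf z; apply: differentiable_continuous; exact: (Sm_closed Sf).1. Qed.

Lemma compact_inb r : compact [set z : V | inb r z].
Proof.
have [r0|r0] := leP 0 r; last first.
  rewrite (_ : [set z | _] = set0); first exact: compact0.
  by apply/seteqP; split => // z [z1 _]; have := normr_ge0 z.1; lra.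
rewrite (_ : [set z | _] = [set x : 'rV[R]_n | forall i, [set` `[- r, r]] (x ord0 i)] `*` [set` `[- r, r]]).
  apply: compact_setX; last exact: segment_compact.
  by apply: (@rV_compact _ _ (fun=> [set` `[- r, r]])) => i; exact: segment_compact.
apply/seteqP; split=> z /= [h1 h2]; split => //.
- by move=> i; rewrite /= in_itv/= -ler_norml; exact: (rV_norm_leP _ r0).1.
- by rewrite in_itv/= -ler_norml.
- by apply/rV_norm_leP => // i; have := h1 i; rewrite /= in_itv/= -ler_norml.
- by move: h2; rewrite in_itv/= -ler_norml.
Qed.

Definition csupp (f : V -> R) := exists r, forall z, f z != 0 -> inb r z.
Definition Cc (f : V -> R) := Sm f /\ csupp f.

Lemma Cc_bounded f : Cc f -> exists M, forall z, `|f z| <= M.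
Proof.
move=> [Sf [r fr]].
have := @continuous_compact _ _ f [set z : V | inb r z] (continuous_subspaceT (Sm_continuous Sf)) (@compact_inb r).
move=> /compact_bounded[N [_ HN]].
exists (Num.max 0 (N + 1)) => z; have [->|/fr zr] := eqVneq (f z) 0.
  by rewrite normr0 le_max lexx.
rewrite le_max; apply/orP; right; apply: HN; first by rewrite ltrDl.
by exists z.
Qed.

Lemma Cc_nice f : Cc f -> nice f.
Proof.
move=> Cf; have [M HM] := Cc_bounded Cf; case: Cf => Sf [r fr].
split; first exact: Sm_mfun.
exists (M + `|r|) => z; split; first by rewrite (le_trans (HM z))// lerDl.
move=> /fr; apply: inbW; rewrite (le_trans (ler_norm _))// lerDr.
by rewrite (le_trans _ (HM z)).
Qed.

Lemma csupp_D r (f : V -> R) (v : V) : (forall z : V, f z != 0 -> inb r z) -> forall z, 'D_v f z != 0 -> inb r z.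
Proof.
move=> fr z; apply: contra_neqP => zr.
suff : exists2 d, 0 < d & forall h : V, `|h| < d -> ~ inb r (z + h).
  move=> [d d0 H].
  have [_ ->] : differentiable f z /\ forall v, 'D_v f z = 'D_v (fun _ : V => 0 : R) z.
    apply: near_diff (D_cst 0 z).1; exists d => // h /H hr.
    by apply/eqP; apply: contrapT => /negP/fr.
  exact: (D_cst _ _).2.
have [z1|z1] := leP `|z.1| r; last first.
  exists (`|z.1| - r); first by rewrite subr_gt0.
  move=> h hd [/= hr _]; have := lerB_normD z.1 h.1; have := normV1 h; lra.
have [z2|z2] := leP `|z.2| r; first by exfalso; apply: zr.
exists (`|z.2| - r); first by rewrite subr_gt0.
by move=> h hd [/= _ hr]; have := lerB_normD z.2 h.2; have := normV2 h; lra.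
Qed.

Lemma Cc_D (v : V) f : Cc f -> Cc ('D_v f).
Proof. by move=> [Sf [r fr]]; split; [exact: (Sm_closed Sf).2|exists r; exact: csupp_D]. Qed.

Lemma Cc_add f g : Cc f -> Cc g -> Cc (fun z => f z + g z).
Proof.
move=> [Sf [r fr]] [Sg [r' gr]]; split; first exact: Sm_D.
exists (Num.max r r') => z; have [fz|/fr] := eqVneq (f z) 0.
  by rewrite fz add0r => /gr; apply: inbW; rewrite le_max lexx orbT.
by move=> h _; apply: inbW h; rewrite le_max lexx.
Qed.

Lemma Cc_mul f g : Sm f -> Cc g -> Cc (fun z => f z * g z).
Proof.
move=> Sf [Sg [r gr]]; split; first exact: Sm_M.
by exists r => z; rewrite mulf_eq0 negb_or => /andP[_ /gr].
Qed.

Lemma Cc_0 : Cc (fun=> 0).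
Proof. by split; [exact: Sm_cst|exists 0 => z; rewrite eqxx]. Qed.

Lemma Cc_sum (J : finType) (F : J -> V -> R) : (forall j, Cc (F j)) -> Cc (fun z => \sum_j F j z).
Proof.
move=> H; rewrite (_ : (fun z => _) = \sum_j (F j : V -> R)); last first.
  by apply/funext => z; rewrite fct_sumE.
by elim/big_ind : _ => [|f g| j _] //; [exact: Cc_0|exact: Cc_add].
Qed.

Definition dirs (j : option 'I_n) : V := if j is Some i then xdir i else tdir.
Definition coef (z : V) (j : option 'I_n) : R := if j is Some i then z.1 ord0 i else z.2.

Lemma coef_le z j : `|coef z j| <= `|z|.
Proof.
by case: j => [i|] /=; [rewrite (le_trans (rV_coord_le _ _))// normV1|rewrite normV2].
Qed.

Lemma sum_option (F : option 'I_n -> R) : \sum_j F j = F None + \sum_i F (Some i).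
Proof.
rewrite (bigD1 None)//= (reindex_omap Some id) /=; last by case.
by congr (_ + _); apply: eq_bigl => i; rewrite /= eqxx.
Qed.

Lemma dirs_sum (z : V) : z = \sum_i z.1 ord0 i *: xdir i + z.2 *: tdir.
Proof.
have -> : \sum_i z.1 ord0 i *: xdir i = (z.1, 0) :> V.
  rewrite [LHS]surjective_pairing; congr (_, _).
    rewrite (big_morph (fst : V -> 'rV[R]_n) (id1 := 0) (op1 := +%R))//=.
    by rewrite -row_sum_delta.
  rewrite (big_morph (snd : V -> R) (id1 := 0) (op1 := +%R))//= big1// => i _.
  by rewrite /GRing.scale/= mulr0.
have -> : z.2 *: tdir = (0, z.2) :> V.
  by apply: (congr2 pair); [exact: scaler0|exact: mulr1].
by rewrite [LHS]surjective_pairing; apply: (congr2 pair); rewrite /= ?addr0 ?add0r.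
Qed.

Lemma D_dirs (f : V -> R) w : differentiable f w ->
  forall z, 'D_z f w = \sum_j coef z j * 'D_(dirs j) f w.
Proof.
move=> df z; rewrite sum_option /= addrC [in LHS](dirs_sum z) !deriveE// linearD linear_sum linearZ.
congr (_ + _); apply: eq_bigr => i _.
by rewrite deriveE// linearZ.
Qed.

Lemma mvt0 (g g' : R -> R) M : g 0 = 0 -> (forall s : R, is_derive s 1 g (g' s)) ->
  (forall s, 0 <= s <= 1 -> `|g' s| <= M) -> forall s, 0 <= s <= 1 -> `|g s| <= M.
Proof.
move=> g0 dg HM s /andP[s0 s1].
have M0 : 0 <= M by rewrite (le_trans _ (HM 0 _))// lexx ler01.
have [->|sn0] := eqVneq s 0; first by rewrite g0 normr0.
have sp : 0 < s by rewrite lt_neqAle eq_sym sn0.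
have [|c cs E] := @MVT_segment R g g' 0 s s0 (fun x _ => dg x).
  by apply: derivable_within_continuous => x _; case: (dg x).
rewrite -[g s]subr0 -g0 E subr0 normrM (gtr0_norm sp).
move: cs; rewrite in_itv/= => /andP[c0 cs].
by rewrite -[M]mulr1 ler_pM// HM// c0 (le_trans cs).
Qed.

Lemma taylor3 (g g1 g2 g3 : R -> R) M :
  (forall s : R, is_derive s 1 g (g1 s)) -> (forall s : R, is_derive s 1 g1 (g2 s)) ->
  (forall s : R, is_derive s 1 g2 (g3 s)) -> (forall s, `|g3 s| <= M) ->
  `|g 1 - g 0 - g1 0 - 2^-1 * g2 0| <= M.
Proof.
move=> d0 d1 d2 HM.
have H2 : forall s, 0 <= s <= 1 -> `|g2 s - g2 0| <= M.
  apply: (@mvt0 (fun s => g2 s - g2 0) g3); rewrite ?subrr// => s.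
  by apply: is_derive_eq; rewrite subr0.
have H1 : forall s, 0 <= s <= 1 -> `|g1 s - g1 0 - s * g2 0| <= M.
  apply: (@mvt0 (fun s => g1 s - g1 0 - s * g2 0) (fun s => g2 s - g2 0)) => //.
    by rewrite subrr mul0r subrr.
  move=> s; apply: is_derive_eq; rewrite /GRing.scale/=; ring.
have H0 : forall s, 0 <= s <= 1 -> `|g s - g 0 - s * g1 0 - 2^-1 * (s * s) * g2 0| <= M.
  apply: (@mvt0 (fun s => g s - g 0 - s * g1 0 - 2^-1 * (s * s) * g2 0) (fun s => g1 s - g1 0 - s * g2 0)) => //.
    by rewrite !mul0r mulr0 mul0r !subrr.
  move=> s; by apply: is_derive_eq; rewrite /GRing.scale/=; field.
have := H0 1; rewrite !mul1r mulr1; apply; rewrite ler01 lexx //.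
Qed.

End smooth_class.

(** * Parabolic Taylor expansion, integration by parts, affine changes of variables *)

Section taylor.
Context {R : realType} {n : nat}.
Local Notation V := ('rV[R]_n * R)%type.

Lemma line_deriv (f : V -> R) (w z : V) (s : R) : Sm f ->
  is_derive s 1 (fun s : R => f (w + s *: z)) ('D_z f (w + s *: z)).
Proof.
move=> Sf; have df := (Sm_closed Sf).1 (w + s *: z).
have [h1 h2] : differentiable (fun s : R => f (w + s *: z)) s /\
   forall v, 'D_v (fun s : R => f (w + s *: z)) s = v * 'D_z f (w + s *: z).
  apply: (@eps_diff _ _ _ _ _ `|'D_z f (w + s *: z)|).
  - by move=> a x y; rewrite mulrDl /GRing.scale/= mulrA.
  - by move=> h; rewrite normrM mulrC.
  move=> e e0; have e1 : 0 < e / (`|z| + 1) by rewrite divr_gt0// ltr_wpDl.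
  have [d d0 Hd] := diff_eps df e1.
  exists (d / (`|z| + 1)); first by rewrite divr_gt0// ltr_wpDl.
  move=> h hd; have zp : 0 < `|z| + 1 by rewrite ltr_wpDl.
  have hz : `|h *: z| <= `|h| * (`|z| + 1) by rewrite normrZ ler_wpM2l// lerDl.
  have := Hd (h *: z); rewrite linearZ/= -deriveE// scalerDl addrA => H.
  apply: le_trans (H _) _; first by apply: le_lt_trans hz _; rewrite -ltr_pdivlMr.
  apply: (@le_trans _ _ (e / (`|z| + 1) * (`|h| * (`|z| + 1)))); first by rewrite ler_wpM2l// ltW.
  by rewrite mulrA mulrAC divfK ?gt_eqF.
split; first by apply/derivable1_diffP.
by rewrite h2 mul1r.
Qed.

Definition itD (z : V) k (f : V -> R) := iter k (fun f => 'D_z f) f.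

Lemma itD_Sm z k f : Sm f -> Sm (itD z k f).
Proof. by elim: k f => //= k IH f /IH /Sm_closed[]. Qed.

Lemma D_expand (f : V -> R) z : Sm f ->
  'D_z f = fun w => \sum_j coef z j * 'D_(dirs j) f w.
Proof. by move=> Sf; apply/funext => w; apply: D_dirs; exact: (Sm_closed Sf).1. Qed.

Lemma D_lincomb (J : finType) (c : J -> R) (F : J -> V -> R) z : (forall j, Sm (F j)) ->
  'D_z (fun w => \sum_j c j * F j w) = fun w => \sum_j c j * 'D_z (F j) w.
Proof.
move=> SF; apply/funext => w.
have H j : differentiable (fun w => c j * F j w) w /\
    forall v, 'D_v (fun w => c j * F j w) w = c j * 'D_v (F j) w.
  have [h1 h2] := D_mul (D_cst (c j) w).1 ((Sm_closed (SF j)).1 w).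
  by split => // v; rewrite h2 (D_cst _ _).2 mul0r add0r.
rewrite (D_sum (fun j => (H j).1)).2; apply: eq_bigr => j _; exact: (H j).2.
Qed.

Lemma D_lincombE (J : finType) (c : J -> R) (F : J -> V -> R) z w : (forall j, Sm (F j)) ->
  'D_z (fun w => \sum_j c j * F j w) w = \sum_j c j * 'D_z (F j) w.
Proof. by move=> SF; have := D_lincomb c z SF => /(congr1 (@^~ w)). Qed.

Lemma itD_lincomb (J : finType) (c : J -> R) (F : J -> V -> R) z k : (forall j, Sm (F j)) ->
  itD z k (fun w => \sum_j c j * F j w) = fun w => \sum_j c j * itD z k (F j) w.
Proof.
move=> SF; elim: k => //= k IH; rewrite IH D_lincomb// => j; exact: itD_Sm.
Qed.

Lemma itD_bound k f : Cc f -> exists2 C : R, 0 <= C &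
  forall z w : V, `|itD z k f w| <= C * `|z| ^+ k.
Proof.
elim: k f => [|k IH] f Cf.
  have [M HM] := Cc_bounded Cf; exists M; first exact: le_trans (HM (0, 0)).
  by move=> z w; rewrite expr0 mulr1; exact: HM.
have {}IH j := IH _ (Cc_D (dirs j) Cf).
pose C j := sval (cid2 (IH j)).
have C0 j : 0 <= C j by rewrite /C; case: cid2.
have HC j z w : `|itD z k ('D_(dirs j) f) w| <= C j * `|z| ^+ k by rewrite /C; case: cid2.
exists (\sum_j C j); first exact: sumr_ge0.
move=> z w; rewrite /itD iterSr -/(itD z k _) D_expand; last by case: Cf.
rewrite itD_lincomb; last by move=> j; case: (Cc_D (dirs j) Cf).
apply: le_trans (ler_norm_sum _ _ _) _; rewrite mulr_suml; apply: ler_sum => j _.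
by rewrite normrM exprS mulrCA ler_pM// coef_le.
Qed.

Lemma V_taylor f : Cc f -> exists2 C : R, 0 <= C & forall w z : V,
  `|f (w + z) - f w - 'D_z f w - 2^-1 * 'D_z ('D_z f) w| <= C * `|z| ^+ 3.
Proof.
move=> Cf; have [C C0 HC] := itD_bound 3 Cf; exists C => // w z.
case: Cf => Sf _.
have := @taylor3 R (fun s => f (w + s *: z)) (fun s => 'D_z f (w + s *: z))
  (fun s => 'D_z ('D_z f) (w + s *: z)) (fun s => itD z 3 f (w + s *: z)) (C * `|z| ^+ 3).
rewrite scale0r addr0 scale1r; apply.
- by move=> s; exact: line_deriv.
- by move=> s; apply: line_deriv; exact: (@itD_Sm z 1).
- by move=> s; apply: (line_deriv (f := itD z 2 f)); exact: (@itD_Sm z 2).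
- by move=> s; exact: HC.
Qed.

Definition Dx (i : 'I_n) (f : V -> R) := 'D_(xdir i) f.
Definition Dt (f : V -> R) := 'D_tdir f.

Lemma D_split f (z w : V) : Sm f ->
  'D_z f w = \sum_i z.1 ord0 i * Dx i f w + z.2 * Dt f w.
Proof. by move=> Sf; rewrite D_dirs ?sum_option /= 1?addrC//; exact: (Sm_closed Sf).1. Qed.

Lemma sum2_option (F : option 'I_n -> option 'I_n -> R) :
  \sum_j \sum_k F j k = \sum_i \sum_j F (Some i) (Some j)
   + \sum_i (F None (Some i) + F (Some i) None) + F None None.
Proof.
rewrite sum_option (sum_option (F None)).
have -> : \sum_i \sum_k F (Some i) k = \sum_i (F (Some i) None + \sum_j F (Some i) (Some j)).
  by apply: eq_bigr => i _; rewrite sum_option.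
by rewrite !big_split/=; ring.
Qed.

(** In parabolic counting time has weight two: of the second-order terms of [V_taylor], the mixed
    ones are of order [p^3] and the pure time one of order [p^4], the latter being absorbed by
    [p <= R0]. *)
Lemma ptaylor f (R0 : R) : Cc f -> 0 <= R0 -> exists2 C : R, 0 <= C &
  forall (w z : V) (p : R), 0 <= p -> p <= R0 -> `|z.1| <= p -> `|z.2| <= p ^+ 2 ->
  `|f (w + z) - f w - (\sum_i z.1 ord0 i * Dx i f w + z.2 * Dt f w)
    - 2^-1 * (\sum_i \sum_j z.1 ord0 i * z.1 ord0 j * Dx i (Dx j f) w)| <= C * p ^+ 3.
Proof.
move=> Cf R00; have [C C0 HC] := V_taylor Cf.
have Sf : Sm f by case: Cf.
have Mex v u : exists2 M, 0 <= M & forall w : V, `|'D_v ('D_u f) w| <= M.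
  have [M HM] := Cc_bounded (Cc_D v (Cc_D u Cf)); exists M => //.
  exact: le_trans (HM (0, 0)).
pose M v u := sval (cid2 (Mex v u)).
have M0 v u : 0 <= M v u by rewrite /M; case: cid2.
have HM v u w : `|'D_v ('D_u f) w| <= M v u by rewrite /M; case: cid2.
have R1 : 0 <= 1 + R0 by lra.
pose B : R := \sum_i (M tdir (xdir i) + M (xdir i) tdir) + R0 * M tdir tdir.
have B0 : 0 <= B.
  by rewrite addr_ge0// ?mulr_ge0// sumr_ge0// => i _; rewrite addr_ge0.
exists (C * (1 + R0) ^+ 3 + B); first by rewrite addr_ge0// mulr_ge0// exprn_ge0.
move=> w z p p0 pR z1 z2.
have zp : `|z| <= (1 + R0) * p.
  rewrite normV ge_max; apply/andP; split.
    by apply: (le_trans z1); rewrite ler_peMl// lerDl.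
  apply: (le_trans z2); rewrite expr2 ler_wpM2r//; fast_lra.
have E : 'D_z ('D_z f) w = \sum_i \sum_j z.1 ord0 i * z.1 ord0 j * Dx i (Dx j f) w
    + \sum_i (z.2 * z.1 ord0 i * 'D_tdir ('D_(xdir i) f) w + z.1 ord0 i * z.2 * 'D_(xdir i) ('D_tdir f) w)
    + z.2 * z.2 * 'D_tdir ('D_tdir f) w.
  transitivity (\sum_j \sum_k coef z j * coef z k * 'D_(dirs j) ('D_(dirs k) f) w).
    rewrite D_dirs; last exact: (Sm_closed ((Sm_closed Sf).2 z)).1.
    apply: eq_bigr => j _.
    rewrite (D_expand z Sf) D_lincombE; last by move=> k; exact: (Sm_closed Sf).2.
    by rewrite mulr_sumr; apply: eq_bigr => k _; rewrite mulrA.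
  exact: (sum2_option (fun j k => coef z j * coef z k * 'D_(dirs j) ('D_(dirs k) f) w)).
have := HC w z; rewrite E D_split//.
set a := f (w + z) - f w; set c := \sum_i \sum_j _; set e := z.2 * z.2 * _; set d := \sum_i (z.2 * _ * _ + _); set b := \sum_i _ + z.2 * _ => H.
have -> : a - b - 2^-1 * c = (a - b - 2^-1 * (c + d + e)) + 2^-1 * (d + e) by ring.
apply: le_trans (ler_normD _ _) _; rewrite mulrDl; apply: lerD.
  apply: le_trans H _; rewrite -mulrA -exprMn ler_wpM2l// lerXn2r ?nnegrE// mulr_ge0//.
rewrite normrM ger0_norm ?invr_ge0// -[leRHS]mul1r ler_pM//; first by rewrite invf_le1// ler1n.
apply: le_trans (ler_normD _ _) _; rewrite mulrDl; apply: lerD.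
  apply: le_trans (ler_norm_sum _ _ _) _; rewrite mulr_suml; apply: ler_sum => i _.
  have zi := le_trans (rV_coord_le z.1 i) z1.
  apply: le_trans (ler_normD _ _) _; rewrite mulrDl; apply: lerD.
    by rewrite !normrM mulrC ler_pM ?mulr_ge0// exprSr ler_pM.
  by rewrite !normrM mulrC ler_pM ?mulr_ge0// exprS ler_pM.
apply: (@le_trans _ _ (p ^+ 2 * p ^+ 2 * M tdir tdir)).
  by rewrite !normrM ler_pM ?mulr_ge0// ler_pM.
have -> : p ^+ 2 * p ^+ 2 * M tdir tdir = p * M tdir tdir * p ^+ 3 by ring.
by rewrite ler_wpM2r ?exprn_ge0// ler_wpM2r.
Qed.

(** By translation invariance the first-order Taylor remainder of [f] along [h v] has integral
    [- h I (D_v f)]. It is of size [h^2] on a fixed bounded set, so dividing by [h] forces the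
    integral to be 0. *)
Lemma ibp (v : V) f : Cc f -> I ('D_v f) = 0 :> R.
Proof.
move=> Cf; have [C C0 HC] := V_taylor Cf.
have [Sf [r fr]] := Cf.
have [M HM] := Cc_bounded (Cc_D v (Cc_D v Cf)).
have M0 : 0 <= M by exact: le_trans (HM (0, 0)).
have nf := Cc_nice Cf; have nD := Cc_nice (Cc_D v Cf).
pose r' : R := `|r| + `|v|; have r'0 : 0 <= r' by rewrite addr_ge0.
pose K := (C * `|v| ^+ 3 + M) * (2 * r') ^+ n.+1.
have K0 : 0 <= K.
  by rewrite mulr_ge0// ?exprn_ge0// ?mulr_ge0// addr_ge0// mulr_ge0// exprn_ge0.
have key h : 0 < h -> h <= 1 -> `|I ('D_v f)| <= h * K.
  move=> h0 h1.
  pose D (w : V) := f (w.1 + (h *: v).1, w.2 + (h *: v).2) - f w - h * 'D_v f w.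
  have nsh : nice (fun w : V => f (w.1 + (h *: v).1, w.2 + (h *: v).2)).
    have := nice_affV (h *: v) (oner_neq0 R) (oner_neq0 R) nf.
    by congr nice; apply/funext => w; rewrite /affV scale1r mul1r.
  have ID : I D = - (h * I ('D_v f)).
    rewrite I_B//; [|exact: niceB|exact: niceZ].
    by rewrite I_B// I_shift// subrr sub0r I_Z.
  have DE w : D w = f (w + h *: v) - f w - 'D_(h *: v) f w.
    by rewrite /D !deriveE ?linearZ//; exact: (Sm_closed Sf).1.
  have : `|I D| <= (h ^+ 2 * (C * `|v| ^+ 3 + M)) * (2 * r') ^+ n.+1.
    apply: I_bound => //.
    - have [mD _] := niceB (niceB nsh nf) (niceZ h nD); exact: mD.
    - move=> w; rewrite DE.
      have E : 'D_(h *: v) ('D_(h *: v) f) w = h ^+ 2 * 'D_v ('D_v f) w.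
        have -> : 'D_(h *: v) f = fun w => \sum_(j < 1) h * 'D_v f w.
          by apply/funext => y; rewrite big_ord1 !deriveE ?linearZ//; exact: (Sm_closed Sf).1.
        rewrite (D_lincombE (fun=> h) _ _ (fun=> (Sm_closed Sf).2 v)) big_ord1.
        by rewrite !(deriveE _ ((Sm_closed ((Sm_closed Sf).2 v)).1 w)) linearZ/= mulrA.
      have := HC w (h *: v); rewrite E normrZ (gtr0_norm h0).
      set a := _ - 'D_(h *: v) f w => H.
      have -> : a = (a - 2^-1 * (h ^+ 2 * 'D_v ('D_v f) w)) + 2^-1 * (h ^+ 2 * 'D_v ('D_v f) w) by rewrite subrK.
      apply: le_trans (ler_normD _ _) _; rewrite mulrDr; apply: lerD.
        apply: le_trans H _; rewrite exprMn mulrCA ler_wpM2r ?mulr_ge0 ?exprn_ge0//.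
        by rewrite exprS ler_piMl// exprn_ge0// ltW.
      rewrite normrM [`|h ^+ 2 * _|]normrM normrX (gtr0_norm h0) mulrCA ler_wpM2l ?exprn_ge0 ?(ltW h0)//.
      rewrite ger0_norm ?invr_ge0// -[leRHS]mul1r ler_pM//; by rewrite invf_le1// ler1n.
    - move=> w; rewrite /D => Dw.
      have hv1 : `|(h *: v).1| <= `|v|.
        rewrite normrZ (gtr0_norm h0) (le_trans _ (normV1 v))//; by rewrite ler_piMl.
      have hv2 : `|(h *: v).2| <= `|v|.
        rewrite normrM (gtr0_norm h0) (le_trans _ (normV2 v))//; by rewrite ler_piMl.
      have := ler_norm r.
      have [/fr[a1 a2]|/negPn/eqP fw] := boolP (f w != 0).
        by split; rewrite /r'; have := normr_ge0 v; fast_lra.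
      have [/(@csupp_D _ _ r f v fr w)[a1 a2]|/negPn/eqP dw] := boolP ('D_v f w != 0).
        by split; rewrite /r'; have := normr_ge0 v; fast_lra.
      move: Dw; rewrite dw mulr0 subr0.
      rewrite fw subr0 => /fr[/= a1 a2]; split; rewrite /r'.
        have := ler_normB (w.1 + h *: v.1) (h *: v.1); rewrite addrK; move: hv1 => /=; fast_lra.
      have := ler_normB (w.2 + h *: v.2) (h *: v.2); rewrite addrK; move: hv2 => /=; fast_lra.
  rewrite ID normrN normrM (gtr0_norm h0) -mulrA expr2 -!mulrA ler_pM2l//.
apply/eqP; rewrite -normr_le0 leNgt; apply/negP => Ip.
set J := `|I ('D_v f)| in key Ip.
have h0 : 0 < Num.min 1 (J / (2 * (K + 1))).
  by rewrite lt_min ltr01 divr_gt0// mulr_gt0// ltr_wpDl.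
have := key _ h0; rewrite ge_min lexx => /(_ isT).
apply/negP; rewrite -ltNge.
apply: (@le_lt_trans _ _ (J / (2 * (K + 1)) * K)).
  by rewrite ler_wpM2r// ge_min lexx orbT.
rewrite mulrAC ltr_pdivrMr ?mulr_gt0 ?ltr_wpDl// ltr_pM2l//; fast_lra.
Qed.

Lemma D_affV (f : V -> R) l m z0 v z :
  'D_v (fun w => f (affV l m z0 w)) z = 'D_(l *: v.1, m * v.2) f (affV l m z0 z).
Proof.
rewrite /derive.
suff -> : (fun h : R => h^-1 *: (((fun w => f (affV l m z0 w)) \o shift z) (h *: v) - f (affV l m z0 z)))
  = (fun h : R => h^-1 *: ((f \o shift (affV l m z0 z)) (h *: (l *: v.1, m * v.2)) - f (affV l m z0 z))) by [].
apply/funext => h /=; congr (h^-1 *: (f _ - _)); rewrite /affV; apply: (congr2 pair) => /=.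
  by rewrite scalerDr !scalerA mulrC addrA.
by rewrite /GRing.scale/=; ring.
Qed.

Lemma diff_affV (f : V -> R) l m z0 z : differentiable f (affV l m z0 z) ->
  differentiable (fun w => f (affV l m z0 w)) z.
Proof.
move=> df.
pose A (h : V) : V := (l *: h.1, m * h.2).
pose Cm := `|l| + `|m|.
have AC h : `|A h| <= Cm * `|h|.
  rewrite normV ge_max /A /= normrZ normrM mulrDl; apply/andP; split.
    by rewrite (le_trans (ler_wpM2l _ (normV1 h)))// lerDl mulr_ge0.
  by rewrite (le_trans (ler_wpM2l _ (normV2 h)))// lerDr mulr_ge0.
have AE h : affV l m z0 (z + h) = affV l m z0 z + A h.
  rewrite /affV; apply: (congr2 pair) => /=; first by rewrite scalerDr addrAC.
  by rewrite mulrDr addrAC.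
set y := affV l m z0 z in df AE *.
have HCl h : `|'d f y h| <= (\sum_j `|'D_(dirs j) f y|) * `|h|.
  rewrite -deriveE// D_dirs// (le_trans (ler_norm_sum _ _ _))// mulr_suml ler_sum// => j _.
  by rewrite normrM mulrC ler_wpM2l// coef_le.
set Cl := \sum_j _ in HCl; have Cl0 : 0 <= Cl by exact: sumr_ge0.
have Cm0 : 0 <= Cm by rewrite addr_ge0.
suff [] : differentiable (fun w => f (affV l m z0 w)) z /\
  forall v, 'D_v (fun w => f (affV l m z0 w)) z = 'd f y (A v) by [].
apply: (@eps_diff _ _ _ _ _ (Cl * Cm)).
- move=> a u w; have -> : A (a *: u + w) = a *: A u + A w.
    rewrite /A; apply: (congr2 pair) => /=; first by rewrite scalerDr !scalerA mulrC.
    by rewrite /GRing.scale/=; ring.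
  by rewrite linearP.
- by move=> h; apply: le_trans (HCl _) _; rewrite -mulrA ler_wpM2l.
move=> e e0; have e1 : 0 < e / (Cm + 1) by rewrite divr_gt0// ltr_wpDl.
have [d d0 Hd] := diff_eps df e1.
exists (d / (Cm + 1)); first by rewrite divr_gt0// ltr_wpDl.
move=> h hd; rewrite AE; have Cp : 0 < Cm + 1 by rewrite ltr_wpDl.
have Ah : `|A h| <= `|h| * (Cm + 1).
  by apply: le_trans (AC h) _; rewrite mulrC ler_wpM2l// lerDl.
apply: le_trans (Hd _ _) _; first by apply: le_lt_trans Ah _; rewrite -ltr_pdivlMr.
apply: (@le_trans _ _ (e / (Cm + 1) * (`|h| * (Cm + 1)))); first by rewrite ler_wpM2l// ltW.
by rewrite mulrA mulrAC divfK ?gt_eqF.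
Qed.

Lemma smooth_affV (f : V -> R) l m z0 : smooth f -> smooth (fun w => f (affV l m z0 w)).
Proof.
move=> Sf vs z.
suff -> : foldr (fun v f => 'D_v f) (fun w => f (affV l m z0 w)) vs =
   fun w => foldr (fun v f => 'D_v f) f [seq (l *: v.1, m * v.2) | v : V <- vs] (affV l m z0 w).
  exact: diff_affV.
elim: vs => //= v vs ->; apply/funext => w; exact: D_affV.
Qed.

End taylor.

(** * Kernels *)

Section kernels.
Context {R : realType} {n : nat}.
Local Notation V := ('rV[R]_n * R)%type.

(** The formal adjoint of the operator of the equation; it acts on test kernels, and the backward
    heat kernel solves [Hs = 0]. *)
Definition Hs (f : V -> R) (z : V) : R := \sum_i Dx i (Dx i f) z + Dt f z.

(** A smooth step, equal to 1 up to [x = 1] and to 0 from [x = 3] on. Its symmetry about 2 gives the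
    value 1/2 there, on which the lower bounds for the annular weight rest. *)
Definition stp (x : R) : R := Eflat 0 (3 - x) / (Eflat 0 (3 - x) + Eflat 0 (x - 1)).

Lemma Eflat_gt0 m (t : R) : 0 < t -> 0 < Eflat m t.
Proof. by move=> t0; rewrite /Eflat t0 mulr_gt0 ?expR_gt0// exprn_gt0// invr_gt0. Qed.
Lemma Eflat_le0 m (t : R) : t <= 0 -> Eflat m t = 0.
Proof. by move=> t0; rewrite /Eflat ltNge t0. Qed.
Lemma Eflat0_mono (s t : R) : s <= t -> Eflat 0 s <= Eflat 0 t.
Proof.
move=> st; have [s0|s0] := leP s 0; first by rewrite Eflat_le0// Eflat_ge0.
have t0 := lt_le_trans s0 st.
by rewrite /Eflat s0 t0 !expr0 !mul1r ler_expR lerN2 lef_pV2.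
Qed.
Lemma stp_den x : 0 < Eflat 0 (3 - x) + Eflat 0 (x - 1) :> R.
Proof.
have [x2|x2] := leP x 2.
  by rewrite ltr_wpDr ?Eflat_ge0// Eflat_gt0//; lra.
by rewrite ltr_wpDl ?Eflat_ge0// Eflat_gt0//; lra.
Qed.
Lemma stp_ge0 x : 0 <= stp x.
Proof. by rewrite divr_ge0 ?Eflat_ge0// ltW// stp_den. Qed.
Lemma stp_le1 x : stp x <= 1.
Proof. by rewrite ler_pdivrMr ?stp_den// mul1r lerDl Eflat_ge0. Qed.
Lemma stp1 x : x <= 1 -> stp x = 1.
Proof.
move=> x1; rewrite /stp [Eflat 0 (x - 1)]Eflat_le0 ?addr0; last lra.
by rewrite divff// gt_eqF// Eflat_gt0//; lra.
Qed.
Lemma stp0 x : 3 <= x -> stp x = 0.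
Proof. by move=> x1; rewrite /stp [Eflat 0 (3 - x)]Eflat_le0 ?mul0r//; lra. Qed.
Lemma stp2 : stp 2 = 2^-1.
Proof.
rewrite /stp (_ : 3 - 2 = 1); last lra. rewrite (_ : 2 - 1 = 1); last lra.
have := @Eflat_gt0 0 1 ltr01; set e := Eflat 0 1 => e0.
have -> : e + e = 2 * e by ring.
by rewrite invfM mulrCA divff ?gt_eqF// mulr1.
Qed.
Lemma stp_anti x y : x <= y -> stp y <= stp x.
Proof.
move=> xy; rewrite /stp ler_pdivlMr ?stp_den// mulrAC ler_pdivrMr ?stp_den//.
have h1 : Eflat 0 (3 - y) <= Eflat 0 (3 - x) by apply: Eflat0_mono; lra.
have h2 : Eflat 0 (x - 1) <= Eflat 0 (y - 1) by apply: Eflat0_mono; lra.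
rewrite !mulrDr [_ * Eflat 0 (3 - y)]mulrC lerD2l ler_pM// Eflat_ge0//.
Qed.

Lemma Sm_stp f : Sm f -> Sm (fun z : V => stp (f z)).
Proof.
move=> Sf; have h1 : Sm (fun z => Eflat 0 (3 - f z)).
  by apply: Sm_E; apply: Sm_B => //; exact: Sm_cst.
apply: Sm_M => //; apply: Sm_V; last by move=> z; exact: stp_den.
apply: Sm_D => //; apply: Sm_E; apply: Sm_B => //; exact: Sm_cst.
Qed.

(* Both terms of the numerator of the quotient rule have the same sign. *)
Definition dstp (x : R) : R :=
  - (Eflat 2 (3 - x) * Eflat 0 (x - 1) + Eflat 0 (3 - x) * Eflat 2 (x - 1))
  / (Eflat 0 (3 - x) + Eflat 0 (x - 1)) ^+ 2.

Lemma D_stp (f : V -> R) (z v : V) : differentiable f z ->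
  'D_v (fun w => stp (f w)) z = dstp (f z) * 'D_v f z.
Proof.
move=> df.
have [a1 a2] := D_mul (D_cst (-1) z).1 df.
have [b1 b2] := D_add (D_cst 3 z).1 a1.
have [c1 c2] := D_add df (D_cst (-1) z).1.
have [e1 e2] := D_E 0 b1. have [g1 g2] := D_E 0 c1.
have [s1 s2] := D_add e1 g1.
have den : Eflat 0 (3 + -1 * f z) + Eflat 0 (f z + -1) != 0 by rewrite mulN1r gt_eqF// stp_den.
have [i1 i2] := D_inv s1 den.
have [q1 q2] := D_mul e1 i1.
rewrite (_ : (fun w => stp (f w)) = fun w => Eflat 0 (3 + -1 * f w) * (Eflat 0 (3 + -1 * f w) + Eflat 0 (f w + -1))^-1); last first.
  by apply/funext => w; rewrite mulN1r.
rewrite q2 i2 s2 e2 g2 b2 c2 a2 !(D_cst _ _).2 !mul0r !subr0 !add0r addr0 mulN1r /dstp.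
move: den; rewrite !mulN1r.
set u := Eflat 0 _; set w := Eflat 0 _ => den.
by field.
Qed.

(** Time is cut off towards the past only: at positive times the second factor is 1, which is
    harmless since every use is multiplied by some [Gm]. *)
Definition eta (l : R) (z : V) : R := stp (l * rho z) * stp (- (l * z.2)).

Lemma Sm_eta l : Sm (eta l).
Proof.
by apply: Sm_M; apply: Sm_stp; [apply/Sm_Z/Sm_rho|apply/Sm_N/Sm_Z/Sm_tm].
Qed.
Lemma eta_ge0 l (z : V) : 0 <= eta l z.
Proof. by rewrite mulr_ge0// stp_ge0. Qed.

(** So small that [eta 1] and [eta 4] both equal 1 on [inb c0]. Hence their difference and the
    derivatives of [eta 1] vanish near the singularity of [Gm]. *)
Definition c0 : R := (4 * (n%:R + 1))^-1.
Lemma c0_gt0 : 0 < c0.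
Proof. by rewrite invr_gt0 mulr_gt0// ltr_wpDl. Qed.

Lemma rho_small (z : V) : inb c0 z -> 4 * rho z <= 1.
Proof.
move=> [z1 _].
have : rho z <= n%:R * c0 ^+ 2.
  have -> : n%:R * c0 ^+ 2 = \sum_(i < n) c0 ^+ 2.
    by rewrite sumr_const card_ord mulr_natl.
  apply: ler_sum => i _.
  rewrite -real_normK ?num_real// lerXn2r ?nnegrE ?(ltW c0_gt0)//.
  exact: le_trans (rV_coord_le _ _) z1.
have n0 : 0 <= n%:R :> R by [].
have : n%:R * c0 ^+ 2 <= 16^-1.
  rewrite /c0 exprVn ler_pdivrMr ?exprn_gt0 ?mulr_gt0 ?ltr_wpDl//.
  rewrite -ler_pdivrMl ?invr_gt0//; nra.
lra.
Qed.

Lemma t_small (z : V) : inb c0 z -> - (4 * z.2) <= 1.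
Proof.
move=> [_ z2]; have : c0 <= 4^-1.
  rewrite /c0 lef_pV2 ?posrE ?mulr_gt0 ?ltr_wpDl//.
  by rewrite ler_peMr// lerDr.
by move: z2; rewrite ler_norml => /andP[]; lra.
Qed.

Lemma eta_near l (z : V) : 0 <= l -> l <= 4 -> inb c0 z -> eta l z = 1.
Proof.
move=> l0 l4 zc; rewrite /eta !stp1 ?mulr1//.
  have [h|h] := leP 0 z.2; first by have := mulr_ge0 l0 h; lra.
  by have := t_small zc; nra.
by have := rho_small zc; have := rho_ge0 z; nra.
Qed.

Definition vanish (f : V -> R) := exists2 c, 0 < c & forall z : V, inb c z -> f z = 0.

Lemma vanishD (v : V) f : vanish f -> vanish ('D_v f).
Proof. by move=> [c cp H]; exists (c / 2); [rewrite divr_gt0|exact: vanish_D]. Qed.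

Lemma vanishMr f g : vanish f -> vanish (fun z => g z * f z).
Proof. by move=> [c cp H]; exists c => // z /H ->; rewrite mulr0. Qed.

Lemma near1_D (v : V) (f : V -> R) : (exists2 c, 0 < c & forall z : V, inb c z -> f z = 1) -> vanish ('D_v f).
Proof.
move=> [c cp H].
exists (c / 2) => [|z [z1 z2]]; first by rewrite divr_gt0.
have [_ ->] : differentiable f z /\ forall v, 'D_v f z = 'D_v (fun _ : V => 1 : R) z.
  apply: near_diff (D_cst 1 z).1; exists (c / 2); first by rewrite divr_gt0.
  move=> h hc; apply: H; split => /=.
    have := ler_normD z.1 h.1; have := normV1 h; lra.
  have := ler_normD z.2 h.2; have := normV2 h; lra.
exact: (D_cst _ _).2.
Qed.

Lemma Sm_Gv m f : vanish f -> Sm f -> Sm (fun z => f z * Gm m z).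
Proof. by move=> [c cp H]; exact: Sm_G cp H. Qed.

Lemma dot_xdir (z : V) i : dotV z (xdir i) = z.1 ord0 i.
Proof.
rewrite /dotV (bigD1 i)//= mxE !eqxx mulr1 big1 ?addr0// => j ji.
by rewrite mxE eqxx (negbTE ji) mulr0.
Qed.
Lemma dot_tdir (z : V) : dotV z tdir = 0.
Proof. by rewrite /dotV big1// => i _; rewrite mxE mulr0. Qed.

Lemma Dx_G i m f : vanish f -> Sm f -> Dx i (fun z => f z * Gm m z) =
  fun z => Dx i f z * Gm m z + (- 2^-1 * (z.1 ord0 i * f z)) * Gm m.+1 z.
Proof.
move=> [c cp H] Sf; apply/funext => z; rewrite /Dx (D_G m cp H ((Sm_closed Sf).1 z)).2.
by rewrite dot_xdir /=; ring.
Qed.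
Lemma Dx_GE i m f z : vanish f -> Sm f -> Dx i (fun z => f z * Gm m z) z =
  Dx i f z * Gm m z + (- 2^-1 * (z.1 ord0 i * f z)) * Gm m.+1 z.
Proof. by move=> vf Sf; rewrite Dx_G. Qed.
Lemma Dt_G m f : vanish f -> Sm f -> Dt (fun z => f z * Gm m z) =
  fun z => Dt f z * Gm m z + (n%:R / 2 + m%:R) * f z * Gm m.+1 z - rho z / 4 * f z * Gm m.+2 z.
Proof.
move=> [c cp H] Sf; apply/funext => z; rewrite /Dt (D_G m cp H ((Sm_closed Sf).1 z)).2.
by rewrite dot_tdir /=; ring.
Qed.

Lemma Gm1 m (z : V) : Gm m z = - z.2 * Gm m.+1 z.
Proof.
have [z0|z0] := ltP z.2 0; last by rewrite /Gm ltNge z0 mulr0.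
by rewrite GmS//; field; rewrite lt_eqF.
Qed.

Lemma Sm_diff f (z : V) : Sm f -> differentiable f z. Proof. by move=> /Sm_closed[]. Qed.

(** The first summand is [f] times [D_ij (Gm 0)], as [Gm 2] is [Gm 0] divided by the square of time;
    the other two carry derivatives of [f]. *)
Lemma Dxx_G i j f : vanish f -> Sm f -> forall z, Dx i (Dx j (fun z => f z * Gm 0 z)) z =
   f z * (Gm 2 z / 4) * (z.1 ord0 i * z.1 ord0 j + 2 * z.2 * (i == j)%:R) +
   (Dx i (Dx j f) z * Gm 0 z
   - 2^-1 * (z.1 ord0 i * Dx j f z + z.1 ord0 j * Dx i f z) * Gm 1 z).
Proof.
move=> vf Sf z; rewrite (Dx_G _ _ vf Sf).
have S1 : Sm (Dx j f) by exact: (Sm_closed Sf).2.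
have S2 : Sm (fun z => - 2^-1 * (z.1 ord0 j * f z)).
  by apply: Sm_Z; apply: Sm_M => //; exact: Sm_co.
have v1 : vanish (Dx j f) by exact: vanishD.
have v2 : vanish (fun z => - 2^-1 * (z.1 ord0 j * f z)) by apply/vanishMr/vanishMr.
have [m1 m2] := D_mul (co_diff j z).1 (Sm_diff z Sf).
have E2 : Dx i (fun z => - 2^-1 * (z.1 ord0 j * f z)) z =
    - 2^-1 * ((i == j)%:R * f z + z.1 ord0 j * Dx i f z).
  rewrite /Dx (D_mul (D_cst _ z).1 m1).2 m2 (D_cst _ _).2 (co_diff j z).2.
  by rewrite /= mxE eqxx /= [j == i]eq_sym mul0r add0r.
apply: etrans; first exact: (D_add (Sm_diff z (Sm_Gv 0 v1 S1)) (Sm_diff z (Sm_Gv 1 v2 S2))).2.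
apply: etrans (congr2 +%R (Dx_GE i 0 z v1 S1) (Dx_GE i 1 z v2 S2)) _.
rewrite E2 (Gm1 1).
set a := Dx i (Dx j f) z; set b := Dx j f z; set c := Dx i f z; set d := (i == j)%:R.
set g2 := Gm 2 z; set g0 := Gm 0 z.
by field.
Qed.

(** [Gm 0] is annihilated by [Hs], so only terms with a derivative on [f] survive. The cross term is
    twice the product of the gradients, and the gradient of [Gm 0] is [- x / 2] times [Gm 1]. *)
Lemma Hs_G f : vanish f -> Sm f -> forall z,
  Hs (fun z => f z * Gm 0 z) z = Hs f z * Gm 0 z - (\sum_i z.1 ord0 i * Dx i f z) * Gm 1 z.
Proof.
move=> vf Sf z.
transitivity (\sum_i (f z * (Gm 2 z / 4) * (z.1 ord0 i * z.1 ord0 i + 2 * z.2) +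
  (Dx i (Dx i f) z * Gm 0 z - 2^-1 * (z.1 ord0 i * Dx i f z + z.1 ord0 i * Dx i f z) * Gm 1 z))
  + (Dt f z * Gm 0 z + (n%:R / 2 + 0%:R) * f z * Gm 1 z - rho z / 4 * f z * Gm 2 z)).
  congr (_ + _); last by rewrite (Dt_G 0 vf Sf).
  by apply: eq_bigr => i _; rewrite (Dxx_G i i vf Sf z) eqxx mulr1.
have -> : \sum_i (f z * (Gm 2 z / 4) * (z.1 ord0 i * z.1 ord0 i + 2 * z.2) +
  (Dx i (Dx i f) z * Gm 0 z - 2^-1 * (z.1 ord0 i * Dx i f z + z.1 ord0 i * Dx i f z) * Gm 1 z)) =
  f z * (Gm 2 z / 4) * (rho z + n%:R * (2 * z.2)) + ((\sum_i Dx i (Dx i f) z) * Gm 0 z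
   - (\sum_i z.1 ord0 i * Dx i f z) * Gm 1 z).
  rewrite big_split/= -mulr_sumr; congr (_ + _).
    rewrite big_split/= sumr_const card_ord; congr (_ * (_ + _)).
    by rewrite -[_ *+ n]mulr_natl.
  rewrite sumrB !mulr_suml; congr (_ - _); apply: eq_bigr => i _; by field.
by rewrite /Hs (Gm1 1) addr0; field.
Qed.

Definition dl (z : V) : V := affV 2 4 0 z.

Lemma dl1 z i : (dl z).1 ord0 i = 2 * z.1 ord0 i.
Proof. by rewrite /dl /affV /= !mxE addr0. Qed.
Lemma dl2 z : (dl z).2 = 4 * z.2.
Proof. by rewrite /dl /affV /= addr0. Qed.
Lemma rho_dl z : rho (dl z) = 4 * rho z.
Proof. by rewrite /rho mulr_sumr; apply: eq_bigr => i _; rewrite dl1; ring. Qed.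

Lemma Gm_dl m z : 2 ^+ n * 4 ^+ m * Gm m (dl z) = Gm m z.
Proof.
rewrite /Gm dl2 rho_dl.
have -> : (4 * z.2 < 0) = (z.2 < 0) by rewrite pmulr_rlt0.
case: ifP => z0; last by rewrite mulr0.
have -> : 2 ^+ n * 4 ^+ m = expR ((n%:R / 2 + m%:R) * ln 4) :> R.
  have -> : (n%:R / 2 + m%:R) * ln 4 = n%:R * ln 2 + m%:R * ln 4 :> R.
    have -> : (4 : R) = 2 * 2 by ring.
    by rewrite lnM ?posrE//; field.
  by rewrite expRD !expRM_natl !lnK ?posrE.
rewrite -expRD; congr expR.
have -> : - (4 * z.2) = 4 * (- z.2) by ring.
rewrite lnM ?posrE ?oppr_gt0//.
by field; rewrite lt_eqF.
Qed.

Lemma eta4E z : eta 4 z = eta 1 (dl z).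
Proof. by rewrite /eta rho_dl dl2 !mul1r. Qed.

Lemma D_scale_dir (f : V -> R) c (v : V) z : differentiable f z -> 'D_(c *: v) f z = c * 'D_v f z.
Proof. by move=> df; rewrite !deriveE// linearZ. Qed.

Lemma Dx_dl i f z : Sm f -> Dx i (fun z => f (dl z)) z = 2 * Dx i f (dl z).
Proof.
move=> Sf; rewrite /Dx /dl D_affV -D_scale_dir; last exact: Sm_diff.
by congr derive; apply: (congr2 pair) => //=; rewrite mulr0 /GRing.scale/= mulr0.
Qed.
Lemma Dt_dl f z : Sm f -> Dt (fun z => f (dl z)) z = 4 * Dt f (dl z).
Proof.
move=> Sf; rewrite /Dt /dl D_affV -D_scale_dir; last exact: Sm_diff.
by congr derive; apply: (congr2 pair) => //=; rewrite !scaler0.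
Qed.

(** [eta 4] is [eta 1] at half the scale, so [th] localizes to one parabolic dyadic annulus, and its
    dilates add up telescopically. *)
Definition th (z : V) : R := eta 1 z - eta 4 z.
Lemma Sm_th : Sm th. Proof. by apply: Sm_B; exact: Sm_eta. Qed.
Lemma vanish_th : vanish th.
Proof.
exists c0; first exact: c0_gt0.
by move=> z zc; rewrite /th !eta_near ?subrr//; lra.
Qed.

Lemma eta1_D v : vanish ('D_v (eta 1)).
Proof.
apply: near1_D; exists c0; first exact: c0_gt0.
by move=> z zc; apply: eta_near => //; lra.
Qed.

(* [Gm 0] solves the heat equation, so [kap0] and [Xi0 i j] are the commutators
   [Hs (eta Gm 0)] and [D_ij (eta Gm 0) - eta D_ij (Gm 0)], supported away from the origin. *)
Definition psi0 (z : V) := th z * Gm 0 z.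
Definition Xi0 i j (z : V) : R := Dx i (Dx j (eta 1)) z * Gm 0 z
   - 2^-1 * (z.1 ord0 i * Dx j (eta 1) z + z.1 ord0 j * Dx i (eta 1) z) * Gm 1 z.
Definition om0 (z : V) : R := th z * (Gm 2 z / 4).
Definition kap0 (z : V) : R := Hs (eta 1) z * Gm 0 z
   - (\sum_i z.1 ord0 i * Dx i (eta 1) z) * Gm 1 z.

Lemma Sm_Dx i (f : V -> R) : Sm f -> Sm (Dx i f). Proof. by move=> Sf; exact: (Sm_closed Sf).2. Qed.
Lemma Sm_Dt (f : V -> R) : Sm f -> Sm (Dt f). Proof. by move=> Sf; exact: (Sm_closed Sf).2. Qed.

Lemma Dx_Z i c (f : V -> R) z : differentiable f z -> Dx i (fun z => c * f z) z = c * Dx i f z.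
Proof. by move=> df; rewrite /Dx (D_mul (D_cst c z).1 df).2 (D_cst _ _).2 mul0r add0r. Qed.

Lemma Dx_eta4 i : Dx i (eta 4) = fun z => 2 * Dx i (eta 1) (dl z).
Proof.
rewrite (_ : eta 4 = fun z => eta 1 (dl z)); last by apply/funext => z; exact: eta4E.
by apply/funext => z; rewrite Dx_dl//; exact: Sm_eta.
Qed.
Lemma Dxx_eta4 i j z : Dx i (Dx j (eta 4)) z = 4 * Dx i (Dx j (eta 1)) (dl z).
Proof.
rewrite (_ : eta 4 = fun z => eta 1 (dl z)); last by apply/funext => y; exact: eta4E.
rewrite (_ : Dx j _ = fun z => 2 * Dx j (eta 1) (dl z)); last first.
  by apply/funext => y; rewrite Dx_dl//; exact: Sm_eta.
have S1 : Sm (Dx j (eta 1)) by apply/Sm_Dx/Sm_eta.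
have d1 : differentiable (fun z => Dx j (eta 1) (dl z)) z by apply: diff_affV; exact: Sm_diff.
apply: etrans (Dx_Z i 2 d1) _.
apply: etrans (congr1 _ (Dx_dl i z S1)) _.
by rewrite mulrA; congr (_ * _); ring.
Qed.
Lemma Dt_eta4 z : Dt (eta 4) z = 4 * Dt (eta 1) (dl z).
Proof.
rewrite (_ : eta 4 = fun z => eta 1 (dl z)); last by apply/funext => y; exact: eta4E.
by rewrite Dt_dl//; exact: Sm_eta.
Qed.

Lemma Dx_B i (f g : V -> R) : Sm f -> Sm g -> Dx i (fun z => f z - g z) = fun z => Dx i f z - Dx i g z.
Proof. by move=> Sf Sg; apply/funext => z; apply: deriveB; apply: diff_derivable; exact: Sm_diff. Qed.
Lemma Dt_B (f g : V -> R) : Sm f -> Sm g -> Dt (fun z => f z - g z) = fun z => Dt f z - Dt g z.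
Proof. by move=> Sf Sg; apply/funext => z; apply: deriveB; apply: diff_derivable; exact: Sm_diff. Qed.

Lemma th_x i z : Dx i th z = Dx i (eta 1) z - 2 * Dx i (eta 1) (dl z).
Proof. by rewrite /th Dx_B ?Dx_eta4//; exact: Sm_eta. Qed.
Lemma th_xx i j z : Dx i (Dx j th) z = Dx i (Dx j (eta 1)) z - 4 * Dx i (Dx j (eta 1)) (dl z).
Proof.
have S l : Sm (Dx j (eta l)) by apply/Sm_Dx/Sm_eta.
rewrite -Dxx_eta4 /th (Dx_B j (Sm_eta 1) (Sm_eta 4)).
by rewrite (Dx_B i (S 1) (S 4)).
Qed.
Lemma th_t z : Dt th z = Dt (eta 1) z - 4 * Dt (eta 1) (dl z).
Proof. by rewrite -Dt_eta4 /th (Dt_B (Sm_eta 1) (Sm_eta 4)). Qed.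

Opaque Dx Dt eta th dl Gm.

(** As [eta 4] is [eta 1] composed with [dl] and [Gm] is homogeneous, the commutator of the inner
    cutoff is a rescaling of that of the outer one. What does not telescope is the weight [om0]
    times an explicit quadratic matrix. *)
Lemma psi0_xx i j z : Dx i (Dx j psi0) z =
  om0 z * (z.1 ord0 i * z.1 ord0 j + 2 * z.2 * (i == j)%:R) +
  Xi0 i j z - 2 ^+ n.+2 * Xi0 i j (dl z).
Proof.
rewrite /psi0 (Dxx_G i j vanish_th Sm_th z) /om0 -addrA; congr (_ + _).
have E0 := Gm_dl 0 z; have E1 := Gm_dl 1 z.
rewrite /Xi0 !dl1 -E0 -E1 th_xx !th_x expr0 expr1 (exprS 2 n.+1) (exprS 2 n).
have key (a a' b b' c c' yi yj q g0 g1 : R) :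
  (a - 4 * a') * (q * 1 * g0) - 2^-1 * (yi * (b - 2 * b') + yj * (c - 2 * c')) * (q * 4 * g1) =
  a * (q * 1 * g0) - 2^-1 * (yi * b + yj * c) * (q * 4 * g1) -
  2 * (2 * q) * (a' * g0 - 2^-1 * (2 * yi * b' + 2 * yj * c') * g1) by field.
exact: key.
Qed.

(** The same telescoping for [Hs], where nothing else is left since [Gm 0] is annihilated. It
    relates the averages with [kap] at two consecutive scales. *)
Lemma Hs_psi0 z : Hs psi0 z = kap0 z - 2 ^+ n.+2 * kap0 (dl z).
Proof.
rewrite /psi0 (Hs_G vanish_th Sm_th z) /kap0 /Hs.
have A : \sum_i Dx i (Dx i th) z = \sum_i Dx i (Dx i (eta 1)) z - 4 * \sum_i Dx i (Dx i (eta 1)) (dl z).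
  by rewrite mulr_sumr -sumrB; apply: eq_bigr => i _; rewrite th_xx.
have B : \sum_i z.1 ord0 i * Dx i th z = \sum_i z.1 ord0 i * Dx i (eta 1) z - 2 * \sum_i z.1 ord0 i * Dx i (eta 1) (dl z).
  by rewrite mulr_sumr -sumrB; apply: eq_bigr => i _; rewrite th_x mulrBr [z.1 ord0 i * (2 * _)]mulrCA.
have C : \sum_i (dl z).1 ord0 i * Dx i (eta 1) (dl z) = 2 * \sum_i z.1 ord0 i * Dx i (eta 1) (dl z).
  by rewrite mulr_sumr; apply: eq_bigr => i _; rewrite dl1 mulrA.
rewrite (exprS 2 n.+1) (exprS 2 n).
have key (X x x' T t t' Y y y' Z q G0 G1 g0 g1 : R) : X = x - 4 * x' -> T = t - 4 * t' ->
  Y = y - 2 * y' -> Z = 2 * y' -> q * 4 ^+ 0 * g0 = G0 -> q * 4 ^+ 1 * g1 = G1 ->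
  (X + T) * G0 - Y * G1 = (x + t) * G0 - y * G1 - 2 * (2 * q) * ((x' + t') * g0 - Z * g1).
  by move=> -> -> -> -> <- <-; rewrite expr0 expr1; ring.
exact: (key _ _ _ _ _ _ _ _ _ _ _ _ _ _ _ A (th_t z) B C (Gm_dl 0 z) (Gm_dl 1 z)).
Qed.

Definition KB (z : V) := `|z.1| <= 2 /\ -3 <= z.2 < 0.

Lemma KB_inb z : KB z -> inb 3 z.
Proof.
move=> [z1 /andP[z2 z3]]; split; first by apply: le_trans z1 _; lra.
by rewrite ler_norml z2/=; lra.
Qed.

Lemma eta_supp l z : 1 <= l -> eta l z != 0 -> `|z.1| <= 2 /\ -3 <= z.2.
Proof.
Transparent eta.
move=> l1; rewrite /eta mulf_eq0 negb_or => /andP[h1 h2].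
have r3 : l * rho z < 3 by rewrite ltNge; apply/negP => /stp0 E; rewrite E eqxx in h1.
have t3 : - (l * z.2) < 3 by rewrite ltNge; apply/negP => /stp0 E; rewrite E eqxx in h2.
have rz := rho_ge0 z.
split; last by have [h|h] := leP 0 z.2; nra.
have := norm_le_rho z; have := normr_ge0 z.1; nra.
Qed.
Opaque eta.

Lemma Gm_neg m (z : V) : Gm m z != 0 -> z.2 < 0.
Proof. Transparent Gm. by rewrite /Gm; case: ifP => //; rewrite eqxx. Qed.
Opaque Gm.

Lemma vanish_KB (f : V -> R) : (forall z, ~ (`|z.1| <= 2 /\ -3 <= z.2) -> f z = 0) ->
  forall v z, ~ (`|z.1| <= 2 /\ -3 <= z.2) -> 'D_v f z = 0.
Proof.
move=> H v z zK.
suff : exists2 d, 0 < d & forall h : V, `|h| < d -> ~ (`|(z + h).1| <= 2 /\ -3 <= (z + h).2).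
  move=> [d d0 Hd].
  have [_ ->] : differentiable f z /\ forall v, 'D_v f z = 'D_v (fun _ : V => 0 : R) z.
    by apply: near_diff (D_cst 0 z).1; exists d => // h /Hd/H.
  exact: (D_cst _ _).2.
have [z1|z1] := leP `|z.1| 2; last first.
  exists (`|z.1| - 2); first by rewrite subr_gt0.
  move=> h hd [/= hr _]; have := lerB_normD z.1 h.1; have := normV1 h; lra.
have [z2|z2] := leP (-3) z.2; first by exfalso; apply: zK.
exists (-3 - z.2); first by rewrite subr_gt0.
move=> h hd [/= _ hr]; have := normV2 h; have := ler_norm h.2; lra.
Qed.

Lemma eta_out l (z : V) : 1 <= l -> ~ (`|z.1| <= 2 /\ -3 <= z.2) -> eta l z = 0.
Proof. by move=> l1 zK; apply/eqP; apply: contrapT => /negP/(eta_supp l1). Qed.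

Lemma D_out (f g : V -> R) m (z : V) : (forall z, ~ (`|z.1| <= 2 /\ -3 <= z.2) -> f z = 0) ->
  f z * g z * Gm m z != 0 -> KB z.
Proof.
move=> H; rewrite !mulf_eq0 !negb_or => /andP[/andP[fz _] /Gm_neg z0].
have : `|z.1| <= 2 /\ -3 <= z.2 by apply: contrapT => /H/eqP E; rewrite E in fz.
by move=> [h1 h2]; split=> //; rewrite h2.
Qed.

Lemma Dx_out i (z : V) : ~ (`|z.1| <= 2 /\ -3 <= z.2) -> Dx i (eta 1) z = 0.
Proof. by apply: vanish_KB => y; apply: eta_out; rewrite lexx. Qed.
Lemma Dt_out (z : V) : ~ (`|z.1| <= 2 /\ -3 <= z.2) -> Dt (eta 1) z = 0.
Proof. by apply: vanish_KB => y; apply: eta_out; rewrite lexx. Qed.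
Lemma Dxx_out i j (z : V) : ~ (`|z.1| <= 2 /\ -3 <= z.2) -> Dx i (Dx j (eta 1)) z = 0.
Proof. by apply: vanish_KB => y; apply: Dx_out. Qed.
Lemma th_out (z : V) : ~ (`|z.1| <= 2 /\ -3 <= z.2) -> th z = 0.
Proof. Transparent th. by move=> zK; rewrite /th !eta_out ?subrr//; lra. Qed.
Opaque th.

Definition ker (f : V -> R) := Sm f /\ forall z, f z != 0 -> KB z.

Lemma ker_Cc f : ker f -> Cc f.
Proof. by move=> [Sf H]; split=> //; exists 3 => z /H/KB_inb. Qed.

Lemma ker_G m f : Sm f -> vanish f -> (forall z, ~ (`|z.1| <= 2 /\ -3 <= z.2) -> f z = 0) ->
  ker (fun z => f z * Gm m z).
Proof.
move=> Sf vf H; split; first exact: Sm_Gv.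
by move=> z fz; apply: (@D_out f (fun=> 1) m z) => //; rewrite mulr1.
Qed.

Lemma kerD f g : ker f -> ker g -> ker (fun z => f z + g z).
Proof.
move=> [Sf Hf] [Sg Hg]; split; first exact: Sm_D.
by move=> z; have [fz|/Hf//] := eqVneq (f z) 0; rewrite fz add0r => /Hg.
Qed.
Lemma kerZ c f : ker f -> ker (fun z => c * f z).
Proof.
move=> [Sf Hf]; split; first exact: Sm_Z.
by move=> z; rewrite mulf_eq0 negb_or => /andP[_ /Hf].
Qed.

Lemma ker_psi0 : ker psi0.
Proof. exact: ker_G Sm_th vanish_th th_out. Qed.
Lemma ker_om0 : ker om0.
Proof.
have := kerZ 4^-1 (ker_G 2 Sm_th vanish_th th_out).
by congr ker; apply/funext => z; rewrite /om0; ring.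
Qed.
Lemma ker_Xi0 i j : ker (Xi0 i j).
Proof.
have k1 := ker_G 0 (Sm_Dx i (Sm_Dx j (Sm_eta 1))) (vanishD (xdir i) (eta1_D (xdir j))) (Dxx_out i j).
have k2 : ker (fun z => (z.1 ord0 i * Dx j (eta 1) z + z.1 ord0 j * Dx i (eta 1) z) * Gm 1 z).
  apply: ker_G.
  - by apply: Sm_D; apply: Sm_M; try exact: Sm_co; apply/Sm_Dx/Sm_eta.
  - have [c cp Hc] : vanish (Dx i (eta 1)) := eta1_D (xdir i).
    have [d dp Hd] : vanish (Dx j (eta 1)) := eta1_D (xdir j).
    exists (Num.min c d); first by rewrite lt_min cp.
    move=> z zi; have zc : inb c z by apply: inbW zi; rewrite ge_min lexx.
    have zd : inb d z by apply: inbW zi; rewrite ge_min lexx orbT.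
    by rewrite (Hc z zc) (Hd z zd) !mulr0 addr0.
  - by move=> z zK; rewrite !Dx_out// !mulr0 addr0.
have := kerD k1 (kerZ (- 2^-1) k2).
by congr ker; apply/funext => z; rewrite /Xi0 mulNr [2^-1 * (_ * Gm 1 z)]mulrA.
Qed.
Lemma Xi0_tr z : kap0 z = \sum_i Xi0 i i z + Dt (eta 1) z * Gm 0 z.
Proof.
rewrite /kap0 /Hs /Xi0 sumrB -!mulr_suml.
have -> : \sum_i 2^-1 * (z.1 ord0 i * Dx i (eta 1) z + z.1 ord0 i * Dx i (eta 1) z) =
  \sum_i z.1 ord0 i * Dx i (eta 1) z by apply: eq_bigr => i _; field.
ring.
Qed.
Lemma ker_kap0 : ker kap0.
Proof.
have k1 := ker_G 0 (Sm_Dt (Sm_eta 1)) (eta1_D tdir) Dt_out.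
have k2 : ker (fun z => \sum_i Xi0 i i z).
  split; first by apply: Sm_sum => i; case: (ker_Xi0 i i).
  move=> z sz; apply: contrapT => zK; move/eqP: sz; apply.
  by rewrite big1// => i _; apply/eqP; apply: contrapT => /negP/(ker_Xi0 i i).2.
have := kerD k2 k1.
by congr ker; apply/funext => z; rewrite Xi0_tr.
Qed.

Lemma th_ge0 z : 0 <= th z.
Proof.
Transparent th eta.
have rz := rho_ge0 z.
rewrite /th subr_ge0 /eta; have [h|h] := leP z.2 0.
  by rewrite ler_pM ?stp_ge0//; apply: stp_anti; lra.
rewrite [stp (- (4 * z.2))]stp1 ?[stp (- (1 * z.2))]stp1; try lra.
by rewrite !mulr1; apply: stp_anti; lra.
Qed.

Lemma om0_ge0 z : 0 <= om0 z.
Proof.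
rewrite mulr_ge0 ?th_ge0// divr_ge0//.
Transparent Gm.
by rewrite /Gm; case: ifP => // _; exact: expR_ge0.
Qed.

Lemma om0_even (x : 'rV[R]_n) t : om0 (- x, t) = om0 (x, t).
Proof.
have E : rho (- x, t) = rho (x, t) by apply: eq_bigr => i _; rewrite /= mxE sqrrN.
by rewrite /om0 /th /eta /Gm E.
Qed.

(** Outside the half-size box, [rho z] or [- z.2] lies between 1/2 and 2, where
    [stp x - stp (4 * x)] is at least 1/2; the cutoff in the other variable is at least 1/2 as
    well. *)
Lemma th_lower z : rho z <= 2 -> -2 <= z.2 -> z.2 < 0 -> ~ (rho z <= 2^-1 /\ - 2^-1 <= z.2) ->
  4^-1 <= th z.
Proof.
move=> r2 t2 t0 H; have rz := rho_ge0 z.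
have half x : x <= 2 -> 2^-1 <= stp x by move=> x2; rewrite -stp2; exact: stp_anti.
have diff x : 2^-1 <= x -> x <= 2 -> 2^-1 <= stp x - stp (4 * x).
  move=> x1 x2; have [h|h] := leP x 1.
    rewrite [stp x]stp1//; suff : stp (4 * x) <= 2^-1 by lra.
    by rewrite -stp2; apply: stp_anti; lra.
  rewrite [stp (4 * x)]stp0; last lra.
  by have := half x x2; lra.
have anti x : 0 <= x -> stp (4 * x) <= stp x by move=> ?; apply: stp_anti; lra.
have E4 : - (4 * z.2) = 4 * - z.2 by ring.
rewrite /th /eta !mul1r E4.
have [h|h] := leP (rho z) 2^-1; last first.
  have d1 := diff _ (ltW h) r2; have a1 := anti (- z.2) ltac:(fast_lra).
  have h1 := half (- z.2) ltac:(fast_lra).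
  have s0 := stp_ge0 (4 * rho z); have s1 := stp_ge0 (4 * - z.2).
  set a := stp (rho z) in d1 *; set b := stp (4 * rho z) in d1 s0 *.
  set c := stp (- z.2) in a1 h1 *; set d := stp (4 * - z.2) in a1 s1 *.
  have : b * d <= b * c by rewrite ler_wpM2l.
  have : 2^-1 * 2^-1 <= (a - b) * c by rewrite ler_pM.
  fast_lra.
have h' : 2^-1 <= - z.2 by rewrite leNgt; apply/negP => ?; apply: H; lra.
have d1 := diff _ h' ltac:(fast_lra); have a1 := anti (rho z) rz.
have h1 := half (rho z) r2.
have s0 := stp_ge0 (4 * rho z); have s1 := stp_ge0 (4 * - z.2).
set a := stp (rho z) in a1 h1 *; set b := stp (4 * rho z) in a1 s0 *.
set c := stp (- z.2) in d1 *; set d := stp (4 * - z.2) in d1 s1 *.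
have : b * d <= a * d by rewrite ler_wpM2r.
have : 2^-1 * 2^-1 <= a * (c - d) by rewrite ler_pM.
fast_lra.
Qed.

Lemma Gm_lower m tau (z : V) : 0 < tau -> rho z <= 2 -> -2 <= z.2 -> z.2 <= - tau ->
  expR (- (n%:R / 2 + m%:R) * ln 2 - 2 / (4 * tau)) <= Gm m z.
Proof.
move=> tau0 r2 t2 tt; rewrite /Gm ifT; last lra.
rewrite ler_expR; apply: lerD.
  rewrite !mulNr lerN2 ler_wpM2l//.
  by rewrite ler_ln ?posrE//; lra.
have -> : (4 * z.2)^-1 = - (4 * - z.2)^-1 by rewrite mulrN invrN opprK.
rewrite mulrN lerN2 ler_pM ?rho_ge0 ?invr_ge0//; first lra.
by rewrite lef_pV2 ?posrE; lra.
Qed.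

(** The Gaussian degenerates as time tends to 0, so a layer of thickness [tau] has to be left
    out. *)
Lemma om0_lower tau : 0 < tau -> exists2 c, 0 < c & forall z : V, rho z <= 2 -> -2 <= z.2 ->
  z.2 <= - tau -> ~ (rho z <= 2^-1 /\ - 2^-1 <= z.2) -> c <= om0 z.
Proof.
move=> t0; exists (4^-1 * (expR (- (n%:R / 2 + 2%:R) * ln 2 - 2 / (4 * tau)) / 4)).
  by rewrite mulr_gt0// divr_gt0// expR_gt0.
move=> z r2 t2 tt H; rewrite /om0 ler_pM//.
- by apply: th_lower => //; lra.
- by rewrite ler_pM2r//; exact: Gm_lower.
Qed.

Lemma I_pos (k : V -> R) z0 : nice k -> (forall z, 0 <= k z) -> {for z0, continuous k} -> 0 < k z0 -> 0 < I k.
Proof.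
move=> nk k0 ck kz.
have c0 : 0 < k z0 / 2 by rewrite divr_gt0.
have [d d0 Hd] := cont_eps ck c0.
have nb : nice (\1_(@box R n (d / 2))).
  by apply: (@nice_indic _ _ _ (d / 2)) => //; apply: measurable_box; rewrite divr_ge0// ltW.
have nb' := nice_affV (- z0) (oner_neq0 R) (oner_neq0 R) nb.
have : k z0 / 2 * I (\1_(@box R n (d / 2))) <= I k.
  have <- : I (fun z => \1_(box (d / 2)) (affV 1 1 (- z0) z)) = I (\1_(@box R n (d / 2))).
    by rewrite I_affV ?oner_neq0// normr1 invr1 expr1n !mul1r.
  rewrite -I_Z//; apply: I_le => //; first exact: niceZ.
  move=> z; rewrite indicE; have [|_] := boolP (_ \in _); last by rewrite mulr0.
  rewrite inE => -[] /=; rewrite scale1r mul1r mulr1 => z1 z2.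
  have := Hd (z - z0); rewrite [z0 + _]addrC subrK ltr_distl => H.
  suff /H/andP[+ _] : `|z - z0| < d by fast_lra.
  rewrite normV /=; have h : d / 2 < d by fast_lra.
  by rewrite gt_max (le_lt_trans z1 h) (le_lt_trans z2 h).
apply: lt_le_trans; rewrite mulr_gt0// I_indic; last by apply: measurable_box; rewrite divr_ge0// ltW.
by rewrite mu_box/= ?exprn_gt0 ?mulr_gt0 ?divr_gt0// divr_ge0// ltW.
Qed.

Lemma I_Hs f : Cc f -> I (Hs f) = 0 :> R.
Proof.
move=> Cf.
have Cxx i : Cc (Dx i (Dx i f)) by apply/Cc_D/Cc_D.
have Ct : Cc (Dt f) by exact: Cc_D.
rewrite /Hs I_D; [|by apply: nice_sum => i; exact: Cc_nice|exact: Cc_nice].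
rewrite I_sum => [|i]; last exact: Cc_nice.
rewrite (ibp tdir Cf) addr0 big1// => i _; apply: ibp; exact: (Cc_D (xdir i)).
Qed.

(** Vanishes for times after [- e] and is 1 before [- 3 e]. It removes the singularity, so that
    [eta 1 * bcut e * Gm 0] is a kernel to which [I_Hs] applies. *)
Definition bcut e (z : V) : R := 1 - stp (- (e^-1 * z.2)).

Lemma Sm_bcut e : Sm (bcut e).
Proof. by apply: Sm_B; [exact: Sm_cst|apply/Sm_stp/Sm_N/Sm_Z/Sm_tm]. Qed.

Lemma D_bcut e v z : 'D_v (bcut e) z = dstp (- (e^-1 * z.2)) * (e^-1 * v.2).
Proof.
have [a1 a2] := D_mul (D_cst e^-1 z).1 (tm_diff z).1.
have [b1 b2] := D_mul (D_cst (-1) z).1 a1.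
have E : (fun z : V => - (e^-1 * z.2)) = fun z => -1 * (e^-1 * z.2).
  by apply/funext => y; rewrite mulN1r.
have d1 : differentiable (fun z : V => - (e^-1 * z.2)) z by rewrite E.
have Ss : Sm (fun z : V => stp (- (e^-1 * z.2))) by apply/Sm_stp/Sm_N/Sm_Z/Sm_tm.
rewrite /bcut deriveB; [|exact: diff_derivable|by apply: diff_derivable; exact: Sm_diff].
rewrite derive_cst (D_stp _ d1) E b2 a2 !(D_cst _ _).2 (tm_diff z).2 mulN1r.
ring.
Qed.

Lemma dstp_le0 x : dstp x <= 0 :> R.
Proof.
rewrite /dstp mulNr oppr_le0 divr_ge0// ?exprn_ge0 ?addr_ge0 ?mulr_ge0 ?Eflat_ge0//.
Qed.

Lemma dstp_near x : x <= 1 -> dstp x = 0 :> R.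
Proof. by move=> x1; rewrite /dstp ![Eflat _ (x - 1)]Eflat_le0 ?mulr0 ?addr0 ?oppr0 ?mul0r//; lra. Qed.

Lemma Hs_bcut e z : 0 < e -> Hs (fun z => (eta 1 z * bcut e z) * Gm 0 z) z =
  bcut e z * kap0 z + e^-1 * (eta 1 z * dstp (- (e^-1 * z.2)) * Gm 0 z).
Proof.
move=> e0; have Sf : Sm (fun z => eta 1 z * bcut e z) by apply: Sm_M; [exact: Sm_eta|exact: Sm_bcut].
have vf : vanish (fun z => eta 1 z * bcut e z).
  exists e => // y [_ y2]; rewrite /bcut stp1 ?subrr ?mulr0//.
  by rewrite -mulrN ler_pdivrMl// mulr1; move: y2; rewrite ler_norml => /andP[]; lra.
have Dxf i : Dx i (fun z => eta 1 z * bcut e z) = fun z => bcut e z * Dx i (eta 1) z.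
  apply/funext => y; have := (D_mul (Sm_diff y (Sm_eta 1)) (Sm_diff y (Sm_bcut e))).2 (xdir i).
  by rewrite D_bcut /= !mulr0 addr0 mulrC.
have Dtf : Dt (fun z => eta 1 z * bcut e z) z = Dt (eta 1) z * bcut e z + eta 1 z * (dstp (- (e^-1 * z.2)) * e^-1).
  have := (D_mul (Sm_diff z (Sm_eta 1)) (Sm_diff z (Sm_bcut e))).2 tdir.
  by rewrite D_bcut /= mulr1.
have Dxxf i : Dx i (Dx i (fun z => eta 1 z * bcut e z)) z = bcut e z * Dx i (Dx i (eta 1)) z.
  rewrite Dxf; have := (D_mul (Sm_diff z (Sm_bcut e)) (Sm_diff z (Sm_Dx i (Sm_eta 1)))).2 (xdir i).
  by rewrite D_bcut /= !mulr0 mul0r add0r.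
have A : \sum_i Dx i (Dx i (fun z => eta 1 z * bcut e z)) z = bcut e z * \sum_i Dx i (Dx i (eta 1)) z.
  by rewrite mulr_sumr; apply: eq_bigr => i _; exact: Dxxf.
have B : \sum_i z.1 ord0 i * Dx i (fun z => eta 1 z * bcut e z) z = bcut e z * \sum_i z.1 ord0 i * Dx i (eta 1) z.
  by rewrite mulr_sumr; apply: eq_bigr => i _; rewrite Dxf mulrCA.
have key (X T Y S S' d g0 g1 b h ds ei : R) : X = b * S -> T = d * b + h * (ds * ei) -> Y = b * S' ->
  (X + T) * g0 - Y * g1 = b * ((S + d) * g0 - S' * g1) + ei * (h * ds * g0).
  by move=> -> -> ->; ring.
apply: etrans (Hs_G vf Sf z) _.
exact: (key _ _ _ _ _ _ _ _ _ _ _ _ A Dtf B).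
Qed.

(** Up to the factor [- e^-1], the term of [Hs_bcut] in which the time derivative falls on [bcut]: a
    nonnegative density of flux through the time layer. *)
Definition Fm e (z : V) : R := - (eta 1 z * dstp (- (e^-1 * z.2)) * Gm 0 z).

Lemma Gm_ge0 m (z : V) : 0 <= Gm m z.
Proof. by rewrite /Gm; case: ifP => // _; exact: expR_ge0. Qed.

Lemma Fm_ge0 e z : 0 <= Fm e z.
Proof.
rewrite /Fm -mulNr -mulrN; apply: mulr_ge0; last exact: Gm_ge0.
by apply: mulr_ge0; [exact: eta_ge0|rewrite oppr_ge0 dstp_le0].
Qed.

Lemma Sm_Dbcut e : Sm (fun z : V => dstp (- (e^-1 * z.2)) * (e^-1 * 1)).
Proof.
have := (Sm_closed (Sm_bcut e)).2 tdir; congr Sm; apply/funext => z.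
by rewrite D_bcut.
Qed.

Lemma ker_Fm e : 0 < e -> ker (Fm e).
Proof.
move=> e0.
have Sd : Sm (fun z : V => dstp (- (e^-1 * z.2))).
  have := Sm_Z e (Sm_Dbcut e); congr Sm; apply/funext => z.
  by rewrite mulr1 mulrCA mulfV ?mulr1// gt_eqF.
have : ker (fun z => (eta 1 z * dstp (- (e^-1 * z.2))) * Gm 0 z).
  apply: ker_G.
  - by apply: Sm_M => //; exact: Sm_eta.
  - exists e => // y [_ y2]; rewrite dstp_near ?mulr0//.
    by rewrite -mulrN ler_pdivrMl// mulr1; move: y2; rewrite ler_norml => /andP[]; lra.
  - by move=> z zK; rewrite eta_out ?mul0r.
move=> /(kerZ (-1)); congr ker; apply/funext => z.
by rewrite /Fm mulN1r.
Qed.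

Lemma I_Fm1 : 0 < I (Fm 1).
Proof.
have k1 := ker_Fm ltr01; apply: (@I_pos _ (0, -2)).
- exact/Cc_nice/ker_Cc.
- exact: Fm_ge0.
- by apply: Sm_continuous; case: k1.
rewrite /Fm -mulNr -mulrN invr1 mul1r /= opprK.
apply: mulr_gt0; [apply: mulr_gt0|].
- have -> : eta 1 (0, -2) = 2^-1 :> R.
    rewrite /eta /= (_ : rho _ = 0); last by apply: big1 => i _; rewrite /= mxE expr0n.
    by rewrite mulr0 stp1// !mul1r opprK stp2.
  by rewrite invr_gt0.
- rewrite oppr_gt0 /dstp mulNr oppr_lt0 divr_gt0 ?exprn_gt0 ?stp_den//.
  by rewrite addr_gt0// mulr_gt0// Eflat_gt0//; lra.
- by rewrite /Gm ifT ?expR_gt0//=; lra.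
Qed.

Lemma Gm_scale (r : R) (z : V) : 0 < r -> r ^+ n * Gm 0 (affV r (r ^+ 2) 0 z) = Gm 0 z.
Proof.
move=> r0; have r20 : 0 < r ^+ 2 by rewrite exprn_gt0.
have E2 : (affV r (r ^+ 2) 0 z).2 = r ^+ 2 * z.2 by rewrite /affV /= addr0.
have Er : rho (affV r (r ^+ 2) 0 z) = r ^+ 2 * rho z.
  by rewrite /rho mulr_sumr; apply: eq_bigr => i _; rewrite /affV /= !mxE addr0; ring.
rewrite /Gm E2 Er pmulr_rlt0//.
case: ifP => z0; last by rewrite mulr0.
have -> : r ^+ n = expR (n%:R / 2 * ln (r ^+ 2)) :> R.
  by rewrite expr2 lnM ?posrE// (_ : n%:R / 2 * _ = n%:R * ln r) ?expRM_natl ?lnK ?posrE//; field.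
rewrite -expRD; congr expR.
rewrite -mulrN (@lnM _ (r ^+ 2) (- z.2)) ?posrE ?oppr_gt0//.
by field; rewrite lt_eqF// gt_eqF.
Qed.

(** [I_Hs] turns the integral into [e^-1 I (Fm e)] with [e = r^2]. A parabolic dilation by [r]
    brings the layer to unit size, [Gm 0] scales exactly, and the cutoff [eta 1] only becomes larger
    since [stp] is nonincreasing. So the bound does not depend on [r]. *)
Lemma I_bcut_lower r : 0 < r -> r <= 1 -> I (Fm 1) <= I (fun z => bcut (r ^+ 2) z * kap0 z).
Proof.
move=> r0 r1; set e := r ^+ 2; have e0 : 0 < e by rewrite exprn_gt0.
have kF := ker_Fm e0; have nF := Cc_nice (ker_Cc kF).
have nbk : nice (fun z => bcut e z * kap0 z).
  by apply: Cc_nice; apply: Cc_mul; [exact: Sm_bcut|exact/ker_Cc/ker_kap0].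
have Cf : Cc (fun z => (eta 1 z * bcut e z) * Gm 0 z).
  apply: ker_Cc; apply: ker_G.
  - by apply: Sm_M; [exact: Sm_eta|exact: Sm_bcut].
  - exists e => // y [_ y2]; rewrite /bcut stp1 ?subrr ?mulr0//.
    by rewrite -mulrN ler_pdivrMl// mulr1; move: y2; rewrite ler_norml => /andP[]; lra.
  - by move=> z zK; rewrite eta_out ?mul0r.
have IE : I (fun z => bcut e z * kap0 z) = e^-1 * I (Fm e).
  have := I_Hs Cf.
  have -> : Hs (fun z => (eta 1 z * bcut e z) * Gm 0 z) = fun z => bcut e z * kap0 z - e^-1 * Fm e z.
    by apply/funext => z; rewrite Hs_bcut// /Fm mulrN opprK.
  rewrite I_B//; last exact: niceZ.
  by rewrite I_Z// => /eqP; rewrite subr_eq0 => /eqP.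
rewrite IE.
have rn0 : r != 0 by rewrite gt_eqF. have en0 : e != 0 by rewrite gt_eqF.
have := I_affV 0 rn0 en0 nF; rewrite (gtr0_norm r0) (gtr0_norm e0) => IA.
have -> : e^-1 * I (Fm e) = I (fun z => r ^+ n * Fm e (affV r e 0 z)).
  rewrite I_Z; last exact: nice_affV.
  by rewrite IA !mulrA -exprMn mulfV// expr1n mul1r.
apply: I_le.
- exact/Cc_nice/ker_Cc/ker_Fm.
- by apply: niceZ; exact: nice_affV.
move=> z; rewrite /Fm mulrN lerN2 mulrCA Gm_scale// invr1 mul1r.
have -> : e^-1 * (affV r e 0 z).2 = z.2 by rewrite /affV /= addr0 mulrA mulVf// mul1r.
rewrite ler_wpM2r ?Gm_ge0//.
have [z0|z0] := leP 0 z.2.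
  by rewrite dstp_near ?mulr0//; clear -z0; lra.
rewrite ler_wnM2r ?dstp_le0// /eta ler_pM ?stp_ge0//; apply: stp_anti.
  rewrite (_ : rho _ = e * rho z); last first.
    by rewrite /rho mulr_sumr; apply: eq_bigr => i _; rewrite /affV /= !mxE addr0 /e; ring.
  rewrite !mul1r ler_piMl ?rho_ge0//; by rewrite /e expr_le1// ltW.
have : e <= 1 by rewrite /e expr_le1// ltW.
by rewrite /affV /= addr0; move: (z.2) z0; clearbody e; clear -e0 => x x0; nra.
Qed.

(** The integral of [kap0] is the flux of the heat kernel into the origin. Cutting off a layer of
    thickness of order [e] changes it by a multiple of [e], while the truncated integral stays above
    the positive number [I (Fm 1)]. *)
Lemma I_kap0_gt0 : 0 < I kap0.
Proof.
have [M HM] := Cc_bounded (ker_Cc ker_kap0).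
have M0 : 0 <= M by exact: le_trans (HM (0, 0)).
set J := I (Fm 1); have J0 : 0 < J by exact: I_Fm1.
pose K : R := M * (4 ^+ n * 3); have K0 : 0 <= K by rewrite !mulr_ge0// exprn_ge0.
(* [K * e] bounds the integral of [|kap0|] over the layer, where [e = r^2 <= r]; this [r] makes it
   at most [J / 2]. *)
pose r := Num.min 1 (J / (2 * (K + 1))).
have r0 : 0 < r by rewrite lt_min ltr01 divr_gt0// mulr_gt0// ltr_wpDl.
have r1 : r <= 1 by rewrite ge_min lexx.
set e := r ^+ 2; have e0 : 0 < e by rewrite exprn_gt0.
have er : e <= r by rewrite /e expr2 ler_piMl// ltW.
have nk := Cc_nice (ker_Cc ker_kap0).
have nbk : nice (fun z => bcut e z * kap0 z).
  by apply: Cc_nice; apply: Cc_mul; [exact: Sm_bcut|exact/ker_Cc/ker_kap0].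
pose A : set ('rV[R]_n * measurableTypeR R) := @cube R n 2 `*` `[- (3 * e), 0].
have mA : measurable A by apply: measurableX => //; exact: measurable_cube.
have nA : nice (\1_A).
  apply: (@nice_indic _ _ _ (2 + 3 * e)) => // z [/= z1]; rewrite in_itv/= => /andP[z2 z3].
  split; first by apply: (@le_trans _ _ 2); [exact/rV_norm_leP|lra].
  by rewrite ler_norml; apply/andP; split; fast_lra.
have : I kap0 - I (fun z => bcut e z * kap0 z) >= - (K * e).
  rewrite -I_B//; have -> : - (K * e) = I (fun z => - M * \1_A z).
    rewrite I_Z// I_indic// mu_rect//=; last by lra.
    by rewrite /K; have -> : 2 * 2 = 4 :> R; [lra|ring].
  apply: I_le; [exact: niceZ|exact: niceB|].
  move=> z; rewrite indicE.
  have -> : kap0 z - bcut e z * kap0 z = stp (- (e^-1 * z.2)) * kap0 z by rewrite /bcut; ring.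
  have [_|/negP zA] := boolP (z \in A).
    have := HM z; rewrite ler_norml => /andP[h1 h2].
    have := stp_ge0 (- (e^-1 * z.2)); have := stp_le1 (- (e^-1 * z.2)); rewrite mulr1; nra.
  rewrite mulr0; have [->|/ker_kap0.2[z1 /andP[z2 z3]]] := eqVneq (kap0 z) 0; first by rewrite mulr0.
  rewrite stp0 ?mul0r// leNgt; apply/negP => h; apply: zA; rewrite inE; split => /=.
    by move=> i; exact: le_trans (rV_coord_le _ _) z1.
  rewrite in_itv/= (ltW z3) andbT; move: h; rewrite -mulrN ltr_pdivrMl//; fast_lra.
have := I_bcut_lower r0 r1; rewrite -/J -/e.
have : K * e <= J / 2.
  apply: (@le_trans _ _ (K * (J / (2 * (K + 1))))).
    by rewrite ler_wpM2l// (le_trans er)// ge_min lexx orbT.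
  rewrite mulrA ler_pdivrMr ?mulr_gt0 ?ltr_wpDl//; nra.
fast_lra.
Qed.

End kernels.

(** * Weak solutions and rescaling *)

Section normalized.
Context {R : realType} {n : nat}.
Local Notation V := ('rV[R]_n * R)%type.

Definition mass : R := I (@kap0 R n).
Lemma mass_gt0 : 0 < mass. Proof. exact: I_kap0_gt0. Qed.
Definition kap (z : V) : R := mass^-1 * kap0 z.
Definition psi (z : V) : R := mass^-1 * psi0 z.
Definition om (z : V) : R := mass^-1 * om0 z.
Definition Xi i j (z : V) : R := mass^-1 * Xi0 i j z.

Lemma ker_kap : ker kap. Proof. exact: kerZ ker_kap0. Qed.
Lemma ker_psi : ker psi. Proof. exact: kerZ ker_psi0. Qed.
Lemma ker_om : ker om. Proof. exact: kerZ ker_om0. Qed.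
Lemma ker_Xi i j : ker (Xi i j). Proof. exact: kerZ (ker_Xi0 i j). Qed.

Lemma I_kap : I kap = 1.
Proof.
rewrite /kap I_Z; last exact/Cc_nice/ker_Cc/ker_kap0.
by rewrite mulVf// gt_eqF// mass_gt0.
Qed.

Lemma Dt_Z c (f : V -> R) z : differentiable f z -> Dt (fun z => c * f z) z = c * Dt f z.
Proof. by move=> df; apply: etrans ((D_mul (D_cst c z).1 df).2 _) _; rewrite (D_cst _ _).2 mul0r add0r. Qed.

Lemma Dxx_Z i j c (f : V -> R) z : Sm f -> Dx i (Dx j (fun z => c * f z)) z = c * Dx i (Dx j f) z.
Proof.
move=> Sf; have -> : Dx j (fun z => c * f z) = fun z => c * Dx j f z.
  by apply/funext => y; apply: Dx_Z; exact: Sm_diff.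
by apply: Dx_Z; apply: Sm_diff; exact: Sm_Dx.
Qed.

Lemma Hs_psi z : Hs psi z = kap z - 2 ^+ n.+2 * kap (dl z).
Proof.
have [S0 _] := ker_psi0 (R := R) (n := n).
have -> : Hs psi z = mass^-1 * Hs psi0 z.
  rewrite /Hs mulrDr mulr_sumr; congr (_ + _); last by apply: Dt_Z; exact: Sm_diff.
  by apply: eq_bigr => i _; exact: Dxx_Z.
by rewrite Hs_psi0 /kap mulrBr [2 ^+ _ * (_ * _)]mulrCA.
Qed.

Lemma psi_xx i j z : Dx i (Dx j psi) z =
  om z * (z.1 ord0 i * z.1 ord0 j + 2 * z.2 * (i == j)%:R) +
  Xi i j z - 2 ^+ n.+2 * Xi i j (dl z).
Proof.
have [S0 _] := ker_psi0 (R := R) (n := n).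
rewrite (Dxx_Z i j _ _ S0) psi0_xx /om /Xi.
set a := om0 z; set b := Xi0 i j z; set c := Xi0 i j (dl z); set m := mass^-1; set q := 2 ^+ _; set e := _ + _ * _.
by ring.
Qed.

Lemma om_ge0 z : 0 <= om z.
Proof. by rewrite mulr_ge0 ?om0_ge0// invr_ge0 ltW// mass_gt0. Qed.

Lemma om_even (x : 'rV[R]_n) t : om (- x, t) = om (x, t).
Proof. by rewrite /om om0_even. Qed.

Lemma om_lower tau : 0 < tau -> exists2 c, 0 < c & forall z : V, rho z <= 2 -> -2 <= z.2 ->
  z.2 <= - tau -> ~ (rho z <= 2^-1 /\ - 2^-1 <= z.2) -> c <= om z.
Proof.
move=> t0; have [c cp H] := @om0_lower R n tau t0; exists (mass^-1 * c).
  by rewrite mulr_gt0// invr_gt0 mass_gt0.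
by move=> z *; rewrite ler_pM2l ?invr_gt0 ?mass_gt0//; exact: H.
Qed.

(** Beyond the support of [f] the derivative is plainly 0, except at time 0. There [v] may be
    replaced by [- v] to point forward in time, and all difference quotients in that direction
    vanish. *)
Lemma ker_D v (f : V -> R) : ker f -> ker ('D_v f).
Proof.
move=> [Sf Hf]; split; first exact: (Sm_closed Sf).2.
move=> z Dz.
have [h1 h2] : `|z.1| <= 2 /\ -3 <= z.2.
  apply: contrapT => zK; move/eqP: Dz; apply; apply: vanish_KB zK => y yK.
  apply/eqP; apply: contrapT => /negP/Hf[a /andP[b _]]; exact: yK.
split => //; rewrite h2/= ltNge; apply/negP => z0.
move/eqP: Dz; apply.
wlog v0 : v / 0 <= v.2.
  move=> H; have [|v0] := leP 0 v.2; first exact: H.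
  have := H (- v); rewrite /= oppr_ge0 => /(_ (ltW v0)).
  by rewrite !deriveE ?linearN /=; try exact: Sm_diff; move/eqP; rewrite oppr_eq0 => /eqP.
have fz y : 0 <= y.2 -> f y = 0.
  by move=> y0; apply/eqP; apply: contrapT => /negP/Hf[_ /andP[_]]; rewrite ltNge y0.
have df := Sm_diff z Sf; rewrite deriveE//.
apply/eqP; rewrite -normr_le0; apply/ler_addgt0Pr => e e0; rewrite add0r.
have e1 : 0 < e / (`|v| + 1) by rewrite divr_gt0// ltr_wpDl.
have [d d0 Hd] := diff_eps df e1.
have vp : 0 < `|v| + 1 by rewrite ltr_wpDl.
pose h := d / 2 / (`|v| + 1); have hp : 0 < h by rewrite !divr_gt0.
have hv : `|h *: v| < d.
  rewrite normrZ gtr0_norm//; apply: (@le_lt_trans _ _ (d / 2)); last by fast_lra.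
  by rewrite /h mulrAC ler_pdivrMr// ler_wpM2l ?divr_ge0 ?(ltW d0)// lerDl.
have := Hd _ hv; rewrite linearZ/= !fz//=; last by rewrite addr_ge0// mulr_ge0// ltW.
rewrite subrr sub0r normrN normrZ [X in _ <= _ * X]normrZ (gtr0_norm hp) => H.
rewrite -(ler_pM2l hp); apply: le_trans H _.
by rewrite mulrCA ler_pM2l// mulrAC ler_pdivrMr// ler_wpM2l ?(ltW e0)// lerDl.
Qed.

Lemma mvt_line (G G' : R -> R) a M : (forall s : R, is_derive s 1 G (G' s)) ->
  (forall s, 0 <= s <= 1 -> `|G' s - a| <= M) -> `|G 1 - G 0 - a| <= M.
Proof.
move=> dG H.
have dg (s : R) : is_derive s 1 (fun s => G s - G 0 - s * a) (G' s - a).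
  have d1 := dG s.
  have E : G' s - a = G' s - 0 - 1 * a by rewrite subr0 mul1r.
  rewrite E; apply: is_deriveB.
  have -> : (fun s : R => s * a) = a \*: (id : R -> R^o) by apply/funext => x; rewrite /= mulrC.
  by rewrite [1 * a]mulrC; exact: is_deriveZ.
have := @mvt0 R _ _ M _ dg H 1.
by rewrite mul1r ler01 lexx => /(_ _ isT); apply; rewrite mul0r !subrr.
Qed.

Lemma Cc_lip (f : V -> R) u : Cc f -> exists2 C, 0 <= C & forall (w : V) (h : R), 0 <= h -> `|f (w + h *: u) - f w| <= C * h.
Proof.
move=> Cf; have [M HM] := Cc_bounded (Cc_D u Cf).
have M0 : 0 <= M by exact: le_trans (HM (0, 0)).
exists M => // w h h0; have [Sf _] := Cf.
have := @mvt_line (fun s => f (w + s *: (h *: u))) _ 0 (M * h) (fun s => line_deriv w (h *: u) s Sf).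
rewrite scale0r addr0 scale1r subr0; apply=> s _.
rewrite subr0 D_scale_dir; last exact: Sm_diff.
by rewrite normrM (ger0_norm h0) mulrC ler_wpM2r.
Qed.

Lemma Cc_lip2 (f : V -> R) u : Cc f -> exists2 C, 0 <= C & forall (w : V) (h : R), 0 <= h ->
  `|f (w + h *: u) - f w - h * 'D_u f w| <= C * h ^+ 2.
Proof.
move=> Cf; have [M M0 HM] := Cc_lip u (Cc_D u Cf).
exists M => // w h h0; have [Sf _] := Cf.
have := @mvt_line (fun s => f (w + s *: (h *: u))) _ (h * 'D_u f w) (M * h ^+ 2) (fun s => line_deriv w (h *: u) s Sf).
rewrite scale0r addr0 scale1r; apply=> s /andP[s0 s1].
rewrite D_scale_dir; last exact: Sm_diff.
rewrite -mulrBr normrM (ger0_norm h0) scalerA.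
have := HM w (s * h) (mulr_ge0 s0 h0) => H.
apply: (@le_trans _ _ (h * (M * (s * h)))); first by rewrite ler_wpM2l.
have : M * h ^+ 2 * s <= M * h ^+ 2 by rewrite ler_piMr// mulr_ge0// sqr_ge0.
rewrite expr2; lra.
Qed.

(* The mixed second difference, computed along v first. *)
Lemma second_diff (f : V -> R) u v : Cc f -> exists2 C, 0 <= C & forall (w : V) (h : R), 0 <= h -> h <= 1 ->
  `|f (w + h *: u + h *: v) - f (w + h *: v) - (f (w + h *: u) - f w) - h ^+ 2 * 'D_u ('D_v f) w| <= C * h ^+ 3.
Proof.
move=> Cf; have [C1 C10 H1] := Cc_lip2 u (Cc_D v Cf).
have [C2 C20 H2] := Cc_lip v (Cc_D u (Cc_D v Cf)).
exists (C1 + C2); first exact: addr_ge0.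
move=> w h h0 h1; have [Sf _] := Cf.
have dG (s : R) : is_derive s 1 (fun s : R => f (w + h *: u + s *: (h *: v)) - f (w + s *: (h *: v)))
   (h * 'D_v f (w + h *: u + s *: (h *: v)) - h * 'D_v f (w + s *: (h *: v))).
  have := is_deriveB (line_deriv (w + h *: u) (h *: v) s Sf) (line_deriv w (h *: v) s Sf).
  by rewrite !D_scale_dir//; exact: Sm_diff.
have := mvt_line (a := h ^+ 2 * 'D_u ('D_v f) w) (M := (C1 + C2) * h ^+ 3) dG.
rewrite !scale0r !addr0 !scale1r; apply=> s /andP[s0 s1].
rewrite scalerA; have := H1 (w + (s * h) *: v) h h0; have := H2 w (s * h) (mulr_ge0 s0 h0).
rewrite (addrAC w).
set A := 'D_v f _; set B := 'D_v f _; set D := 'D_u _ _; set E := 'D_u _ _ => h3 h4.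
have -> : h * A - h * B - h ^+ 2 * E = h * (A - B - h * D) + h ^+ 2 * (D - E) by ring.
apply: le_trans (ler_normD _ _) _; rewrite !normrM (ger0_norm h0).
have a1 : h * `|A - B - h * D| <= h * (C1 * h ^+ 2) by rewrite ler_wpM2l.
have a2 : h ^+ 2 * `|D - E| <= h ^+ 2 * (C2 * h).
  rewrite ler_wpM2l ?sqr_ge0//; apply: le_trans h3 _.
  by rewrite ler_wpM2l// ler_piMl.
have -> : (C1 + C2) * h ^+ 3 = h * (C1 * h ^+ 2) + h ^+ 2 * (C2 * h) by ring.
exact: lerD.
Qed.

(** Both mixed derivatives equal the same second difference divided by [h^2], up to a multiple of
    [h]. *)
Lemma schwarz (f : V -> R) u v z : Cc f -> 'D_u ('D_v f) z = 'D_v ('D_u f) z.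
Proof.
move=> Cf; have [C C0 HC] := second_diff u v Cf; have [C' C'0 HC'] := second_diff v u Cf.
set X := 'D_u ('D_v f) z; set Y := 'D_v ('D_u f) z.
have H h : 0 < h -> h <= 1 -> `|X - Y| <= (C + C') * h.
  move=> h0 h1; have h20 : 0 < h ^+ 2 by rewrite exprn_gt0.
  have := HC z h (ltW h0) h1; have := HC' z h (ltW h0) h1; rewrite -/X -/Y (addrAC z).
  set a := f _; set b := f _; set c := f _; set d := f z => e1 e2.
  rewrite -(ler_pM2l h20) -[X in X * `|_|]gtr0_norm// -normrM.
  have -> : h ^+ 2 * (X - Y) = (a - b - (c - d) - h ^+ 2 * Y) - (a - c - (b - d) - h ^+ 2 * X) by ring.
  apply: le_trans (ler_normB _ _) _.
  have -> : h ^+ 2 * ((C + C') * h) = C' * h ^+ 3 + C * h ^+ 3 by ring.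
  exact: lerD.
apply/eqP; rewrite -subr_eq0 -normr_le0; apply/ler_addgt0Pr => e e0; rewrite add0r.
have K1 : 0 < C + C' + 1 by rewrite ltr_wpDl// addr_ge0.
have := H (Num.min 1 (e / (C + C' + 1))); rewrite lt_min ltr01 divr_gt0// ge_min lexx => /(_ isT isT) /le_trans; apply.
apply: (@le_trans _ _ ((C + C' + 1) * (e / (C + C' + 1)))); last by rewrite mulrCA divff ?mulr1// gt_eqF.
apply: ler_pM; rewrite ?addr_ge0 ?lerDl ?le_min ?ler01 ?divr_ge0 ?(ltW e0) ?(ltW K1) ?ge_min ?lexx ?orbT//.
Qed.

(** One unit of time more than [KB], to leave room for moving a kernel into the past by up to 1. *)
Definition KB4 (z : V) := `|z.1| <= 2 /\ -4 <= z.2 < 0.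

(* [Laplacian v - dv/dt = g] in [D], tested against rescaled kernels only. *)
Definition wsol (D : set V) (v g : V -> R) :=
  [/\ bm v, mfun g, (forall z, `|g z| <= 1) &
   forall k, ker k -> forall r p, 0 < r -> (forall z, KB4 z -> D (affV r (r ^+ 2) p z)) ->
   I (fun z => v (affV r (r ^+ 2) p z) * Hs k z) = r ^+ 2 * I (fun z => g (affV r (r ^+ 2) p z) * k z)].

(** The division by [r^2] cancels the factor from the two spatial derivatives, so that the
    right-hand side keeps its bound 1. *)
Definition zm r p (v : V -> R) (z : V) : R := r ^- 2 * v (affV r (r ^+ 2) p z).

Lemma affV_comp r p s q z : affV r (r ^+ 2) p (affV s (s ^+ 2) q z : V) =
  affV (r * s) ((r * s) ^+ 2) (affV r (r ^+ 2) p q) z.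
Proof.
rewrite /affV; apply: (congr2 pair) => /=; first by rewrite scalerDr scalerA addrA.
by rewrite exprMn; ring.
Qed.

Lemma wsol_zm D v g r p : 0 < r -> wsol D v g ->
  wsol [set z | D (affV r (r ^+ 2) p z)] (zm r p v) (fun z => g (affV r (r ^+ 2) p z)).
Proof.
move=> r0 [bv mg g1 W]; split.
- by apply: bmM; [exact: bm_cst|exact: bm_affV].
- exact: mfun_affV.
- by move=> z.
move=> k kk s q s0 H.
have rn : r ^+ 2 != 0 by rewrite expf_neq0// gt_eqF.
have := W k kk (r * s) (affV r (r ^+ 2) p q) (mulr_gt0 r0 s0).
have nk := Cc_nice (ker_Cc kk).
have nH : nice (Hs k).
  apply: niceD; first by apply: nice_sum => i; apply/Cc_nice/Cc_D/Cc_D/ker_Cc.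
  exact/Cc_nice/Cc_D/ker_Cc.
move=> /(_ _)E.
rewrite (_ : (fun z => _) = fun z => r ^- 2 * (v (affV (r * s) ((r * s) ^+ 2) (affV r (r ^+ 2) p q) z) * Hs k z)); last first.
  by apply/funext => z; rewrite /zm affV_comp mulrA.
rewrite I_Z; last by apply: nice_mul => //; exact: bm_affV.
rewrite E; last by move=> z /H /=; rewrite affV_comp.
have -> : (fun z => g (affV r (r ^+ 2) p (affV s (s ^+ 2) q z)) * k z) =
    fun z => g (affV (r * s) ((r * s) ^+ 2) (affV r (r ^+ 2) p q) z) * k z.
  by apply/funext => z; rewrite affV_comp.
by move: (I _) => J; rewrite exprMn -[r ^+ 2 * _ * J]mulrA [LHS]mulrA mulVf// mul1r.
Qed.

Lemma wsolW D D' v g : D' `<=` D -> wsol D v g -> wsol D' v g.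
Proof.
move=> DD [bv mg g1 W]; split=> // k kk r p r0 H.
by apply: W => // z /H/DD.
Qed.

Lemma affV1 p (z : V) : affV 1 (1 ^+ 2) p z = z + p.
Proof. by rewrite /affV scale1r expr1n mul1r. Qed.

Lemma nice_Hs (k : V -> R) : ker k -> nice (Hs k).
Proof.
move=> kk; apply: niceD; last exact/Cc_nice/Cc_D/ker_Cc.
by apply: nice_sum => i; apply/Cc_nice/Cc_D/Cc_D/ker_Cc.
Qed.

Lemma wsol1 D v g (k : V -> R) p : wsol D v g -> ker k -> (forall z, KB4 z -> D (z + p)) ->
  I (fun z => v (z + p) * Hs k z) = I (fun z => g (z + p) * k z).
Proof.
move=> [_ _ _ W] kk KD; have := W k kk 1 p ltr01.
rewrite expr1n mul1r => H.
have E f (h : V -> R) : (fun z => f (affV 1 1 p z) * h z) = (fun z : V => f (z + p) * h z).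
  by apply/funext => z; have := affV1 p z; rewrite expr1n => ->.
by rewrite !E in H; apply: H => z /KD; have := affV1 p z; rewrite expr1n => ->.
Qed.

Lemma I_half (w k : V -> R) : bm w -> nice k ->
  I (fun y => w (affV 2^-1 4^-1 0 y) * k y) = 2 ^+ n.+2 * I (fun y => w y * k (dl y)).
Proof.
move=> bw nk; have nk' : nice (fun y => k (dl y)) by apply: nice_affV.
have a0 : (2^-1 : R) != 0 by []. have b0 : (4^-1 : R) != 0 by [].
have := I_affV 0 a0 b0 (nice_mul bw nk').
rewrite !gtr0_norm// !invrK => E; rewrite -[RHS]/(2 ^+ n.+2 * I _).
have -> : 2 ^+ n.+2 = 2 ^+ n * 4 :> R by rewrite !exprS; ring.
rewrite -E; congr I; apply/funext => y; congr (_ * k _).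
rewrite /dl /affV /= [LHS]surjective_pairing; congr pair.
  by rewrite addr0 scalerDr scalerA mulfV// scale1r scaler0 !addr0.
by rewrite !addr0 mulrA mulfV// mul1r.
Qed.

End normalized.

(** * Averages at dyadic scales and a representation formula *)

Section representation.
Context {R : realType} {n : nat}.
Local Notation V := ('rV[R]_n * R)%type.

Definition Bx r : set V := [set z | `|z.1| < r /\ - r ^+ 2 < z.2 < 0].

(** A correlation: for a kernel in negative times it averages [v] over the past of [z]. *)
Definition cv (k v : V -> R) (z : V) : R := I (fun y => v (y + z) * k y).

Lemma bm_shift (v : V -> R) z : bm v -> bm (fun y : V => v (y + z)).
Proof.
move=> /(bm_affV 1 1 z); congr bm; apply/funext => y.
by have := affV1 z y; rewrite expr1n => ->.
Qed.

Lemma nice_shift (k : V -> R) z : nice k -> nice (fun y : V => k (y + z)).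
Proof.
move=> /(nice_affV z (oner_neq0 R) (oner_neq0 R)); congr nice; apply/funext => y.
by have := affV1 z y; rewrite expr1n => ->.
Qed.

Lemma I_shiftE (k : V -> R) z : nice k -> I (fun y : V => k (y + z)) = I k.
Proof. exact: I_shift. Qed.

Lemma cvE (k v : V -> R) z : bm v -> nice k -> cv k v z = I (fun y => v y * k (y - z)).
Proof.
move=> bv nk; rewrite -(@I_shiftE (fun y => v y * k (y - z)) z); last first.
  by apply: nice_mul => //; exact: nice_shift.
by rewrite /cv; congr I; apply/funext => y; rewrite addrK.
Qed.

Lemma kap_dl (z : V) : 2 ^+ n.+2 * kap (dl z) = kap z - Hs psi z.
Proof. by rewrite Hs_psi; ring. Qed.

Lemma affV_half r p (y : V) : affV r (r ^+ 2) p (affV 2^-1 4^-1 0 y : V) =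
  affV (r / 2) ((r / 2) ^+ 2) p y.
Proof.
have := affV_comp r p 2^-1 0 y; rewrite (_ : 2^-1 ^+ 2 = 4^-1); last by field.
move=> ->; congr affV.
by rewrite /affV /= scaler0 mulr0 !add0r -surjective_pairing.
Qed.

(** By [Hs_psi], the difference of the averaging kernels at scales [r] and [r / 2] is [Hs psi], so
    the equation tested with [psi] gives the difference of the averages. *)
Lemma rep_step D v g r p : wsol D v g -> 0 < r ->
  (forall z : V, KB4 z -> D (affV r (r ^+ 2) p z)) ->
  I (fun y => v (affV r (r ^+ 2) p y) * kap y) -
  I (fun y => v (affV (r / 2) ((r / 2) ^+ 2) p y) * kap y) =
  r ^+ 2 * I (fun y => g (affV r (r ^+ 2) p y) * psi y).
Proof.
move=> [bv mg g1 W] r0 HD; rewrite -W//; last exact: ker_psi.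
have nk := Cc_nice (ker_Cc (@ker_kap R n)); have bw := bm_affV r (r ^+ 2) p bv.
have := I_half bw nk; under eq_fun do rewrite affV_half.
move=> ->; rewrite -I_Z; last by apply: nice_mul => //; exact: nice_affV.
rewrite -I_B; [|exact: nice_mul|by apply/niceZ/nice_mul => //; exact: nice_affV].
have key (w q b c h : R) : c * b = q - h -> w * q - c * (w * b) = w * h.
  by move=> E; rewrite mulrCA E; ring.
by congr I; apply/funext => y; apply: key; exact: kap_dl.
Qed.

(* Continuity from earlier times, the only one available on the top of a cylinder. *)
Definition lcont (v : V -> R) (p : V) := forall e, 0 < e -> exists2 d, 0 < d &
  forall h : V, `|h| < d -> h.2 < 0 -> `|v (p + h) - v p| <= e.

Definition rj j : R := 2^-1 ^+ j.
Lemma rj_gt0 j : 0 < rj j. Proof. by rewrite exprn_gt0. Qed.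
Lemma rj_le1 j : rj j <= 1. Proof. by rewrite exprn_ile1//; lra. Qed.
Lemma rjS j : rj j.+1 = rj j / 2. Proof. by rewrite /rj exprSr. Qed.
Lemma rj_sqr j : rj j ^+ 2 = 4^-1 ^+ j.
Proof. by rewrite /rj exprAC; congr (_ ^+ _); field. Qed.

Lemma rj_small e : 0 < e -> exists N, forall j, (N <= j)%N -> rj j <= e.
Proof.
move=> e0; have [N HN] : exists N : nat, e^-1 <= N%:R.
  by exists (Num.bound e^-1); apply/ltW/archi_boundP; rewrite invr_ge0 ltW.
exists N => j Nj; rewrite /rj exprVn -[e]invrK lef_pV2 ?posrE ?exprn_gt0 ?invr_gt0//.
apply: le_trans HN _; rewrite -natrX ler_nat (leq_trans Nj)//.
exact/ltnW/ltn_expl.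
Qed.

Lemma kap_local v p e : bm v -> lcont v p -> 0 < e -> exists N, forall j, (N <= j)%N ->
  `|I (fun y => v (affV (rj j) (rj j ^+ 2) p y) * kap y) - v p| <= e * I (fun y : V => `|kap y|).
Proof.
move=> bv lv e0; have [d d0 Hd] := lv e e0.
have [N HN] := rj_small (e := d / 4) ltac:(by rewrite divr_gt0).
exists N => j /HN rd; have r0 := rj_gt0 j; have r1 := rj_le1 j.
have nk := Cc_nice (ker_Cc (@ker_kap R n)); have bw := bm_affV (rj j) (rj j ^+ 2) p bv.
have E : I (fun y : V => v p * kap y) = v p by rewrite (I_Z (v p) nk) I_kap mulr1.
rewrite -[X in _ - X]E.
rewrite -I_B; [|exact: nice_mul|exact: niceZ].
apply: le_trans (I_norm _) _; first by apply: niceB; [exact: nice_mul|exact: niceZ].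
rewrite -I_Z; last exact: nice_norm.
apply: I_le; [apply: nice_norm; apply: niceB; [exact: nice_mul|exact: niceZ]|exact/niceZ/nice_norm|].
move=> y; rewrite -mulrBl normrM.
have [->|/(ker_kap).2[y1 /andP[y2 y3]]] := eqVneq (kap y) 0; first by rewrite normr0 !mulr0.
rewrite ler_wpM2r//.
have -> : affV (rj j) (rj j ^+ 2) p y = p + (rj j *: y.1, rj j ^+ 2 * y.2) by apply: (congr2 pair); rewrite /= addrC.
apply: Hd; last by rewrite /= nmulr_llt0// exprn_gt0.
have r2 : rj j ^+ 2 <= rj j by rewrite expr2 ler_piMr// ltW.
have r3 : 0 < rj j ^+ 2 by rewrite exprn_gt0.
rewrite normV gt_max /= normrZ normrM (gtr0_norm r0) (gtr0_norm r3).
have : `|y.2| <= 3 by rewrite ler_norml; lra.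
move=> y4; apply/andP; split; first by nra.
apply: (@le_lt_trans _ _ (rj j * 3)); last lra.
by rewrite ler_pM// ltW// exprn_gt0.
Qed.

(** [rep_step] summed over the scales [2^-j], together with the convergence of the averages to
    [v p]. It is a Duhamel formula: [v] is a smooth average minus a dyadic heat potential of [g]. *)
Lemma rep D v g p : wsol D v g -> lcont v p ->
  (forall r (z : V), 0 < r -> r <= 1 -> KB4 z -> D (affV r (r ^+ 2) p z)) ->
  forall e, 0 < e -> exists N0, forall N, (N0 <= N)%N ->
  `|cv kap v p - \sum_(j < N) 4^-1 ^+ j * I (fun y => g (affV (rj j) (rj j ^+ 2) p y) * psi y) - v p| <= e.
Proof.
move=> Ws lv HD e e0; have [bv _ _ _] := Ws.
pose K := I (fun y : V => `|kap y|); have K0 : 0 <= K by apply: I_ge0.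
have K1 : 0 < K + 1 by rewrite ltr_wpDl.
have [N0 HN] := kap_local bv lv (e := e / (K + 1)) ltac:(by rewrite divr_gt0).
exists N0 => N /HN H; apply: le_trans (le_trans _ H) _; last first.
  by rewrite -/K mulrAC ler_pdivrMr// ler_wpM2l ?(ltW e0)// lerDl.
rewrite le_eqVlt; apply/orP; left; apply/eqP; congr (`|_ - _|).
elim: (N) => [|m IH].
  rewrite big_ord0 subr0 /cv; congr I; apply/funext => y.
  by rewrite /rj expr0 affV1.
rewrite big_ord_recr /= opprD addrA IH -rj_sqr -(rep_step Ws (rj_gt0 m)) ?rjS; first by ring.
by move=> z Kz; apply: HD => //; [exact: rj_gt0|exact: rj_le1].
Qed.

Lemma geo4 N : \sum_(j < N) 4^-1 ^+ j = 4 / 3 * (1 - 4^-1 ^+ N) :> R.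
Proof.
elim: N => [|N IH]; first by rewrite big_ord0 expr0 subrr mulr0.
by rewrite big_ord_recr /= IH exprS; field.
Qed.

Lemma psi_ge0 (z : V) : 0 <= psi z.
Proof.
rewrite mulr_ge0 ?invr_ge0 ?(ltW mass_gt0)//.
by rewrite mulr_ge0 ?Gm_ge0// th_ge0.
Qed.

Lemma nice_psi : nice (@psi R n). Proof. exact: Cc_nice (ker_Cc ker_psi). Qed.
Lemma nice_kap : nice (@kap R n). Proof. exact: Cc_nice (ker_Cc ker_kap). Qed.

(** The potential in [rep] is dominated by the geometric series of [4^-j], whose sum is 4/3. *)
Lemma rep_dist D v g p : wsol D v g -> lcont v p ->
  (forall r (z : V), 0 < r -> r <= 1 -> KB4 z -> D (affV r (r ^+ 2) p z)) ->
  `|cv kap v p - v p| <= 4 / 3 * I (@psi R n).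
Proof.
move=> Ws lv HD; apply/ler_addgt0Pr => e e0.
have [N0 /(_ N0 (leqnn _))] := rep Ws lv HD e0.
set S := \sum_(_ < _) _ => H.
have SP : `|S| <= 4 / 3 * I (@psi R n).
  apply: le_trans (ler_norm_sum _ _ _) _.
  apply: (@le_trans _ _ (\sum_(j < N0) 4^-1 ^+ j * I (@psi R n))).
    apply: ler_sum => j _; rewrite normrM ger0_norm ?exprn_ge0// ler_wpM2l ?exprn_ge0//.
    have [_ mg g1 _] := Ws.
    have ng : nice (fun y => g (affV (rj j) (rj j ^+ 2) p y) * psi y).
      apply: nice_mul nice_psi; apply: bm_affV; split => //; by exists 1.
    apply: le_trans (I_norm ng) _; apply: I_le; [exact: nice_norm|exact: nice_psi|].
    by move=> y; rewrite normrM (ger0_norm (psi_ge0 y)) ler_piMl ?psi_ge0.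
  have I0 : 0 <= I (@psi R n) by apply: I_ge0; exact: psi_ge0.
  rewrite -mulr_suml geo4 ler_wpM2r//.
  have : 0 <= 4^-1 ^+ N0 :> R by rewrite exprn_ge0.
  lra.
have -> : cv kap v p - v p = (cv kap v p - S - v p) + S by ring.
by apply: le_trans (ler_normD _ _) _; rewrite addrC lerD.
Qed.

(** Solving [rep] with [g = 2 f - 1] for the potential of [f] gives this expression: it is the limit
    of the sums of [4^-j] times the integral of [f] against [psi] at scale [2^-j]. Written through
    [v] and [cv kap v], its continuity and its heat operator are at hand. *)
Definition Wf v (p : V) : R := 2^-1 * (4 / 3 * I (@psi R n) - v p + cv kap v p).

Lemma Wf_bounds D v f p E : wsol D v (fun z => 2 * f z - 1) -> lcont v p ->
  (forall r (z : V), 0 < r -> r <= 1 -> KB4 z -> D (affV r (r ^+ 2) p z)) ->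
  mfun f -> (forall z, 0 <= f z <= 1) ->
  (forall N, \sum_(j < N) 4^-1 ^+ j * I (fun y => f (affV (rj j) (rj j ^+ 2) p y) * psi y) <= E) ->
  0 <= Wf v p <= E.
Proof.
move=> Ws lv HD mf f01 HE.
have bf j : bm (fun y => f (affV (rj j) (rj j ^+ 2) p y)).
  apply: bm_affV; split => //; exists 1 => z; have := f01 z; rewrite ler_norml; lra.
have Ej j : I (fun y => (2 * f (affV (rj j) (rj j ^+ 2) p y) - 1) * psi y) =
    2 * I (fun y => f (affV (rj j) (rj j ^+ 2) p y) * psi y) - I (@psi R n).
  have nf := nice_mul (bf j) nice_psi.
  have /= := I_B (niceZ 2 nf) nice_psi; rewrite (I_Z 2 nf) => <-.
  by congr I; apply/funext => y; ring.
have EN N : \sum_(j < N) 4^-1 ^+ j * I (fun y => (2 * f (affV (rj j) (rj j ^+ 2) p y) - 1) * psi y) =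
   2 * \sum_(j < N) 4^-1 ^+ j * I (fun y => f (affV (rj j) (rj j ^+ 2) p y) * psi y) -
   4 / 3 * (1 - 4^-1 ^+ N) * I (@psi R n).
  rewrite -geo4 mulr_sumr mulr_suml -sumrB; apply: eq_bigr => j _.
  by rewrite Ej; ring.
have S0 N : 0 <= \sum_(j < N) 4^-1 ^+ j * I (fun y => f (affV (rj j) (rj j ^+ 2) p y) * psi y).
  apply: sumr_ge0 => j _; rewrite mulr_ge0 ?exprn_ge0// I_ge0// => y.
  by rewrite mulr_ge0 ?psi_ge0//; case/andP: (f01 (affV (rj j) (rj j ^+ 2) p y)).
have I0 : 0 <= I (@psi R n) by apply: I_ge0; exact: psi_ge0.
suff H e : 0 < e -> - e <= Wf v p <= E + e.
  apply/andP; split; apply/ler_addgt0Pr => e /H/andP[h1 h2]; lra.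
move=> e0; have [N0 HN] := rep Ws lv HD e0.
have e1 : 0 < e / (4 / 3 * I (@psi R n) + 1) by rewrite divr_gt0// ltr_wpDl// mulr_ge0.
have [N1 HN1] := rj_small e1.
pose N := maxn N0 N1; have := HN N (leq_maxl _ _); rewrite EN ler_norml.
have := S0 N; have := HE N; set S := \sum_(_ < _) _ => s1 s2.
have q1 : 4^-1 ^+ N <= e / (4 / 3 * I (@psi R n) + 1).
  by rewrite -rj_sqr; have := HN1 N (leq_maxr _ _); have := rj_le1 N; have := rj_gt0 N; nra.
have q2 : 4 / 3 * 4^-1 ^+ N * I (@psi R n) <= e.
  have p1 : 0 < 4 / 3 * I (@psi R n) + 1 by rewrite ltr_wpDl// mulr_ge0.
  move: q1; rewrite ler_pdivlMr//; have : 0 <= 4^-1 ^+ N :> R by rewrite exprn_ge0.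
  fast_lra.
have q3 : 0 <= 4 / 3 * 4^-1 ^+ N * I (@psi R n) by rewrite !mulr_ge0// exprn_ge0.
rewrite /Wf; fast_lra.
Qed.

End representation.

(** * How the Taylor data change under one zoom *)

Section zooming.
Context {R : realType} {n : nat}.
Local Notation V := ('rV[R]_n * R)%type.

Lemma Hs_D (d : V) (f : V -> R) z : Cc f -> 'D_d (Hs f) z = Hs ('D_d f) z.
Proof.
move=> Cf.
have C2 i : Cc (Dx i (Dx i f)) by apply/Cc_D/Cc_D.
have Ct : Cc (Dt f) by exact: Cc_D.
have S (g : V -> R) : Cc g -> differentiable g z by move=> [Sg _]; exact: Sm_diff.
have [d1 e1] := D_sum (fun i => S _ (C2 i)).
apply: etrans ((D_add d1 (S _ Ct)).2 d) _.
have E1 : 'D_d (fun w => \sum_j Dx j (Dx j f) w) z = \sum_i Dx i (Dx i ('D_d f)) z.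
  apply: etrans (e1 d) _; apply: eq_bigr => i _; apply: etrans (schwarz _ _ _ (Cc_D (xdir i) Cf)) _.
  have -> : Dx i ('D_d f) = 'D_d ('D_(xdir i) f) by apply/funext => y; exact: schwarz.
  by [].
exact: (congr2 +%R E1 (schwarz d tdir z Cf)).
Qed.

Lemma wsol0 D v g (k : V -> R) : wsol D v g -> ker k -> KB4 `<=` D ->
  I (fun z => v z * Hs k z) = I (fun z => g z * k z).
Proof.
move=> Ws kk KD; have := wsol1 (p := 0) Ws kk.
have E (f h : V -> R) : (fun z => f (z + 0) * h z) = (fun z : V => f z * h z).
  by apply/funext => z; rewrite addr0.
by rewrite !E; apply => z /KD; rewrite addr0.
Qed.

Definition dscale (d : V) (s : R) := forall (f : V -> R) z, Sm f ->
  'D_d (fun z => f (dl z)) z = s * 'D_d f (dl z).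

Lemma dscale_x i : dscale (xdir i) 2. Proof. by move=> f z; exact: Dx_dl. Qed.
Lemma dscale_t : dscale tdir 4. Proof. by move=> f z; exact: Dt_dl. Qed.

Lemma Sm_dl (f : V -> R) z : Sm f -> differentiable (fun z => f (dl z)) z.
Proof. by move=> Sf; apply: diff_affV; exact: Sm_diff. Qed.

Lemma Cc_Hs (f : V -> R) : Cc f -> Cc (Hs f).
Proof.
by move=> Cf; apply: Cc_add; [apply: Cc_sum => i; apply/Cc_D/Cc_D|exact: Cc_D].
Qed.

(** The scaling relation of [kap] in a form stable under differentiation: a derivative multiplies
    [c] by 2 or 4. One computation, [I_zmv], then serves the Taylor coefficients of all orders. *)
Definition zrel (c : R) (a b h : V -> R) := [/\ Cc a, Cc b, ker h & forall y, c * a (dl y) = b y - Hs h y].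

Lemma zrel_kap : zrel (2 ^+ n.+2) kap kap psi.
Proof. by split; [exact/ker_Cc/ker_kap|exact/ker_Cc/ker_kap|exact: ker_psi|exact: kap_dl]. Qed.

Lemma zrel_D c a b h d s : dscale d s -> zrel c a b h -> zrel (c * s) ('D_d a) ('D_d b) ('D_d h).
Proof.
move=> ds [Ca Cb kh E]; split; [exact: Cc_D|exact: Cc_D|exact: ker_D|] => y.
have [Sa _] := Ca; have [Sb _] := Cb; have [SH _] := Cc_Hs (ker_Cc kh).
rewrite -Hs_D; last exact: ker_Cc.
rewrite -mulrA -(ds _ _ Sa).
have <- : 'D_d (fun y => c * a (dl y)) y = c * 'D_d (fun z => a (dl z)) y.
  by rewrite (D_mul (D_cst c y).1 (Sm_dl y Sa)).2 (D_cst _ _).2 mul0r add0r.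
have -> : (fun y => c * a (dl y)) = fun y => b y - Hs h y by apply/funext.
by apply: deriveB; apply: diff_derivable; exact: Sm_diff.
Qed.

Definition zmg (g : V -> R) (z : V) : R := g (affV 2^-1 4^-1 0 z).
Definition zmv (v : V -> R) (z : V) : R := 4 * v (affV 2^-1 4^-1 0 z).

(** The factor 4 of the zoom and the Jacobian [2^(n+2)] make [2^(n+4)]; the relation replaces the
    dilated kernel, and the equation turns [Hs h] into an integral of [g]. *)
Lemma I_zmv D v g c a b h : wsol D v g -> KB4 `<=` D -> zrel c a b h -> c != 0 ->
  I (fun y => zmv v y * a y) = 2 ^+ n.+4 / c * (I (fun y => v y * b y) - I (fun y => g y * h y)).
Proof.
move=> Ws KD [Ca Cb kh E] c0; have [bv mg _ _] := Ws.
have na := Cc_nice Ca.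
have nadl : nice (fun y => a (dl y)) by apply: nice_affV.
have -> : I (fun y => g y * h y) = I (fun y => v y * Hs h y).
  by rewrite (wsol0 Ws kh).
rewrite -I_B; [|by apply: nice_mul => //; exact: Cc_nice|by apply: nice_mul => //; exact: nice_Hs].
have -> : I (fun y => v y * b y - v y * Hs h y) = c * I (fun y => v y * a (dl y)).
  rewrite -I_Z; last exact: nice_mul.
  by congr I; apply/funext => y; rewrite -mulrBr -E mulrCA.
rewrite mulrA divfK//.
have -> : I (fun y => zmv v y * a y) = 4 * I (fun y => v (affV 2^-1 4^-1 0 y) * a y).
  rewrite -I_Z; last by apply: nice_mul => //; exact: bm_affV.
  by congr I; apply/funext => y; rewrite /zmv mulrA.
rewrite I_half// mulrA; congr (_ * _); rewrite !exprS; ring.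
Qed.

Definition cc (k v : V -> R) : R := I (fun y => v y * k y).
Definition bb (k v : V -> R) i : R := - I (fun y => v y * Dx i k y).
Definition dtk (k v : V -> R) : R := - I (fun y => v y * Dt k y).
Definition PP (k v : V -> R) i j : R := I (fun y => v y * Dx i (Dx j k) y).
Definition pol (c : R) (b : 'I_n -> R) (d : R) (P : 'I_n -> 'I_n -> R) (z : V) : R :=
  c + (\sum_i z.1 ord0 i * b i + z.2 * d) + 2^-1 * \sum_i \sum_j z.1 ord0 i * z.1 ord0 j * P i j.
(** The parabolic second-order Taylor polynomial of [cv k v] at the origin. Derivatives fall on the
    kernel, which explains the minus signs in [bb] and [dtk]. *)
Definition qq (k v : V -> R) (z : V) : R := pol (cc k v) (bb k v) (dtk k v) (PP k v) z.

Lemma pol_zm c c1 c2 b b1 b2 d d1 d2 P P1 P2 z :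
  c1 = 4 * (c - c2) -> (forall i, b1 i = 2 * (b i - b2 i)) -> d1 = d - d2 ->
  (forall i j, P1 i j = P i j - P2 i j) ->
  pol c1 b1 d1 P1 z = 4 * (pol c b d P (affV 2^-1 4^-1 0 z) - pol c2 b2 d2 P2 (affV 2^-1 4^-1 0 z)).
Proof.
move=> -> Eb -> EP.
have z1 i : (affV 2^-1 4^-1 0 z).1 ord0 i = 2^-1 * z.1 ord0 i by rewrite /affV /= !mxE addr0.
have z2 : (affV 2^-1 4^-1 0 z).2 = 4^-1 * z.2 by rewrite /affV /= addr0.
rewrite /pol z2.
have -> : \sum_i z.1 ord0 i * b1 i = 4 * (\sum_i (affV 2^-1 4^-1 0 z).1 ord0 i * b i
  - \sum_i (affV 2^-1 4^-1 0 z).1 ord0 i * b2 i).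
  by rewrite -sumrB mulr_sumr; apply: eq_bigr => i _; rewrite Eb z1; field.
have -> : \sum_i \sum_j z.1 ord0 i * z.1 ord0 j * P1 i j =
  4 * (\sum_i \sum_j (affV 2^-1 4^-1 0 z).1 ord0 i * (affV 2^-1 4^-1 0 z).1 ord0 j * P i j
  - \sum_i \sum_j (affV 2^-1 4^-1 0 z).1 ord0 i * (affV 2^-1 4^-1 0 z).1 ord0 j * P2 i j).
  rewrite -sumrB mulr_sumr; apply: eq_bigr => i _; rewrite -sumrB mulr_sumr; apply: eq_bigr => j _.
  by rewrite EP !z1; field.
by field.
Qed.

Section relations.
Variables (D : set V) (v g : V -> R).
Hypotheses (Ws : wsol D v g) (KD : KB4 `<=` D).

Let pw (c : R) : c != 0 -> 2 ^+ n.+4 / (2 ^+ n.+2 * c) = 4 / c.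
Proof.
move=> c0; rewrite !exprS; have : 2 ^+ n != 0 :> R by rewrite expf_neq0.
by move: (2 ^+ n) => p p0; field; rewrite c0 p0.
Qed.
Let pn : 2 ^+ n.+2 != 0 :> R. Proof. by rewrite expf_neq0. Qed.

Lemma cc_zm : cc kap (zmv v) = 4 * (cc kap v - cc psi g).
Proof.
have := I_zmv Ws KD zrel_kap pn; have := pw (oner_neq0 R); rewrite mulr1 => -> E.
by apply: etrans E _; rewrite divr1.
Qed.
Lemma bb_zm i : bb kap (zmv v) i = 2 * (bb kap v i - bb psi g i).
Proof.
have c0 : 2 ^+ n.+2 * 2 != 0 :> R by rewrite mulf_neq0.
have := I_zmv Ws KD (zrel_D (dscale_x i) zrel_kap) c0; rewrite pw// => E.
have key (X Y Z : R) : X = 4 / 2 * (Y - Z) -> - X = 2 * (- Y - - Z) by move=> ->; field.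
exact: key E.
Qed.
Lemma dt_zm : dtk kap (zmv v) = dtk kap v - dtk psi g.
Proof.
have c0 : 2 ^+ n.+2 * 4 != 0 :> R by rewrite mulf_neq0.
have := I_zmv Ws KD (zrel_D dscale_t zrel_kap) c0; rewrite pw// => E.
have key (X Y Z : R) : X = 4 / 4 * (Y - Z) -> - X = - Y - - Z by move=> ->; field.
exact: key E.
Qed.
(** Second derivatives are invariant under the zoom: increments are neither amplified nor damped,
    hence the risk of a logarithm. *)
Lemma PP_zm i j : PP kap (zmv v) i j = PP kap v i j - PP psi g i j.
Proof.
have c0 : 2 ^+ n.+2 * 2 * 2 != 0 :> R by rewrite mulf_neq0// mulf_neq0.
have := I_zmv Ws KD (zrel_D (dscale_x i) (zrel_D (dscale_x j) zrel_kap)) c0.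
rewrite -[_ * 2 * 2]mulrA pw ?mulf_neq0// => E.
have key (X Y Z : R) : X = 4 / (2 * 2) * (Y - Z) -> X = Y - Z by move=> ->; field.
exact: key E.
Qed.

Lemma qq_zm z : qq kap (zmv v) z = 4 * (qq kap v (affV 2^-1 4^-1 0 z) - qq psi g (affV 2^-1 4^-1 0 z)).
Proof. exact: pol_zm cc_zm bb_zm dt_zm PP_zm. Qed.

Lemma cv_zm z : (forall y, KB4 y -> D (y + affV 2^-1 4^-1 0 z)) ->
  cv kap (zmv v) z = 4 * (cv kap v (affV 2^-1 4^-1 0 z) - cv psi g (affV 2^-1 4^-1 0 z)).
Proof.
move=> H; have [bv mg g1 _] := Ws; set p := affV 2^-1 4^-1 0 z.
have := rep_step (p := p) Ws ltr01; rewrite expr1n mul1r => /(_ _) E.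
rewrite /cv mulrBr; have := wsol1 Ws (@ker_psi R n) H => <-.
have bs := bm_shift p bv; have nk := @nice_kap R n.
have nkd : nice (fun y : V => kap (dl y)) by apply: nice_affV.
have nH := nice_Hs (@ker_psi R n).
rewrite -mulrBr -I_B; [|exact: nice_mul|exact: nice_mul].
have -> : I (fun y => zmv v (y + z) * kap y) = 4 * I (fun y => v (affV 2^-1 4^-1 0 y + p) * kap y).
  rewrite -I_Z; last by apply: nice_mul => //; exact: (@bm_affV _ _ (fun y => v (y + p)) 2^-1 4^-1 0 bs).
  congr I; apply/funext => y; rewrite /zmv mulrA; congr (_ * v _ * _).
  apply: (congr2 pair); first by rewrite /= !addr0 scalerDr.
  by rewrite /= !addr0 mulrDr.
have -> := I_half bs nk; congr (_ * _).
rewrite -I_Z; last exact: nice_mul.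
have key (w q b c h : R) : c * b = q - h -> c * (w * b) = w * q - w * h.
  by move=> E'; rewrite mulrCA E'; ring.
by congr I; apply/funext => y; apply: key; exact: kap_dl.
Qed.

(** The equation tested with [kap] itself. It makes the time coefficient redundant once the Hessian
    is bounded. *)
Lemma dt_trace : dtk kap v = \sum_i PP kap v i i - cc kap g.
Proof.
have := wsol0 Ws (@ker_kap R n) KD; rewrite -[I (fun z => g z * _)]/(cc kap g) => <-.
have [bv _ _ _] := Ws; have Ck := ker_Cc (@ker_kap R n).
have -> : (fun z => v z * Hs kap z) = fun z => (\sum_i v z * Dx i (Dx i kap) z) + v z * Dt kap z.
  by apply/funext => z; rewrite /Hs mulrDr mulr_sumr.
rewrite I_D; last 2 first.
- by apply: nice_sum => i; apply: nice_mul => //; apply/Cc_nice/Cc_D/Cc_D.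
- by apply: nice_mul => //; apply/Cc_nice/Cc_D.
rewrite I_sum => [|i]; last by apply: nice_mul => //; apply/Cc_nice/Cc_D/Cc_D.
by rewrite /dtk opprD addrA subrr add0r.
Qed.
End relations.

Lemma PP_sym (k v : V -> R) i j : Cc k -> PP k v i j = PP k v j i.
Proof.
move=> Ck; have E : Dx i (Dx j k) = Dx j (Dx i k) by apply/funext => y; exact: schwarz.
by rewrite /PP E.
Qed.

(** The expansion is made on the kernel, so the constant depends on [k] only and [w] enters through
    its supremum. *)
Lemma cv_taylor (k : V -> R) : ker k -> exists2 C, 0 <= C & forall w M z p, mfun w -> (forall y, `|w y| <= M) ->
  0 <= p -> p <= 2 -> `|z.1| <= p -> `|z.2| <= p ^+ 2 ->
  `|cv k w z - qq k w z| <= C * M * p ^+ 3.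
Proof.
move=> kk; have Ck := ker_Cc kk; have [C C0 HC] := ptaylor Ck (ler0n R 2).
(* Twice the radius 7 of a box containing the remainder: the kernel lies in [inb 3], and the shift
   is at most 2 in space and 4 in time. *)
exists (C * 14 ^+ n.+1); first by rewrite mulr_ge0// exprn_ge0.
move=> w M z p mw wM p0 p2 z1 z2.
have bw : bm w by split=> //; exists M.
have nk := Cc_nice Ck.
have nD i : nice (Dx i k) by apply/Cc_nice/Cc_D.
have nt : nice (Dt k) by apply/Cc_nice/Cc_D.
have nDD i j : nice (Dx i (Dx j k)) by apply/Cc_nice/Cc_D/Cc_D.
pose T (y : V) := k (y + - z) - k y - (\sum_i (- z).1 ord0 i * Dx i k y + (- z).2 * Dt k y)
    - 2^-1 * (\sum_i \sum_j (- z).1 ord0 i * (- z).1 ord0 j * Dx i (Dx j k) y).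
have nT : nice T.
  apply: niceB; last by apply/niceZ/nice_sum => i; apply: nice_sum => j; exact: niceZ.
  apply: niceB; last by apply: niceD; [apply: nice_sum => i; exact: (niceZ _ (nD i))|exact: (niceZ _ nt)].
  by apply: niceB => //; exact: nice_shift.
have -> : cv k w z - qq k w z = I (fun y => w y * T y).
  rewrite cvE//.
  have -> : (fun y => w y * T y) = fun y => w y * k (y - z) - w y * k y
      - ((\sum_i (- z).1 ord0 i * (w y * Dx i k y)) + (- z).2 * (w y * Dt k y))
      - 2^-1 * (\sum_i \sum_j (- z).1 ord0 i * (- z).1 ord0 j * (w y * Dx i (Dx j k) y)).
    have key (a b c d e f h w0 : R) : w0 * d = c -> w0 * f = e ->
       w0 * (a - b - (d + h) - 2^-1 * f) = w0 * a - w0 * b - (c + w0 * h) - 2^-1 * e.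
      by move=> <- <-; ring.
    apply/funext => y; rewrite [(- z).2 * (w y * _)]mulrCA; apply: key.
      by rewrite mulr_sumr; apply: eq_bigr => i _; rewrite mulrCA.
    by rewrite mulr_sumr; apply: eq_bigr => i _; rewrite mulr_sumr; apply: eq_bigr => j _; rewrite mulrCA.
  have nws := nice_mul bw (nice_shift (- z) nk).
  have nwk := nice_mul bw nk.
  have nwD i := niceZ ((- z).1 ord0 i) (nice_mul bw (nD i)).
  have nwt := niceZ (- z).2 (nice_mul bw nt).
  have nwDD i j := niceZ ((- z).1 ord0 i * (- z).1 ord0 j) (nice_mul bw (nDD i j)).
  have nS2 := nice_sum (fun i => nice_sum (fun j => nwDD i j)).
  have n1 := niceB nws nwk.
  have n2 := niceD (nice_sum nwD) nwt.
  rewrite (I_B (niceB n1 n2) (niceZ 2^-1 nS2)) (I_B n1 n2) (I_B nws nwk) (I_D (nice_sum nwD) nwt).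
  rewrite (I_Z 2^-1 nS2) (I_Z (- z).2 (nice_mul bw nt)) (I_sum nwD) (I_sum (fun i => nice_sum (fun j => nwDD i j))).
  rewrite /qq /pol /cc /dtk /bb /PP.
  have e1 : \sum_i I (fun y => (- z).1 ord0 i * (w y * Dx i k y)) = \sum_i z.1 ord0 i * - I (fun y => w y * Dx i k y).
    by apply: eq_bigr => i _; rewrite (I_Z _ (nice_mul bw (nD i))) /= mxE mulrN mulNr.
  have e2 : \sum_i I (fun y => \sum_j (- z).1 ord0 i * (- z).1 ord0 j * (w y * Dx i (Dx j k) y)) =
     \sum_i \sum_j z.1 ord0 i * z.1 ord0 j * I (fun y => w y * Dx i (Dx j k) y).
    apply: eq_bigr => i _; rewrite (I_sum (nwDD i)); apply: eq_bigr => j _.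
    by rewrite (I_Z _ (nice_mul bw (nDD i j))) /= !mxE mulrNN.
  rewrite e1 e2 /=; ring.
have -> : C * 14 ^+ n.+1 * M * p ^+ 3 = M * (C * p ^+ 3) * (2 * 7) ^+ n.+1.
  by rewrite (_ : 2 * 7 = 14); [ring|lra].
have z1' : `|(- z).1| <= p by rewrite /= normrN.
have z2' : `|(- z).2| <= p ^+ 2 by rewrite /= normrN.
have M0 : 0 <= M by exact: le_trans (wM 0).
apply: I_bound => //.
- by apply: mfunM => //; case: nT.
- move=> y; rewrite normrM ler_pM//; exact: HC.
have p4 : p ^+ 2 <= 4 by nra.
have kr (y : V) : k y != 0 -> inb 3 y by move=> /kk.2/KB_inb.
move=> y; rewrite mulf_eq0 negb_or => /andP[_ Ty].
apply: contrapT => yr; move/eqP: Ty; apply.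
have y3 : ~ inb 3 y by apply: contra_not yr; apply: inbW; fast_lra.
have k0 (f : V -> R) : (forall z : V, f z != 0 -> inb 3 z) -> f y = 0.
  by move=> H; apply/eqP; apply: contrapT => /negP/H.
rewrite /T (k0 k kr) (k0 (Dt k)); last exact: csupp_D kr.
rewrite (_ : k (y + - z) = 0); last first.
  apply/eqP; apply: contrapT => /negP/kr[a b]; apply: yr; split.
    have := ler_normD (y + - z).1 z.1; rewrite /= subrK => /le_trans; apply.
    by apply: (@le_trans _ _ (3 + 2)); [apply: lerD => //; exact: le_trans p2|fast_lra].
  have := ler_normD (y + - z).2 z.2; rewrite /= subrK => /le_trans; apply.
  by apply: (@le_trans _ _ (3 + 4)); [apply: lerD => //; exact: le_trans p4|fast_lra].
rewrite big1 => [|i _]; last by rewrite (k0 (Dx i k)) ?mulr0//; exact: csupp_D kr.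
rewrite big1 => [|i _]; first by rewrite !mulr0 !addr0 !subr0.
apply: big1 => j _; rewrite (k0 (Dx i (Dx j k))) ?mulr0//.
by apply: csupp_D; exact: csupp_D kr.
Qed.

End zooming.

(** * Rescaled solutions are quadratic polynomials up to a bounded error *)

Section approximation.
Context {R : realType} {n : nat}.
Local Notation V := ('rV[R]_n * R)%type.

Lemma zmv_zm (v : V -> R) : zmv v = zm 2^-1 0 v.
Proof.
have E : 2^-1 ^+ 2 = 4^-1 :> R by field.
by apply/funext => z; rewrite /zmv /zm E invrK.
Qed.

Lemma Bx_half (r : R) (z : V) : 0 <= r -> Bx r z -> Bx r (affV 2^-1 4^-1 0 z).
Proof.
move=> r0 [z1 /andP[z2 z3]]; rewrite /Bx /affV /= !addr0; split.
  by rewrite normrZ gtr0_norm//; have := normr_ge0 z.1; lra.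
have : 0 <= r ^+ 2 by rewrite sqr_ge0.
lra.
Qed.

Lemma wsol_zmv v g : wsol (@Bx R n 8) v g -> wsol (Bx 8) (zmv v) (zmg g).
Proof.
have E : 2^-1 ^+ 2 = 4^-1 :> R by field.
have h0 : 0 < 2^-1 :> R by [].
move=> W; rewrite zmv_zm; have := wsol_zm 0 h0 W; rewrite E.
by apply: wsolW => z /(Bx_half (ler0n R 8)).
Qed.

Lemma lcont_zmv v z : lcont v (affV 2^-1 4^-1 0 z : V) -> lcont (zmv v) z.
Proof.
move=> lv e e0; have e4 : 0 < e / 4 by rewrite divr_gt0.
have [d d0 Hd] := lv _ e4; exists d => // h hd h2.
rewrite /zmv -mulrBr normrM gtr0_norm//.
have -> : affV 2^-1 4^-1 0 (z + h) = affV 2^-1 4^-1 0 z + (2^-1 *: h.1, 4^-1 * h.2).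
  by apply: (congr2 pair); rewrite /= !addr0 ?scalerDr ?mulrDr.
rewrite -ler_pdivlMl// [_ * e]mulrC; apply: Hd; last by rewrite /= pmulr_rlt0.
have i2 : 0 < 2^-1 :> R by []. have i4 : 0 < 4^-1 :> R by [].
apply: le_lt_trans hd; rewrite normV ge_max /= normrZ normrM (gtr0_norm i2) (gtr0_norm i4).
have := normV1 h; have := normV2 h; have := normr_ge0 h.1; have := normr_ge0 h.2; lra.
Qed.

(** This accounts for the size 8: a kernel placed at a point of size 2, at any scale up to 1, stays
    inside the box. *)
Lemma KB4_shift (z : V) r y : `|z.1| <= 2 -> -4 <= z.2 -> z.2 <= 0 -> 0 < r -> r <= 1 -> KB4 y ->
  Bx 8 (affV r (r ^+ 2) z y).
Proof.
move=> z1 z2 z3 r0 r1 [y1 /andP[y2 y3]].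
have r20 : 0 < r ^+ 2 by rewrite exprn_gt0.
have r21 : r ^+ 2 <= 1 by rewrite expr_le1// ltW.
split; rewrite /affV /=.
  apply: le_lt_trans (ler_normD _ _) _; rewrite normrZ gtr0_norm//.
  have := normr_ge0 y.1; nra.
have : r ^+ 2 * y.2 < 0 by rewrite pmulr_rlt0.
have : -4 <= r ^+ 2 * y.2 by nra.
lra.
Qed.

Lemma KB4_shift1 (z : V) y : `|z.1| <= 2 -> -4 <= z.2 -> z.2 <= 0 -> KB4 y -> Bx 8 (y + z).
Proof.
move=> z1 z2 z3 /(KB4_shift z1 z2 z3 ltr01 (lexx 1)).
by rewrite affV1.
Qed.

Lemma KB4_Bx : KB4 `<=` (@Bx R n 8).
Proof. by move=> z /(@KB4_shift1 0); rewrite addr0; apply; rewrite ?normr0 //=; lra. Qed.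

Definition RmB (v : V -> R) (T : R) := forall z p, 0 <= p -> p <= 2 -> `|z.1| <= p -> - p ^+ 2 <= z.2 -> z.2 <= 0 ->
  `|cv kap v z - qq kap v z| <= T * p ^+ 3.

Definition Cpsi : R := sval (cid2 (cv_taylor (@ker_psi R n))).
Definition Ckap : R := sval (cid2 (cv_taylor (@ker_kap R n))).

Lemma Cpsi_ge0 : 0 <= Cpsi. Proof. by rewrite /Cpsi; case: cid2. Qed.
Lemma Ckap_ge0 : 0 <= Ckap. Proof. by rewrite /Ckap; case: cid2. Qed.

Lemma RmB0 v M : mfun v -> (forall z, `|v z| <= M) -> RmB v (Ckap * M).
Proof.
move=> mv vM z p p0 p2 z1 z2 z3; rewrite /Ckap; case: cid2 => C C0 /= HC.
by apply: HC => //; rewrite ler_norml; have := sqr_ge0 p; lra.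
Qed.

(** A zoom multiplies a cubic remainder by [4 * (1/2)^3 = 1/2], and the potential of the removed
    annulus contributes [Cpsi / 2]. Hence the constant stays bounded over all scales. *)
Lemma RmB_zmv v g T : wsol (Bx 8) v g -> RmB v T -> RmB (zmv v) (T / 2 + Cpsi / 2).
Proof.
move=> Ws RT z p p0 p2 z1 z2 z3.
have p20 := sqr_ge0 p.
set z' := affV 2^-1 4^-1 0 z.
have z'1 : `|z'.1| <= p / 2.
  by rewrite /z' /affV /= addr0 normrZ gtr0_norm//; lra.
have z'2 : z'.2 = 4^-1 * z.2 by rewrite /z' /affV /= addr0.
have E4 : (p / 2) ^+ 2 = 4^-1 * p ^+ 2 by field.
rewrite (cv_zm Ws); last first.
  move=> y; apply: KB4_shift1; rewrite -/z' ?z'2; nra.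
rewrite (qq_zm Ws); last exact: KB4_Bx.
rewrite -/z'.
have key (a b c d : R) : 4 * (a - b) - 4 * (c - d) = 4 * ((a - c) - (b - d)) by ring.
rewrite key normrM gtr0_norm//.
have h1 : `|cv kap v z' - qq kap v z'| <= T * (p / 2) ^+ 3.
  by apply: RT => //; rewrite ?E4 ?z'2; fast_lra.
have h2 : `|cv psi g z' - qq psi g z'| <= Cpsi * (p / 2) ^+ 3.
  have [_ mg g1 _] := Ws.
  rewrite -[Cpsi]mulr1 /Cpsi; case: cid2 => C C0 /= HC; apply: HC => //; try fast_lra.
  by rewrite z'2 E4 ler_norml; fast_lra.
have h := le_trans (ler_normB _ _) (lerD h1 h2).
have -> : (T / 2 + Cpsi / 2) * p ^+ 3 = 4 * (T * (p / 2) ^+ 3 + Cpsi * (p / 2) ^+ 3) by field.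
by rewrite ler_pM2l.
Qed.

Definition base (v g : V -> R) := wsol (Bx 8) v g /\ forall z, Bx 8 z -> lcont v z.

Lemma base_zmv v g : base v g -> base (zmv v) (zmg g).
Proof.
move=> [W H]; split; first exact: wsol_zmv.
by move=> z /(Bx_half (ler0n R 8)) /H; exact: lcont_zmv.
Qed.

(** The first term is the Taylor remainder at size 2, with [8 = 2^3], the second the distance of [v]
    from its average. At every scale the solution is thus a quadratic polynomial up to a fixed
    error. *)
Lemma approx v g T z : base v g -> RmB v T -> `|z.1| <= 2 -> -4 <= z.2 -> z.2 < 0 ->
  `|v z - qq kap v z| <= 8 * T + 4 / 3 * I (@psi R n).
Proof.
move=> [W H] RT z1 z2 z3.
have h1 : `|cv kap v z - qq kap v z| <= T * 2 ^+ 3 by apply: RT => //; lra.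
have Bz : Bx 8 z by split; [fast_lra|apply/andP; split; fast_lra].
have h2 := rep_dist W (H z Bz) (fun r y r0 r1 Ky => KB4_shift z1 z2 (ltW z3) r0 r1 Ky).
have -> : v z - qq kap v z = (cv kap v z - qq kap v z) - (cv kap v z - v z) by ring.
apply: le_trans (ler_normB _ _) _.
have -> : 8 * T = T * 2 ^+ 3 by ring.
exact: lerD.
Qed.

Lemma iterate_zmv v g M k : base v g -> (forall z, `|v z| <= M) ->
  base (iter k zmv v) (iter k zmg g) /\ RmB (iter k zmv v) (Ckap * M + Cpsi).
Proof.
move=> B vM; have M0 : 0 <= M by exact: le_trans (vM 0).
elim: k => [|k [IB IR]] /=.
  split=> // z p p0 p2 z1 z2 z3; have [[[mv _] _ _ _] _] := B.
  apply: le_trans (RmB0 mv vM p0 p2 z1 z2 z3) _.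
  by rewrite ler_wpM2r ?exprn_ge0// lerDl Cpsi_ge0.
split; first exact: base_zmv.
move=> z p p0 p2 z1 z2 z3; have [W _] := IB.
apply: le_trans (RmB_zmv W IR p0 p2 z1 z2 z3) _.
rewrite ler_wpM2r ?exprn_ge0//.
have := Cpsi_ge0; have : 0 <= Ckap * M by rewrite mulr_ge0// Ckap_ge0.
lra.
Qed.

End approximation.

(** * The increments of the Hessian *)

Section drift.
Context {R : realType} {n : nat}.
Local Notation V := ('rV[R]_n * R)%type.

Lemma I_wle (w h : V -> R) M : mfun w -> (forall z, `|w z| <= M) -> nice h ->
  `|I (fun z => w z * h z)| <= M * I (fun z => `|h z|).
Proof.
move=> mw wM nh; have bw : bm w by split=> //; exists M.
apply: le_trans (I_norm (nice_mul bw nh)) _; rewrite -I_Z; last exact: nice_norm.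
apply: I_le; [exact/nice_norm/nice_mul|exact/niceZ/nice_norm|].
by move=> z; rewrite normrM ler_wpM2r.
Qed.

(** The part of [D_ij psi] that does not telescope. It keeps the nonnegative weight [om], on which
    all sign arguments rest. *)
Definition Th i j (z : V) : R := om z * (z.1 ord0 i * z.1 ord0 j + 2 * z.2 * (i == j)%:R).

Lemma nice_om : nice (@om R n). Proof. exact: Cc_nice (ker_Cc ker_om). Qed.
Lemma nice_Xi i j : nice (@Xi R n i j). Proof. exact: Cc_nice (ker_Cc (ker_Xi i j)). Qed.

Lemma Cc_Th i j : Cc (Th i j).
Proof.
have E : Th i j = fun z => (z.1 ord0 i * z.1 ord0 j + 2 * z.2 * (i == j)%:R) * om z.
  by apply/funext => z; rewrite /Th mulrC.
rewrite E; apply: Cc_mul; last exact: ker_Cc ker_om.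
apply: Sm_D; first by apply: Sm_M; exact: Sm_co.
by apply: Sm_M; [apply: Sm_M; [exact: Sm_cst|exact: Sm_tm]|exact: Sm_cst].
Qed.
Lemma nice_Th i j : nice (Th i j). Proof. exact: Cc_nice (Cc_Th i j). Qed.

Lemma I_Xi_zmg (f : V -> R) i j : bm f ->
  I (fun z => zmg f z * Xi i j z) = 2 ^+ n.+2 * I (fun z => f z * Xi i j (dl z)).
Proof. by move=> bf; exact: (I_half bf (nice_Xi i j)). Qed.

Lemma nice_Xidl i j : nice (fun z : V => Xi i j (dl z)).
Proof. by apply: nice_affV => //; exact: nice_Xi. Qed.

Lemma PP_psi (f : V -> R) i j : bm f -> PP psi f i j =
  I (fun z => f z * Th i j z) + I (fun z => f z * Xi i j z) - I (fun z => zmg f z * Xi i j z).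
Proof.
move=> bf; rewrite I_Xi_zmg//.
have nT := nice_mul bf (nice_Th i j); have nX := nice_mul bf (nice_Xi i j).
have nXd := nice_mul bf (nice_Xidl i j).
rewrite -(I_Z _ nXd) -(I_D nT nX) -(I_B (niceD nT nX) (niceZ _ nXd)).
by congr I; apply/funext => z; rewrite psi_xx /Th; ring.
Qed.

Lemma PP_psi1 i j : PP psi (fun _ : V => 1) i j = 0.
Proof.
rewrite /PP; have <- : I (Dx i (Dx j (@psi R n))) = 0.
  by apply: ibp; apply: Cc_D; exact: ker_Cc ker_psi.
by congr I; apply/funext => z; rewrite mul1r.
Qed.

(** [PP_psi] for [f = 1]: the zoom does not change a constant, so the two [Xi] terms cancel, and the
    second derivatives of [psi] have integral 0. *)
Lemma I_Th i j : I (Th i j) = 0.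
Proof.
have := PP_psi i j (bm_cst 1); rewrite PP_psi1.
have -> : (fun z : V => 1 * Th i j z) = Th i j by apply/funext => z; rewrite mul1r.
have -> : (fun z => zmg (fun=> 1) z * Xi i j z) = (fun z : V => 1 * Xi i j z) by [].
by move=> ->; ring.
Qed.

(** The Hessian without its telescoping part. The correction is bounded uniformly in the scale, and
    the increments of [Pt] only involve [Th]. *)
Definition Pt (v f : V -> R) i j : R := PP kap v i j - 2 * I (fun z => f z * Xi i j z).

Lemma Pt_zmv v f i j : wsol (Bx 8) v (fun z => 2 * f z - 1) -> bm f ->
  Pt (zmv v) (zmg f) i j = Pt v f i j - 2 * I (fun z => f z * Th i j z).
Proof.
move=> W bf; rewrite /Pt (PP_zm W KB4_Bx).
have -> : PP psi (fun z => 2 * f z - 1) i j = 2 * PP psi f i j - PP psi (fun _ : V => 1) i j.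
  have nD : nice (Dx i (Dx j (@psi R n))) by apply/Cc_nice/Cc_D/Cc_D/ker_Cc/ker_psi.
  rewrite /PP -(I_Z 2 (nice_mul bf nD)) -(I_B (niceZ 2 (nice_mul bf nD)) (nice_mul (bm_cst 1) nD)).
  have key (a d : R) : (2 * a - 1) * d = 2 * (a * d) - 1 * d by ring.
  by congr I; apply/funext => z; exact: key.
rewrite PP_psi1 PP_psi//; ring.
Qed.

End drift.

(** * Small sublevel sets of quadratic forms *)

Section small_sets.
Context {R : realType} {n : nat}.
Local Notation V := ('rV[R]_n * R)%type.
Local Notation mV := ('rV[R]_n * measurableTypeR R)%type.

(** Of the [m] translates of [Z] along [e], at most two contain a given point, and all lie in a box
    of size 5. Integrating the number of translates that contain a point gives the bound. *)
Lemma small_set (Z : set mV) (e : V) m : measurable Z -> (forall z, Z z -> inb 4 z) -> `|e| <= 1 ->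
  (forall x : V, forall j1 j2 j3 : 'I_m, j1 != j2 -> j2 != j3 -> j3 != j1 ->
    Z (x + (j1%:R / m%:R) *: e) -> Z (x + (j2%:R / m%:R) *: e) -> Z (x + (j3%:R / m%:R) *: e) -> False) ->
  m%:R * I (\1_Z : V -> R) <= 2 * 10 ^+ n.+1.
Proof.
move=> mZ Zb e1 H.
have nZ : nice (\1_Z : V -> R) by exact: (@nice_indic _ _ _ 4).
have nB : nice (\1_(@box R n 5) : V -> R).
  by apply: (@nice_indic _ _ _ 5) => //; exact: measurable_box.
have -> : m%:R * I (\1_Z : V -> R) = I (fun x : V => \sum_(j < m) \1_Z (x + (j%:R / m%:R) *: e)).
  rewrite I_sum => [|j]; last exact: nice_shift.
  under eq_bigr do rewrite I_shiftE//.
  by rewrite sumr_const card_ord mulr_natl.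
have -> : 2 * 10 ^+ n.+1 = I (fun z : V => 2 * \1_(@box R n 5) z).
  rewrite (I_Z 2 nB) I_indic; last exact: measurable_box.
  by rewrite mu_box//= (_ : 2 * 5 = 10); [|lra].
apply: I_le; [by apply: nice_sum => j; exact: nice_shift|exact: niceZ|].
move=> x.
have step (j : 'I_m) : `|(j%:R / m%:R) *: e| <= 1.
  have m0 : 0 < m%:R :> R by rewrite ltr0n; case: j => j; case: (m).
  rewrite normrZ ger0_norm ?divr_ge0//.
  have : j%:R / m%:R <= 1 :> R by rewrite ler_pdivrMr// mul1r ler_nat ltnW.
  have : 0 <= j%:R / m%:R :> R by rewrite divr_ge0.
  have := normr_ge0 e; nra.
have [xb|/negP xb] := boolP (x \in box 5); last first.
  rewrite [\1_(box 5) x]indicE (negbTE (introN idP xb)) mulr0 big1// => j _.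
  rewrite indicE; case: (boolP (_ \in Z)) => // /set_mem/Zb[a b].
  exfalso; apply: xb; rewrite inE; have s1 := le_trans (normV1 _) (step j); have s2 := le_trans (normV2 _) (step j).
  split.
    have := ler_normB (x + (j%:R / m%:R) *: e).1 ((j%:R / m%:R) *: e).1; rewrite /= addrK.
    by move=> /le_trans; apply; apply: le_trans (lerD a s1) _; lra.
  have := ler_normB (x + (j%:R / m%:R) *: e).2 ((j%:R / m%:R) *: e).2; rewrite /= addrK.
  by move=> /le_trans; apply; apply: le_trans (lerD b s2) _; lra.
rewrite [\1_(box 5) x]indicE xb mulr1.
pose q (j : 'I_m) : bool := (x + (j%:R / m%:R) *: e : mV) \in Z.
have -> : \sum_(j < m) \1_Z (x + (j%:R / m%:R) *: e) = #|[pred j | q j]|%:R :> R.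
  rewrite -sum1_card natr_sum [RHS]big_mkcond /=; apply: eq_bigr => j _.
  by rewrite [LHS]indicE -[j \in _]/(q j) -[X in X%:R = _]/(q j : nat); case: (q j).
rewrite ler_nat leqNgt; apply/negP => /card_gt2P[j1 [j2 [j3 [[h1 h2 h3] [d1 d2 d3]]]]].
by apply: (H x j1 j2 j3 d1 d2 d3); exact: set_mem.
Qed.

Definition bil (P : 'I_n -> 'I_n -> R) (x y : V) : R := \sum_i \sum_j x.1 ord0 i * y.1 ord0 j * P i j.
(** The caloric polynomial with Hessian [P]: the trace term makes its Laplacian equal to its time
    derivative. *)
Definition pt (P : 'I_n -> 'I_n -> R) (z : V) : R := 2^-1 * bil P z z + z.2 * \sum_i P i i.

Lemma bil_line P (x e : V) (t : R) :
  bil P (x + t *: e) (x + t *: e) = bil P x x + t * (bil P x e + bil P e x) + t ^+ 2 * bil P e e.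
Proof.
rewrite /bil mulrDr !mulr_sumr -!big_split /=; apply: eq_bigr => i _.
rewrite !mulr_sumr -!big_split /=; apply: eq_bigr => j _.
by rewrite !mxE; ring.
Qed.

Lemma pt_line P (x e : V) (t : R) : e.2 = 0 ->
  pt P (x + t *: e) = pt P x + t * (2^-1 * (bil P x e + bil P e x)) + t ^+ 2 * (2^-1 * bil P e e).
Proof.
move=> e2; have -> : pt P (x + t *: e) = 2^-1 * bil P (x + t *: e) (x + t *: e) + x.2 * \sum_i P i i.
  by rewrite /pt /= e2 scaler0 addr0.
by rewrite bil_line /pt; ring.
Qed.

(** Polarization: if both diagonal entries are below [m / 4], the sum of the two coordinate vectors
    works, and its sup norm is still 1. *)
Lemma bil_dir P i j m : (forall i j, P i j = P j i) -> 0 < m -> m <= `|P i j| ->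
  exists e : V, [/\ `|e| <= 1, e.2 = 0 & m / 4 <= `|bil P e e|].
Proof.
move=> Ps m0 Pm.
have nxd k : `|xdir k : V| <= 1.
  rewrite normV /= normr0 ge_max ler01 andbT; apply/rV_norm_leP => // l.
  by rewrite mxE; case: (_ && _); rewrite ?normr1 ?normr0.
have bxd k l : bil P (xdir k) (xdir l) = P k l.
  rewrite /bil (bigD1 k)//= [X in _ + X]big1 => [|i' ik]; last first.
    by apply: big1 => j' _; rewrite !mxE eqxx (negbTE ik) !mul0r.
  rewrite addr0 (bigD1 l)//= [X in _ + X]big1 => [|j' jl]; last by rewrite !mxE !eqxx (negbTE jl) mulr0 mul0r.
  by rewrite !mxE !eqxx !mul1r addr0.
have [h1|h1] := leP (m / 4) `|P i i|; first by exists (xdir i); rewrite bxd; split.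
have [h2|h2] := leP (m / 4) `|P j j|; first by exists (xdir j); rewrite bxd; split.
have ij : i != j by apply/eqP => ij; move: Pm h1; rewrite -ij; lra.
exists (xdir i + 1 *: xdir j); split.
- rewrite scale1r normV /= addr0 normr0 ge_max ler01 andbT; apply/rV_norm_leP => // l.
  rewrite !mxE; have [->|li] := eqVneq l i; first by rewrite (negbTE ij) !eqxx addr0 normr1.
  by rewrite eqxx add0r; case: (l == j); rewrite ?normr1 ?normr0.
- by rewrite /= scale1r addr0.
rewrite bil_line !bxd (Ps j i) mul1r expr1n mul1r.
have -> : P i i + (P i j + P i j) + P j j = 2 * P i j + (P i i + P j j) by ring.
have := ler_normB (2 * P i j + (P i i + P j j)) (P i i + P j j); rewrite addrK normrM gtr0_norm//.
have := ler_normD (P i i) (P j j); lra.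
Qed.

(** The leading coefficient of a quadratic is its second divided difference; Lagrange interpolation
    at three separated nodes bounds it by the values. *)
Lemma three_points (a b c t1 t2 t3 th k : R) : 0 < th -> th <= `|t1 - t2| -> th <= `|t2 - t3| -> th <= `|t3 - t1| ->
  `|a + t1 * b + t1 ^+ 2 * c| <= k -> `|a + t2 * b + t2 ^+ 2 * c| <= k -> `|a + t3 * b + t3 ^+ 2 * c| <= k ->
  `|c| * th ^+ 2 <= 3 * k.
Proof.
move=> th0; set F1 := a + t1 * b + _; set F2 := a + t2 * b + _; set F3 := a + t3 * b + _.
have E : (t1 - t2) * (t2 - t3) * (t3 - t1) * c = - (F1 * (t2 - t3) + F2 * (t3 - t1) + F3 * (t1 - t2)).
  by rewrite /F1 /F2 /F3; ring.
move: E; set x := t1 - t2; set y := t2 - t3; set z := t3 - t1 => E x0 y0 z0 h1 h2 h3.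
have k0 : 0 <= k by exact: le_trans h1.
have : `|x| * `|y| * `|z| * `|c| <= k * `|y| + k * `|z| + k * `|x|.
  rewrite -!normrM E normrN; apply: le_trans (ler_normD _ _) _; apply: lerD; last by rewrite normrM ler_wpM2r.
  by apply: le_trans (ler_normD _ _) _; rewrite !normrM; apply: lerD; rewrite ler_wpM2r.
move: x0 y0 z0; move: `|x| `|y| `|z| `|c| (normr_ge0 c) => X Y W C C0 hX hY hW H.
have q (u v : R) : th <= u -> th <= v -> th ^+ 2 <= u * v.
  by move=> hu hv; rewrite expr2 ler_pM// ltW.
have e1 : Y * th ^+ 2 <= X * Y * W by have := ler_wpM2l (le_trans (ltW th0) hY) (q _ _ hX hW); fast_lra.
have e2 : W * th ^+ 2 <= X * Y * W by have := ler_wpM2l (le_trans (ltW th0) hW) (q _ _ hX hY); fast_lra.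
have e3 : X * th ^+ 2 <= X * Y * W by have := ler_wpM2l (le_trans (ltW th0) hX) (q _ _ hY hW); fast_lra.
have p0 : 0 < X * Y * W by rewrite !mulr_gt0//; fast_lra.
rewrite -(ler_pM2l p0).
have : X * Y * W * C * th ^+ 2 <= (k * Y + k * W + k * X) * th ^+ 2 by rewrite ler_wpM2r// sqr_ge0.
have := ler_wpM2l k0 e1; have := ler_wpM2l k0 e2; have := ler_wpM2l k0 e3; fast_lra.
Qed.

Lemma ord_sep m (j1 j2 : 'I_m) : j1 != j2 -> m%:R^-1 <= `|j1%:R / m%:R - j2%:R / m%:R| :> R.
Proof.
move=> j12; have m0 : 0 < m%:R :> R by rewrite ltr0n; case: (j1) => j; case: (m).
rewrite -mulrBl normrM [`|_^-1|]gtr0_norm ?invr_gt0// ler_peMl ?invr_ge0 ?(ltW m0)//.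
wlog lt : j1 j2 j12 / (j1 < j2)%N.
  move=> H; have [|h|/val_inj h] := ltngtP j1 j2; first exact: H.
    by rewrite distrC; apply: H; rewrite // eq_sym.
  by rewrite h eqxx in j12.
rewrite distrC -natrB ?(ltnW lt)// normr_nat ler1n subn_gt0//.
Qed.

Lemma mfun_pt P : mfun (pt P).
Proof.
apply: Sm_mfun; apply: Sm_D; last by apply: Sm_M; [exact: Sm_tm|exact: Sm_cst].
apply: Sm_Z; apply: Sm_sum => i; apply: Sm_sum => j.
by apply: Sm_M; [apply: Sm_M; exact: Sm_co|exact: Sm_cst].
Qed.

Definition flat P k : set mV := [set z | inb 4 z /\ `|pt P z| <= k].

Lemma measurable_flat P k : measurable (flat P k).
Proof.
have -> : flat P k = box 4 `&` (fun z => `|pt P z|) @^-1` `]-oo, k].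
  by apply/seteqP; split=> z /=; rewrite in_itv.
apply: measurableI; first exact: measurable_box.
rewrite -[X in measurable X]setTI; apply: (mfun_norm (mfun_pt P)) => //.
Qed.

Lemma nice_flat P k : nice (\1_(flat P k) : V -> R).
Proof. by apply: (@nice_indic _ _ _ 4); [exact: measurable_flat|move=> z []]. Qed.

(** On a line in the direction of [bil_dir], [pt P] is a quadratic with leading coefficient of size
    [m], so it cannot be small at three points spaced by [1 / N]; [small_set] turns this into a
    bound for the measure. *)
Lemma flat_small P i j m N : (forall i j, P i j = P j i) -> 0 < m -> m <= `|P i j| -> (0 < N)%N ->
  N%:R * I (\1_(flat P (m / (25 * N%:R ^+ 2))) : V -> R) <= 2 * 10 ^+ n.+1.
Proof.
move=> Ps m0 Pm N0; have [e [e1 e2 be]] := bil_dir Ps m0 Pm.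
have N0' : 0 < N%:R :> R by rewrite ltr0n.
apply: (@small_set _ e); [exact: measurable_flat|by move=> z []|by []|].
move=> x j1 j2 j3 d1 d2 d3 [_ h1] [_ h2] [_ h3].
move: h1 h2 h3; rewrite !pt_line// => h1 h2 h3.
have := three_points (th := N%:R^-1) _ (ord_sep d1) (ord_sep d2) (ord_sep d3) h1 h2 h3.
rewrite invr_gt0 => /(_ N0').
rewrite normrM gtr0_norm// exprVn ler_pdivrMr ?exprn_gt0//.
(* The leading coefficient is at least [m / 8], which just exceeds [3 m / 25]. *)
have -> : 3 * (m / (25 * N%:R ^+ 2)) * N%:R ^+ 2 = 3 * m / 25 by field; rewrite gt_eqF.
fast_lra.
Qed.

Definition slab (b : 'I_n -> R) s : set mV := [set z | inb 4 z /\ `|\sum_i z.1 ord0 i * b i| <= s].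

Lemma mfun_lin (b : 'I_n -> R) : mfun (fun z : V => \sum_i z.1 ord0 i * b i).
Proof. by apply: Sm_mfun; apply: Sm_sum => i; apply: Sm_M; [exact: Sm_co|exact: Sm_cst]. Qed.

Lemma measurable_slab b s : measurable (slab b s).
Proof.
have -> : slab b s = box 4 `&` (fun z : V => `|\sum_i z.1 ord0 i * b i|) @^-1` `]-oo, s].
  by apply/seteqP; split=> z /=; rewrite in_itv.
apply: measurableI; first exact: measurable_box.
rewrite -[X in measurable X]setTI; apply: (mfun_norm (mfun_lin b)) => //.
Qed.

Lemma nice_slab b s : nice (\1_(slab b s) : V -> R).
Proof. by apply: (@nice_indic _ _ _ 4); [exact: measurable_slab|move=> z []]. Qed.

(** The translation argument again, for a linear form: two points already suffice for a
    contradiction. If [|b i|] is at most [6 s], the trivial bound by a box is enough. *)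
Lemma slab_small b s i : 0 < s -> b i != 0 -> I (\1_(slab b s) : V -> R) <= 10 ^+ n.+1 * 12 * s / `|b i|.
Proof.
move=> s0 bi; have b0 : 0 < `|b i| by rewrite normr_gt0.
have I0 : 0 <= I (\1_(slab b s) : V -> R) by apply: I_ge0 => z; rewrite indicE.
have Ib : I (\1_(slab b s) : V -> R) <= 10 ^+ n.+1.
  have nB : nice (\1_(@box R n 5) : V -> R).
    by apply: (@nice_indic _ _ _ 5) => //; exact: measurable_box.
  have -> : 10 ^+ n.+1 = I (\1_(@box R n 5) : V -> R).
    by rewrite I_indic; [rewrite mu_box//= (_ : 2 * 5 = 10); [|lra]|exact: measurable_box].
  apply: I_le => //; first exact: nice_slab.
  move=> z; rewrite !indicE; case: (boolP (z \in slab b s)) => // /set_mem[zb _].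
  by rewrite mem_set//; apply: inbW zb; lra.
have p10 : 0 < 10 ^+ n.+1 :> R by rewrite exprn_gt0.
have [h|h] := leP `|b i| (6 * s).
  apply: le_trans Ib _; rewrite ler_pdivlMr// -mulrA ler_pM2l//; lra.
(* With [N] translates the linear form moves by at least [3 s] at each step, more than the width
   [2 s] of the slab; rounding down costs at most a factor 2 here. *)
pose N := Num.truncn (`|b i| / (3 * s)).
have x0 : 0 <= `|b i| / (3 * s) by rewrite divr_ge0//; fast_lra.
have /andP[N1 N2] := truncn_itv x0; rewrite -/N in N1 N2.
have N3 : 2 <= `|b i| / (3 * s) by rewrite ler_pdivlMr; fast_lra.
have Nn : (0 < N)%N by rewrite -(ltr0n R); move: N2; have := @natr1 R N => <-; fast_lra.
have N4 : `|b i| / (6 * s) <= N%:R.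
  have -> : `|b i| / (6 * s) = `|b i| / (3 * s) / 2 by field; rewrite gt_eqF.
  by move: N2; have := @natr1 R N => <-; fast_lra.
have N0 : 0 < N%:R :> R by rewrite ltr0n.
have nxd : `|xdir i : V| <= 1.
  rewrite normV /= normr0 ge_max ler01 andbT; apply/rV_norm_leP => // l.
  by rewrite mxE; case: (_ && _); rewrite ?normr1 ?normr0.
have := @small_set (slab b s) (xdir i) N (measurable_slab b s) (fun z Hz => Hz.1) nxd.
have lin (x : V) t : \sum_k (x + t *: xdir i).1 ord0 k * b k = \sum_k x.1 ord0 k * b k + t * b i.
  rewrite -(_ : \sum_k t * (xdir i : V).1 ord0 k * b k = t * b i); last first.
    rewrite (bigD1 i)//= big1 => [|k ki]; last by rewrite mxE eqxx (negbTE ki) mulr0 mul0r.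
    by rewrite mxE !eqxx mulr1 addr0.
  by rewrite -big_split; apply: eq_bigr => k _; rewrite /= !mxE mulrDl.
move=> /(_ _) H.
have {}H : N%:R * I (\1_(slab b s) : V -> R) <= 2 * 10 ^+ n.+1.
  apply: H => x j1 j2 j3 d1 _ _ [_ h1] [_ h2] _.
  move: h1 h2; rewrite !lin => h1 h2.
  have := ler_normB (\sum_k x.1 ord0 k * b k + j1%:R / N%:R * b i) (\sum_k x.1 ord0 k * b k + j2%:R / N%:R * b i).
  have -> : \sum_k x.1 ord0 k * b k + j1%:R / N%:R * b i - (\sum_k x.1 ord0 k * b k + j2%:R / N%:R * b i) =
    (j1%:R / N%:R - j2%:R / N%:R) * b i by ring.
  rewrite normrM => /le_trans/(_ (lerD h1 h2)).
  have : `|b i| / N%:R <= `|j1%:R / N%:R - j2%:R / N%:R| * `|b i|.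
    by rewrite mulrC ler_wpM2r// ord_sep.
  have : 3 * s <= `|b i| / N%:R by rewrite ler_pdivlMr// mulrC -ler_pdivlMr//; fast_lra.
  fast_lra.
rewrite ler_pdivlMr//; have : `|b i| <= N%:R * (6 * s) by rewrite -ler_pdivrMr//; fast_lra.
move=> hb; have h1 := ler_wpM2l I0 hb; have h2 := ler_wpM2r (ltW s0) H; fast_lra.
Qed.

End small_sets.

(** * One-phase problems *)

Section problem.
Context {R : realType} {n : nat}.
Local Notation V := ('rV[R]_n * R)%type.
Local Notation mV := ('rV[R]_n * measurableTypeR R)%type.

Definition ccont (v : V -> R) (z : V) := forall e, 0 < e -> exists2 d, 0 < d &
  forall h : V, `|h| < d -> `|v (z + h) - v z| <= e.

Definition dens (f : V -> R) (A : set V) := forall k, nice k -> (forall z, ~ Bx 8 z -> k z = 0) ->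
  (forall z, Bx 8 z -> A z -> 0 <= k z) -> 0 <= I (fun z => f z * k z).

(* [prob_in] and [prob_out] say that [f] is the indicator of [A] almost everywhere; unlike that, they
   pass to rescalings by a change of variables in the integral. *)
Record prob (v f : V -> R) (A : set V) : Prop := Prob {
  prob_wsol : wsol (Bx 8) v (fun z => 2 * f z - 1);
  prob_mf : mfun f;
  prob_f : forall z, 0 <= f z <= 1;
  prob_in : dens f A;
  prob_out : dens (fun z => 1 - f z) (~` A);
  prob_open : forall z, Bx 8 z -> A z -> exists2 d, 0 < d & forall w, `|w - z| < d -> A w;
  prob_pos : forall z, Bx 8 z -> A z -> 0 < v z;
  prob_bd : forall z, Bx 8 z -> ~ A z ->
    (forall d, 0 < d -> exists w, [/\ Bx 8 w, A w & `|w - z| < d]) -> v z <= 0;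
  prob_cont : forall z, Bx 8 z -> ccont v z;
  prob_lc : lcont v 0;
  prob_0 : v 0 = 0;
  prob_near : forall d, 0 < d -> exists z, Bx d z /\ A z }.

Definition zmA (A : set V) : set V := [set z | A (affV 2^-1 4^-1 0 z)].

Lemma halfK (z : V) : affV 2^-1 4^-1 0 (dl z) = z.
Proof.
rewrite [RHS]surjective_pairing; apply: (congr2 pair); rewrite /= !addr0.
  by rewrite scalerA mulVf// scale1r.
by rewrite mulrA mulVf// mul1r.
Qed.

Lemma Bx_dl r (z : V) : 0 <= r -> Bx r (dl z) -> Bx r z.
Proof. by move=> r0 /(Bx_half r0); rewrite halfK. Qed.

Lemma half_dist (w z : V) : `|affV 2^-1 4^-1 0 w - affV 2^-1 4^-1 0 z| <= `|w - z|.
Proof.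
have -> : affV 2^-1 4^-1 0 w - affV 2^-1 4^-1 0 z = (2^-1 *: (w - z).1, 4^-1 * (w - z).2).
  by apply: (congr2 pair); rewrite /= !addr0 ?scalerBr ?mulrBr.
have i2 : 0 < 2^-1 :> R by []. have i4 : 0 < 4^-1 :> R by [].
rewrite normV ge_max /= normrZ normrM (gtr0_norm i2) (gtr0_norm i4).
have := normV1 (w - z); have := normV2 (w - z); rewrite /=.
have := normr_ge0 (w.1 - z.1); have := normr_ge0 (w.2 - z.2); lra.
Qed.

Lemma dens_zm (f : V -> R) A : bm f -> dens f A -> dens (zmg f) (zmA A).
Proof.
move=> bf df k nk k0 kA; rewrite (I_half bf nk) mulr_ge0 ?exprn_ge0//.
have h8 : 0 <= 8 :> R by [].
apply: df; first exact: nice_affV.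
  by move=> z zB; apply: k0 => /(Bx_dl h8).
move=> z zB Az; have [zd|zd] := pselect (Bx 8 (dl z)); last by rewrite k0.
by apply: kA => //; rewrite /zmA /= halfK.
Qed.

Lemma bm01 (f : V -> R) : mfun f -> (forall z, 0 <= f z <= 1) -> bm f.
Proof. by move=> mf f01; split=> //; exists 1 => z; have := f01 z; rewrite ler_norml; lra. Qed.

Lemma prob_zmv (v f : V -> R) A : prob v f A -> prob (zmv v) (zmg f) (zmA A).
Proof.
move=> [W mf f01 d1 d2 Ao pos bd co lc v0 near].
have h8 : 0 <= 8 :> R by [].
have bf := bm01 mf f01.
have b1f : bm (fun z => 1 - f z).
  have := bmD (bm_cst 1) (bmM (bm_cst (-1)) bf); congr bm; apply/funext => z; ring.
split.
- exact: wsol_zmv W.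
- exact: mfun_affV.
- by move=> z; exact: f01.
- exact: dens_zm.
- exact: (dens_zm b1f d2).
- move=> z /(Bx_half h8) zB Az; have [d d0 Hd] := Ao _ zB Az; exists d => // w wd.
  by apply: Hd; apply: le_lt_trans (half_dist _ _) wd.
- by move=> z /(Bx_half h8) zB Az; rewrite /zmv mulr_gt0//; exact: pos.
- move=> z /(Bx_half h8) zB Az H; rewrite /zmv pmulr_rle0//; apply: bd => // d d0.
  have [w [wB Aw wd]] := H d d0; exists (affV 2^-1 4^-1 0 w); split=> //; first exact: Bx_half.
  exact: le_lt_trans (half_dist _ _) wd.
- move=> z /(Bx_half h8) /co cz e e0; have e4 : 0 < e / 4 by rewrite divr_gt0.
  have [d d0 Hd] := cz _ e4; exists d => // h hd.
  rewrite /zmv -mulrBr normrM gtr0_norm// -ler_pdivlMl// [_ * e]mulrC.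
  have := Hd (affV 2^-1 4^-1 0 (z + h) - affV 2^-1 4^-1 0 z); rewrite subrKC.
  by apply; apply: le_lt_trans (half_dist _ _) _; rewrite addrC addKr.
- apply: lcont_zmv; rewrite (_ : affV _ _ _ _ = 0)//.
  by apply: (congr2 pair); rewrite /= addr0 ?scaler0 ?mulr0.
- rewrite /zmv (_ : affV _ _ _ _ = 0) ?v0 ?mulr0//.
  by apply: (congr2 pair); rewrite /= addr0 ?scaler0 ?mulr0.
- move=> d d0; have d2' : 0 < d / 2 by rewrite divr_gt0.
  have [z [[z1 /andP[z2 z3]] Az]] := near _ d2'; exists (dl z); split; last by rewrite /zmA /= halfK.
  rewrite /Bx /dl /affV /= !addr0 normrZ gtr0_norm//; split; first fast_lra.
  by move: z2; rewrite (_ : (d / 2) ^+ 2 = d ^+ 2 / 4); [fast_lra|field].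
Qed.

Lemma prob_base v f A : prob v f A -> base v (fun z => 2 * f z - 1).
Proof.
move=> [W mf f01 d1 d2 Ao pos bd co lc v0 near]; split=> // z /co cz e /cz[d d0 Hd].
by exists d => // h /Hd.
Qed.

Definition Kabs (k : V -> R) : R := I (fun z => `|k z|).
Lemma Kabs_ge0 k : 0 <= Kabs k. Proof. exact: I_ge0. Qed.

Definition KX : R := \sum_(i < n) \sum_(j < n) Kabs (Xi i j).
Lemma KX_ge0 : 0 <= KX. Proof. by apply: sumr_ge0 => i _; apply: sumr_ge0 => j _; exact: Kabs_ge0. Qed.

Definition energy (P : 'I_n -> 'I_n -> R) : R := \sum_i \sum_j P i j ^+ 2.
Definition C1 (T Cc : R) : R := 8 * T + 4 / 3 * I (@psi R n) + Cc + 4 * Kabs kap + 16 * KX.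

(** [dt_trace] replaces the time coefficient of [qq] by the trace, so that quadratic and time terms
    combine to [pt]. The average of [g], the constant coefficient and the passage from [PP] to [Pt]
    cost bounded amounts. *)
Lemma pt_approx (v f : V -> R) T Cc (z : V) : base v (fun z => 2 * f z - 1) -> mfun f -> (forall z, 0 <= f z <= 1) ->
  RmB v T -> `|cc kap v| <= Cc -> `|z.1| <= 2 -> -4 <= z.2 -> z.2 < 0 ->
  `|v z - \sum_i z.1 ord0 i * bb kap v i - pt (Pt v f) z| <= C1 T Cc.
Proof.
move=> B mf f01 RT cC z1 z2 z3; have [W _] := B.
have h1 := approx B RT z1 z2 z3; have [_ mg g1 _] := W.
have h2 : `|cc kap (fun z => 2 * f z - 1)| <= Kabs kap.
  by rewrite -[Kabs kap]mul1r; apply: I_wle => //; exact: nice_kap.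
have f1 z' : `|f z'| <= 1 by have := f01 z'; rewrite ler_norml; fast_lra.
have hX i j : `|I (fun z => f z * Xi i j z)| <= Kabs (Xi i j).
  by rewrite -[Kabs _]mul1r; apply: I_wle => //; exact: nice_Xi.
have zi i : `|z.1 ord0 i| <= 2 by apply: le_trans (rV_coord_le _ _) z1.
set S1 := \sum_i \sum_j z.1 ord0 i * z.1 ord0 j * I (fun z => f z * Xi i j z).
have hS1 : `|S1| <= 4 * KX.
  rewrite /S1 /KX mulr_sumr; apply: le_trans (ler_norm_sum _ _ _) _; apply: ler_sum => i _.
  rewrite mulr_sumr; apply: le_trans (ler_norm_sum _ _ _) _; apply: ler_sum => j _.
  rewrite normrM ler_pM// normrM (_ : 4 = 2 * 2); last by ring.
  by rewrite ler_pM.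
set S2 := \sum_i I (fun z => f z * Xi i i z).
have hS2 : `|S2| <= KX.
  rewrite /S2 /KX; apply: le_trans (ler_norm_sum _ _ _) _; apply: ler_sum => i _.
  rewrite (bigD1 i)//=; apply: le_trans (hX i i) _; rewrite lerDl sumr_ge0// => j _; exact: Kabs_ge0.
set B1 := \sum_i z.1 ord0 i * bb kap v i.
have Eq : qq kap v z = cc kap v + (B1 + z.2 * (\sum_i PP kap v i i - cc kap (fun z => 2 * f z - 1))) + 2^-1 * bil (PP kap v) z z.
  by rewrite /qq /pol (dt_trace W KB4_Bx).
have Eb : bil (Pt v f) z z = bil (PP kap v) z z - 2 * S1.
  rewrite /bil /S1 /Pt mulr_sumr -sumrB; apply: eq_bigr => i _.
  by rewrite mulr_sumr -sumrB; apply: eq_bigr => j _; ring.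
have Et : \sum_i Pt v f i i = \sum_i PP kap v i i - 2 * S2.
  by rewrite /S2 /Pt mulr_sumr -sumrB.
rewrite /pt Eb Et.
move: Eq h1; set Q := qq kap v z; set c := cc kap v in cC *; set g := cc kap _ in h2 *; move=> Eq h1.
set tr := \sum_i PP kap v i i in Eq *; set b := bil _ z z in Eq *.
have -> : v z - B1 - (2^-1 * (b - 2 * S1) + z.2 * (tr - 2 * S2)) =
  (v z - Q) + c - z.2 * g + S1 + 2 * (z.2 * S2) by rewrite Eq; field.
have zg : `|z.2 * g| <= 4 * Kabs kap by rewrite normrM ler_pM// ler_norml; fast_lra.
have zS : `|z.2 * S2| <= 4 * KX by rewrite normrM ler_pM// ler_norml; fast_lra.
have := KX_ge0; rewrite /C1.
move: zg zS h1 cC hS1; move: (z.2 * g) (z.2 * S2) (v z - Q) => t1 t2 t3.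
rewrite !ler_norml; fast_lra.
Qed.

Lemma KB_KB4 (z : V) : KB z -> [/\ `|z.1| <= 2, -4 <= z.2 & z.2 < 0].
Proof. by move=> [a /andP[b c]]; split=> //; lra. Qed.

Lemma KB_Bx8 (z : V) : KB z -> Bx 8 z.
Proof. by move=> [a /andP[b c]]; split; [lra|apply/andP; split; lra]. Qed.

Lemma Th_le i j (z : V) : `|Th i j z| <= 12 * om z.
Proof.
rewrite /Th normrM (ger0_norm (om_ge0 z)) mulrC.
have [->|/(ker_om).2[z1 /andP[z2 z3]]] := eqVneq (om z) 0; first by rewrite !mulr0.
rewrite ler_wpM2r ?om_ge0//.
have zi k : `|z.1 ord0 k| <= 2 by apply: le_trans (rV_coord_le _ _) z1.
apply: le_trans (ler_normD _ _) _.
have : `|z.1 ord0 i * z.1 ord0 j| <= 2 * 2 by rewrite normrM ler_pM.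
have : `|2 * z.2 * (i == j)%:R| <= 6.
  by case: (i == j); rewrite ?mulr1 ?mulr0 ?normr0// normrM gtr0_norm// ltr0_norm//; lra.
lra.
Qed.

(** The reason for measuring the Hessian by a sum of squares: its first variation becomes the
    integral of [om * pt P] over the phase. *)
Lemma pt_Th P (z : V) : \sum_i \sum_j P i j * Th i j z = 2 * (om z * pt P z).
Proof.
rewrite /pt /bil mulrDr mulrDr !mulr_sumr -big_split /=; apply: eq_bigr => i _.
rewrite !mulr_sumr (bigD1 i)//= [in RHS](bigD1 i)//= /Th eqxx.
have -> : \sum_(i0 < n | i0 != i) P i i0 * (om z * (z.1 ord0 i * z.1 ord0 i0 + 2 * z.2 * (i == i0)%:R)) =
   \sum_(j < n | j != i) 2 * (om z * (2^-1 * (z.1 ord0 i * z.1 ord0 j * P i j))).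
  by apply: eq_bigr => j ji; rewrite [i == j]eq_sym (negbTE ji) mulr0 addr0; field.
by rewrite mulr1; field.
Qed.

Lemma nice_ompt P : nice (fun z : V => om z * pt P z).
Proof.
have -> : (fun z => om z * pt P z) = fun z : V => 2^-1 * \sum_i \sum_j P i j * Th i j z.
  by apply/funext => z; rewrite pt_Th mulKf.
by apply: niceZ; apply: nice_sum => i; apply: nice_sum => j; apply: niceZ; exact: nice_Th.
Qed.

Definition amass (f : V -> R) : R := I (fun z => f z * om z).

Lemma amass_ge0 (f : V -> R) : (forall z, 0 <= f z <= 1) -> 0 <= amass f.
Proof. by move=> f01; apply: I_ge0 => z; rewrite mulr_ge0 ?om_ge0//; case/andP: (f01 z). Qed.

Lemma J_le (f : V -> R) i j : mfun f -> (forall z, 0 <= f z <= 1) -> `|I (fun z => f z * Th i j z)| <= 12 * amass f.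
Proof.
move=> mf f01; have bf := bm01 mf f01.
have nT := nice_mul bf (nice_Th i j); have no := nice_mul bf (@nice_om R n).
apply: le_trans (I_norm nT) _; rewrite -(I_Z 12 no).
apply: I_le; [exact: nice_norm|exact: niceZ|] => z.
have /andP[f0 _] := f01 z.
by rewrite normrM (ger0_norm f0) mulrCA ler_wpM2l// Th_le.
Qed.

(** The square of [P - 2 J] is expanded: the linear term is [4 * 2] times the integral of [pt_Th],
    and the quadratic one uses [|J| <= 12 amass], with [576 = 4 * 12^2]. *)
Lemma energy_zm v f A : prob v f A ->
  energy (Pt (zmv v) (zmg f)) <= energy (Pt v f) - 8 * I (fun z => f z * (om z * pt (Pt v f) z))
    + 576 * n%:R ^+ 2 * amass f ^+ 2.
Proof.
move=> p; have mf := prob_mf p; have f01 := prob_f p; have bf := bm01 mf f01.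
pose J i j := I (fun z => f z * Th i j z).
have E : energy (Pt (zmv v) (zmg f)) =
  energy (Pt v f) - 4 * (\sum_i \sum_j Pt v f i j * J i j) + 4 * energy J.
  rewrite /energy !mulr_sumr -sumrB -big_split /=; apply: eq_bigr => i _.
  rewrite !mulr_sumr -sumrB -big_split /=; apply: eq_bigr => j _.
  by rewrite (Pt_zmv _ _ (prob_wsol p) bf) -/(J i j); ring.
have E2 : \sum_i \sum_j Pt v f i j * J i j = 2 * I (fun z => f z * (om z * pt (Pt v f) z)).
  rewrite -(I_Z 2 (nice_mul bf (nice_ompt _))).
  have nfT i j := nice_mul bf (nice_Th i j).
  have -> : (fun z => 2 * (f z * (om z * pt (Pt v f) z))) = fun z => \sum_i \sum_j Pt v f i j * (f z * Th i j z).
    apply/funext => z; rewrite mulrCA -pt_Th mulr_sumr; apply: eq_bigr => i _.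
    by rewrite mulr_sumr; apply: eq_bigr => j _; rewrite mulrCA.
  rewrite I_sum => [|i]; last by apply: nice_sum => j; exact: niceZ.
  apply: eq_bigr => i _; rewrite I_sum => [|j]; last exact: niceZ.
  by apply: eq_bigr => j _; rewrite (I_Z _ (nfT i j)).
have E3 : energy J <= n%:R ^+ 2 * (144 * amass f ^+ 2).
  have -> : n%:R ^+ 2 * (144 * amass f ^+ 2) = \sum_(i < n) \sum_(j < n) 144 * amass f ^+ 2.
    move: (144 * _) => c.
    by under eq_bigr do rewrite sumr_const card_ord; rewrite sumr_const card_ord -[RHS]mulr_natl -[X in _ = _ * X]mulr_natl mulrA expr2.
  apply: ler_sum => i _; apply: ler_sum => j _.
  have -> : 144 * amass f ^+ 2 = (12 * amass f) ^+ 2 by ring.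
  rewrite -real_normK ?num_real// lerXn2r ?nnegrE ?J_le// mulr_ge0// amass_ge0//.
rewrite E E2; move: (I _) => q; fast_lra.
Qed.

(** [prob_in] applied to [om * (pt P + L)], which is nonnegative on the phase. *)
Lemma drift_lower v f A L : prob v f A -> (forall z, KB z -> A z -> - L <= pt (Pt v f) z) ->
  - (L * amass f) <= I (fun z => f z * (om z * pt (Pt v f) z)).
Proof.
move=> p H; have mf := prob_mf p; have f01 := prob_f p; have bf := bm01 mf f01.
have no := @nice_om R n; have np := nice_ompt (Pt v f).
have nk := niceD np (niceZ L no).
have := prob_in p nk; rewrite (_ : (fun z => f z * (om z * pt (Pt v f) z + L * om z)) =
  fun z => f z * (om z * pt (Pt v f) z) + L * (f z * om z)); last by apply/funext => z; ring.
rewrite (I_D (nice_mul bf np) (niceZ L (nice_mul bf no))) (I_Z L (nice_mul bf no)) -/(amass f).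
have H0 : forall z : V, ~ KB z -> om z = 0.
  by move=> z zK; apply/eqP; apply: contrapT => /negP/(ker_om).2.
have key (a b : R) : 0 <= a + b -> - b <= a by lra.
move=> h; apply: key; apply: h => z zB; first by rewrite H0 ?mul0r ?mulr0 ?addr0// => /KB_Bx8.
move=> Az; rewrite [L * _]mulrC -mulrDr; have [zK|zK] := pselect (KB z); last by rewrite H0// mul0r.
by rewrite mulr_ge0 ?om_ge0//; have := H z zK Az; lra.
Qed.

Definition Kom : R := `|sval (cid (Cc_bounded (ker_Cc (@ker_om R n))))|.
Lemma om_le (z : V) : om z <= Kom.
Proof.
rewrite /Kom; case: cid => M HM /=; have := HM z; rewrite ger0_norm ?om_ge0// => h.
exact: le_trans h (ler_norm _).
Qed.
Lemma Kom_ge0 : 0 <= Kom. Proof. exact: normr_ge0. Qed.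

(** On the phase [pt P] is at least [- L] and [L <= k], so wherever its modulus exceeds [k] it is
    above [k]. The exceptional set is [flat], of small measure when [P] has a large entry. *)
Lemma drift_thick v f A L k : prob v f A -> 0 <= L -> L <= k ->
  (forall z, KB z -> A z -> - L <= pt (Pt v f) z) ->
  (k - L) * amass f - k * Kom * I (\1_(flat (Pt v f) k) : V -> R) <= I (fun z => f z * (om z * pt (Pt v f) z)).
Proof.
move=> p L0 Lk H; have mf := prob_mf p; have f01 := prob_f p; have bf := bm01 mf f01.
have no := @nice_om R n; have np := nice_ompt (Pt v f).
have key2 (x : R) : - L <= x -> k < `|x| -> 0 <= x + (L - k) + 0.
  by case: (lerP 0 x) => hp; [rewrite ger0_norm//|rewrite ltr0_norm//]; lra.
set Z : V -> R := \1_(flat (Pt v f) k); have nZ : nice Z := nice_flat _ _.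
have noZ := nice_mul (nice_bm no) nZ.
have nk := niceD (niceD np (niceZ (L - k) no)) (niceZ k noZ).
have := prob_in p nk; rewrite (_ : (fun z => f z * (om z * pt (Pt v f) z + (L - k) * om z + k * (om z * Z z))) =
  fun z => f z * (om z * pt (Pt v f) z) + (L - k) * (f z * om z) + k * (f z * (om z * Z z))); last by apply/funext => z; ring.
rewrite (I_D (niceD (nice_mul bf np) (niceZ (L - k) (nice_mul bf no))) (niceZ k (nice_mul bf noZ))).
rewrite (I_D (nice_mul bf np) (niceZ (L - k) (nice_mul bf no))) (I_Z _ (nice_mul bf no)) (I_Z k (nice_mul bf noZ)) -/(amass f).
have H0 : forall z : V, ~ KB z -> om z = 0.
  by move=> z zK; apply/eqP; apply: contrapT => /negP/(ker_om).2.
have hZ : I (fun z => f z * (om z * Z z)) <= Kom * I Z.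
  rewrite -(I_Z Kom nZ); apply: I_le; [exact: nice_mul|exact: niceZ|] => z.
  have Z0 : 0 <= Z z by rewrite /Z indicE.
  have /andP[f0 f1] := f01 z; have o0 := om_ge0 z; have oK := om_le z.
  have a : om z * Z z <= Kom * Z z by rewrite ler_wpM2r.
  have b : 0 <= om z * Z z by rewrite mulr_ge0.
  nra.
have k0 : 0 <= k by lra.
have hZ' := ler_wpM2l k0 hZ.
have key (a b c q : R) : c <= q -> 0 <= a + (L - k) * b + c -> (k - L) * b - q <= a by lra.
rewrite -[k * Kom * _]mulrA.
move=> h; apply: (key _ _ _ _ hZ'); apply: h => z zB; first by rewrite H0 ?mul0r ?mulr0 ?addr0// => /KB_Bx8.
move=> Az; have -> : om z * pt (Pt v f) z + (L - k) * om z + k * (om z * Z z) = om z * (pt (Pt v f) z + (L - k) + k * Z z) by ring.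
have [zK|zK] := pselect (KB z); last by rewrite H0// mul0r.
rewrite mulr_ge0 ?om_ge0//; have := H z zK Az.
rewrite /Z indicE; have [_|/negP zZ] := boolP (z \in flat (Pt v f) k); first by rewrite mulr1; lra.
rewrite mulr0 => h1; have : k < `|pt (Pt v f) z|.
  rewrite ltNge; apply/negP => h2; apply: zZ; rewrite inE; split=> //.
  by apply: inbW (KB_inb zK); lra.
exact: key2.
Qed.

(** [schwarz] needs compact support, which [eta 1] has not. It applies to [psi], and [psi_xx] then
    gives [d = 2^(n+2) (d o dl)] for the antisymmetric part [d]. Iterated doubling carries every
    point of negative time below time -3, where [d] is 0. *)
Lemma Xi_sym i j (z : V) : Xi i j z = Xi j i z.
Proof.
pose d (z : V) := Xi i j z - Xi j i z.
have step y : d y = 2 ^+ n.+2 * d (dl y).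
  have := psi_xx i j y; have := psi_xx j i y.
  have -> : Dx i (Dx j psi) y = Dx j (Dx i psi) y by apply: schwarz; exact: ker_Cc ker_psi.
  have -> : (j == i) = (i == j) by rewrite eq_sym.
  rewrite /d; move: (Dx j _ _) (om y) (Xi i j y) (Xi j i y) (Xi i j (dl y)) (Xi j i (dl y)).
  by move=> a b c e f g -> /eqP; rewrite [y.1 ord0 j * _]mulrC -subr_eq0 => /eqP h; lra.
have dK y : ~ KB y -> d y = 0.
  move=> yK; rewrite /d; have H k l : Xi k l y = 0 by apply/eqP; apply: contrapT => /negP/(ker_Xi k l).2.
  by rewrite !H subrr.
have itd k y : d y = (2 ^+ n.+2) ^+ k * d (iter k dl y).
  elim: k y => [|k IH] y; first by rewrite expr0 mul1r.
  by rewrite IH step mulrA -exprSr.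
have it2 k (y : V) : (iter k dl y).2 = 4 ^+ k * y.2.
  by elim: k => [|k IH] /=; rewrite ?expr0 ?mul1r// addr0 IH exprS mulrA.
suff : d z = 0 by rewrite /d => /eqP; rewrite subr_eq0 => /eqP.
have [z0|z0] := leP 0 z.2; first by apply: dK => -[_ /andP[_]]; rewrite ltNge z0.
pose N := Num.bound (3 / - z.2).
rewrite (itd N) dK ?mulr0// => -[_ /andP[]]; rewrite it2 leNgt => /negP h _; apply: h.
have zp : 0 < - z.2 by lra.
have h1 : 3 / - z.2 < N%:R by apply: archi_boundP; rewrite divr_ge0// ltW.
have h2 : N%:R <= 4 ^+ N :> R by rewrite -natrX ler_nat ltnW// ltn_expl.
have : 3 < N%:R * - z.2 by rewrite -ltr_pdivrMr.
have : N%:R * - z.2 <= 4 ^+ N * - z.2 by rewrite ler_wpM2r// ltW.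
by rewrite mulrN mulrN; lra.
Qed.

Lemma Pt_sym (v f : V -> R) i j : Pt v f i j = Pt v f j i.
Proof.
have e1 := PP_sym v i j (ker_Cc (@ker_kap R n)).
have EX : Xi i j = Xi j i :> (V -> R) by apply/funext => z; exact: Xi_sym.
have e2 := congr1 (fun X : V -> R => I (fun z => f z * X z)) EX.
exact: (congr2 (fun a b => a - 2 * b) e1 e2).
Qed.

End problem.

(** * Large gradient: the phase is nearly a half space *)

Section halfspace.
Context {R : realType} {n : nat}.
Local Notation V := ('rV[R]_n * R)%type.
Local Notation mV := ('rV[R]_n * measurableTypeR R)%type.

(** Connectedness of the unit interval: the supremum of the initial segments on which [P] holds is
    attained, and cannot be below 1. *)
Lemma seg_clopen (P : R -> Prop) : P 0 ->
  (forall t, 0 <= t <= 1 -> P t -> exists2 d, 0 < d & forall t', 0 <= t' <= 1 -> `|t' - t| < d -> P t') ->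
  (forall t, 0 <= t <= 1 -> (forall d, 0 < d -> exists t', [/\ 0 <= t' <= 1, `|t' - t| < d & P t']) -> P t) ->
  P 1.
Proof.
move=> P0 Po Pc.
pose S := [set t | 0 <= t <= 1 /\ forall s, 0 <= s <= t -> P s].
have S0 : S 0 by split; [rewrite lexx ler01|move=> s /andP[a b]; have -> : s = 0 by apply/le_anti/andP].
have Sub : has_sup S by split; [exists 0|exists 1 => t [/andP[]]].
set m := sup S.
have m0 : 0 <= m by apply: ub_le_sup => //; case: Sub.
have m1 : m <= 1 by apply: sup_le_ub; [exists 0|move=> t [/andP[]]].
have Plt s : 0 <= s -> s < m -> P s.
  move=> s0 sm; have ms : 0 < m - s by rewrite subr_gt0.
  have [t [_ tP]] := sup_adherent ms Sub; rewrite subKr => st.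
  by apply: tP; rewrite s0 ltW.
have Pm : P m.
  have [->//|mn0] := eqVneq m 0.
  have mp : 0 < m by rewrite lt_neqAle eq_sym mn0.
  apply: Pc => [|d d0]; first by rewrite m0.
  exists (Num.max 0 (m - d / 2)); split.
  - by rewrite le_max lexx /= ge_max ler01/=; lra.
  - rewrite distrC ger0_norm ?subr_ge0 ?ge_max ?m0//=; last by lra.
    have : m - d / 2 <= Num.max 0 (m - d / 2) by rewrite le_max lexx orbT.
    lra.
  - by apply: Plt; [rewrite le_max lexx|rewrite gt_max mp/=; lra].
have Sm' : S m.
  by split; [rewrite m0|move=> s /andP[s0]; rewrite le_eqVlt => /predU1P[->//|]; exact: Plt].
have [d d0 Hd] := Po m (introT andP (conj m0 m1)) Pm.
have [m1'|m1'] := ltP m 1; last by have <- : m = 1 by apply/le_anti; rewrite m1 m1'.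
pose t := Num.min 1 (m + d / 2).
have mt : m < t by rewrite lt_min m1'/=; lra.
have : S t.
  split; first by rewrite ge_min lexx andbT (le_trans m0)// ltW.
  move=> s /andP[s0 st]; have [sm|sm] := leP s m; first by apply: Sm'.2; rewrite s0.
  apply: Hd; first by rewrite s0 (le_trans st)// ge_min lexx.
  rewrite ger0_norm; last by fast_lra.
  have : t <= m + d / 2 by rewrite ge_min lexx orbT.
  fast_lra.
have : ubound S m by move=> x Sx; apply: ub_le_sup => //; case: Sub.
by move=> /[apply]; rewrite leNgt mt.
Qed.

Definition lin (b : 'I_n -> R) (z : V) : R := \sum_i z.1 ord0 i * b i.

Lemma lin_seg b (z w : V) t : lin b (z + t *: (w - z)) = (1 - t) * lin b z + t * lin b w.
Proof.
by rewrite /lin !mulr_sumr -big_split; apply: eq_bigr => i _; rewrite /= !mxE; ring.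
Qed.

Lemma conv_lt (a b c t : R) : a < c -> b < c -> 0 <= t <= 1 -> (1 - t) * a + t * b < c.
Proof.
move=> ac bc /andP[t0 t1]; have [->|tn0] := eqVneq t 0; first lra.
have tp : 0 < t by rewrite lt_neqAle eq_sym tn0.
have h1 : 0 < t * (c - b) by rewrite mulr_gt0// subr_gt0.
have h2 : 0 <= (1 - t) * (c - a) by rewrite mulr_ge0// subr_ge0// ltW.
lra.
Qed.

Lemma KB_seg (z w : V) t : KB z -> KB w -> 0 <= t <= 1 -> KB (z + t *: (w - z)).
Proof.
move=> [z1 /andP[z2 z3]] [w1 /andP[w2 w3]] /andP[t0 t1].
have -> : z + t *: (w - z) = (1 - t) *: z + t *: w.
  by rewrite scalerBr scalerBl scale1r addrAC -!addrA.
split; rewrite /=.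
  apply: le_trans (ler_normD _ _) _; rewrite !normrZ !ger0_norm ?subr_ge0//.
  have : (1 - t) * `|z.1| <= (1 - t) * 2 by rewrite ler_wpM2l ?subr_ge0.
  have : t * `|w.1| <= t * 2 by rewrite ler_wpM2l.
  lra.
rewrite /GRing.scale /=; apply/andP; split; first by nra.
by apply: conv_lt => //; rewrite t0.
Qed.

(** Where the linear form exceeds [s], [v] is positive, so no point outside [A] is a limit of [A].
    The region is convex, and [A] propagates along segments. *)
Lemma half_all (v f : V -> R) A b s : prob v f A -> (forall z, KB z -> `|v z - lin b z| <= s) ->
  forall z w : V, KB z -> KB w -> s < lin b z -> s < lin b w -> A z -> A w.
Proof.
move=> p H z w zK wK zs ws Az.
pose g (t : R) := z + t *: (w - z).
have gK t : 0 <= t <= 1 -> KB (g t) by exact: KB_seg.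
have gs t : 0 <= t <= 1 -> s < lin b (g t).
  move=> t01; rewrite lin_seg.
  have h1 : - lin b z < - s by rewrite ltrN2. have h2 : - lin b w < - s by rewrite ltrN2.
  by have := conv_lt h1 h2 t01; lra.
have gd t t' : `|g t' - g t| <= `|t' - t| * (`|w - z| + 1).
  have -> : g t' - g t = (t' - t) *: (w - z) by rewrite /g opprD addrACA subrr add0r -scalerBl.
  by rewrite normrZ ler_wpM2l// lerDl.
have wz : 0 < `|w - z| + 1 by rewrite ltr_wpDl.
have gd' t t' d : `|t' - t| < d / (`|w - z| + 1) -> `|g t' - g t| < d.
  by rewrite ltr_pdivlMr// => h; apply: le_lt_trans (gd _ _) h.
have := @seg_clopen (fun t => A (g t)).
rewrite /g scale0r addr0 scale1r subrKC -/g; apply=> //.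
- move=> t t01 At; have [d d0 Hd] := prob_open p (KB_Bx8 (gK t t01)) At.
  by exists (d / (`|w - z| + 1)); [rewrite divr_gt0|move=> t' _ /gd'/Hd].
move=> t t01 Ht; apply: contrapT => nA.
have : v (g t) <= 0.
  apply: (prob_bd p) => //; first exact: KB_Bx8 (gK t t01).
  move=> d d0; have [|t' [t'01 /gd' t'd At']] := Ht (d / (`|w - z| + 1)); first by rewrite divr_gt0.
  by exists (g t'); split=> //; exact: KB_Bx8 (gK t' t'01).
have := H _ (gK t t01); have := gs t t01; rewrite ler_norml; lra.
Qed.

Definition above (b : 'I_n -> R) s : set mV := [set z | s < lin b z].
Definition below (b : 'I_n -> R) s : set mV := [set z | lin b z < - s].

Lemma measurable_above b s : measurable (above b s).
Proof.
have -> : above b s = (lin b : mV -> R) @^-1` `]s, +oo[.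
  by apply/seteqP; split=> z /=; rewrite in_itv/= andbT.
rewrite -[X in measurable X]setTI; exact: (mfun_lin b).
Qed.
Lemma measurable_below b s : measurable (below b s).
Proof.
have -> : below b s = (lin b : mV -> R) @^-1` `]-oo, - s[.
  by apply/seteqP; split=> z /=; rewrite in_itv.
rewrite -[X in measurable X]setTI; exact: (mfun_lin b).
Qed.

Lemma bm_indic (S : set mV) : measurable S -> bm (\1_S : V -> R).
Proof.
move=> mS; split; first exact: measurable_indic.
by exists 1 => z; rewrite indicE; case: (_ \in _); rewrite ?normr1 ?normr0.
Qed.

Lemma three_parts b s (z : V) : 0 < s -> inb 4 z ->
  \1_(above b s) z + \1_(below b s) z + \1_(slab b s) z = 1 :> R.
Proof.
move=> s0 zb; rewrite !indicE.
have [h|h] := ltP s (lin b z).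
  rewrite [z \in above b s]mem_set// [z \in below b s]memNset; last by rewrite /below/=; lra.
  rewrite memNset ?addr0// => -[_]; rewrite -/(lin b z) ger0_norm; lra.
have [h'|h'] := ltP (lin b z) (- s).
  rewrite [z \in below b s]mem_set// [z \in above b s]memNset; last by rewrite /above/=; lra.
  rewrite memNset ?addr0 ?add0r// => -[_]; rewrite -/(lin b z) ltr0_norm; lra.
rewrite [z \in slab b s]mem_set; last by split=> //; rewrite -/(lin b z) ler_norml h h'.
by rewrite !memNset ?add0r//; rewrite /above /below /=; lra.
Qed.

Lemma Th_slab i j b s l : 0 < s -> b l != 0 ->
  `|I (fun z : V => \1_(slab b s) z * Th i j z)| <= 12 * @Kom R n * (10 ^+ n.+1 * 12 * s / `|b l|).
Proof.
move=> s0 bl; have nS := nice_slab b s; have nT := @nice_Th R n i j.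
have nST := nice_mul (nice_bm nS) nT.
apply: le_trans (I_norm nST) _; apply: (@le_trans _ _ (12 * @Kom R n * I (\1_(slab b s) : V -> R))).
  rewrite -(I_Z _ nS); apply: I_le; [exact: nice_norm|exact: niceZ|].
  move=> z; have i0 : 0 <= \1_(slab b s) z :> R by rewrite indicE.
  rewrite normrM (ger0_norm i0) mulrC ler_wpM2r//.
  by apply: le_trans (Th_le _ _ _) _; rewrite ler_wpM2l// om_le.
by rewrite ler_wpM2l ?mulr_ge0 ?Kom_ge0// slab_small.
Qed.

(** The weight is even in space, so the integrals over the two half spaces agree. Together with the
    slab they make up [I_Th], which is 0; hence each is half of the slab integral in modulus. *)
Lemma Th_half i j b s l : 0 < s -> b l != 0 ->
  `|I (fun z : V => \1_(above b s) z * Th i j z)| <= 12 * @Kom R n * (10 ^+ n.+1 * 12 * s / `|b l|).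
Proof.
move=> s0 bl; have nT := @nice_Th R n i j.
have nA := nice_mul (bm_indic (measurable_above b s)) nT.
have nB := nice_mul (bm_indic (measurable_below b s)) nT.
have nS := nice_mul (nice_bm (nice_slab b s)) nT.
have E : I (fun z : V => \1_(below b s) z * Th i j z) = I (fun z : V => \1_(above b s) z * Th i j z).
  have m1 : (-1 : R) != 0 by rewrite oppr_eq0 oner_eq0.
  have := I_affV 0 m1 (oner_neq0 R) nA; rewrite normrN1 normr1 invr1 expr1n !mul1r => <-.
  congr I; apply/funext => z.
  have -> : affV (-1) 1 0 z = (- z.1, z.2) by apply: (congr2 pair); rewrite /= addr0 ?scaleN1r ?mul1r.
  congr (_ * _).
    rewrite !indicE; congr (_%:R); congr nat_of_bool.
    have lN : lin b (- z.1, z.2) = - lin b z.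
      by rewrite /lin -sumrN; apply: eq_bigr => k _; rewrite /= mxE mulNr.
    apply/idP/idP => /set_mem h; apply/mem_set; move: h; rewrite /above /below /= lN; lra.
  by rewrite /Th om_even -surjective_pairing /= !mxE mulrNN.
have ET : (fun z => \1_(above b s) z * Th i j z + \1_(below b s) z * Th i j z + \1_(slab b s) z * Th i j z) = Th i j.
  apply/funext => z; rewrite -!mulrDl.
  have [->|Tz] := eqVneq (Th i j z) 0; first by rewrite mulr0.
  rewrite three_parts ?mul1r//; have : om z != 0 by apply: contra_neq Tz; rewrite /Th => ->; rewrite mul0r.
  by move=> /(ker_om).2/KB_inb; apply: inbW; lra.
have := I_Th (R := R) (n := n) i j; rewrite -[X in I X]ET (I_D (niceD nA nB) nS) (I_D nA nB) E.
have := Th_slab i j s0 bl; move: (I _) (I _) => x y h /eqP; rewrite addr_eq0 => /eqP e.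
have : `|x + x| <= 12 * @Kom R n * (10 ^+ n.+1 * 12 * s / `|b l|) by rewrite e normrN.
rewrite -mulr2n normrMn mulr2n; have := normr_ge0 x; lra.
Qed.

(** In the lower part [v] is negative, so [A] is absent; in the upper part [A] is everything or
    nothing by [half_all], and both cases are controlled by [Th_half]. The slab itself contributes
    the other half of 24. *)
Lemma J_half (v f : V -> R) A b s l i j : prob v f A -> (forall z, KB z -> `|v z - lin b z| <= s) -> 0 < s -> b l != 0 ->
  `|I (fun z => f z * Th i j z)| <= 24 * @Kom R n * (10 ^+ n.+1 * 12 * s / `|b l|).
Proof.
move=> p H s0 bl; have mf := prob_mf p; have f01 := prob_f p; have bf := bm01 mf f01.
have nT := @nice_Th R n i j.
have nA := nice_mul (bm_indic (measurable_above b s)) nT.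
have nB := nice_mul (bm_indic (measurable_below b s)) nT.
have nS := nice_mul (nice_bm (nice_slab b s)) nT.
have Tom (z : V) : Th i j z != 0 -> KB z.
  move=> Tz; have : om z != 0 by apply: contra_neq Tz; rewrite /Th => ->; rewrite mul0r.
  by move=> /(ker_om).2.
have T0 (z : V) : ~ KB z -> Th i j z = 0 by move=> zK; apply/eqP; apply: contrapT => /negP/Tom.
(* The sign condition [prob_in], used for [g] and for [- g], yields an equality. *)
have vz (g : V -> R) : nice g -> (forall z, ~ KB z -> g z = 0) -> (forall z, KB z -> A z -> g z = 0) ->
    I (fun z => f z * g z) = 0.
  move=> ng g0 gA; apply/le_anti/andP; split.
    rewrite -oppr_ge0 -(I_N (nice_mul bf ng)).
    have := prob_in p (niceN ng); rewrite (_ : (fun z => f z * - g z) = fun z => - (f z * g z)).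
      apply=> z zB; first by rewrite g0 ?oppr0// => /KB_Bx8.
      by move=> Az; have [zK|zK] := pselect (KB z); [rewrite gA//|rewrite g0//]; rewrite oppr0.
    by apply/funext => z; rewrite mulrN.
  apply: (prob_in p ng) => z zB; first by rewrite g0// => /KB_Bx8.
  by move=> Az; have [zK|zK] := pselect (KB z); [rewrite gA//|rewrite g0//].
have vo (g : V -> R) : nice g -> (forall z, ~ KB z -> g z = 0) -> (forall z, KB z -> ~ A z -> g z = 0) ->
    I (fun z => f z * g z) = I g.
  move=> ng g0 gA.
  have nf1 : nice (fun z => (1 - f z) * g z).
    apply: nice_mul => //; have := bmD (bm_cst 1) (bmM (bm_cst (-1)) bf); congr bm.
    by apply/funext => z; ring.
  have E : I (fun z => (1 - f z) * g z) = I g - I (fun z => f z * g z).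
    rewrite -(I_B ng (nice_mul bf ng)); congr I; apply/funext => z; ring.
  suff : I (fun z => (1 - f z) * g z) = 0 by rewrite E => /eqP; rewrite subr_eq0 => /eqP.
  apply/le_anti/andP; split.
    rewrite -oppr_ge0 -(I_N nf1).
    have := prob_out p (niceN ng); rewrite (_ : (fun z => (1 - f z) * - g z) = fun z => - ((1 - f z) * g z)).
      apply=> z zB; first by rewrite g0 ?oppr0// => /KB_Bx8.
      by move=> Az; have [zK|zK] := pselect (KB z); [rewrite gA//|rewrite g0//]; rewrite oppr0.
    by apply/funext => z; rewrite mulrN.
  apply: (prob_out p ng) => z zB; first by rewrite g0// => /KB_Bx8.
  by move=> Az; have [zK|zK] := pselect (KB z); [rewrite gA//|rewrite g0//].
have hA : `|I (fun z => f z * (\1_(above b s) z * Th i j z))| <= 12 * @Kom R n * (10 ^+ n.+1 * 12 * s / `|b l|).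
  have [[z0 [zK zA zs]]|none] := pselect (exists z, [/\ KB z, A z & s < lin b z]).
    rewrite vo//; first exact: Th_half.
      by move=> z zK'; rewrite T0 ?mulr0.
    move=> z zK' nAz; rewrite indicE memNset ?mul0r// => zs'.
    by apply: nAz; exact: (half_all p H zK zK').
  rewrite vz ?normr0//.
  - by rewrite !mulr_ge0 ?Kom_ge0 ?exprn_ge0 ?invr_ge0 ?(ltW s0).
  - by move=> z zK'; rewrite T0 ?mulr0.
  by move=> z zK Az; rewrite indicE memNset ?mul0r// => zs; apply: none; exists z.
have hB : I (fun z => f z * (\1_(below b s) z * Th i j z)) = 0.
  apply: vz => //; first by move=> z zK'; rewrite T0 ?mulr0.
  move=> z zK Az; rewrite indicE memNset ?mul0r// /below /= => zs.
  have := H z zK; have := prob_pos p (KB_Bx8 zK) Az; rewrite ler_norml; lra.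
have hS : `|I (fun z => f z * (\1_(slab b s) z * Th i j z))| <= 12 * @Kom R n * (10 ^+ n.+1 * 12 * s / `|b l|).
  have nfS := nice_mul bf nS.
  apply: le_trans (I_norm nfS) _; apply: (@le_trans _ _ (12 * @Kom R n * I (\1_(slab b s) : V -> R))).
    rewrite -(I_Z _ (nice_slab b s)); apply: I_le; [exact: nice_norm|exact/niceZ/nice_slab|].
    move=> z; have /andP[f0 f1] := f01 z; rewrite normrM (ger0_norm f0).
    apply: (@le_trans _ _ (1 * `|\1_(slab b s) z * Th i j z|)); first by rewrite ler_wpM2r.
    have i0 : 0 <= \1_(slab b s) z :> R by rewrite indicE.
    rewrite mul1r normrM (ger0_norm i0) mulrC ler_wpM2r//.
    by apply: le_trans (Th_le _ _ _) _; rewrite ler_wpM2l// om_le.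
  by rewrite ler_wpM2l ?mulr_ge0 ?Kom_ge0// slab_small.
have -> : (fun z => f z * Th i j z) = fun z => f z * (\1_(above b s) z * Th i j z) +
   f z * (\1_(below b s) z * Th i j z) + f z * (\1_(slab b s) z * Th i j z).
  apply/funext => z; rewrite -!mulrDr -!mulrDl; congr (_ * _).
  have [->|/Tom/KB_inb zb] := eqVneq (Th i j z) 0; first by rewrite mulr0.
  by rewrite three_parts ?mul1r//; apply: inbW zb; lra.
rewrite (I_D (niceD (nice_mul bf nA) (nice_mul bf nB)) (nice_mul bf nS)) (I_D (nice_mul bf nA) (nice_mul bf nB)) hB addr0.
apply: le_trans (ler_normD _ _) _.
move: hA hS; move: (I _) (I _) => x y; lra.
Qed.

End halfspace.

(** * Maximum principle, nondegeneracy and growth *)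

Section heat.
Context {R : realType} {n : nat}.
Local Notation V := ('rV[R]_n * R)%type.

Definition dheat (F : V -> R) (z : V) (p : R) : R :=
  \sum_(i < n) (F (z + p *: xdir i) + F (z - p *: xdir i) - 2 * F z) + (F (z - p ^+ 2 *: tdir) - F z).

(* A discrete form of "(Laplacian - d/dt) F z = l" that only looks backward in time. *)
Definition heat (F : V -> R) (z : V) (l : R) := exists C r0 : R, [/\ 0 <= C, 0 < r0 &
  forall p, 0 < p -> p <= r0 -> `|dheat F z p - p ^+ 2 * l| <= C * p ^+ 3].

Lemma dheat_lin F G a b z p : dheat (fun y => a * F y + b * G y) z p = a * dheat F z p + b * dheat G z p.
Proof.
rewrite /dheat !mulrDr !mulr_sumr addrACA -big_split /=; congr (_ + _); last by ring.
by apply: eq_bigr => i _; ring.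
Qed.

Lemma heat_lin F G a b z k l : heat F z k -> heat G z l -> heat (fun y => a * F y + b * G y) z (a * k + b * l).
Proof.
move=> [C [r0 [C0 r00 H]]] [C' [r1 [C'0 r10 H']]].
exists (`|a| * C + `|b| * C'), (Num.min r0 r1); split.
- by rewrite addr_ge0// mulr_ge0.
- by rewrite lt_min r00.
move=> p p0; rewrite le_min => /andP[pr0 pr1].
rewrite dheat_lin; have -> : a * dheat F z p + b * dheat G z p - p ^+ 2 * (a * k + b * l) =
  a * (dheat F z p - p ^+ 2 * k) + b * (dheat G z p - p ^+ 2 * l) by ring.
apply: le_trans (ler_normD _ _) _; rewrite ![`|_ * (_ - _)|]normrM.
have := ler_wpM2l (normr_ge0 a) (H p p0 pr0); have := ler_wpM2l (normr_ge0 b) (H' p p0 pr1); lra.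
Qed.

Lemma heat_cst c z : heat (fun=> c) z 0.
Proof.
exists 0, 1; split=> // p _ _; rewrite /dheat mulr0 subr0 subrr addr0 big1 ?normr0 ?mul0r// => i _; ring.
Qed.

Lemma heat_eq F G z d l : 0 < d -> (forall h : V, `|h| < d -> h.2 <= 0 -> F (z + h) = G (z + h)) ->
  heat G z l -> heat F z l.
Proof.
move=> d0 E [C [r0 [C0 r00 H]]]; exists C, (Num.min r0 (Num.min 1 (d / 2))); split=> //.
  by rewrite !lt_min r00 ltr01 divr_gt0.
move=> p p0; rewrite !le_min => /and3P[pr0 p1 pd].
suff -> : dheat F z p = dheat G z p by exact: H.
have nxd (k : 'I_n) : `|xdir k : V| <= 1.
  rewrite normV /= normr0 ge_max ler01 andbT; apply/rV_norm_leP => // l'.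
  by rewrite mxE; case: (_ && _); rewrite ?normr1 ?normr0.
have xd i : `|p *: xdir i : V| < d.
  rewrite normrZ gtr0_norm//; have := ler_wpM2l (ltW p0) (nxd i); rewrite mulr1 => h; lra.
have td : `|- (p ^+ 2 *: tdir) : V| < d.
  have p20 : 0 < p ^+ 2 by rewrite exprn_gt0.
  rewrite normrN normrZ (gtr0_norm p20) normV /= normr0 normr1.
  have -> : Num.max 0 1 = 1 :> R by apply/max_idPr.
  rewrite mulr1; have : p ^+ 2 <= p by rewrite expr2 ler_piMr// ltW.
  lra.
have E0 : F z = G z by have := E 0; rewrite normr0 addr0; apply.
rewrite /dheat E0 E//; last by rewrite /= /GRing.scale/= mulr1 oppr_le0 sqr_ge0.
congr (_ + _); apply: eq_bigr => i _; rewrite E//; last by rewrite /= scaler0.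
by rewrite E ?normrN//= scaler0 oppr0.
Qed.

(** The barrier of all comparison arguments: 0 at [z1], at least 1/4 on the parabolic boundary of
    [past z1], with constant heat operator [2 n + 1]. *)
Definition parab (z1 z : V) : R := rho (z - z1) + (z1.2 - z.2).

Lemma heat_parab z1 z : heat (parab z1) z (2 * n%:R + 1).
Proof.
exists 0, 1; split=> // p _ _; rewrite mul0r.
have rx (s : R) i : rho (z + s *: xdir i - z1) = rho (z - z1) + 2 * s * (z.1 ord0 i - z1.1 ord0 i) + s ^+ 2.
  rewrite /rho (bigD1 i)//= [in RHS](bigD1 i)//= !mxE !eqxx /=.
  rewrite (eq_bigr (fun j => (z - z1).1 ord0 j ^+ 2)) => [|j ji]; last by rewrite /= !mxE (negbTE ji) mulr0 addr0.
  rewrite (eq_bigr (fun j => (z - z1).1 ord0 j ^+ 2))//.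
  by move: (\sum_(_ < n | _) _) => q; ring.
have -> : dheat (parab z1) z p = \sum_(i < n) 2 * p ^+ 2 + p ^+ 2.
  rewrite /dheat; congr (_ + _); last first.
    rewrite /parab (_ : rho (z - p ^+ 2 *: tdir - z1) = rho (z - z1)) /=; last first.
      by apply: eq_bigr => i _; rewrite /= !mxE mulr0 subr0.
    by rewrite /GRing.scale/=; ring.
  apply: eq_bigr => i _; rewrite /parab -scaleNr !rx /= scaler0 /GRing.scale /=; ring.
rewrite sumr_const card_ord -[_ *+ n]mulr_natl (_ : _ - _ = 0) ?normr0//; ring.
Qed.

(** The differences are moved onto the kernel, where [ptaylor] applies and the odd orders cancel
    between [p] and [- p]. Nothing but boundedness of [v] enters. *)
Lemma heat_cv (k v : V -> R) z : ker k -> bm v -> heat (cv k v) z (I (fun y => v (y + z) * Hs k y)).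
Proof.
have e5 : 3 + 1 <= 5 :> R by lra.
move=> kk bv; have Ck := ker_Cc kk; have nk := Cc_nice Ck.
have [C C0 HC] := ptaylor Ck (ler01 : 0 <= (1 : R)).
have [mv [M HM]] := bv.
pose D p (y : V) := \sum_(i < n) (k (y - p *: xdir i) + k (y + p *: xdir i) - 2 * k y) + (k (y + p ^+ 2 *: tdir) - k y).
exists (M * ((2 * n%:R + 1) * C) * (2 * 5) ^+ n.+1), 1.
have M0 : 0 <= M by exact: le_trans (HM 0).
split=> //; first by rewrite !mulr_ge0// ?exprn_ge0// addr_ge0// mulr_ge0.
move=> p p0 p1.
have nks (h : V) : nice (fun y => k (y + h)) by exact: nice_shift.
have nD : nice (D p).
  apply: niceD; last by apply: niceB => //; exact: nks.
  apply: nice_sum => i; apply: niceB; last exact: niceZ.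
  by apply: niceD; [exact: (nks (- (p *: xdir i)))|exact: nks].
have bs := bm_shift z bv.
have cvh (h : V) : cv k v (z + h) = I (fun y => v (y + z) * k (y - h)).
  rewrite cvE// -(@I_shiftE _ _ (fun y => v y * k (y - (z + h))) z); last first.
    by apply: nice_mul => //; exact: nice_shift.
  by congr I; apply/funext => y; rewrite opprD addrA addrK.
have cv0 : cv k v z = I (fun y => v (y + z) * k y) by [].
have E : dheat (cv k v) z p = I (fun y => v (y + z) * D p y).
  have n0 := nice_mul bs nk.
  have n1 h := nice_mul bs (nks h).
  have n2 i := niceB (niceD (n1 (- (p *: xdir i))) (n1 (p *: xdir i))) (niceZ 2 n0).
  have -> : (fun y => v (y + z) * D p y) = fun y => \sum_(i < n) (v (y + z) * k (y - p *: xdir i) +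
      v (y + z) * k (y + p *: xdir i) - 2 * (v (y + z) * k y)) + (v (y + z) * k (y + p ^+ 2 *: tdir) - v (y + z) * k y).
    apply/funext => y; rewrite /D mulrDr mulr_sumr; congr (_ + _); last by ring.
    by apply: eq_bigr => i _; ring.
  rewrite (I_D (nice_sum n2) (niceB (n1 _) n0)) (I_B (n1 _) n0) (I_sum n2) /dheat.
  congr (_ + (_ - _)); last by rewrite cvh opprK.
  apply: eq_bigr => i _; rewrite (I_B (niceD (n1 _) (n1 _)) (niceZ 2 n0)) (I_D (n1 _) (n1 _)) (I_Z 2 n0) !cvh -cv0.
  by rewrite opprK.
have nH := nice_Hs kk.
have nvH := nice_mul bs nH; have nvD := nice_mul bs nD.
rewrite E -(I_Z _ nvH) -(I_B nvD (niceZ _ nvH)).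
have -> : M * ((2 * n%:R + 1) * C) * (2 * 5) ^+ n.+1 * p ^+ 3 = M * ((2 * n%:R + 1) * C * p ^+ 3) * (2 * 5) ^+ n.+1 by ring.
have p20 : 0 <= p ^+ 2 := sqr_ge0 p.
have nxd (i : 'I_n) : `|xdir i : V| <= 1.
  rewrite normV /= normr0 ge_max ler01 andbT; apply/rV_norm_leP => // l'.
  by rewrite mxE; case: (_ && _); rewrite ?normr1 ?normr0.
have tay (y h : V) : `|h.1| <= p -> `|h.2| <= p ^+ 2 ->
  `|k (y + h) - k y - (\sum_i h.1 ord0 i * Dx i k y + h.2 * Dt k y)
    - 2^-1 * (\sum_i \sum_j h.1 ord0 i * h.1 ord0 j * Dx i (Dx j k) y)| <= C * p ^+ 3.
  by move=> h1 h2; apply: HC => //; exact: ltW.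
have sx (s : R) i (G : 'I_n -> R) : \sum_j (s *: xdir i : V).1 ord0 j * G j = s * G i.
  rewrite (bigD1 i)//= !mxE !eqxx mulr1 big1 ?addr0// => j ji.
  by rewrite !mxE (negbTE ji) andbF mulr0 mul0r.
have sxx (s : R) i (G : 'I_n -> 'I_n -> R) :
    \sum_j \sum_l (s *: xdir i : V).1 ord0 j * (s *: xdir i : V).1 ord0 l * G j l = s ^+ 2 * G i i.
  transitivity (\sum_j (s *: xdir i : V).1 ord0 j * (s * G j i)).
    apply: eq_bigr => j _; rewrite -(sx s i) mulr_sumr; apply: eq_bigr => l _; ring.
  by rewrite sx; ring.
apply: I_bound => //; first by case: (niceB nvD (niceZ (p ^+ 2) nvH)).
  move=> y; rewrite [p ^+ 2 * _]mulrCA -mulrBr normrM ler_pM//.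
  have -> : D p y - p ^+ 2 * Hs k y =
     \sum_(i < n) (k (y - p *: xdir i) + k (y + p *: xdir i) - 2 * k y - p ^+ 2 * Dx i (Dx i k) y)
     + (k (y + p ^+ 2 *: tdir) - k y - p ^+ 2 * Dt k y).
    by rewrite sumrB /D /Hs mulrDr mulr_sumr; move: (\sum_i _) (\sum_i _) => a b; ring.
  have hi i : `|k (y - p *: xdir i) + k (y + p *: xdir i) - 2 * k y - p ^+ 2 * Dx i (Dx i k) y| <= 2 * (C * p ^+ 3).
    have := tay y (p *: xdir i); have := tay y ((- p) *: xdir i).
    rewrite !sx !sxx /= !scaler0 !mul0r !normr0 scaleNr normrN normrZ gtr0_norm//.
    have nd : `|delta_mx ord0 i : 'rV[R]_n| <= 1 by have := le_trans (normV1 _) (nxd i).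
    have pd : p * `|delta_mx ord0 i : 'rV[R]_n| <= p by rewrite ler_piMr// ltW.
    move=> /(_ pd p20) h1 /(_ pd p20) h2.
    have key (a b c d q e : R) : `|a - c - (- p * d + 0) - 2^-1 * ((- p) ^+ 2 * e)| <= q ->
      `|b - c - (p * d + 0) - 2^-1 * (p ^+ 2 * e)| <= q -> `|a + b - 2 * c - p ^+ 2 * e| <= 2 * q.
      move=> q1 q2; have -> : a + b - 2 * c - p ^+ 2 * e =
        (a - c - (- p * d + 0) - 2^-1 * ((- p) ^+ 2 * e)) + (b - c - (p * d + 0) - 2^-1 * (p ^+ 2 * e)) by field.
      by apply: le_trans (ler_normD _ _) _; fast_lra.
    by move: h1; rewrite scaleNr => h1; exact: key h1 h2.
  have ht : `|k (y + p ^+ 2 *: tdir) - k y - p ^+ 2 * Dt k y| <= C * p ^+ 3.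
    have := tay y (p ^+ 2 *: tdir).
    have e1 (G : 'I_n -> R) : \sum_i (p ^+ 2 *: tdir : V).1 ord0 i * G i = 0.
      by apply: big1 => i _; rewrite /= !mxE mulr0 mul0r.
    have e2 (G : 'I_n -> 'I_n -> R) : \sum_i \sum_j (p ^+ 2 *: tdir : V).1 ord0 i * (p ^+ 2 *: tdir : V).1 ord0 j * G i j = 0.
      by apply: big1 => i _; apply: big1 => j _; rewrite /= !mxE mulr0 !mul0r.
    have t1 : (p ^+ 2 *: tdir : V).1 = 0 by rewrite /= scaler0.
    have t2 : (p ^+ 2 *: tdir : V).2 = p ^+ 2 by rewrite /= /GRing.scale /= mulr1.
    rewrite e1 e2 t1 t2 normr0 (ger0_norm p20) => /(_ (ltW p0) (lexx _)).
    by rewrite mulr0 subr0 add0r.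
  apply: le_trans (ler_normD _ _) _.
  have hs : `|\sum_(i < n) (k (y - p *: xdir i) + k (y + p *: xdir i) - 2 * k y - p ^+ 2 * Dx i (Dx i k) y)| <= n%:R * (2 * (C * p ^+ 3)).
    apply: le_trans (ler_norm_sum _ _ _) _; apply: le_trans (ler_sum _ (fun i _ => hi i)) _.
    by rewrite sumr_const card_ord -[_ *+ n]mulr_natl.
  apply: le_trans (lerD hs ht) _; fast_lra.
move=> y; rewrite [p ^+ 2 * _]mulrCA -mulrBr mulf_eq0 negb_or => /andP[_ Dy].
apply: contrapT => yb; move/eqP: Dy; apply.
have kr (w : V) : k w != 0 -> inb 3 w by move=> /kk.2/KB_inb.
have far (h : V) : `|h| <= 1 -> k (y + h) = 0.
  move=> h1; apply/eqP; apply: contrapT => /negP/kr[a b]; apply: yb.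
  have i1 := le_trans (normV1 _) h1; have i2 := le_trans (normV2 _) h1; split.
    have := ler_normB (y + h).1 h.1; rewrite /= addrK => /le_trans; apply; exact: le_trans (lerD a i1) e5.
  have := ler_normB (y + h).2 h.2; rewrite /= addrK => /le_trans; apply; exact: le_trans (lerD b i2) e5.
have y3 : ~ inb 3 y by apply: contra_not yb; apply: inbW; fast_lra.
have Hs0 : Hs k y = 0.
  have k0 (f : V -> R) : (forall z : V, f z != 0 -> inb 3 z) -> f y = 0.
    by move=> H; apply/eqP; apply: contrapT => /negP/H.
  rewrite /Hs (k0 (Dt k)) ?addr0; last exact: csupp_D kr.
  by apply: big1 => i _; rewrite (k0 (Dx i (Dx i k)))//; apply: csupp_D; exact: csupp_D kr.
have pxd i : `|p *: xdir i : V| <= 1.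
  by rewrite normrZ gtr0_norm//; have := nxd i; have := normr_ge0 (xdir i : V); nra.
have ky : k y = 0 by have := far 0; rewrite addr0 normr0; apply; exact: ler01.
rewrite Hs0 mulr0 subr0 /D ky far ?subr0 ?addr0; last first.
  rewrite normV /= scaler0 normr0 ge_max ler01 /= /GRing.scale /= mulr1 ger0_norm//.
  by rewrite expr_le1// ltW.
by apply: big1 => i _; rewrite !far ?normrN// mulr0 subr0 addr0.
Qed.

Lemma ccont_continuous (F : V -> R) z : ccont F z -> {for z, continuous F}.
Proof.
move=> cF; apply/cvgrPdist_le => e e0; have [d d0 Hd] := cF e e0.
apply: filterS (nbhsx_ballx z d d0) => y; rewrite -ball_normE /= distrC => yd.
by have := Hd _ yd; rewrite subrKC distrC.
Qed.

Definition past (z1 : V) : set V := [set z | `|z.1 - z1.1| <= 2^-1 /\ z1.2 - 4^-1 <= z.2 <= z1.2].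

Lemma closure_eps (S : set V) z : closure S z -> forall d, 0 < d -> exists w, S w /\ `|w - z| < d.
Proof.
move=> cS d d0; have [w [Sw wz]] := cS _ (nbhsx_ballx z d d0).
by exists w; split=> //; move: wz; rewrite -ball_normE /= distrC.
Qed.

Lemma le_eps (a b : R) : (forall d, 0 < d -> a <= b + d) -> a <= b.
Proof. by move=> H; apply/ler_addgt0Pr. Qed.

Lemma closure_past z1 (S : set V) z : S `<=` past z1 -> closure S z -> past z1 z.
Proof.
move=> SP /closure_eps cS; split.
  apply: le_eps => d d0; have [w [/SP[w1 _] wz]] := cS d d0.
  have -> : z.1 - z1.1 = (w.1 - z1.1) - (w - z).1 by rewrite /= opprB addrACA [- z1.1 + _]addrC addrACA subrr add0r addrC.
  by apply: le_trans (ler_normB _ _) _; apply: lerD => //; apply: le_trans (normV1 _) (ltW wz).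
apply/andP; split; apply: le_eps => d d0; have [w [/SP[_ /andP[w1 w2]] wz]] := cS d d0;
  have := le_lt_trans (normV2 _) wz; rewrite /= ltr_norml => /andP[]; fast_lra.
Qed.

(** The maximum is taken over the closure of the part of the cylinder in [A]. At a maximum point
    outside [A], [prob_bd] gives [v <= 0], hence [F <= 0]. At one off the parabolic boundary all
    differences in [dheat] are nonpositive, against [0 < l]; the top face is no exception, since
    [dheat] looks backward. *)
Lemma max_principle (v f F : V -> R) A z1 : prob v f A -> `|z1.1| < 2^-1 -> - 4^-1 < z1.2 -> z1.2 < 0 ->
  A z1 -> 0 < F z1 ->
  (forall z, past z1 z -> ccont F z) ->
  (forall z, past z1 z -> A z -> exists2 l, 0 < l & heat F z l) ->
  (forall z, past z1 z -> v z <= 0 -> F z <= 0) ->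
  exists z, [/\ past z1 z, A z, 0 < F z & `|z.1 - z1.1| = 2^-1 \/ z.2 = z1.2 - 4^-1].
Proof.
move=> p x1 t1 t1' A1 F1 cF hF bF.
pose S := past z1 `&` A.
have PB z : past z1 z -> Bx 8 z /\ inb 1 z.
  move=> [a /andP[b c]]; have := ler_normD (z.1 - z1.1) z1.1; rewrite subrK => h.
  have h8 : (8 : R) ^+ 2 = 64 by ring.
  split; first by split; [fast_lra|rewrite h8; fast_lra].
  by split; [fast_lra|rewrite ler_norml; fast_lra].
have P1 : past z1 z1 by split; [rewrite subrr normr0|lra].
have SS : S `<=` past z1 by move=> z [].
have cS : compact (closure S).
  apply: (subclosed_compact (@closed_closure _ S) (@compact_inb R n 1)).
  by move=> z /(closure_past SS)/PB[].
have Sn : closure S !=set0 by exists z1; apply: subset_closure.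
have cFS : {within closure S, continuous F}.
  apply: continuous_in_subspaceT => z /set_mem/(closure_past SS) zP.
  exact/ccont_continuous/cF.
have [z zS zmax] := compact_EVT_max Sn cS cFS.
move/set_mem: zS => zS; have zP := closure_past SS zS.
have maxS w : S w -> F w <= F z by move=> Sw; apply: zmax; apply/mem_set/subset_closure.
have Fz : 0 < F z by apply: lt_le_trans F1 _; apply: maxS.
have Az : A z.
  apply: contrapT => nA; have : v z <= 0.
    apply: (prob_bd p) => //; first exact: (PB _ zP).1.
    move=> d d0; have [w [[wP wA] wz]] := closure_eps zS d0.
    by exists w; split=> //; exact: (PB _ wP).1.
  by move=> /(bF _ zP); rewrite leNgt Fz.
exists z; split=> //; apply: contrapT => /not_orP[nl nb].
have [zx /andP[zt zt']] := zP.
have {}zx : `|z.1 - z1.1| < 2^-1 by rewrite lt_neqAle zx andbT; apply/eqP.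
have {}zt : z1.2 - 4^-1 < z.2 by rewrite lt_neqAle zt andbT eq_sym; apply/eqP.
have [l l0 [C [r0 [C0 r00 H]]]] := hF _ zP Az.
have [d d0 Hd] := prob_open p (PB _ zP).1 Az.
pose m := Num.min (Num.min (Num.min d (2^-1 - `|z.1 - z1.1|)) (z.2 - (z1.2 - 4^-1))) 1.
have m0 : 0 < m by rewrite !lt_min d0 !subr_gt0 zx zt ltr01.
have [[[md mx] mt] m1] : ((m <= d /\ m <= 2^-1 - `|z.1 - z1.1|) /\ m <= z.2 - (z1.2 - 4^-1)) /\ m <= 1.
  by rewrite /m !ge_min !lexx !orbT.
(* [q <= m / 2] keeps the compared points in the cylinder and in [A]; [C * q <= l / 2] keeps the
   error [C * q^3] below [q^2 * l]. *)
pose q := Num.min (Num.min (m / 2) r0) (l / (2 * (C + 1))).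
have C1 : 0 < C + 1 by rewrite ltr_wpDl.
have q0 : 0 < q by rewrite !lt_min r00 !divr_gt0// mulr_gt0.
have [[qm qr] ql] : (q <= m / 2 /\ q <= r0) /\ q <= l / (2 * (C + 1)) by rewrite /q !ge_min !lexx !orbT.
clearbody q m.
have q2 : q ^+ 2 <= q by rewrite expr2 ler_piMr ?(ltW q0)//; clear -qm m1 m0; lra.
have q20 : 0 < q ^+ 2 by rewrite exprn_gt0.
have nxd (k : 'I_n) : `|delta_mx ord0 k : 'rV[R]_n| <= 1.
  apply/rV_norm_leP => // l'.
  by rewrite mxE; case: (_ && _); rewrite ?normr1 ?normr0.
have Fx (s : R) i : `|s| = q -> F (z + s *: xdir i) <= F z.
  move=> sq; have sx : `|s *: delta_mx ord0 i : 'rV[R]_n| <= q.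
    by rewrite normrZ sq ler_piMr// ltW.
  apply: maxS; split.
    split; rewrite /= ?scaler0 ?addr0; last by rewrite (ltW zt).
    by rewrite addrAC; apply: le_trans (ler_normD _ _) _; clear -sx qm mx m0; lra.
  apply: Hd; rewrite addrC addKr normV /= scaler0 normr0 gt_max d0 andbT; clear -sx qm md m0; lra.
have Ft : F (z - q ^+ 2 *: tdir) <= F z.
  apply: maxS; split.
    split => /=; first by rewrite scaler0 subr0 ltW.
    by rewrite /GRing.scale /= mulr1; clear -zt zt' q2 q20 qm mt m0; apply/andP; split; lra.
  apply: Hd; rewrite addrC addKr normrN normV /= scaler0 normr0 /GRing.scale /= mulr1 gt_max d0/= ger0_norm; clear -q2 q20 qm md m0; lra.
have dle : dheat F z q <= 0.
  rewrite /dheat; apply: (@le_trans _ _ (0 + 0)); last by rewrite addr0.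
  apply: lerD; last by rewrite subr_le0.
  apply: sumr_le0 => i _.
  have := Fx q i (gtr0_norm q0); have := Fx (- q) i; rewrite normrN (gtr0_norm q0) scaleNr => /(_ erefl); clear; lra.
have := H q q0 qr; rewrite ler_norml => /andP[h _].
have : C * q <= l / 2.
  move: ql; rewrite ler_pdivlMr ?mulr_gt0//; clear -q0 C0; nra.
have E : C * q ^+ 3 = q ^+ 2 * (C * q) by ring.
move: h; rewrite E => h /(ler_wpM2l (ltW q20)) h'.
have : 0 < q ^+ 2 * l by rewrite mulr_gt0.
fast_lra.
Qed.

End heat.

(** * The solution where the right-hand side is constant *)

Section local_structure.
Context {R : realType} {n : nat}.
Local Notation V := ('rV[R]_n * R)%type.

(** The increment is moved onto the kernel and expanded there, so [v] need only be bounded and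
    measurable. *)
Lemma cv_diff (k v : V -> R) z : ker k -> bm v ->
  differentiable (cv k v) z /\ forall h, 'D_h (cv k v) z = - cv ('D_h k) v z.
Proof.
move=> kk bv; have Ck := ker_Cc kk; have nk := Cc_nice Ck; have [Sk _] := Ck.
have [C C0 HC] := V_taylor Ck; have [C2 C20 HC2] := itD_bound 2 Ck.
have [C1' C10 HC1] := itD_bound 1 Ck.
have [mv [M HM]] := bv; have M0 : 0 <= M by exact: le_trans (HM 0).
have bs := bm_shift z bv.
have nD h : nice ('D_h k) by apply/Cc_nice/Cc_D.
have nvD h := nice_mul bs (nD h).
pose B := M * (2 * 5) ^+ n.+1.
have B0 : 0 <= B by rewrite mulr_ge0// exprn_ge0.
have kr (w : V) : k w != 0 -> inb 3 w by move=> /kk.2/KB_inb.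
have e5 : 3 + 1 <= 5 :> R by lra.
have sup5 (q : V -> R) c : nice q -> (forall y, `|q y| <= c) -> (forall y, q y != 0 -> inb 5 y) ->
    `|I (fun y => v (y + z) * q y)| <= c * B.
  move=> nq qc q5; have c0 : 0 <= c by exact: le_trans (qc 0).
  have -> : c * B = M * c * (2 * 5) ^+ n.+1 by rewrite /B; ring.
  apply: I_bound => //.
  - by case: (nice_mul bs nq).
  - by move=> y; rewrite normrM ler_pM.
  - by move=> y; rewrite mulf_eq0 negb_or => /andP[_ /q5].
apply: (@eps_diff _ _ (cv k v) (fun h => - cv ('D_h k) v z) z (C1' * B)).
- move=> a h h'; rewrite /cv.
  have -> : (fun y => v (y + z) * 'D_(a *: h + h') k y) =
      fun y => a * (v (y + z) * 'D_h k y) + v (y + z) * 'D_h' k y.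
    apply/funext => y; have dk := Sm_diff y Sk.
    by rewrite !(deriveE _ dk) linearD linearZ /= /GRing.scale /=; ring.
  have key (x y : R) : - (a * x + y) = a * - x + - y by ring.
  rewrite (I_D (niceZ a (nvD h)) (nvD h')) (I_Z a (nvD h)); exact: key.
- move=> h; rewrite normrN /cv.
  have -> : C1' * B * `|h| = C1' * `|h| * B by ring.
  apply: sup5 => [||y /(csupp_D kr)].
  + exact: nD.
  + by move=> y; have := HC1 h y; rewrite expr1.
  + by apply: inbW; lra.
move=> e e0; pose D := (C + C2) * B + 1.
have D0 : 0 < D by rewrite /D ltr_wpDl// mulr_ge0// addr_ge0.
exists (Num.min 1 (e / D)); first by rewrite lt_min ltr01 divr_gt0.
move=> h; rewrite lt_min => /andP[h1 hD].
have nks (g : V) : nice (fun y => k (y + g)) by exact: nice_shift.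
have cvh : cv k v (z + h) = I (fun y => v (y + z) * k (y - h)).
  rewrite cvE// -(@I_shiftE _ _ (fun y => v y * k (y - (z + h))) z); last first.
    by apply: nice_mul => //; exact: nice_shift.
  by congr I; apply/funext => y; rewrite opprD addrA addrK.
have n1 := nice_mul bs (nks (- h)); have n0 := nice_mul bs nk.
have nq : nice (fun y => k (y - h) - k y + 'D_h k y) by apply: niceD => //; apply: niceB => //; exact: nks.
have -> : cv k v (z + h) - cv k v z - - cv ('D_h k) v z = I (fun y => v (y + z) * (k (y - h) - k y + 'D_h k y)).
  rewrite cvh /cv opprK -(I_B n1 n0) -(I_D (niceB n1 n0) (nvD h)).
  by congr I; apply/funext => y; ring.
apply: (@le_trans _ _ ((C + C2) * `|h| ^+ 2 * B)).
  apply: sup5 => // y.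
    have := HC y (- h); have := HC2 (- h) y; rewrite normrN /itD /= => a b.
    have -> : k (y - h) - k y + 'D_h k y = (k (y - h) - k y - 'D_(- h) k y - 2^-1 * 'D_(- h) ('D_(- h) k) y)
      + 2^-1 * 'D_(- h) ('D_(- h) k) y.
      have -> : 'D_(- h) k y = - 'D_h k y by have dk := Sm_diff y Sk; rewrite !deriveE// linearN.
      by move: ('D__ _ _) ('D__ _ _) => p q; ring.
    apply: le_trans (ler_normD _ _) _; rewrite normrM gtr0_norm//.
    have : `|h| ^+ 3 <= `|h| ^+ 2 by rewrite exprS ler_piMl ?sqr_ge0// ltW.
    move=> h3; have := ler_wpM2l C0 h3; have := normr_ge0 ('D_(- h) ('D_(- h) k) y); fast_lra.
  move=> q0; apply: contrapT => yb; move/eqP: q0; apply.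
  have y3 : ~ inb 3 y by apply: contra_not yb; apply: inbW; fast_lra.
  have k0 (f : V -> R) : (forall z : V, f z != 0 -> inb 3 z) -> f y = 0.
    by move=> H; apply/eqP; apply: contrapT => /negP/H.
  rewrite (k0 k kr) (k0 ('D_h k)); last exact: csupp_D kr.
  rewrite subr0 addr0; apply/eqP; apply: contrapT => /negP/kr[a b]; apply: yb.
  have i1 := le_trans (normV1 h) (ltW h1); have i2 := le_trans (normV2 h) (ltW h1); split.
    have := ler_normD (y - h).1 h.1; rewrite /= subrK => /le_trans; apply; exact: le_trans (lerD a i1) e5.
  have := ler_normD (y - h).2 h.2; rewrite /= subrK => /le_trans; apply; exact: le_trans (lerD b i2) e5.
have -> : (C + C2) * `|h| ^+ 2 * B = (C + C2) * B * `|h| * `|h| by ring.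
rewrite ler_wpM2r//; move: hD; rewrite ltr_pdivlMr// => hD.
have := normr_ge0 h; rewrite /D in hD *; nra.
Qed.

Lemma differentiable_ccont (F : V -> R) z : differentiable F z -> ccont F z.
Proof.
move=> /differentiable_continuous cF e e0; have [d d0 Hd] := cont_eps cF e0.
by exists d => // h /Hd/ltW.
Qed.

Lemma ccont_lin (F G : V -> R) a b z : ccont F z -> ccont G z -> ccont (fun y => a * F y + b * G y) z.
Proof.
move=> cF cG e e0; have a0 : 0 < `|a| + `|b| + 1 by rewrite ltr_wpDl// addr_ge0.
have e1 : 0 < e / (`|a| + `|b| + 1) by rewrite divr_gt0.
have [d d0 Hd] := cF _ e1; have [d' d'0 Hd'] := cG _ e1.
exists (Num.min d d'); first by rewrite lt_min d0.
move=> h; rewrite lt_min => /andP[/Hd h1 /Hd' h2].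
have -> : a * F (z + h) + b * G (z + h) - (a * F z + b * G z) = a * (F (z + h) - F z) + b * (G (z + h) - G z) by ring.
apply: le_trans (ler_normD _ _) _; rewrite !normrM.
set e' := e / _ in e1 h1 h2 *.
have E : e = e' * (`|a| + `|b| + 1) by rewrite /e' divfK// gt_eqF.
rewrite E; have := ler_wpM2l (normr_ge0 a) h1; have := ler_wpM2l (normr_ge0 b) h2; fast_lra.
Qed.

Lemma ccont_cst c (z : V) : ccont (fun=> c) z.
Proof. by move=> e e0; exists 1 => // h _; rewrite subrr normr0 ltW. Qed.

Lemma ccont_parab (z1 z : V) : ccont (parab z1) z.
Proof.
apply: differentiable_ccont; apply: Sm_diff.
have -> : parab z1 = fun z => \sum_i (z.1 ord0 i - z1.1 ord0 i) * (z.1 ord0 i - z1.1 ord0 i) + (z1.2 - z.2).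
  by apply/funext => y; rewrite /parab /rho; congr (_ + _); apply: eq_bigr => i _; rewrite /= !mxE expr2.
apply: Sm_D; last by apply: Sm_B; [exact: Sm_cst|exact: Sm_tm].
by apply: Sm_sum => i; apply: Sm_M; apply: Sm_B; [exact: Sm_co|exact: Sm_cst|exact: Sm_co|exact: Sm_cst].
Qed.

(** Turns an integral at a rescaled point into one at the original scale, where the sign conditions
    and the statements almost everywhere are available. *)
Lemma pullback r p (k : V -> R) : 0 < r -> nice k -> exists k' : V -> R,
  [/\ nice k', forall t, k' (affV r (r ^+ 2) p t) = k t,
   forall z, k' z != 0 -> exists2 t, k t != 0 & z = affV r (r ^+ 2) p t &
   forall F : V -> R, bm F -> I (fun t => F (affV r (r ^+ 2) p t) * k t) = r^-1 ^+ n * r ^- 2 * I (fun z => F z * k' z)].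
Proof.
move=> r0 nk; have rn : r != 0 by rewrite gt_eqF. have r2n : r ^+ 2 != 0 by rewrite expf_neq0.
pose q : V := (- (r^-1 *: p.1), - (r ^- 2 * p.2)).
have rin : r^-1 != 0 by rewrite invr_eq0. have r2in : r ^- 2 != 0 by rewrite invr_eq0.
have K1 t : affV r^-1 (r ^- 2) q (affV r (r ^+ 2) p t) = t.
  rewrite [RHS]surjective_pairing; apply: (congr2 pair); rewrite /=.
    by rewrite scalerDr scalerA mulVf// scale1r addrK.
  by rewrite mulrDr mulrA mulVf// mul1r addrK.
have K2 z : affV r (r ^+ 2) p (affV r^-1 (r ^- 2) q z) = z.
  rewrite [RHS]surjective_pairing; apply: (congr2 pair); rewrite /=.
    by rewrite scalerDr scalerN !scalerA mulfV// !scale1r subrK.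
  by rewrite mulrDr mulrN !mulrA mulfV// !mul1r subrK.
have nk' : nice (fun z => k (affV r^-1 (r ^- 2) q z)) by exact: nice_affV.
exists (fun z => k (affV r^-1 (r ^- 2) q z)); split=> //.
- by move=> t; rewrite K1.
- by move=> z kz; exists (affV r^-1 (r ^- 2) q z).
move=> F bF; have r20 : 0 < r ^+ 2 by rewrite exprn_gt0.
have := I_affV p rn r2n (nice_mul bF nk'); rewrite (gtr0_norm r0) (gtr0_norm r20) => <-.
by congr I; apply/funext => t; rewrite K1.
Qed.

(** Says weakly that [g = c] almost everywhere in [Bx 8]. *)
Definition constg (g : V -> R) (c : R) := forall k, nice k -> (forall z, ~ Bx 8 z -> k z = 0) ->
  I (fun z => g z * k z) = c * I k.

(** All terms of [rep] equal [c * I psi] up to their factor [4^-j], so the potential is a constant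
    and [w] is the smooth function [cv kap w] minus a constant. The classical derivatives come from
    here. *)
Lemma loc w g c y : wsol (Bx 8) w g -> constg g c -> lcont w y -> `|y.1| <= 2 -> -4 <= y.2 -> y.2 <= 0 ->
  w y = cv kap w y - 4 / 3 * c * I (@psi R n).
Proof.
move=> W gc ly y1 y2 y3; have [_ mg g1 _] := W.
have bg : bm g by split=> //; exists 1.
have x j : I (fun t => g (affV (rj j) (rj j ^+ 2) y t) * psi t) = c * I (@psi R n).
  have [k' [nk' k'1 k'2 k'I]] := pullback y (rj_gt0 j) (@nice_psi R n).
  rewrite (k'I _ bg) gc//; last first.
    move=> z zB; apply/eqP; apply: contrapT => /negP/k'2[t /(ker_psi).2 tK ze]; apply: zB.
    rewrite ze; apply: KB4_shift => //; [exact: rj_gt0|exact: rj_le1|].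
    by have [a b d] := KB_KB4 tK; split=> //; rewrite b d.
  have := k'I (fun=> 1) (bm_cst 1).
  have -> : (fun t : V => 1 * psi t) = psi by apply/funext => t; rewrite mul1r.
  have -> : (fun t : V => 1 * k' t) = k' by apply/funext => t; rewrite mul1r.
  by move=> ->; ring.
suff H e : 0 < e -> `|w y - (cv kap w y - 4 / 3 * c * I (@psi R n))| <= e.
  apply/eqP; rewrite -subr_eq0 -normr_le0; apply/ler_addgt0Pr => e /H; by rewrite add0r.
move=> e0; have e2 : 0 < e / 2 by rewrite divr_gt0.
have [N0 HN] := rep W ly (fun r z r0 r1 Kz => KB4_shift y1 y2 y3 r0 r1 Kz) e2.
have q0 : 0 < 4 / 3 * `|c * I (@psi R n)| + 1 by rewrite ltr_wpDl// mulr_ge0.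
have [N1 HN1] := rj_small (e := e / 2 / (4 / 3 * `|c * I (@psi R n)| + 1)) ltac:(by rewrite divr_gt0).
pose N := maxn N0 N1; have := HN N (leq_maxl _ _).
under eq_bigr do rewrite x.
rewrite -mulr_suml geo4.
have := HN1 N (leq_maxr _ _); rewrite ler_pdivlMr// => hr.
have h4 : 4^-1 ^+ N <= rj N :> R by rewrite -rj_sqr expr2 ler_piMr ?rj_le1// ltW// rj_gt0.
have h40 : 0 <= 4^-1 ^+ N :> R by rewrite exprn_ge0.
set cp := c * I psi in q0 hr *; move=> h.
have -> : w y - (cv kap w y - 4 / 3 * c * I (@psi R n)) = - (cv kap w y - 4 / 3 * (1 - 4^-1 ^+ N) * cp - w y)
   + 4 / 3 * 4^-1 ^+ N * cp by rewrite /cp; ring.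
apply: le_trans (ler_normD _ _) _; rewrite normrN.
have : `|4 / 3 * 4^-1 ^+ N * cp| <= e / 2.
  have p0 : 0 <= 4 / 3 * 4^-1 ^+ N :> R by rewrite mulr_ge0.
  rewrite normrM (ger0_norm p0).
  have := ler_wpM2r (normr_ge0 cp) h4; have := rj_gt0 (R := R) N; fast_lra.
fast_lra.
Qed.

Lemma lcont_zm r p (v : V -> R) t : 0 < r -> r <= 1 -> lcont v (affV r (r ^+ 2) p t) -> lcont (zm r p v) t.
Proof.
move=> r0 r1 lv e e0; have r20 : 0 < r ^+ 2 by rewrite exprn_gt0.
have r21 : r ^+ 2 <= r by rewrite expr2 ler_piMr// ltW.
have er : 0 < r ^+ 2 * e by rewrite mulr_gt0.
have [d d0 Hd] := lv _ er; exists d => // h hd h2.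
rewrite /zm -mulrBr normrM [`|_ ^- 2|]gtr0_norm ?invr_gt0// ler_pdivrMl//.
have -> : affV r (r ^+ 2) p (t + h) = affV r (r ^+ 2) p t + (r *: h.1, r ^+ 2 * h.2).
  by apply: (congr2 pair); rewrite /= ?scalerDr ?mulrDr addrAC.
apply: Hd; last by rewrite /= pmulr_rlt0.
apply: le_lt_trans hd; rewrite normV ge_max /= normrZ normrM (gtr0_norm r0) (gtr0_norm r20).
have := normV1 h; have := normV2 h; have := normr_ge0 h.1; have := normr_ge0 h.2.
move=> a b x y; apply/andP; split; nra.
Qed.

Lemma Bx_open r (z : V) : Bx r z -> exists2 d, 0 < d & forall w, `|w - z| < d -> Bx r w.
Proof.
move=> [z1 /andP[z2 z3]]; pose d := Num.min (r - `|z.1|) (Num.min (z.2 + r ^+ 2) (- z.2)).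
exists d; first by rewrite !lt_min subr_gt0 z1 oppr_gt0 z3; lra.
move=> w; rewrite !lt_min => /and3P[w1 w2 w3].
have := ler_normD (w.1 - z.1) z.1; rewrite subrK => a.
have b := normV1 (w - z); have := normV2 (w - z); rewrite /= => c.
have := ler_norm (w.2 - z.2); have := ler_norm (- (w.2 - z.2)); rewrite normrN => e f.
by split; [move: b => /= b; fast_lra|fast_lra].
Qed.

Lemma zoom_in (z : V) r d t : 0 < r -> r <= 1 -> r <= d / 128 -> `|t.1| <= 8 -> `|t.2| <= 64 ->
  `|affV r (r ^+ 2) z t - z| < d.
Proof.
move=> r0 r1 rd t1 t2.
have r20 : 0 < r ^+ 2 by rewrite exprn_gt0.
have r21 : r ^+ 2 <= r by rewrite expr2 ler_piMr// ltW.
rewrite (_ : affV r (r ^+ 2) z t - z = (r *: t.1, r ^+ 2 * t.2)); last first.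
  by apply: (congr2 pair); rewrite /= addrK.
rewrite normV gt_max /= normrZ normrM (gtr0_norm r0) (gtr0_norm r20).
have := normr_ge0 t.1 => t0; have := normr_ge0 t.2 => t0'; apply/andP; split; nra.
Qed.

Lemma heat_zm r z (v : V -> R) l : 0 < r -> heat (zm r z v) 0 l -> heat v z l.
Proof.
move=> r0 [C [r1 [C0 r10 H]]]; have rn : r != 0 by rewrite gt_eqF.
exists (C / r), (r * r1); split=> //; [by rewrite divr_ge0// ltW|by rewrite mulr_gt0|].
move=> q q0 qr; pose p := q / r; have p0 : 0 < p by rewrite divr_gt0.
have qE : q = r * p by rewrite /p mulrCA mulfV// mulr1.
have pr : p <= r1 by rewrite /p ler_pdivrMr// mulrC.
have E : dheat v z q = r ^+ 2 * dheat (zm r z v) 0 p.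
  have r2n : r ^+ 2 != 0 by rewrite expf_neq0.
  have zE h : v (z + (r *: h.1, r ^+ 2 * h.2)) = r ^+ 2 * zm r z v h.
    by rewrite /zm mulrA mulfV// mul1r /affV; congr v; apply: (congr2 pair); rewrite /= addrC.
  have z0 : v z = r ^+ 2 * zm r z v 0.
    by rewrite -zE; congr v; rewrite [LHS]surjective_pairing; apply: (congr2 pair); rewrite /= ?scaler0 ?mulr0 addr0.
  have zx (s : R) i : v (z + (r * s) *: xdir i) = r ^+ 2 * zm r z v (0 + s *: xdir i).
    by rewrite -zE add0r; congr v; apply: (congr2 pair); rewrite /= ?scaler0 ?mulr0 ?scalerA.
  have zt : v (z - q ^+ 2 *: tdir) = r ^+ 2 * zm r z v (0 - p ^+ 2 *: tdir).
    rewrite -zE add0r qE; congr v; apply: (congr2 pair); rewrite /= ?scaler0 ?oppr0 ?scaler0//.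
    by rewrite /GRing.scale /=; ring.
  rewrite /dheat zt z0 mulrDr mulrBr mulr_sumr; congr (_ + _); apply: eq_bigr => i _.
  have := zx p i; have := zx (- p) i; rewrite mulrN !scaleNr -qE => -> ->.
  by move: (zm r z v _) (zm r z v _) (zm r z v 0) => a b c; ring.
rewrite E qE.
have -> : r ^+ 2 * dheat (zm r z v) 0 p - (r * p) ^+ 2 * l = r ^+ 2 * (dheat (zm r z v) 0 p - p ^+ 2 * l) by ring.
rewrite normrM ger0_norm ?sqr_ge0//.
have -> : C / r * (r * p) ^+ 3 = r ^+ 2 * (C * p ^+ 3) by field.
by rewrite ler_wpM2l ?sqr_ge0//; exact: H.
Qed.

Lemma loc_heat w g c : wsol (Bx 8) w g ->
  (forall y, `|y.1| <= 2 -> -4 <= y.2 -> y.2 <= 0 -> lcont w y) -> constg g c -> heat w 0 c.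
Proof.
move=> W lw gc; have [bw _ _ _] := W.
apply: (@heat_eq _ _ _ (fun y => 1 * cv kap w y + 1 * (- (4 / 3 * c * I (@psi R n)))) 0 1) => //.
  move=> h h1 h2; rewrite add0r !mul1r.
  have a := normV1 h; have := le_lt_trans (normV2 h) h1; rewrite ltr_norml => /andP[b _].
  by apply: (loc W gc) => //; try apply: lw; fast_lra.
have supp : forall z : V, ~ Bx 8 z -> kap z = 0.
  by move=> z zB; apply/eqP; apply: contrapT => /negP/(ker_kap).2/KB_Bx8.
have := heat_lin 1 1 (heat_cv 0 (@ker_kap R n) bw) (heat_cst (- (4 / 3 * c * I (@psi R n))) 0).
rewrite mulr0 addr0 mul1r (wsol1 (p := 0) W (@ker_kap R n)); last first.
  by move=> z /KB4_Bx; rewrite addr0.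
have -> : (fun z => g (z + 0) * kap z) = fun z => g z * kap z by apply/funext => z; rewrite addr0.
by rewrite (gc _ (@nice_kap R n) supp) I_kap mulr1 mul1r.
Qed.

Lemma constg_in (v f : V -> R) A z r : prob v f A -> 0 < r ->
  (forall t, Bx 8 t -> Bx 8 (affV r (r ^+ 2) z t) /\ A (affV r (r ^+ 2) z t)) ->
  constg (fun t => 2 * f (affV r (r ^+ 2) z t) - 1) 1.
Proof.
move=> p r0 H k nk k0; have mf := prob_mf p; have f01 := prob_f p; have bf := bm01 mf f01.
have [k' [nk' k'1 k'2 k'I]] := pullback z r0 nk.
have b1f : bm (fun z => 1 - f z).
  have := bmD (bm_cst 1) (bmM (bm_cst (-1)) bf); congr bm; apply/funext => y; ring.
have supp y : k' y != 0 -> Bx 8 y /\ A y.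
  by move=> /k'2[t kt ->]; apply: H; apply: contrapT => /k0/eqP; rewrite (negbTE kt).
have Z : I (fun y => (1 - f y) * k' y) = 0.
  apply/le_anti/andP; split.
    rewrite -oppr_ge0 -(I_N (nice_mul b1f nk')).
    have := prob_out p (niceN nk'); rewrite (_ : (fun y => (1 - f y) * - k' y) = fun y => - ((1 - f y) * k' y)).
      apply=> y yB; first by apply/eqP; rewrite oppr_eq0; apply: contrapT => /negP/supp[].
      by move=> nA; have [->|/supp[]//] := eqVneq (k' y) 0; rewrite oppr0.
    by apply/funext => y; rewrite mulrN.
  apply: (prob_out p nk') => y yB; first by apply/eqP; apply: contrapT => /negP/supp[].
  by move=> nA; have [->|/supp[]//] := eqVneq (k' y) 0.
have := k'I _ b1f; rewrite Z mulr0 => Z'.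
have ba := bm_affV r (r ^+ 2) z b1f.
have -> : (fun t => (2 * f (affV r (r ^+ 2) z t) - 1) * k t) =
   fun t => k t - 2 * ((1 - f (affV r (r ^+ 2) z t)) * k t).
  by apply/funext => t; ring.
by rewrite (I_B nk (niceZ 2 (nice_mul ba nk))) (I_Z 2 (nice_mul ba nk)) Z' mulr0 subr0 mul1r.
Qed.

(** After a zoom so strong that [Bx 8] is carried into the open set [A], the right-hand side is 1
    almost everywhere, and [loc] gives the expansion. *)
Lemma heat_on (v f : V -> R) A z : prob v f A -> Bx 8 z -> A z -> heat v z 1.
Proof.
move=> p zB Az; have [d d0 Hd] := prob_open p zB Az; have [d' d'0 Hd'] := Bx_open zB.
pose e := Num.min d d'; have e0 : 0 < e by rewrite lt_min d0.
have [ed ed'] : e <= d /\ e <= d' by rewrite /e !ge_min !lexx orbT.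
pose r := Num.min 1 (e / 128); have r0 : 0 < r by rewrite lt_min ltr01 divr_gt0.
have [r1 re] : r <= 1 /\ r <= e / 128 by rewrite /r !ge_min !lexx orbT.
have inside t : `|t.1| <= 8 -> `|t.2| <= 64 -> Bx 8 (affV r (r ^+ 2) z t) /\ A (affV r (r ^+ 2) z t).
  move=> t1 t2; have h := zoom_in z r0 r1 re t1 t2.
  by split; [apply: Hd'; exact: lt_le_trans ed'|apply: Hd; exact: lt_le_trans ed].
have h8 : (8 : R) ^+ 2 = 64 by ring.
have inB t : Bx 8 t -> Bx 8 (affV r (r ^+ 2) z t) /\ A (affV r (r ^+ 2) z t).
  move=> [t1 /andP[t2 t3]]; rewrite h8 in t2.
  by apply: inside; [exact: ltW|rewrite ltr0_norm//; fast_lra].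
apply: (heat_zm r0); apply: (@loc_heat _ (fun t => 2 * f (affV r (r ^+ 2) z t) - 1)).
- have := wsol_zm z r0 (prob_wsol p); apply: wsolW => t tB; exact: (inB t tB).1.
- move=> y y1 y2 y3; apply: lcont_zm => //; have [yB _] := inside y ltac:(fast_lra) ltac:(by rewrite ler_norml; fast_lra).
  by have [_] := prob_base p; apply.
- exact: (constg_in p r0 inB).
Qed.

End local_structure.

(** * Nondegeneracy, and decay where the phase is thin *)

Section barriers.
Context {R : realType} {n : nat}.
Local Notation V := ('rV[R]_n * R)%type.
Local Notation mV := ('rV[R]_n * measurableTypeR R)%type.

Lemma past_inb1 (z1 z : V) : `|z1.1| < 2^-1 -> - 4^-1 < z1.2 -> z1.2 < 0 -> past z1 z -> Bx 1 z.
Proof.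
move=> x1 t1 t1' [a /andP[b c]]; have := ler_normD (z.1 - z1.1) z1.1; rewrite subrK => h.
by split; [fast_lra|rewrite expr1n; apply/andP; split; fast_lra].
Qed.

Lemma Bx1_8 (z : V) : Bx 1 z -> Bx 8 z.
Proof.
rewrite /Bx /= expr1n (_ : 8 ^+ 2 = 64 :> R); last by ring.
by move=> [a /andP[b c]]; split; [lra|apply/andP; split; lra].
Qed.

Lemma Bx1_bounds (z : V) : Bx 1 z -> [/\ `|z.1| <= 2, -4 <= z.2 & z.2 <= 0].
Proof. by rewrite /Bx /= expr1n => -[a /andP[b c]]; split; lra. Qed.

Lemma parab_ge0 (z1 z : V) : past z1 z -> 0 <= parab z1 z.
Proof. by move=> [_ /andP[_ h]]; rewrite addr_ge0 ?rho_ge0// subr_ge0. Qed.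

Lemma parab_edge (z1 z : V) : past z1 z -> `|z.1 - z1.1| = 2^-1 \/ z.2 = z1.2 - 4^-1 ->
  4^-1 <= parab z1 z.
Proof.
move=> [_ /andP[_ h]] [e|e]; rewrite /parab.
  have := norm_le_rho (z - z1); rewrite /= e (_ : 2^-1 ^+ 2 = 4^-1); [lra|by field].
by have := rho_ge0 (z - z1); lra.
Qed.

Lemma parab_self (z : V) : parab z z = 0.
Proof. by rewrite /parab subrr subrr addr0 /rho big1// => i _; rewrite /= !mxE expr0n. Qed.

(** A quarter, the value of the barrier on the parabolic boundary, times the coefficient
    [1 / (2 (2 n + 1))] that leaves heat 1/2. *)
Definition cnd : R := (8 * (2 * n%:R + 1))^-1.
Lemma cnd_gt0 : 0 < cnd.
Proof. by rewrite invr_gt0 mulr_gt0// ltr_wpDl// mulr_ge0. Qed.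

(** Started at a point [z1] of [A] near the origin, [v] minus the barrier is positive at [z1] and
    has heat 1/2 on [A]; its maximum lies on the parabolic boundary, where [v] exceeds the
    barrier. *)
Lemma nondegenerate (v f : V -> R) A : prob v f A -> exists z, [/\ Bx 1 z, A z & cnd < v z].
Proof.
move=> p; have [z1 [[x1 /andP[t1 t1']] A1]] := prob_near p (ltac:(by []) : 0 < 2^-1 :> R).
rewrite (_ : 2^-1 ^+ 2 = 4^-1) in t1; last by field.
have N0 : 0 < 2 * n%:R + 1 :> R by rewrite ltr_wpDl// mulr_ge0.
pose c : R := (2 * (2 * n%:R + 1))^-1; have c0 : 0 < c by rewrite invr_gt0 mulr_gt0.
have cN : c * (2 * n%:R + 1) = 2^-1 by rewrite /c; field; rewrite gt_eqF.
have cE : cnd = c * 4^-1 by rewrite /cnd /c; field; rewrite gt_eqF.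
pose F (z : V) := 1 * v z + (- c) * parab z1 z.
have PB := past_inb1 x1 t1 t1'.
have [z [zP zA Fz zl]] : exists z, [/\ past z1 z, A z, 0 < F z & `|z.1 - z1.1| = 2^-1 \/ z.2 = z1.2 - 4^-1].
  apply: (max_principle p) => //.
  - rewrite /F parab_self mulr0 addr0 mul1r; apply: (prob_pos p) => //.
    by apply/Bx1_8/PB; split; [rewrite subrr normr0|lra].
  - by move=> z /PB/Bx1_8 zB; apply: ccont_lin; [exact: (prob_cont p)|exact: ccont_parab].
  - move=> z /PB/Bx1_8 zB zA; exists (1 * 1 + (- c) * (2 * n%:R + 1)); first by rewrite mulNr cN; lra.
    by apply: heat_lin; [exact: (heat_on p)|exact: heat_parab].
  - by move=> z /parab_ge0 zP vz; rewrite /F mul1r; have := mulr_ge0 (ltW c0) zP; lra.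
exists z; split=> //; first exact: PB.
have := ler_wpM2l (ltW c0) (parab_edge zP zl); move: Fz; rewrite /F cE mul1r; fast_lra.
Qed.

Lemma ccont_Wf (v f : V -> R) A z : prob v f A -> Bx 8 z -> ccont (Wf v) z.
Proof.
move=> p zB; have [bv _ _ _] := prob_wsol p.
have -> : Wf v = fun y => 1 * (2^-1 * (4 / 3 * I (@psi R n))) + 2^-1 * (1 * cv kap v y + (-1) * v y).
  by apply/funext => y; rewrite /Wf; ring.
apply: (@ccont_lin _ _ (fun=> _)); first exact: ccont_cst.
apply: ccont_lin; last exact: (prob_cont p).
exact/differentiable_ccont/(cv_diff z (@ker_kap R n) bv).1.
Qed.

(** So [Wf v] is a strict supersolution on [A] wherever the average of [f] is at most 1/2. *)
Lemma heat_Wf (v f : V -> R) A z : prob v f A -> Bx 1 z -> A z ->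
  heat (Wf v) z (I (fun y => f (y + z) * kap y) - 1).
Proof.
move=> p zB zA; have W := prob_wsol p; have [bv _ _ _] := W.
have -> : Wf v = fun y => 1 * (2^-1 * (4 / 3 * I (@psi R n))) + 2^-1 * (1 * cv kap v y + (-1) * v y).
  by apply/funext => y; rewrite /Wf; ring.
have bf := bm_shift z (bm01 (prob_mf p) (prob_f p)).
have E : I (fun y => v (y + z) * Hs kap y) = 2 * I (fun y => f (y + z) * kap y) - 1.
  rewrite (wsol1 W (@ker_kap R n)); last first.
    by have [a b c] := Bx1_bounds zB; move=> y; apply: KB4_shift1.
  have nf := nice_mul bf (@nice_kap R n).
  have E1 : I (fun y => (2 * f (y + z) - 1) * kap y) = 2 * I (fun y => f (y + z) * kap y) - I (@kap R n).
    rewrite -(I_Z 2 nf) -(I_B (niceZ 2 nf) (@nice_kap R n)).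
    by congr I; apply/funext => y; ring.
  by rewrite E1 I_kap.
have := heat_lin 1 2^-1 (heat_cst (2^-1 * (4 / 3 * I (@psi R n))) z)
  (heat_lin 1 (-1) (heat_cv z (@ker_kap R n) bv) (heat_on p (Bx1_8 zB) zA)).
by rewrite E; congr heat; field.
Qed.

(** Half of it compensates the heat [16 (2 n + 1)] of the barrier [16 parab]. *)
Definition Mgr : R := 32 * (2 * n%:R + 1).
Lemma Mgr_gt0 : 0 < Mgr.
Proof. by rewrite mulr_gt0// ltr_wpDl// mulr_ge0. Qed.

(** If the bound failed at [z1], then [v - S (16 parab + Mgr Wf)] would be positive there with heat
    at least 1 on [A]. On the parabolic boundary it is at most [S - 4 S], a contradiction. *)
Lemma growth (v f : V -> R) A S : prob v f A -> 0 < S -> (forall z, Bx 1 z -> A z -> v z <= S) ->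
  (forall z, Bx 1 z -> 0 <= Wf v z) -> (forall z, Bx 1 z -> I (fun y => f (y + z) * kap y) <= 2^-1) ->
  forall z, Bx 2^-1 z -> A z -> v z <= Mgr * Wf v z * S.
Proof.
move=> p S0 vS W0 fk z1 [x1 /andP[t1 t1']] A1.
rewrite (_ : 2^-1 ^+ 2 = 4^-1) in t1; last by field.
rewrite leNgt; apply/negP => hv.
pose F (z : V) := 1 * v z + (- S) * (16 * parab z1 z + Mgr * Wf v z).
have PB := past_inb1 x1 t1 t1'.
have [z [zP zA Fz zl]] : exists z, [/\ past z1 z, A z, 0 < F z & `|z.1 - z1.1| = 2^-1 \/ z.2 = z1.2 - 4^-1].
  apply: (max_principle p) => //.
  - by rewrite /F parab_self mulr0 add0r mul1r; lra.
  - move=> z /PB/Bx1_8 zB; apply: ccont_lin; first exact: (prob_cont p).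
    by apply: ccont_lin; [exact: ccont_parab|exact: (ccont_Wf p)].
  - move=> z /PB zB zA.
    exists (1 * 1 + (- S) * (16 * (2 * n%:R + 1) + Mgr * (I (fun y => f (y + z) * kap y) - 1))).
      have h := fk _ zB; have : Mgr * (I (fun y => f (y + z) * kap y) - 1) <= Mgr * (- 2^-1).
        by rewrite ler_wpM2l ?(ltW Mgr_gt0)//; lra.
      rewrite {2}/Mgr; move: (I _) => q hq.
      have : 16 * (2 * n%:R + 1) + Mgr * (q - 1) <= 0 by lra.
      by move=> /(ler_wpM2l (ltW S0)); rewrite mulr0; lra.
    apply: heat_lin; first exact: (heat_on p (Bx1_8 zB)).
    by apply: heat_lin; [exact: heat_parab|exact: (heat_Wf p)].
  - move=> z zP vz; have h1 := parab_ge0 zP; have h2 := mulr_ge0 (ltW Mgr_gt0) (W0 _ (PB _ zP)).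
    rewrite /F mul1r; have : 0 <= S * (16 * parab z1 z + Mgr * Wf v z) by apply: mulr_ge0; [exact: ltW|apply: addr_ge0 => //; exact: mulr_ge0].
    lra.
have := parab_edge zP zl; have h2 := mulr_ge0 (ltW Mgr_gt0) (W0 _ (PB _ zP)) => h1.
have := vS _ (PB _ zP) zA; move: Fz; rewrite /F mul1r.
have : S * 4 <= S * (16 * parab z1 z + Mgr * Wf v z) by rewrite ler_wpM2l ?(ltW S0)//; lra.
lra.
Qed.

Definition Q4 : set mV := @cube R n 4 `*` `[- 16, 0].
Lemma measurable_Q4 : measurable Q4.
Proof. by apply: measurableX => //; exact: measurable_cube. Qed.
Lemma Q4P (z : V) : `|z.1| <= 4 -> -16 <= z.2 -> z.2 <= 0 -> Q4 z.
Proof. by move=> a b c; split=> /=; [exact/rV_norm_leP|rewrite in_itv/= b c]. Qed.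
Lemma nice_Q4 : nice (\1_Q4 : V -> R).
Proof.
apply: (@nice_indic _ _ _ 16); first exact: measurable_Q4.
move=> z [/= a]; rewrite in_itv/= => /andP[b c]; split; last by rewrite ler_norml; lra.
by apply: (@le_trans _ _ 4); [exact/rV_norm_leP|lra].
Qed.

(** Plain mass in a box containing the supports of all kernels placed at points of [Bx 1] at scales
    up to 1. *)
Definition amt (f : V -> R) : R := I (fun z => f z * \1_Q4 z).

Lemma amt_scaled (f k : V -> R) M z r : bm f -> (forall y, 0 <= f y) -> nice k -> (forall y, k y != 0 -> KB y) ->
  (forall y, `|k y| <= M) -> Bx 1 z -> 0 < r -> r <= 1 ->
  I (fun y => f (affV r (r ^+ 2) z y) * k y) <= r^-1 ^+ n * r ^- 2 * (M * amt f).
Proof.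
move=> bf f0 nk kK kM; rewrite /Bx /= expr1n => -[z1 /andP[z2 z3]] r0 r1.
have rn : r != 0 by rewrite gt_eqF. have r2n : r ^+ 2 != 0 by rewrite expf_neq0.
have r20 : 0 < r ^+ 2 by rewrite exprn_gt0.
have r21 : r ^+ 2 <= 1 by rewrite expr_le1// ltW.
have nF := nice_mul bf nice_Q4.
rewrite /amt -(I_Z M nF); have := I_affV z rn r2n (niceZ M nF).
rewrite (gtr0_norm r0) (gtr0_norm r20) => <-.
apply: I_le; [by apply: nice_mul => //; exact: bm_affV|exact: (nice_affV z rn r2n (niceZ M nF))|].
move=> y; have fy := f0 (affV r (r ^+ 2) z y).
have M0 : 0 <= M by exact: le_trans (kM 0).
have [->|/kK[y1 /andP[y2 y3]]] := eqVneq (k y) 0.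
  by rewrite mulr0 !mulr_ge0// indicE.
rewrite indicE mem_set ?mulr1; last first.
  have hy : r ^+ 2 * y.2 < 0 by rewrite pmulr_rlt0.
  have hy' : -3 <= r ^+ 2 * y.2 by nra.
  apply: Q4P; rewrite /=; [|fast_lra|fast_lra].
  by apply: le_trans (ler_normD _ _) _; rewrite normrZ gtr0_norm//; have := normr_ge0 y.1; nra.
by rewrite mulrC ler_wpM2r//; apply: le_trans (ler_norm _) (kM y).
Qed.

Lemma Bx1_lcont (v f : V -> R) A z : prob v f A -> Bx 1 z -> lcont v z.
Proof. by move=> p /Bx1_8 zB; have [_] := prob_base p; apply. Qed.

Lemma rj_anti j J : (j <= J)%N -> rj J <= rj j :> R.
Proof. by move=> jJ; rewrite /rj ler_wiXn2l// invf_le1 ?ler1n. Qed.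

(** The potential of [f] is split at a scale [J]. The terms beyond [J] form a small geometric tail
    whatever [f] is; the first ones are bounded by the mass [amt f] times a Jacobian that depends on
    [J] only. *)
Lemma thin_small eps : 0 < eps -> exists2 dt0, 0 < dt0 & forall (v f : V -> R) A, prob v f A -> amt f <= dt0 ->
  forall z, Bx 1 z -> 0 <= Wf v z <= eps /\ I (fun y => f (y + z) * kap y) <= 2^-1.
Proof.
move=> e0; have [Mk HMk] := Cc_bounded (ker_Cc (@ker_kap R n)).
have [Mp HMp] := Cc_bounded (ker_Cc (@ker_psi R n)).
have Mk0 : 0 <= Mk by exact: le_trans (HMk 0). have Mp0 : 0 <= Mp by exact: le_trans (HMp 0).
have I0 : 0 <= I (@psi R n) by apply: I_ge0; exact: psi_ge0.
have [J HJ] := rj_small (e := eps / (4 * (I (@psi R n) + 1))) ltac:(by rewrite divr_gt0// mulr_gt0// ltr_wpDl).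
pose B : R := (rj J)^-1 ^+ n * rj J ^- 2; have B0 : 0 < B.
  by rewrite mulr_gt0 ?invr_gt0 ?exprn_gt0// ?invr_gt0 rj_gt0.
have BE : B = (rj J)^-1 ^+ n * rj J ^- 2 by []. clearbody B.
exists (Num.min (2 * (Mk + 1))^-1 (eps / (4 * (B * (Mp + 1))))).
  have Mk1 : 0 < Mk + 1 by rewrite ltr_wpDl. have Mp1 : 0 < Mp + 1 by rewrite ltr_wpDl.
  have q1 : 0 < 2 * (Mk + 1) by rewrite mulr_gt0.
  have q2 : 0 < 4 * (B * (Mp + 1)) by rewrite mulr_gt0// mulr_gt0.
  by rewrite lt_min invr_gt0 q1 divr_gt0.
move=> v f A p; rewrite le_min => /andP[a1 a2] z zB.
have f0 y : 0 <= f y by case/andP: (prob_f p y).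
have bf := bm01 (prob_mf p) (prob_f p).
have am0 : 0 <= amt f by apply: I_ge0 => y; rewrite mulr_ge0// indicE.
split; last first.
  have := amt_scaled bf f0 (@nice_kap R n) (@ker_kap R n).2 HMk zB ltr01 (lexx 1).
  have E : 1^-1 ^+ n / 1 ^+ 2 = 1 :> R by rewrite invr1 !expr1n divr1.
  rewrite E mul1r => h.
  have -> : I (fun y => f (y + z) * kap y) = I (fun y => f (affV 1 (1 ^+ 2) z y) * kap y).
    by congr I; apply/funext => y; rewrite affV1.
  apply: le_trans h _; apply: (@le_trans _ _ ((Mk + 1) * (2 * (Mk + 1))^-1)).
    by apply: ler_pM => //; lra.
  by rewrite invfM mulrCA mulfV ?mulr1// gt_eqF// ltr_wpDl.
have [b1 b2 b3] := Bx1_bounds zB.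
apply: (Wf_bounds (prob_wsol p) (Bx1_lcont p zB) _ (prob_mf p) (prob_f p)).
  by move=> r y r0 r1 Ky; apply: KB4_shift.
move=> N.
have hx j : I (fun y => f (affV (rj j) (rj j ^+ 2) z y) * psi y) <= B * (Mp * amt f) + (if (J <= j)%N then I (@psi R n) else 0).
  have nf := nice_mul (bm_affV (rj j) (rj j ^+ 2) z bf) (@nice_psi R n).
  have BM : 0 <= B * (Mp * amt f) by apply: mulr_ge0; [exact: ltW|exact: mulr_ge0].
  case: ifP => [Jj|/negbT].
    apply: (@le_trans _ _ (I (@psi R n))); last by rewrite lerDr.
    apply: I_le => //; first exact: nice_psi.
    by move=> y; rewrite ler_piMl ?psi_ge0//; case/andP: (prob_f p (affV (rj j) (rj j ^+ 2) z y)).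
  rewrite -ltnNge addr0 => jJ.
  apply: le_trans (amt_scaled bf f0 (@nice_psi R n) (@ker_psi R n).2 HMp zB (rj_gt0 j) (rj_le1 j)) _.
  rewrite ler_wpM2r ?mulr_ge0//.
  have rJ : rj J <= rj j :> R by exact: rj_anti (ltnW jJ).
  have ri : (rj j)^-1 <= (rj J)^-1 :> R by rewrite lef_pV2 ?posrE ?rj_gt0.
  have ri0 : 0 <= (rj j)^-1 :> R by rewrite invr_ge0 ltW// rj_gt0.
  have hm m : (rj j)^-1 ^+ m <= (rj J)^-1 ^+ m :> R.
    by apply: lerXn2r => //; rewrite nnegrE; exact: le_trans ri.
  have h2 := hm 2%N; rewrite [X in X <= _]exprVn [X in _ <= X]exprVn in h2.
  by rewrite BE; apply: ler_pM; [exact: exprn_ge0|rewrite invr_ge0 sqr_ge0|exact: hm|exact: h2].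
apply: (@le_trans _ _ (\sum_(j < N) (4^-1 ^+ j * (B * (Mp * amt f)) + 2^-1 ^+ j * (rj J * I (@psi R n))))).
  apply: ler_sum => j _; apply: le_trans (ler_wpM2l _ (hx j)) _; first by rewrite exprn_ge0.
  rewrite mulrDr lerD2l; case: ifP => Jj; last by rewrite mulr0 mulr_ge0 ?exprn_ge0// mulr_ge0// ltW// rj_gt0.
  rewrite mulrA ler_wpM2r// -rj_sqr expr2 -/(rj j) ler_wpM2l ?(ltW (rj_gt0 _))//.
  exact: rj_anti.
rewrite big_split /= -!mulr_suml geo4.
have -> : \sum_(j < N) 2^-1 ^+ j = 2 * (1 - 2^-1 ^+ N) :> R.
  elim: (N) => [|m IH]; first by rewrite big_ord0 expr0 subrr mulr0.
  by rewrite big_ord_recr /= IH exprS; field.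
have q1 : rj J * I (@psi R n) <= eps / 4.
  have := HJ J (leqnn _); rewrite ler_pdivlMr; last by rewrite mulr_gt0// ltr_wpDl.
  have := rj_gt0 (R := R) J; nra.
have q2 : B * (Mp * amt f) <= eps / 4.
  move: a2; rewrite ler_pdivlMr; last by rewrite !mulr_gt0// ltr_wpDl.
  have : 0 <= B * amt f by apply: mulr_ge0; [exact: ltW|].
  nra.
have q3 : 0 <= B * (Mp * amt f) by apply: mulr_ge0; [exact: ltW|exact: mulr_ge0].
have q4 : 0 <= rj J * I (@psi R n) by rewrite mulr_ge0// ltW// rj_gt0.
have e4 : 0 <= 4^-1 ^+ N * (B * (Mp * amt f)) by apply: mulr_ge0 => //; exact: exprn_ge0.
have e2 : 0 <= 2^-1 ^+ N * (rj J * I (@psi R n)) by apply: mulr_ge0 => //; exact: exprn_ge0.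
move: q1 q2 q3 q4 e4 e2; move: (B * _) (rj J * _) (4^-1 ^+ N) (2^-1 ^+ N) => x y a b.
by clear; lra.
Qed.

(** With [Wf <= 1 / (8 Mgr)], [growth] gives [v <= S / 8] on the half-size box, and the zoom
    multiplies by 4. *)
Lemma thin_halves : exists2 dt0, 0 < dt0 & forall (v f : V -> R) A S, prob v f A -> amt f <= dt0 -> 0 < S ->
  (forall z, Bx 1 z -> A z -> v z <= S) -> forall z, Bx 1 z -> zmA A z -> zmv v z <= S / 2.
Proof.
have e0 : 0 < (8 * Mgr)^-1 :> R by rewrite invr_gt0 mulr_gt0// Mgr_gt0.
have [dt0 d0 H] := thin_small e0; exists dt0 => // v f A S p af S0 vS z zB zA.
have h := H v f A p af.
have zB' : Bx 2^-1 (affV 2^-1 4^-1 0 z).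
  move: zB; rewrite /Bx /= expr1n !addr0 normrZ gtr0_norm// (_ : 2^-1 ^+ 2 = 4^-1); last by field.
  by move=> [a /andP[b c]]; split; [fast_lra|apply/andP; split; fast_lra].
have := growth p S0 vS (fun y yB => (andP (h y yB).1).1) (fun y yB => (h y yB).2) zB' zA.
have zB1 : Bx 1 (affV 2^-1 4^-1 0 z) := Bx_half ler01 zB.
have [/andP[_ w] _] := h _ zB1.
have : Mgr * Wf v (affV 2^-1 4^-1 0 z) <= 8^-1.
  apply: le_trans (ler_wpM2l (ltW Mgr_gt0) w) _.
  by rewrite invfM mulrCA mulfV ?mulr1// gt_eqF// Mgr_gt0.
move=> /(ler_wpM2r (ltW S0)); rewrite /zmv; lra.
Qed.

End barriers.

(** * Boundedness of the Hessians at a free boundary point *)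

Section sequences.
Context {R : realType}.

(* The potential [E + K ln s - K4 m] is nonincreasing as long as [E] is large:
   [s] halves in thin steps, [m] shrinks only after being used up by thick ones. *)
Lemma potential_bound (D1 Ka Km c mst E0 S0 : R) (Est : R -> R -> R) (Sst : R -> R) :
  0 <= D1 -> 0 <= Ka -> 0 < c -> 0 < mst -> 0 < S0 -> (forall e, 0 < Sst e) ->
  exists L : R, forall (E a m : nat -> R) (ok : nat -> Prop) (sup : nat -> R -> Prop),
  (forall k, 0 <= a k <= Ka) -> (forall k, 0 <= m k <= Km) ->
  (forall k, 4 * (m k - a k) <= m k.+1) ->
  (forall k, ok k -> E k.+1 <= E k + D1) ->
  (forall k d B, 0 < d -> ok k -> d <= a k -> Est d B < E k -> E k.+1 <= E k - B) ->
  (forall k s, 0 < s -> sup k s -> sup k.+1 (4 * s)) ->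
  (forall k s, 0 < s -> sup k s -> sup k.+1 (s / 2) \/ mst <= m k) ->
  (forall k s, 0 < s -> sup k s -> c <= s) ->
  (forall k e, ok k -> E k <= e -> sup k.+1 (Sst e)) ->
  E 0%N <= E0 -> sup 0%N S0 ->
  forall k, (forall j, (j < k)%N -> ok j) -> E k <= L.
Proof.
move=> D10 Ka0 c0 mst0 S00 Sp.
pose l2 : R := ln 2. have l20 : 0 < l2 by rewrite ln_gt0// ltr1n.
(* The constants balance the steps. [K] makes one halving of [s] pay for an increase [D1] with 1 to
   spare. [K4] makes a mass [mst] pay for [D1] and for a quadrupling of [s]. [d] limits to 1 the
   loss through [m] in a thin step. [B] is the decrease of [E] that a thick step must bring, to
   cover the quadrupling and the largest loss through [m]. *)
pose K := (D1 + 1) / l2. have K0 : 0 < K by rewrite divr_gt0// ltr_wpDl.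
have KE : K * l2 = D1 + 1 by rewrite /K divfK// gt_eqF.
pose K4 := (D1 + 2 * (D1 + 1) + 2) / (3 * mst).
have K40 : 0 < K4 by rewrite divr_gt0 ?mulr_gt0//; lra.
have K4E : 3 * (K4 * mst) = D1 + 2 * (D1 + 1) + 2 by rewrite /K4; field; rewrite gt_eqF.
pose d := (4 * K4)^-1. have d0 : 0 < d by rewrite invr_gt0 mulr_gt0.
have dE : 4 * (K4 * d) = 1 by rewrite /d; field; rewrite gt_eqF.
pose B := 2 * (D1 + 1) + 4 * (K4 * Ka).
pose Es := Est d B.
pose Ph := Num.max (E0 + K * ln S0) (Es + D1 + K * ln (Sst Es)).
exists (Ph + K4 * Km - K * ln c) => E a m ok sup ha hm hma hE hthick h4 hthin hc hreset E00 sup0.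
have K4m k : 0 <= K4 * m k <= K4 * Km.
  by have /andP[m0 mK] := hm k; rewrite mulr_ge0 ?(ltW K40)//= ler_wpM2l// ltW.
suff H k : (forall j, (j < k)%N -> ok j) -> exists s, [/\ 0 < s, sup k s & E k + K * ln s - K4 * m k <= Ph].
  move=> k /H[s [s0 sk hs]]; have /andP[_ h1] := K4m k.
  have : K * ln c <= K * ln s by rewrite ler_wpM2l ?(ltW K0)// ler_ln ?posrE//; exact: hc sk.
  fast_lra.
elim: k => [|k IH] okk.
  exists S0; split=> //; have /andP[h1 _] := K4m 0%N.
  by rewrite /Ph le_max; apply/orP; left; fast_lra.
have [s [s0 sk hs]] := IH (fun j jk => okk j (ltnW jk)).
have okk' := okk k (leqnn _).
have /andP[m1 _] := K4m k.+1.
have [Ek|Ek] := leP (E k) Es.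
  exists (Sst Es); split=> //; first exact: hreset.
  have := hE _ okk'; rewrite /Ph le_max => h; apply/orP; right; fast_lra.
have dm : K4 * m k - K4 * m k.+1 <= - 3 * (K4 * m k) + 4 * (K4 * a k).
  by have := ler_wpM2l (ltW K40) (hma k); fast_lra.
have /andP[mk0 _] := K4m k.
have l4 : ln (4 * s) = 2 * l2 + ln s.
  rewrite lnM ?posrE//; congr (_ + _).
  by rewrite (_ : 4 = 2 * 2) ?lnM ?posrE//; [rewrite /l2; ring|ring].
have K4s : K * ln (4 * s) = 2 * (D1 + 1) + K * ln s by rewrite l4 mulrDr mulrCA KE.
have [ad|ad] := leP d (a k).
  exists (4 * s); split; [by rewrite mulr_gt0|exact: h4|].
  have := hthick k d B d0 okk' ad Ek.
  have /andP[_ aK] := ha k; have := ler_wpM2l (ltW K40) aK.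
  rewrite K4s /B; fast_lra.
have Kad : K4 * a k <= K4 * d by rewrite ler_wpM2l ?ltW.
have E1 := hE _ okk'.
have [s2|mm] := hthin _ _ s0 sk.
  exists (s / 2); split=> //; first by rewrite divr_gt0.
  have l2s : K * ln (s / 2) = K * ln s - (D1 + 1).
    by rewrite lnM ?posrE ?invr_gt0// lnV ?posrE// mulrBr KE.
  rewrite l2s; fast_lra.
exists (4 * s); split; [by rewrite mulr_gt0|exact: h4|].
have := ler_wpM2l (ltW K40) mm; rewrite K4s; fast_lra.
Qed.

(* Once [X] exceeds [Xs] it grows geometrically and [(1 + l) expR (3 K / X)] is nonincreasing. *)
Lemma growth_bound (K D Xs L l0 : R) : 0 <= K -> 0 < Xs -> exists C : R,
  forall l X : nat -> R, (forall k, 0 <= l k) ->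
  (forall k, Xs < X k -> 3 / 2 * X k <= X k.+1) ->
  (forall k, Xs < X k -> l k.+1 <= l k + K * (1 + l k) / X k) ->
  (forall k, X k <= Xs -> l k.+1 <= l k + D) ->
  (forall k, (forall j, (j < k)%N -> X j <= Xs) -> l k <= L) -> l 0%N <= l0 ->
  forall k, l k <= C.
Proof.
move=> K0 Xs0; pose l1 := Num.max (L + D) l0.
pose G := (1 + l1) * expR (3 * K / Xs).
exists (Num.max L G) => l X l_ge0 hX hl hD hL hl0.
suff H k : (forall j, (j <= k)%N -> X j <= Xs) \/ (Xs < X k /\ (1 + l k) * expR (3 * K / X k) <= G).
  move=> k; have [hk|[Xk hk]] := H k.
    by rewrite le_max hL// => j /ltnW; exact: hk.
  rewrite le_max; apply/orP; right; apply: le_trans hk.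
  have Xp : 0 < X k := lt_trans Xs0 Xk.
  have : 1 <= expR (3 * K / X k) by rewrite -expR0 ler_expR divr_ge0 ?mulr_ge0// ltW.
  have := l_ge0 k; nra.
have start i : Xs < X i -> l i <= l1 -> (1 + l i) * expR (3 * K / X i) <= G.
  move=> Xk lk; apply: ler_pM; rewrite ?expR_ge0 ?addr_ge0 ?lerD2l//.
  by rewrite ler_expR ler_wpM2l ?mulr_ge0// lef_pV2 ?posrE ?(ltW Xk)// (lt_trans Xs0).
elim: k => [|k [hk|[Xk hk]]].
- have [h|h] := leP (X 0%N) Xs; first by left => j; rewrite leqn0 => /eqP ->.
  by right; split=> //; apply: start => //; rewrite /l1 le_max hl0 orbT.
- have [h|h] := leP (X k.+1) Xs.
    by left => j; rewrite leq_eqVlt => /predU1P[->//|]; rewrite ltnS; exact: hk.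
  right; split=> //; apply: start => //; rewrite /l1 le_max; apply/orP; left.
  apply: le_trans (hD k (hk k (leqnn _))) _; rewrite lerD2r hL// => j jk; exact/hk/ltnW.
right; have Xp : 0 < X k := lt_trans Xs0 Xk.
have X1 := hX _ Xk; have X1p : 0 < X k.+1 by lra.
split; first by lra.
apply: le_trans hk.
(* As [X] grows by 3/2, the exponent drops by at least [K / X k], which pays for the factor
   [1 + K / X k]. *)
have e1 : 3 * K / X k.+1 <= 2 * K / X k.
  by rewrite ler_pdivrMr// mulrAC ler_pdivlMr//; nra.
have e2 : 1 + l k.+1 <= (1 + l k) * expR (K / X k).
  have := expR_ge1Dx (K / X k) => h; have := ler_wpM2l (addr_ge0 ler01 (l_ge0 k)) h.
  have := hl _ Xk; have -> : K * (1 + l k) / X k = (1 + l k) * (K / X k) by field; rewrite gt_eqF.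
  lra.
have -> : 3 * K / X k = K / X k + 2 * K / X k by field; rewrite gt_eqF.
rewrite expRD mulrA; apply: ler_pM; rewrite ?expR_ge0 ?addr_ge0 ?ler_expR//.
Qed.

End sequences.

(** * One step of the iteration at a free boundary point *)

Section steps.
Context {R : realType} {n : nat}.
Local Notation V := ('rV[R]_n * R)%type.
Local Notation mV := ('rV[R]_n * measurableTypeR R)%type.

(** [v] vanishes at the origin, so the average there is bounded by [rep_dist]. *)
Lemma cc_bound (v f : V -> R) A : prob v f A -> `|cc kap v| <= 4 / 3 * I (@psi R n).
Proof.
move=> p; have := rep_dist (prob_wsol p) (prob_lc p).
have -> : cv kap v 0 = cc kap v by congr I; apply/funext => y; rewrite addr0.
rewrite (prob_0 p) subr0; apply => r z r0 r1 Kz.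
by apply: KB4_shift; rewrite //= ?normr0//; lra.
Qed.

Definition K1 T : R := @C1 R n T (4 / 3 * I (@psi R n)).
Definition Xn (v : V -> R) : R := \sum_i `|bb kap v i|.
Definition ell (P : 'I_n -> 'I_n -> R) : R := \sum_i \sum_j `|P i j|.
Lemma Xn_ge0 v : 0 <= Xn v. Proof. exact: sumr_ge0. Qed.
Lemma ell_ge0 P : 0 <= ell P. Proof. by apply: sumr_ge0 => i _; exact: sumr_ge0. Qed.

Lemma lin_le (v : V -> R) (z : V) : `|z.1| <= 2 -> `|lin (bb kap v) z| <= 2 * Xn v.
Proof.
move=> z1; rewrite /Xn mulr_sumr; apply: le_trans (ler_norm_sum _ _ _) _; apply: ler_sum => i _.
by rewrite normrM ler_wpM2r//; apply: le_trans (rV_coord_le _ _) z1.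
Qed.

Lemma pt_le P (z : V) : `|z.1| <= 2 -> -4 <= z.2 -> z.2 <= 0 -> `|pt P z| <= 6 * ell P.
Proof.
move=> z1 z2 z3; rewrite /pt; apply: le_trans (ler_normD _ _) _.
have h1 : `|bil P z z| <= 4 * ell P.
  rewrite /ell mulr_sumr; apply: le_trans (ler_norm_sum _ _ _) _; apply: ler_sum => i _.
  rewrite mulr_sumr; apply: le_trans (ler_norm_sum _ _ _) _; apply: ler_sum => j _.
  rewrite normrM ler_wpM2r// normrM (_ : 4 = 2 * 2); last by ring.
  by rewrite ler_pM//; apply: le_trans (rV_coord_le _ _) z1.
have h2 : `|\sum_i P i i| <= ell P.
  apply: le_trans (ler_norm_sum _ _ _) _; apply: ler_sum => i _.
  by rewrite (bigD1 i)//= lerDl sumr_ge0.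
have h3 : `|z.2 * \sum_i P i i| <= 4 * ell P by rewrite normrM ler_pM// ler_norml; lra.
rewrite normrM gtr0_norm//; lra.
Qed.

Section one_step.
Variables (T : R) (v f : V -> R) (A : set V).
Hypotheses (p : prob v f A) (RT : RmB v T).

Let approx1 (z : V) : `|z.1| <= 2 -> -4 <= z.2 -> z.2 < 0 -> `|v z - lin (bb kap v) z - pt (Pt v f) z| <= K1 T.
Proof. exact: (pt_approx (prob_base p) (prob_mf p) (prob_f p) RT (cc_bound p)). Qed.

Lemma K1_ge0 : 0 <= K1 T.
Proof.
apply: le_trans (approx1 (z := (0, -1)) _ _ _); rewrite //= ?normr0 ?ltrN10//; lra.
Qed.

(** Positivity of [v] on the phase passes to [pt], at the cost of the approximation error and of the
    gradient. A small gradient is needed for this to be uniform. *)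
Lemma pt_lower (z : V) : KB z -> A z -> - (K1 T + 2 * Xn v) <= pt (Pt v f) z.
Proof.
move=> zK zA; have [z1 z2 z3] := KB_KB4 zK.
have := approx1 z1 z2 z3; have := lin_le v z1; have := prob_pos p (KB_Bx8 zK) zA.
by rewrite !ler_norml; lra.
Qed.

Definition Ka : R := I (@om R n).
Lemma amass_le : amass f <= Ka.
Proof.
have bf := bm01 (prob_mf p) (prob_f p).
apply: I_le; [exact: nice_mul (@nice_om R n)|exact: nice_om|].
by move=> z; rewrite ler_piMl ?om_ge0//; case/andP: (prob_f p z).
Qed.

Lemma energy_step X : Xn v <= X ->
  energy (Pt (zmv v) (zmg f)) <= energy (Pt v f) + (8 * (K1 T + 2 * X) * Ka + 576 * n%:R ^+ 2 * Ka ^+ 2).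
Proof.
move=> vX; have h1 := energy_zm p; have h2 := drift_lower p pt_lower.
have a0 := amass_ge0 (prob_f p); have aK := amass_le.
have K10 := K1_ge0; have X0 := Xn_ge0 v.
have h3 : (K1 T + 2 * Xn v) * amass f <= (K1 T + 2 * X) * Ka.
  by apply: ler_pM => //; fast_lra.
have h4 : n%:R ^+ 2 * amass f ^+ 2 <= n%:R ^+ 2 * Ka ^+ 2.
  by rewrite ler_wpM2l ?sqr_ge0// lerXn2r ?nnegrE//; exact: le_trans aK.
move: h1 h2 h3 h4; move: (I _) => q; lra.
Qed.

(** [N] is so large that the flat set takes at most half of the mass [d], and [m] so large that the
    threshold [m / (25 N^2)] dominates the lower bound on [pt]. The other half of the mass then
    forces the decrease. *)
Lemma energy_thick X d m N i j : Xn v <= X -> 0 < d -> d <= amass f -> (0 < N)%N ->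
  @Kom R n * (2 * 10 ^+ n.+1) <= d / 2 * N%:R -> 0 < m -> m <= `|Pt v f i j| ->
  K1 T + 2 * X <= m / (25 * N%:R ^+ 2) ->
  energy (Pt (zmv v) (zmg f)) <= energy (Pt v f) - 4 * d * (m / (25 * N%:R ^+ 2))
    + (8 * (K1 T + 2 * X) * Ka + 576 * n%:R ^+ 2 * Ka ^+ 2).
Proof.
move=> vX d0 da N0 NK m0 mP hm; have h1 := energy_zm p.
set k := m / (25 * N%:R ^+ 2) in hm *.
have K10 := K1_ge0; have X0 := Xn_ge0 v.
have L0 : 0 <= K1 T + 2 * X by fast_lra.
have h2 := drift_thick p L0 hm (fun z zK zA => le_trans (_ : - (K1 T + 2 * X) <= - (K1 T + 2 * Xn v)) (pt_lower zK zA)).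
have {}h2 := h2 ltac:(by move=> *; fast_lra).
have N0' : 0 < N%:R :> R by rewrite ltr0n.
have h3 := flat_small (fun i j => Pt_sym v f i j) m0 mP N0.
rewrite -/k in h3; set F := I (\1_(flat (Pt v f) k)) in h2 h3.
have F0 : 0 <= F by apply: I_ge0 => z; rewrite indicE.
have h4 : @Kom R n * F <= d / 2.
  rewrite -(ler_pM2r N0'); apply: le_trans NK; rewrite -mulrA ler_wpM2l ?Kom_ge0// mulrC//.
have a0 := amass_ge0 (prob_f p); have aK := amass_le.
have h6 : n%:R ^+ 2 * amass f ^+ 2 <= n%:R ^+ 2 * Ka ^+ 2.
  by rewrite ler_wpM2l ?sqr_ge0// lerXn2r ?nnegrE//; exact: le_trans aK.
have k0 : 0 <= k by fast_lra.
have h7 : k * (@Kom R n * F) <= k * (d / 2) by rewrite ler_wpM2l.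
have h8 : k * d <= k * amass f by rewrite ler_wpM2l.
have h9 : (K1 T + 2 * X) * amass f <= (K1 T + 2 * X) * Ka by rewrite ler_wpM2l.
rewrite mulrBl -mulrA in h2.
move: h1 h2 h6 h7 h8 h9; move: (I _) (Kom * F) (amass f ^+ 2) => q1 q2 q3; fast_lra.
Qed.

Definition K3 : R := n%:R ^+ 2 * (2 * (24 * @Kom R n * (10 ^+ n.+1 * 12))) * n%:R * (K1 T + 7).

(** Some component of the gradient is at least [Xn v / n]. With slab half-width [s] of order
    [1 + ell], [J_half] makes each increment at most of order [(1 + ell) / Xn]. *)
Lemma ell_step : 0 < Xn v ->
  ell (Pt (zmv v) (zmg f)) <= ell (Pt v f) + K3 * (1 + ell (Pt v f)) / Xn v.
Proof.
move=> X0; have K10 := K1_ge0; have l0 := ell_ge0 (Pt v f).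
have [l hl] : exists l, Xn v / n%:R <= `|bb kap v l|.
  apply: contrapT => H; have n0 : (0 < n)%N.
    by case: (posnP n) => // n0; move: X0; rewrite /Xn big1 ?ltxx// => i _; have := ltn_ord i; rewrite [X in (_ < X)%N]n0.
  have n0' : 0 < n%:R :> R by rewrite ltr0n.
  have : Xn v < \sum_(i < n) (Xn v / n%:R).
    apply: ltr_sum; first by apply/hasP; exists (Ordinal n0) => //; rewrite mem_index_enum.
    by move=> i _; rewrite ltNge; apply/negP => h; apply: H; exists i.
  by rewrite sumr_const card_ord -[_ *+ n]mulr_natl mulrCA mulfV ?gt_eqF// mulr1 ltxx.
have n0 : (0 < n)%N by case: (l) => i; case: (n).
have n0' : 0 < n%:R :> R by rewrite ltr0n.
have bl : bb kap v l != 0 by rewrite -normr_gt0; apply: lt_le_trans hl; rewrite divr_gt0.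
pose s := K1 T + 6 * ell (Pt v f) + 1; have s0 : 0 < s by rewrite /s; lra.
have H z : KB z -> `|v z - lin (bb kap v) z| <= s.
  move=> /KB_KB4[z1 z2 z3]; have h1 := approx1 z1 z2 z3; have h2 := pt_le (Pt v f) z1 z2 (ltW z3).
  have -> : v z - lin (bb kap v) z = (v z - lin (bb kap v) z - pt (Pt v f) z) + pt (Pt v f) z by ring.
  by apply: le_trans (ler_normD _ _) _; rewrite /s; fast_lra.
pose q := 24 * @Kom R n * (10 ^+ n.+1 * 12); have q0 : 0 <= q.
  by rewrite !mulr_ge0 ?Kom_ge0// exprn_ge0.
have hJ i j : `|I (fun z => f z * Th i j z)| <= q * (K1 T + 7) * (1 + ell (Pt v f)) * n%:R / Xn v.
  apply: le_trans (J_half i j p H s0 bl) _.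
  have -> : 24 * @Kom R n * (10 ^+ n.+1 * 12 * s / `|bb kap v l|) = q * (s / `|bb kap v l|) by rewrite /q; ring.
  have -> : q * (K1 T + 7) * (1 + ell (Pt v f)) * n%:R / Xn v = q * ((K1 T + 7) * (1 + ell (Pt v f)) * (n%:R / Xn v)) by ring.
  rewrite ler_wpM2l//; apply: ler_pM; rewrite ?invr_ge0 ?(ltW s0)//; first by rewrite /s; nra.
  by rewrite -[n%:R / _]invf_div lef_pV2 ?posrE ?divr_gt0 ?normr_gt0.
have bf := bm01 (prob_mf p) (prob_f p).
have -> : K3 * (1 + ell (Pt v f)) / Xn v = \sum_(i < n) \sum_(j < n) 2 * (q * (K1 T + 7) * (1 + ell (Pt v f)) * n%:R / Xn v).
  under eq_bigr do rewrite sumr_const card_ord.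
  rewrite sumr_const card_ord -[RHS]mulr_natl -[X in _ = _ * X]mulr_natl /K3 /q; ring.
rewrite -big_split /=; apply: ler_sum => i _; rewrite -big_split /=; apply: ler_sum => j _.
rewrite (Pt_zmv _ _ (prob_wsol p) bf); apply: le_trans (ler_normB _ _) _.
by rewrite lerD2l normrM gtr0_norm// ler_pM2l.
Qed.

Lemma sup_bound (z : V) : Bx 1 z -> v z <= K1 T + 2 * Xn v + 6 * ell (Pt v f).
Proof.
rewrite /Bx /= expr1n => -[z1 /andP[z2 z3]].
have a1 : `|z.1| <= 2 by lra. have a2 : -4 <= z.2 by lra.
have := approx1 a1 a2 z3; have := lin_le v a1; have := pt_le (Pt v f) a1 a2 (ltW z3).
by rewrite !ler_norml; lra.
Qed.

Definition K2 : R := 2 * \sum_(i < n) Kabs (Dx i (@psi R n)).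

(** First-order coefficients double under a zoom, up to the integral of the right-hand side against
    [D_i psi]. *)
Lemma Xn_step : 2 * Xn v - K2 <= Xn (zmv v).
Proof.
have W := prob_wsol p; have [_ mg g1 _] := W.
rewrite /Xn /K2 !mulr_sumr -sumrB; apply: ler_sum => i _.
rewrite (bb_zm W KB4_Bx) normrM gtr0_norm// -mulrBr ler_pM2l//.
have : `|bb psi (fun z => 2 * f z - 1) i| <= Kabs (Dx i (@psi R n)).
  rewrite /bb normrN -[Kabs _]mul1r; apply: I_wle => //.
  by apply/Cc_nice/Cc_D/ker_Cc/ker_psi.
have := ler_normD (bb kap v i - bb psi (fun z => 2 * f z - 1) i) (bb psi (fun z => 2 * f z - 1) i).
rewrite subrK; move: (bb psi _ i) (bb kap v i) (Kabs _) => a b c h1 h2; lra.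
Qed.

End one_step.
End steps.

(** * Mass of the phase over several scales, and the bound for all scales *)

Section masses.
Context {R : realType} {n : nat}.
Local Notation V := ('rV[R]_n * R)%type.
Local Notation mV := ('rV[R]_n * measurableTypeR R)%type.

(** The Euclidean backward cylinder on which [om_lower] bounds the weight from below, outside its
    half-size copy and a thin layer at time 0. *)
Definition BB : set mV := [set z | rho (z : V) <= 2 /\ -2 <= z.2 <= 0].

Lemma measurable_BB : measurable BB.
Proof.
have -> : BB = (rho : mV -> R) @^-1` `]-oo, 2] `&` (snd : mV -> R) @^-1` `[-2, 0].
  by apply/seteqP; split=> z /=; rewrite !in_itv.
apply: measurableI.
  rewrite -[X in measurable X]setTI; exact: (Sm_mfun Sm_rho).
rewrite -[X in measurable X]setTI; exact: (Sm_mfun (Sm_tm (R := R) (n := n))).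
Qed.

Lemma BB_norm (z : V) : BB z -> `|z.1| <= 2 /\ -2 <= z.2 <= 0.
Proof.
move=> [z1 z2]; split=> //; have := norm_le_rho z; have := normr_ge0 z.1.
by move=> h0 h; rewrite leNgt; apply/negP => h2; nra.
Qed.

Lemma nice_BB : nice (\1_BB : V -> R).
Proof.
apply: (@nice_indic _ _ _ 2); first exact: measurable_BB.
by move=> z /BB_norm[a /andP[b c]]; split=> //; rewrite ler_norml; lra.
Qed.

Definition bmass (f : V -> R) : R := I (fun z => f z * \1_BB z).

Definition slice tau : set mV := @cube R n 2 `*` `[- tau, 0].

Lemma nice_slice tau : 0 <= tau -> nice (\1_(slice tau) : V -> R).
Proof.
move=> t0; apply: (@nice_indic _ _ _ (2 + tau)).
  by apply: measurableX => //; exact: measurable_cube.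
move=> z [/= a]; rewrite in_itv/= => /andP[b c]; split; last by rewrite ler_norml; lra.
by apply: (@le_trans _ _ 2); [exact/rV_norm_leP|lra].
Qed.

Lemma I_slice tau : 0 <= tau -> I (\1_(slice tau) : V -> R) = 4 ^+ n * tau.
Proof.
move=> t0; rewrite I_indic; last by apply: measurableX => //; exact: measurable_cube.
rewrite mu_rect//=; last by lra.
by rewrite (_ : 2 * 2 = 4); [ring|ring].
Qed.

Lemma bmass_rec tau : 0 < tau -> exists2 c, 0 < c & forall f : V -> R, mfun f -> (forall z, 0 <= f z <= 1) ->
  bmass f <= c^-1 * amass f + 4 ^+ n * tau + 4^-1 * bmass (zmg f).
Proof.
move=> t0; have [c c0 Hc] := @om_lower R n tau t0; exists c => // f mf f01.
have bf := bm01 mf f01; have f0 z : 0 <= f z by case/andP: (f01 z).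
have nBd : nice (fun z : V => \1_BB (dl z) : R) by apply: nice_affV => //; exact: nice_BB.
have no := nice_mul bf (@nice_om R n); have nS := nice_slice (ltW t0).
have nfd := nice_mul bf nBd.
have E : 4^-1 * bmass (zmg f) >= I (fun z => f z * \1_BB (dl z)).
  have := I_half bf nice_BB; rewrite -/(bmass (zmg f)) => ->.
  have q0 : 0 <= I (fun z => f z * \1_BB (dl z)) by apply: I_ge0 => z; rewrite mulr_ge0// indicE.
  rewrite mulrA ler_peMl// exprS exprS; have : 1 <= 2 ^+ n :> R by rewrite exprn_ege1// ler1n.
  lra.
apply: (@le_trans _ _ (c^-1 * amass f + 4 ^+ n * tau + I (fun z => f z * \1_BB (dl z)))); last by rewrite lerD2l.
rewrite -I_slice ?(ltW t0)// -(I_Z c^-1 no) -(I_D (niceZ c^-1 no) nS) -(I_D (niceD (niceZ c^-1 no) nS) nfd).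
apply: I_le; [exact: nice_mul bf nice_BB|exact: niceD (niceD (niceZ c^-1 no) nS) nfd|].
move=> z; have o0 : 0 <= c^-1 * (f z * om z) by apply: mulr_ge0; [rewrite invr_ge0 ltW|apply: mulr_ge0; [exact: f0|exact: om_ge0]].
have s0 : 0 <= \1_(slice tau) z :> R by rewrite indicE.
have d0 : 0 <= f z * \1_BB (dl z) by rewrite mulr_ge0// indicE.
have /andP[_ f1] := f01 z.
rewrite {1}indicE; have [/set_mem zB|_] := boolP (z \in BB); last by rewrite mulr0; lra.
rewrite mulr1; have [z1 /andP[z2 z3]] := BB_norm zB.
have [h|h] := ltP (- tau) z.2.
  have : \1_(slice tau) z = 1 :> R.
    rewrite indicE mem_set//; split=> /=; first exact/rV_norm_leP.
    by rewrite in_itv/= (ltW h) z3.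
  lra.
have [[r1 r2]|nb] := pselect (rho z <= 2^-1 /\ - 2^-1 <= z.2).
  have : \1_BB (dl z) = 1 :> R.
    rewrite indicE mem_set//; split; first by rewrite rho_dl; fast_lra.
    by rewrite dl2; apply/andP; split; fast_lra.
  by move=> e; rewrite e mulr1 in d0 *; fast_lra.
have := Hc z zB.1 z2 h nb => oc.
have : f z <= c^-1 * (f z * om z).
  by rewrite ler_pdivlMl// mulrC ler_wpM2l.
fast_lra.
Qed.

(** Iterating [bmass_rec] bounds [bmass] by this sum up to small errors. Dropping its first term and
    zooming multiplies it by at least 4, the recursion on which the potential argument relies. *)
Definition msum J (f : V -> R) : R := \sum_(j < J) 4^-1 ^+ j * amass (iter j zmg f).

Lemma iter_mf k (f : V -> R) : mfun f -> (forall z, 0 <= f z <= 1) ->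
  mfun (iter k zmg f) /\ forall z, 0 <= iter k zmg f z <= 1.
Proof.
move=> mf f01; elim: k => //= k [m1 m2]; split; first exact: mfun_affV.
by move=> z; exact: m2.
Qed.

Lemma amass_bounds (f : V -> R) : mfun f -> (forall z, 0 <= f z <= 1) -> 0 <= amass f <= Ka (R := R) (n := n).
Proof.
move=> mf f01; rewrite amass_ge0//=.
apply: I_le; [exact: nice_mul (bm01 mf f01) (@nice_om R n)|exact: nice_om|].
by move=> z; rewrite ler_piMl ?om_ge0//; case/andP: (f01 z).
Qed.

Lemma bmass_bounds (f : V -> R) : mfun f -> (forall z, 0 <= f z <= 1) -> 0 <= bmass f <= I (\1_BB : V -> R).
Proof.
move=> mf f01; apply/andP; split.
  by apply: I_ge0 => z; rewrite mulr_ge0 ?indicE//; case/andP: (f01 z).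
apply: I_le; [exact: nice_mul (bm01 mf f01) nice_BB|exact: nice_BB|].
by move=> z; rewrite ler_piMl ?indicE//; case/andP: (f01 z).
Qed.

(** [bmass_rec] is iterated [J + 1] times: the layers add up to at most [dm / 6], and the remainder
    is below [dm / 4] by the choice of [J], so half of [dm] is left for [msum]. *)
Lemma bmass_thick dm : 0 < dm -> exists J : nat, exists2 mst, 0 < mst &
  forall f : V -> R, mfun f -> (forall z, 0 <= f z <= 1) -> dm <= bmass f -> mst <= msum J.+1 f.
Proof.
move=> d0; pose tau := dm / (8 * 4 ^+ n); have t4 : 0 < 8 * 4 ^+ n :> R by rewrite mulr_gt0// exprn_gt0.
have t0 : 0 < tau by rewrite divr_gt0.
have tE : 4 ^+ n * tau = dm / 8 by rewrite /tau; field; rewrite expf_neq0.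
have [c c0 Hc] := bmass_rec t0.
pose M := I (\1_BB : V -> R); have M0 : 0 <= M by apply: I_ge0 => z; rewrite indicE.
have [J HJ] := rj_small (e := dm / (4 * (M + 1))) ltac:(by rewrite divr_gt0// mulr_gt0// ltr_wpDl).
exists J, (c * (dm / 2)); first by rewrite mulr_gt0// divr_gt0.
move=> f mf f01 df.
have H N : bmass f <= \sum_(j < N) 4^-1 ^+ j * (c^-1 * amass (iter j zmg f) + 4 ^+ n * tau) + 4^-1 ^+ N * bmass (iter N zmg f).
  elim: N => [|N IH]; first by rewrite big_ord0 expr0 mul1r add0r.
  have [m1 m2] := iter_mf N mf f01; apply: le_trans IH _.
  rewrite big_ord_recr /= -addrA lerD2l exprSr -mulrA -mulrDr ler_wpM2l ?exprn_ge0//.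
  exact: Hc.
have := H J.+1.
have -> : \sum_(j < J.+1) 4^-1 ^+ j * (c^-1 * amass (iter j zmg f) + 4 ^+ n * tau) =
   c^-1 * msum J.+1 f + 4 / 3 * (1 - 4^-1 ^+ J.+1) * (dm / 8).
  rewrite -geo4 /msum mulr_sumr mulr_suml -big_split; apply: eq_bigr => j _.
  by rewrite tE /=; ring.
have [m1 m2] := iter_mf J.+1 mf f01; have /andP[b0 b1] := bmass_bounds m1 m2.
have e0 : 0 <= 4^-1 ^+ J.+1 :> R by rewrite exprn_ge0.
have e1 : 4^-1 ^+ J.+1 * bmass (iter J.+1 zmg f) <= dm / 4.
  have hr := HJ J.+1 (leqnSn _).
  have e4 : 4^-1 ^+ J.+1 <= rj J.+1 :> R by rewrite -rj_sqr expr2 ler_piMr ?rj_le1// ltW// rj_gt0.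
  have M1 : 0 < 4 * (M + 1) by rewrite mulr_gt0// ltr_wpDl.
  move: hr; rewrite ler_pdivlMr// => hr.
  apply: (@le_trans _ _ (rj J.+1 * (M + 1))); last by fast_lra.
  by apply: ler_pM => //; apply: le_trans b1 _; rewrite lerDl.
have key (x y z b : R) : 0 <= x -> dm <= b -> z <= dm / 4 -> b <= y + 4 / 3 * (1 - x) * (dm / 8) + z -> dm / 2 <= y.
  move=> x0 hb hz hy; have : 0 <= x * dm by apply: mulr_ge0 => //; exact: ltW.
  fast_lra.
by move=> hh; rewrite -ler_pdivlMl//; exact: key e0 df e1 hh.
Qed.

Lemma msum_step J (f : V -> R) : mfun f -> (forall z, 0 <= f z <= 1) ->
  4 * (msum J.+1 f - amass f) <= msum J.+1 (zmg f).
Proof.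
move=> mf f01; rewrite /msum big_ord_recl expr0 mul1r /= addrC addKr [X in _ <= X]big_ord_recr /=.
have [m1 m2] := iter_mf J.+1 mf f01; have /andP[a0 _] := amass_bounds m1 m2.
rewrite iterSr in a0.
apply: (@le_trans _ _ (\sum_(i < J) 4^-1 ^+ i * amass (iter i zmg (zmg f)))).
  rewrite mulr_sumr; apply: ler_sum => i _; rewrite /bump /= add1n -iterS iterSr exprS.
  by rewrite !mulrA mulfV// mul1r.
by rewrite lerDl mulr_ge0// exprn_ge0.
Qed.

Lemma msum_bounds J (f : V -> R) : mfun f -> (forall z, 0 <= f z <= 1) ->
  0 <= msum J f <= 2 * Ka (R := R) (n := n).
Proof.
move=> mf f01; have ab j : 0 <= amass (iter j zmg f) <= Ka (R := R) (n := n).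
  by have [m1 m2] := iter_mf j mf f01; exact: amass_bounds.
apply/andP; split.
  by apply: sumr_ge0 => j _; have /andP[a0 _] := ab j; rewrite mulr_ge0// exprn_ge0.
have K0 : 0 <= Ka (R := R) (n := n) by have /andP[a b] := ab 0%N; exact: le_trans b.
apply: (@le_trans _ _ (\sum_(j < J) 4^-1 ^+ j * Ka (R := R) (n := n))).
  by apply: ler_sum => j _; have /andP[_ a1] := ab j; rewrite ler_wpM2l// exprn_ge0.
rewrite -mulr_suml geo4 ler_wpM2r//.
have : 0 <= 4^-1 ^+ J :> R by rewrite exprn_ge0.
lra.
Qed.

Lemma iter_dl1 k (z : V) : (iter k dl z).1 = 2 ^+ k *: z.1 /\ (iter k dl z).2 = 4 ^+ k * z.2.
Proof.
elim: k => [|k [h1 h2]] /=; first by rewrite !expr0 scale1r mul1r.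
by rewrite !addr0 h1 h2 scalerA -exprS mulrA -exprS.
Qed.

(** Shrunk by [2^(n+2)] in space and by the square of it in time, the box [Q4] fits into the
    Euclidean set [BB]. Thinness measured by [bmass] thus takes effect [n + 2] scales later. *)
Lemma amt_iter (f : V -> R) : mfun f -> (forall z, 0 <= f z <= 1) ->
  amt (iter n.+2 zmg f) <= (2 ^+ n.+2) ^+ n.+2 * bmass f.
Proof.
move=> mf f01.
have H k (h : V -> R) : nice h -> nice (fun z => h (iter k dl z)) /\
    I (fun z => iter k zmg f z * h z) = (2 ^+ n.+2) ^+ k * I (fun z => f z * h (iter k dl z)).
  elim: k h => [|k IH] h nh; first by rewrite expr0 mul1r.
  have nd : nice (fun z => h (dl z)) by apply: nice_affV.
  have [m1 m2] := iter_mf k mf f01.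
  have [n1 n2] := IH _ nd; split=> //.
  by rewrite (I_half (bm01 m1 m2) nh) n2 mulrA -exprS.
have [nQ E] := H n.+2 _ (@nice_Q4 R n).
rewrite /amt E.
rewrite ler_wpM2l ?exprn_ge0//; have bf := bm01 mf f01.
apply: I_le; [exact: nice_mul|exact: nice_mul bf nice_BB|].
move=> z; have /andP[f0 _] := f01 z; rewrite ler_wpM2l//.
have [e1 e2] := iter_dl1 n.+2 z.
rewrite indicE; have [/set_mem hQ|_] := boolP (_ \in Q4); last by rewrite indicE.
have q1 : forall i, `|(iter n.+2 dl z).1 ord0 i| <= 4 := hQ.1.
have : [set` `[- 16, 0]] (4 ^+ n.+2 * z.2) by rewrite -e2; exact: hQ.2.
rewrite /mkset in_itv /= => /andP[q2 q3].
rewrite indicE mem_set//.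
have n0 : 0 <= n%:R :> R by [].
have p4 : 8 * (n%:R + 1) <= 4 ^+ n.+2 :> R.
  rewrite !exprS; have : n%:R + 1 <= 4 ^+ n :> R by rewrite natr1 -natrX ler_nat ltn_expl.
  lra.
have c4 i : 4 ^+ n.+2 * z.1 ord0 i ^+ 2 <= 16.
  have := q1 i; rewrite e1 mxE => h.
  have := ler_pM (normr_ge0 _) (normr_ge0 _) h h; rewrite -normrM.
  have -> : 2 ^+ n.+2 * z.1 ord0 i * (2 ^+ n.+2 * z.1 ord0 i) = 4 ^+ n.+2 * z.1 ord0 i ^+ 2.
    by rewrite (_ : 4 = 2 * 2 :> R) ?exprMn; ring.
  by move=> h2; apply: le_trans (ler_norm _) (le_trans h2 _); fast_lra.
split; last by apply/andP; split; nra.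
have : 4 ^+ n.+2 * rho z <= 16 * n%:R.
  have -> : 16 * n%:R = \sum_(i < n) 16 :> R by rewrite sumr_const card_ord -[RHS]mulr_natl mulrC.
  by rewrite /rho mulr_sumr; apply: ler_sum => i _; exact: c4.
have r0 := rho_ge0 z; nra.
Qed.

Lemma entry_le_sum (F : 'I_n -> 'I_n -> R) i j : (forall i j, 0 <= F i j) -> F i j <= \sum_a \sum_b F a b.
Proof.
move=> F0; rewrite (bigD1 i)//= (bigD1 j)//= -addrA lerDl addr_ge0// sumr_ge0// => a _.
by apply: sumr_ge0 => b _.
Qed.

Lemma energy_ell (P : 'I_n -> 'I_n -> R) : ell P <= n%:R ^+ 2 + energy P.
Proof.
have -> : n%:R ^+ 2 = \sum_(i < n) \sum_(j < n) 1 :> R.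
  under eq_bigr do rewrite sumr_const card_ord.
  by rewrite sumr_const card_ord -[RHS]mulr_natl expr2.
rewrite -big_split /=; apply: ler_sum => i _; rewrite -big_split /=; apply: ler_sum => j _.
have := real_normK (num_real (P i j)) => <-; have := normr_ge0 (P i j); nra.
Qed.

Lemma energy_entry (P : 'I_n -> 'I_n -> R) m : 0 < m -> n%:R ^+ 2 * m ^+ 2 < energy P ->
  exists i j, m <= `|P i j|.
Proof.
move=> m0 H; apply: contrapT => none; move: H; rewrite ltNge => /negP; apply.
have -> : n%:R ^+ 2 * m ^+ 2 = \sum_(i < n) \sum_(j < n) m ^+ 2.
  under eq_bigr do rewrite sumr_const card_ord.
  by rewrite sumr_const card_ord -[RHS]mulr_natl -[X in _ = _ * X]mulr_natl mulrA expr2.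
apply: ler_sum => i _; apply: ler_sum => j _.
rewrite -real_normK ?num_real// lerXn2r ?nnegrE ?(ltW m0)//.
by rewrite leNgt; apply/negP => h; apply: none; exists i, j; exact: ltW.
Qed.

(** Valid for any gradient; it covers the one step in which the gradient becomes large. *)
Lemma ell_crude (v f : V -> R) A : prob v f A ->
  ell (Pt (zmv v) (zmg f)) <= ell (Pt v f) + n%:R ^+ 2 * (24 * Ka (R := R) (n := n)).
Proof.
move=> p; have mf := prob_mf p; have f01 := prob_f p; have bf := bm01 mf f01.
have -> : n%:R ^+ 2 * (24 * Ka (R := R) (n := n)) = \sum_(i < n) \sum_(j < n) 24 * Ka (R := R) (n := n).
  move: (24 * _) => c.
  under eq_bigr do rewrite sumr_const card_ord.
  by rewrite sumr_const card_ord -[RHS]mulr_natl -[X in _ = _ * X]mulr_natl mulrA expr2.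
rewrite -big_split /=; apply: ler_sum => i _; rewrite -big_split /=; apply: ler_sum => j _.
rewrite (Pt_zmv _ _ (prob_wsol p) bf); apply: le_trans (ler_normB _ _) _.
rewrite lerD2l normrM gtr0_norm//; have := J_le i j mf f01; have := amass_le p; lra.
Qed.

Lemma iter_zmv_val k (v : V -> R) z : Bx 1 z -> exists2 y, Bx 1 y & iter k zmv v z = 4 ^+ k * v y /\
  forall A : set V, iter k zmA A z -> A y.
Proof.
elim: k z => [|k IH] z zB; first by exists z => //; rewrite expr0 mul1r.
have [y yB [e1 e2]] := IH _ (Bx_half ler01 zB); exists y => //; split.
  by rewrite iterS {1}/zmv e1 mulrA -exprS.
by move=> A; rewrite iterS => /e2.
Qed.

(** As long as the gradient stays below [Xs], [potential_bound] controls the energy; from the first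
    large gradient on, [growth_bound] controls the entries. The bounded [Xi] correction leads back
    from [Pt] to [PP]. *)
Theorem abstract_bound (M0 : R) : exists C : R, forall (v f : V -> R) A, prob v f A -> (forall z, `|v z| <= M0) ->
  forall k i j, `|PP kap (iter k zmv v) i j| <= C.
Proof.
pose T := @Ckap R n * M0 + @Cpsi R n.
pose Xs : R := 2 * @K2 R n + 1.
have K20 : 0 <= @K2 R n by rewrite /K2 mulr_ge0// sumr_ge0// => i _; exact: Kabs_ge0.
have Xs0 : 0 < Xs by rewrite /Xs; lra.
pose k1 : R := `|@K1 R n T|; have k10 : 0 <= k1 := normr_ge0 _.
have k1E : @K1 R n T <= k1 := ler_norm _.
have Ka0 : 0 <= Ka (R := R) (n := n) by apply: I_ge0; exact: om_ge0.
pose D1 : R := 8 * (k1 + 2 * Xs) * Ka (R := R) (n := n) + 576 * n%:R ^+ 2 * Ka (R := R) (n := n) ^+ 2.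
have kX : 0 <= k1 + 2 * Xs by clearbody k1 Xs; lra.
have D10 : 0 <= D1.
  rewrite /D1; move: (k1 + 2 * Xs) kX (Ka (R := R) (n := n)) Ka0 => x x0 y y0.
  apply: addr_ge0; first by apply: mulr_ge0 y0; apply: mulr_ge0 x0; exact: ler0n.
  by apply: mulr_ge0 (sqr_ge0 _); apply: mulr_ge0 (sqr_ge0 _); exact: ler0n.
have D1E : D1 = 8 * (k1 + 2 * Xs) * Ka (R := R) (n := n) + 576 * n%:R ^+ 2 * Ka (R := R) (n := n) ^+ 2 by [].
have XsE : Xs = 2 * @K2 R n + 1 by [].
have TE : T = @Ckap R n * M0 + @Cpsi R n by [].
clearbody D1 k1 Xs T.
have [dt0 dt00 Hthin] := @thin_halves R n.
pose dm := dt0 / (2 ^+ n.+2) ^+ n.+2; have p20 : 0 < (2 ^+ n.+2) ^+ n.+2 :> R by rewrite !exprn_gt0.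
have dm0 : 0 < dm by rewrite divr_gt0.
have dmE : dm = dt0 / (2 ^+ n.+2) ^+ n.+2 by []. clearbody dm.
have [J [mst mst0 Hmst]] := bmass_thick dm0.
(* The number of translates for which the flat set has weighted mass at most [d / 2]. *)
pose Nn (d : R) : nat := (Num.bound (2 / d * (@Kom R n * (2 * 10 ^+ n.+1)))).+1.
(* Chosen so that the threshold [mm / (25 N^2)] exceeds [(|B| + D1) / (4 d)]: the decrease then
   covers [B] and the general increase [D1]. *)
pose mm (d B : R) : R := 25 * (Nn d)%:R ^+ 2 * (k1 + 2 * Xs + (`|B| + D1) / (4 * d) + 1).
pose Est d B : R := n%:R ^+ 2 * mm d B ^+ 2.
(* The bound of [sup_bound] at a scale of small gradient and energy at most [e], multiplied by
   [4^(n+3)] for the zooms up to the next delayed scale. *)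
pose Sst (e : R) : R := 4 ^+ n.+3 * (k1 + 2 * Xs + 6 * (n%:R ^+ 2 + `|e|) + 1).
pose S0 : R := 4 ^+ n.+2 * `|M0| + 1.
pose E0 : R := \sum_(i < n) \sum_(j < n) (M0 * Kabs (Dx i (Dx j (@kap R n))) + 2 * Kabs (Xi (R := R) i j)) ^+ 2.
have S00 : 0 < S0 by rewrite ltr_wpDl// mulr_ge0// exprn_ge0.
have Sp e : 0 < Sst e.
  apply: mulr_gt0; first exact: exprn_gt0.
  have := sqr_ge0 (n%:R : R); have := normr_ge0 e; clear -kX; lra.
have [L HL] := @potential_bound R D1 (Ka (R := R) (n := n)) (2 * Ka (R := R) (n := n)) (@cnd R n) mst E0 S0 Est Sst
  D10 Ka0 (@cnd_gt0 R n) mst0 S00 Sp.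
pose K3' : R := `|@K3 R n T|; pose D := n%:R ^+ 2 * (24 * Ka (R := R) (n := n)).
have [C HC] := @growth_bound R K3' D Xs (n%:R ^+ 2 + L) (n%:R ^+ 2 + E0) (normr_ge0 _) Xs0.
exists (C + 2 * @KX R n) => v f A p vM k i j.
have M00 : 0 <= M0 by exact: le_trans (vM 0).
pose vv k := iter k zmv v; pose ff k := iter k zmg f; pose AA k := iter k zmA A.
have pk q : prob (vv q) (ff q) (AA q) by elim: q => // q IH; exact: prob_zmv IH.
have Rk q : RmB (vv q) T by rewrite TE; have [_] := iterate_zmv q (prob_base p) vM; exact.
pose Pk q := Pt (vv q) (ff q).
have mfk q := prob_mf (pk q). have f01k q := prob_f (pk q).
have E0le : energy (Pk 0%N) <= E0.
  apply: ler_sum => a _; apply: ler_sum => b _.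
  have nD : nice (Dx a (Dx b (@kap R n))) by apply/Cc_nice/Cc_D/Cc_D/ker_Cc/ker_kap.
  have [bv _ _ _] := prob_wsol p; have [mv _] := bv.
  have h1 := I_wle mv vM nD.
  have h2 : `|I (fun z => f z * Xi a b z)| <= Kabs (Xi a b).
    rewrite -[Kabs _]mul1r; apply: I_wle; [exact: prob_mf p| |exact: nice_Xi].
    by move=> z; have := prob_f p z; rewrite ler_norml; clear; lra.
  rewrite -real_normK ?num_real// lerXn2r ?nnegrE//.
    by rewrite addr_ge0 ?mulr_ge0 ?Kabs_ge0.
  apply: le_trans (ler_normB _ _) _; apply: lerD; first exact: h1.
  by rewrite normrM gtr0_norm// ler_pM2l.
pose ok q := Xn (vv q) <= Xs.
(* The supremum is watched [n + 2] scales ahead, where smallness of [bmass] at scale [q] has become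
   smallness of [amt]. *)
pose sup q s := forall z, Bx 1 z -> AA (n.+2 + q)%N z -> vv (n.+2 + q)%N z <= s.
have energy_le q : (forall l, (l < q)%N -> ok l) -> energy (Pk q) <= L.
  move=> okq.
  apply: (HL (fun q => energy (Pk q)) (fun q => amass (ff q)) (fun q => msum J.+1 (ff q)) ok sup) okq => {q}//.
  - by move=> q; exact: amass_bounds.
  - by move=> q; exact: msum_bounds.
  - by move=> q; exact: msum_step.
  - move=> q okq; have := energy_step (pk q) (Rk q) okq.
    have h : (@K1 R n T + 2 * Xs) * Ka (R := R) (n := n) <= (k1 + 2 * Xs) * Ka (R := R) (n := n).
      by rewrite ler_wpM2r// lerD2r.
    by rewrite -/(Pk q) -[Pt (zmv _) _]/(Pk q.+1) D1E; move: h; clear; move: (energy _) (energy _) => x y; lra.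
  - move=> q d B d0 okq ad; rewrite /Est => Eq.
    have N0 : 0 < (Nn d)%:R :> R by rewrite ltr0n.
    have Np : 0 < 25 * (Nn d)%:R ^+ 2 :> R by rewrite mulr_gt0// exprn_gt0.
    have B0 : 0 <= (`|B| + D1) / (4 * d) by rewrite divr_ge0 ?addr_ge0// mulr_ge0// ltW.
    have mm0 : 0 < mm d B by rewrite mulr_gt0//; clear -kX B0; lra.
    have [a [b hab]] := energy_entry mm0 Eq.
    have NK : @Kom R n * (2 * 10 ^+ n.+1) <= d / 2 * (Nn d)%:R.
      have : 2 / d * (@Kom R n * (2 * 10 ^+ n.+1)) < (Nn d)%:R.
        apply: lt_le_trans (archi_boundP _) _; last by rewrite ler_nat.
        by rewrite !mulr_ge0 ?Kom_ge0 ?exprn_ge0// invr_ge0 ltW.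
      move=> /ltW; rewrite -(ler_pM2l (_ : 0 < d / 2)) ?divr_gt0//.
      by rewrite [d / 2 * (2 / d * _)]mulrA (_ : d / 2 * (2 / d) = 1) ?mul1r//; field; rewrite gt_eqF.
    have kE : mm d B / (25 * (Nn d)%:R ^+ 2) = k1 + 2 * Xs + (`|B| + D1) / (4 * d) + 1.
      by rewrite /mm mulrAC mulfV ?mul1r// gt_eqF.
    have := energy_thick (pk q) (Rk q) okq d0 ad (ltn0Sn _) NK mm0 hab.
    rewrite kE => /(_ ltac:(clear -B0 k1E; lra)).
    have h : (@K1 R n T + 2 * Xs) * Ka (R := R) (n := n) <= (k1 + 2 * Xs) * Ka (R := R) (n := n).
      by rewrite ler_wpM2r// lerD2r.
    have h2 : 4 * d * ((`|B| + D1) / (4 * d)) = `|B| + D1 by field; rewrite gt_eqF.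
    have h3 : 0 <= 4 * d * (k1 + 2 * Xs + 1) by rewrite mulr_ge0 ?mulr_ge0 ?(ltW d0)//; clear -kX; lra.
    have h4 := ler_norm B.
    rewrite -/(Pk q) -[Pt (zmv _) _]/(Pk q.+1); move: h h2 h3 h4 D1E.
    move: (`|B|) (energy _) (energy _) (_ / (4 * d)) => bB x y w; clear; lra.
  - move=> q s s0 sq z zB zA; rewrite addnS /= /zmv ler_pM2l//.
    by apply: sq; [exact: Bx_half|move: zA; rewrite addnS].
  (* Either [bmass] is large and [msum] is at least [mst], or the phase is thin [n + 2] scales later
     and the supremum is halved. *)
  - move=> q s s0 sq; have [h|h] := leP dm (bmass (ff q)); first by right; exact: Hmst.
    left => z zB zA; have ha : amt (ff (n.+2 + q)%N) <= dt0.
      rewrite /ff iterD; apply: le_trans (amt_iter (mfk q) (f01k q)) _.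
      by rewrite mulrC -ler_pdivlMr// -dmE ltW.
    have := Hthin _ _ _ _ (pk _) ha s0 sq z zB; rewrite addnS; apply.
    by move: zA; rewrite addnS.
  - move=> q s s0 sq; have [z [zB zA zv]] := nondegenerate (pk (n.+2 + q)%N).
    by apply: le_trans (ltW zv) _; exact: sq.
  - move=> q e okq Eq z zB zA.
    have E3 : (n.+2 + q.+1)%N = (n.+3 + q)%N by rewrite addnS.
    rewrite E3 in zA *; rewrite /vv iterD -/(vv q).
    have [y yB [-> yA]] := iter_zmv_val n.+3 (vv q) zB.
    rewrite /Sst ler_wpM2l ?exprn_ge0//.
    have := sup_bound (pk q) (Rk q) yB; have := energy_ell (Pk q); have := ler_norm e.
    move: okq; rewrite /ok; rewrite -/(Pk q); fast_lra.
  - move=> z zB zA; have [y yB [e _]] := iter_zmv_val n.+2 v zB.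
    have -> : vv (n.+2 + 0)%N z = 4 ^+ n.+2 * v y by rewrite addn0.
    rewrite /S0; have : v y <= `|M0| by apply: le_trans (ler_norm _) _; apply: le_trans (vM y) (ler_norm _).
    move=> h; have h4 : 0 <= 4 ^+ n.+2 :> R by rewrite exprn_ge0.
    have := ler_wpM2l h4 h; fast_lra.
have ell_le q : ell (Pk q) <= C.
  apply: (HC (fun q => ell (Pk q)) (fun q => Xn (vv q))) => {q}.
  - by move=> q; exact: ell_ge0.
  - move=> q Xq; have := Xn_step (pk q); rewrite -[zmv _]/(vv q.+1); move: Xq XsE; clear; lra.
  - move=> q Xq; have X0 : 0 < Xn (vv q) := lt_trans Xs0 Xq.
    apply: le_trans (ell_step (pk q) (Rk q) X0) _; rewrite lerD2l.
    apply: ler_wpM2r; first by rewrite invr_ge0 ltW.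
    by apply: ler_wpM2r; [have := ell_ge0 (Pk q); clear; lra|exact: ler_norm].
  - by move=> q _; exact: ell_crude (pk q).
  - by move=> q okq; apply: le_trans (energy_ell _) _; rewrite lerD2l; exact: energy_le.
  - by apply: le_trans (energy_ell _) _; rewrite lerD2l.
have h1 : `|Pk k i j| <= C.
  apply: le_trans (ell_le k); rewrite /ell.
  exact: (@entry_le_sum (fun a b => `|Pk k a b|) i j (fun a b => normr_ge0 _)).
have h2 : `|I (fun z => ff k z * Xi i j z)| <= @KX R n.
  apply: (@le_trans _ _ (Kabs (Xi i j))).
    rewrite -[Kabs _]mul1r; apply: I_wle; [exact: mfk| |exact: nice_Xi].
    by move=> z; have := f01k k z; rewrite ler_norml; clear; lra.
  exact: (@entry_le_sum (fun a b => Kabs (Xi a b)) i j (fun a b => Kabs_ge0 _)).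
have -> : PP kap (iter k zmv v) i j = Pk k i j + 2 * I (fun z => ff k z * Xi i j z) by rewrite /Pk /Pt /vv; ring.
apply: le_trans (ler_normD _ _) _; rewrite lerD// normrM gtr0_norm// ler_pM2l//.
Qed.

End masses.

(** * Strong solutions are weak solutions *)

Section bridge.
Context {R : realType} {n : nat}.
Local Notation V := ('rV[R]_n * R)%type.
Local Notation mV := ('rV[R]_n * measurableTypeR R)%type.
Local Notation mu := (@spacetime_measure R n).
Implicit Types (z w h : V).

Lemma continuous_affV l m (z0 : V) : continuous (affV l m z0 : V -> V).
Proof.
move=> z; apply/(@cvgrPdist_lt R V _ (nbhs z)) => e e0.
have S0 : 0 < `|l| + `|m| + 1 by rewrite ltr_wpDl// addr_ge0.
have d0 : 0 < e / (`|l| + `|m| + 1) by rewrite divr_gt0.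
apply: filterS (nbhsx_ballx z _ d0) => y; rewrite -ball_normE /= normV gt_max /= => /andP[h1 h2].
have -> : affV l m z0 z - affV l m z0 y = (l *: (z.1 - y.1), m * (z.2 - y.2)).
  by apply: injective_projections => /=; rewrite opprD addrACA subrr addr0 ?scalerBr ?mulrBr.
rewrite normV gt_max /= normrZ normrM.
move: h1 h2; rewrite !ltr_pdivlMr//; move: `|l| `|m| (normr_ge0 l) (normr_ge0 m) => a b a0 b0.
move: `|_| `|_| (normr_ge0 (z.1 - y.1)) (normr_ge0 (z.2 - y.2)) => c d c0 d0' h1 h2.
by apply/andP; split; nra.
Qed.

Lemma Hs_affV r (q : V) (k : V -> R) z : Sm k ->
  Hs (fun w => k (affV r^-1 (r ^- 2) q w)) z = r ^- 2 * Hs k (affV r^-1 (r ^- 2) q z).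
Proof.
move=> Sk; have Dxa (f : V -> R) i : Sm f ->
    Dx i (fun w => f (affV r^-1 (r ^- 2) q w)) = fun w => r^-1 * Dx i f (affV r^-1 (r ^- 2) q w).
  move=> Sf; apply/funext => w; rewrite /Dx D_affV -D_scale_dir; last exact: Sm_diff.
  by congr ('D_ _ _ _); apply: injective_projections => //=; rewrite mulr0 scaler0.
have Dta : Dt (fun w => k (affV r^-1 (r ^- 2) q w)) z = r ^- 2 * Dt k (affV r^-1 (r ^- 2) q z).
  rewrite /Dt D_affV -D_scale_dir; last exact: Sm_diff.
  by congr ('D_ _ _ _); apply: injective_projections => //=; rewrite !scaler0.
rewrite /Hs mulrDr Dta; congr (_ + _); rewrite mulr_sumr; apply: eq_bigr => i _.
rewrite Dxa// Dx_Z; last by apply: diff_affV; apply: Sm_diff; exact: Sm_Dx.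
by rewrite Dxa; [rewrite mulrA -invfM -expr2|exact: Sm_Dx].
Qed.

(* The time shift by [e] makes the support compact in [D]: a kernel only vanishes to infinite order at time 0. *)
Lemma wsol_test (D : set V) (v g : V -> R) : open D -> bm v -> mfun g -> (forall z, `|g z| <= 1) ->
  (forall k r q, ker k -> 0 < r -> test_function D (fun w => k (affV r^-1 (r ^- 2) q w)) ->
    I (fun z => v z * Hs (fun w => k (affV r^-1 (r ^- 2) q w)) z) =
    I (fun z => g z * k (affV r^-1 (r ^- 2) q z))) -> wsol D v g.
Proof.
move=> oD bv mg g1 H; split => // k kk r p r0 KD.
have bg : bm g by split => //; exists 1.
have rn0 : r != 0 by rewrite gt_eqF.
have r2n0 : r ^+ 2 != 0 by rewrite expf_neq0.
have Ck := ker_Cc kk; have Sk := kk.1.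
have CHk : Cc (Hs k) by exact: Cc_Hs.
pose F e := I (fun z => v (affV r (r ^+ 2) p z) * Hs k (z + e *: tdir)).
pose G e := I (fun z => g (affV r (r ^+ 2) p z) * k (z + e *: tdir)).
have FG e : 0 < e -> e <= 1 -> F e = r ^+ 2 * G e.
  move=> e0 e1; pose q : V := (- (r^-1 *: p.1), - (r ^- 2 * p.2) + e).
  have qE z : affV r^-1 (r ^- 2) q (affV r (r ^+ 2) p z) = z + e *: tdir.
    apply: injective_projections => /=.
      by rewrite scaler0 scalerDr scalerA mulVf// scale1r addrK addr0.
    by rewrite /GRing.scale /=; move: (r ^+ 2) r2n0 => s s0; field.
  have qK z : affV r (r ^+ 2) p (affV r^-1 (r ^- 2) q z - e *: tdir) = z.
    apply: injective_projections => /=.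
      by rewrite scaler0 subr0 scalerDr scalerA divff// scale1r scalerN scalerA divff// scale1r subrK.
    by rewrite /GRing.scale /=; move: (r ^+ 2) r2n0 => s s0; field.
  have T : test_function D (fun w => k (affV r^-1 (r ^- 2) q w)).
    split; first by apply: smooth_affV; exact: Sm_smooth.
    (* Before the dilation the image of the unit box is [|x| <= 2], [-4 <= t <= - e]: a compact part
       of [KB4] containing the support of the shifted kernel. *)
    exists ((fun z => affV r (r ^+ 2) p (affV 2 (2 - e / 2) (0, - (2 + e / 2)) z)) @` [set z : V | inb 1 z]).
    split.
    - apply: continuous_compact; last exact: compact_inb.
      apply: continuous_subspaceT => z.
      by apply: continuous_comp; exact: continuous_affV.
    - rewrite ((interior_id D).1 oD) => _ [z [z1 z2] <-]; apply: KD.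
      rewrite /KB4 /= addr0 normrZ; move: z2; rewrite ler_norml (ger0_norm (ler0n _ 2)) => /andP[a b].
      by split; [fast_lra|nra].
    - move=> w nw; apply: contrapT => /eqP kn; apply: nw.
      have [h1 h2] := kk.2 _ kn; set y := affV r^-1 _ q w in h1 h2.
      have Y2 : `|(y.2 - e + 2 + e / 2) / (2 - e / 2)| <= 1.
        move: (y.2) h2 => b h2; rewrite normrM normfV (gtr0_norm (_ : 0 < 2 - e / 2)); last by fast_lra.
        by rewrite ler_pdivrMr; [rewrite ler_norml; fast_lra|fast_lra].
      have d0 : 2 - e / 2 != 0 by rewrite gt_eqF//; fast_lra.
      exists (2^-1 *: y.1, (y.2 - e + 2 + e / 2) / (2 - e / 2)) => /=; last first.
        rewrite -[RHS]qK -/y; congr (affV _ _ _ _).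
        apply: injective_projections => /=.
          by rewrite scalerA divff// scale1r addr0 scaler0 subr0.
        by rewrite mulrC divfK// /GRing.scale /=; fast_lra.
      by split => //=; rewrite normrZ gtr0_norm ?invr_gt0//; fast_lra.
  have := H k r q kk r0 T.
  rewrite (_ : (fun z => v z * _) = (fun z => r ^- 2 * (v z * Hs k (affV r^-1 (r ^- 2) q z)))); last first.
    by apply/funext => z; rewrite Hs_affV// mulrCA.
  have rV0 : r^-1 != 0 by rewrite invr_neq0.
  have r2V0 : r ^- 2 != 0 by rewrite invr_neq0.
  have N1 : nice (fun z => v z * Hs k (affV r^-1 (r ^- 2) q z)).
    by apply: nice_mul => //; apply: nice_affV => //; exact: Cc_nice.
  have N2 : nice (fun z => g z * k (affV r^-1 (r ^- 2) q z)).
    by apply: nice_mul => //; apply: nice_affV => //; exact: Cc_nice.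
  rewrite I_Z// => E; have := I_affV p rn0 r2n0 N1; have := I_affV p rn0 r2n0 N2.
  rewrite /F /G.
  rewrite (_ : (fun z => v _ * _) = fun z => v (affV r (r ^+ 2) p z) * Hs k (z + e *: tdir)); last first.
    by apply/funext => z; rewrite qE.
  rewrite (_ : (fun z => g _ * _) = fun z => g (affV r (r ^+ 2) p z) * k (z + e *: tdir)); last first.
    by apply/funext => z; rewrite qE.
  move=> -> ->; rewrite -E; move: (I _) (_ * `|_|^-1) => a c; by field.
have lip (w f : V -> R) : bm w -> Cc f -> exists2 C, 0 <= C & forall e, 0 < e -> e <= 1 ->
   `|I (fun z => w (affV r (r ^+ 2) p z) * f (z + e *: tdir)) - I (fun z => w (affV r (r ^+ 2) p z) * f z)| <= C * e.
  move=> bw Cf; have [C C0 L] := Cc_lip tdir Cf.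
  have [mw [M wM]] := bw; have M0 : 0 <= M by apply: le_trans (wM 0).
  have [s fs] := Cf.2.
  exists (M * C * (2 * (`|s| + 1)) ^+ n.+1); first by rewrite !mulr_ge0// exprn_ge0// mulr_ge0// addr_ge0.
  move=> e e0 e1; have bw' := bm_affV r (r ^+ 2) p bw.
  have N1 : nice (fun z : V => f (z + e *: tdir)) by apply: nice_shift; exact: Cc_nice.
  rewrite -I_B; [|exact: nice_mul|by apply: nice_mul => //; exact: Cc_nice].
  rewrite mulrAC; apply: I_bound => //.
  - by have [] := niceB (nice_mul bw' N1) (nice_mul bw' (Cc_nice Cf)).
  - move=> z; rewrite -mulrBr normrM -mulrA; apply: ler_pM => //.
    by apply: L; exact: ltW.
  - move=> z; rewrite -mulrBr mulf_eq0 negb_or subr_eq0 => /andP[_ ne].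
    have [fz|/fs[a b]] := eqVneq (f z) 0.
      have /fs[a b] : f (z + e *: tdir) != 0 by move: ne; rewrite fz.
      have := ler_norm s; move: a b; rewrite /= scaler0 addr0 /GRing.scale /= mulr1 => a b c.
      split; first fast_lra.
      by move: b; rewrite !ler_norml; fast_lra.
    by have := ler_norm s; split; fast_lra.
have [C1 C10 L1] := lip v (Hs k) bv CHk.
have [C2 C20 L2] := lip g k bg Ck.
apply/eqP; rewrite -subr_eq0 -normr_le0; apply: le_eps => e e0.
pose S := C1 + r ^+ 2 * C2 + 1; have S0 : 0 < S.
  by rewrite ltr_wpDl// addr_ge0// mulr_ge0// sqr_ge0.
pose d := Num.min 1 (e / S); have d0 : 0 < d by rewrite lt_min ltr01 divr_gt0.
have d1 : d <= 1 by rewrite ge_min lexx.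
have dS : d * S <= e by rewrite -ler_pdivlMr// ge_min lexx orbT.
have {L1} := L1 d d0 d1; have {L2} := L2 d d0 d1; have := FG d d0 d1; rewrite /F /G.
move: (I _) (I _) (I _) (I _) => a b a' b' E Lb La.
rewrite add0r; apply: le_trans dS.
have -> : a - r ^+ 2 * b = r ^+ 2 * (a' - b) - (b' - a) by rewrite E; ring.
apply: (le_trans (ler_normB _ _)); rewrite normrM (ger0_norm (sqr_ge0 r)).
have : r ^+ 2 * `|a' - b| <= r ^+ 2 * (C2 * d) by rewrite ler_wpM2l ?sqr_ge0.
by rewrite /S; move: (r ^+ 2) La => t; nra.
Qed.

Lemma I_mkcond (D : set V) (f h : V -> R) : (forall z, D z -> h z = f z) -> (forall z, ~ D z -> h z = 0) ->
  \int[mu]_(z in D) f z = I h.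
Proof.
move=> h1 h2; rewrite Rintegral_mkcond /I; apply: eq_Rintegral => z _.
rewrite patchE; case: ifPn => [/set_mem/h1//|/negP nz].
by rewrite h2// => Dz; apply: nz; rewrite inE.
Qed.

(** On the bounded support of [k], [|f|] is at most [1 + |f|^q], which is integrable. *)
Lemma Lfun_mul_nice (q : R) (f k : V -> R) : 1 <= q -> (f : mV -> R) \in Lfun mu q%:E -> nice k ->
  mu.-integrable setT (EFin \o ((fun z => f z * k z) : mV -> R)).
Proof.
move=> q1 Lf nk; have mf := sub_Lfun_mfun Lf; rewrite inE /= in mf.
have [mk [M HM]] := nk; have M0 : 0 <= M by apply: le_trans (HM (0, 0)).1.
have iq := Lfun_integrable q1 Lf.
have nb : nice (\1_(@box R n M) : V -> R) by apply: (@nice_indic _ _ _ M) => //; exact: measurable_box.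
have i2 : mu.-integrable setT (fun z : mV => (M * (\1_(@box R n M) z + `|f z| `^ q))%:E).
  rewrite (_ : (fun z => _) = (fun z => M%:E * (EFin \o (\1_(@box R n M) : mV -> R) \+ (fun x : mV => (`|f x| `^ q)%:E)) z)%E).
    by apply: integrableZl => //; apply: integrableD => //; exact: nice_integrable.
  by apply/funext => z; rewrite EFinM.
apply: le_integrable i2 => //; first by apply/measurable_EFinP; exact: mfunM.
move=> z _; rewrite lee_fin normrM.
have p0 : 0 <= `|f z| `^ q by exact: powR_ge0.
have i0 : 0 <= \1_(@box R n M) z :> R by rewrite indicE.
rewrite [leRHS]ger0_norm; last by rewrite mulr_ge0// addr_ge0.
have [-> |kz] := eqVneq (k z) 0; first by rewrite normr0 mulr0 mulr_ge0// addr_ge0.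
have -> : \1_(@box R n M) z = 1 :> R by rewrite indicE mem_set//; exact: (HM z).2.
rewrite mulrC; apply: ler_pM => //; first exact: (HM z).1.
have [f1|/ltW f1] := lerP `|f z| 1; first by rewrite (le_trans f1)// lerDl.
by have := ler_powR f1 q1; rewrite powRr1// => h; rewrite (le_trans h)// lerDr.
Qed.

Lemma hysteresis_pm U T alpha beta (h0 : 'rV[R]_n -> R) (u : V -> R) z :
  (forall x, U x -> relay alpha beta (u (x, 0)) (h0 x)) -> cylinder U T z ->
  hysteresis U T alpha beta h0 u z = -1 \/ hysteresis U T alpha beta h0 u z = 1.
Proof.
move=> H [Uz _]; have [h1 _ _] := H _ Uz.
by rewrite /hysteresis; case: ifP => _ /=; case: ifP => // _; case: ifP; auto.
Qed.

(** The weak derivatives may be tested with dilated kernels that are test functions of the open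
    cylinder, and [wsol_test] extends this to all kernels. Extending [u] by 0 makes it bounded and
    measurable on the whole space. *)
Lemma bridge (U : set 'rV[R]_n) (T alpha beta q M : R) (h0 : 'rV[R]_n -> R) (u : V -> R) :
  open U -> 1 <= q -> strong_solution U T alpha beta q h0 u ->
  (forall z, cylinder U T z -> `|u z| <= M) -> 0 <= M ->
  exists2 g, wsol [set z | U z.1 /\ 0 < z.2 < T] (u \_ (cylinder U T)) g &
    {ae mu, forall z, cylinder U T z -> g z = hysteresis U T alpha beta h0 u z}.
Proof.
move=> oU q1 [_ H0 [ut [D2u [[Lu Lt L2 Wt W2] AE]]]] uM M0.
set Q := cylinder U T.
have mLq (f : V -> R) : Lq Q q f -> mfun (f \_ Q) by move=> /sub_Lfun_mfun; rewrite inE.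
have bu : bm (u \_ Q).
  split; first exact: mLq.
  exists M => z; rewrite patchE; case: ifPn => [/set_mem/uM//|_]; by rewrite normr0.
pose g0 z := \sum_i (D2u i i \_ Q) z - (ut \_ Q) z.
(* The truncation changes [g0] on a null set only, as the relay takes the values 1 and -1. It gives
   the bound at every point that [wsol] asks for. *)
pose g z := Num.max (-1) (Num.min 1 (g0 z)).
have mg0 : mfun g0.
  apply: measurable_funB; last exact: mLq.
  by apply: measurable_sum => i; exact: mLq.
have mg : mfun g by apply: measurable_maxr => //; exact: measurable_minr.
have g1 z : `|g z| <= 1.
  by rewrite ler_norml /g le_max lexx /= ge_max; apply/andP; split; [lra|rewrite ge_min lexx].
have gQ : {ae mu, forall z, g z = g0 z /\ (Q z -> g z = hysteresis U T alpha beta h0 u z)}.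
  apply: ae_S AE => z AE; have [Qz|nQ] := pselect (Q z); last first.
    split => //; rewrite /g (_ : g0 z = 0).
      by rewrite (min_idPr _)// ?ler01// (max_idPr _)// lerN10.
    rewrite /g0 patchN ?subr0; last by apply/negP => /set_mem.
    by apply: big1 => i _; rewrite patchN//; apply/negP => /set_mem.
  have E : g0 z = hysteresis U T alpha beta h0 u z.
    rewrite -(AE Qz) /g0 patchT ?inE//; congr (_ - _).
    by apply: eq_bigr => i _; rewrite patchT ?inE.
  suff : g z = g0 z by move=> ->; split.
  rewrite /g E; case: (hysteresis_pm H0 Qz) => ->.
    by rewrite (min_idPr _)// ?maxxx//; lra.
  by rewrite minxx (max_idPr _)//; lra.
exists g; last by apply: ae_S gQ => z [].
have oD : open [set z : V | U z.1 /\ 0 < z.2 < T].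
  rewrite (_ : [set z | _] = fst @^-1` U `&` (snd @^-1` [set t : R | 0 < t] `&` snd @^-1` [set t : R | t < T])).
    apply: openI; first by apply: open_comp => // z _; exact: cvg_fst.
    by apply: openI; apply: open_comp => [z _|]; [exact: cvg_snd|exact: open_gt|exact: cvg_snd|exact: open_lt].
  by apply/seteqP; split=> z /=; [move=> [? /andP[]]|move=> [? [-> ->]]].
have DQ : [set z : V | U z.1 /\ 0 < z.2 < T] `<=` Q by move=> z [? /andP[? /ltW ?]]; split => //; apply/andP.
apply: wsol_test => // k r p kk r0 tD.
set phi := fun w => _ in tD *.
have tQ : test_function Q phi.
  split; first exact: tD.1.
  have [K [cK KD K0]] := tD.2; exists K; split => //.
  by apply: subset_trans KD _; exact: interiorS.
have rV0 : r^-1 != 0 by rewrite invr_neq0// gt_eqF.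
have r2V0 : r ^- 2 != 0 by rewrite invr_neq0// expf_neq0// gt_eqF.
have Ck := ker_Cc kk.
have nphi : nice phi by apply: nice_affV => //; exact: Cc_nice.
have Dphi d f : Cc f -> 'D_d (fun w => f (affV r^-1 (r ^- 2) p w)) =
     fun w => 'D_(r^-1 *: d.1, r ^- 2 * d.2) f (affV r^-1 (r ^- 2) p w).
  by move=> Cf; apply/funext => w; exact: D_affV.
have nD d f : Cc f -> nice ('D_d (fun w => f (affV r^-1 (r ^- 2) p w))).
  by move=> Cf; rewrite Dphi//; exact: (nice_affV p rV0 r2V0 (Cc_nice (Cc_D (r^-1 *: d.1, r ^- 2 * d.2) Cf))).
have nt : nice (Dt phi) by exact: nD.
have nx i : nice (Dx i (Dx i phi)) by rewrite /Dx /phi Dphi//; exact: (nD _ ('D_(r^-1 *: (xdir i).1, r ^- 2 * (xdir i).2) k) (Cc_D _ Ck)).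
have EQ (f h : V -> R) : \int[mu]_(z in Q) (f z * h z) = I (fun z => (f \_ Q) z * h z).
  apply: I_mkcond => z Qz; first by rewrite patchT ?inE.
  by rewrite patchN ?mul0r//; apply/negP => /set_mem.
have Et := Wt _ tQ; rewrite !EQ in Et.
have Ex i := W2 i i _ tQ.
have Ii i := Lfun_mul_nice q1 (L2 i i) nphi.
have It := Lfun_mul_nice q1 Lt nphi.
have key : I (fun z => g0 z * phi z) = \sum_i I (fun z => (D2u i i \_ Q) z * phi z) - I (fun z => (ut \_ Q) z * phi z).
  rewrite (_ : (fun z => g0 z * phi z) = (fun z => \sum_i ((D2u i i \_ Q) z * phi z) - (ut \_ Q) z * phi z)); last first.
    by apply/funext => z; rewrite mulrBl mulr_suml.
  have [iS ->] : mu.-integrable setT (EFin \o ((fun z => \sum_i ((D2u i i \_ Q) z * phi z)) : mV -> R)) /\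
     \sum_i I (fun z => (D2u i i \_ Q) z * phi z) = I (fun z => \sum_i ((D2u i i \_ Q) z * phi z)).
    rewrite (_ : (fun z => \sum_i _) = \sum_i ((fun z => (D2u i i \_ Q) z * phi z) : V -> R)); last first.
      by apply/funext => z; rewrite fct_sumE.
    elim/big_rec2 : _ => [|j x y _ [nx' ->]].
      by split; [apply: nice_integrable; exact: nice0|rewrite -[LHS](@I_0 R n)].
    split; last by rewrite /I -RintegralD.
    exact: (integrableD measurableT (Ii j) nx').
  by rewrite /I -RintegralB.
have -> : I (fun z => g z * phi z) = I (fun z => g0 z * phi z).
  rewrite /I /Rintegral; congr fine; apply: ae_eq_integral => //.
  - by apply/measurable_EFinP; apply: mfunM => //; have [] := nphi.
  - by apply/measurable_EFinP; apply: mfunM => //; have [] := nphi.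
  - by apply: ae_S gQ => z [-> _] _.
rewrite key -[X in _ - X]opprK -Et opprK.
rewrite (_ : \sum_i _ = \sum_i I (fun z => (u \_ Q) z * Dx i (Dx i phi) z)); last first.
  by apply: eq_bigr => i _; rewrite -!EQ -Ex.
rewrite (_ : (fun z => _ * Hs phi z) = (fun z => \sum_i ((u \_ Q) z * Dx i (Dx i phi) z) + (u \_ Q) z * Dt phi z)); last first.
  by apply/funext => z; rewrite /Hs mulrDr mulr_sumr.
rewrite I_D; [|by apply: nice_sum => i; apply: nice_mul|exact: nice_mul].
by rewrite I_sum// => i; exact: nice_mul.
Qed.

Lemma wsol_add (D : set V) (v g : V -> R) c s : wsol D v g -> `|s| <= 1 -> wsol D (fun z => s * v z + c) (fun z => s * g z).
Proof.
move=> [bv mg g1 H] s1; split.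
- by apply: bmD; [apply: bmM|]; [exact: bm_cst| |exact: bm_cst].
- by apply: mfunM => //; exact: measurable_cst.
- by move=> z; rewrite normrM; apply: mulr_ile1.
- move=> k kk r p r0 KD.
  have nh := nice_Hs kk; have bv' := bm_affV r (r ^+ 2) p bv.
  have nk := Cc_nice (ker_Cc kk).
  have bg' : bm (fun z => g (affV r (r ^+ 2) p z)) by apply: bm_affV; split => //; exists 1.
  rewrite (_ : (fun z => _ * Hs k z) = fun z => s * (v (affV r (r ^+ 2) p z) * Hs k z) + c * Hs k z); last first.
    by apply/funext => z; rewrite mulrDl mulrA.
  rewrite (_ : (fun z => _ * k z) = fun z => s * (g (affV r (r ^+ 2) p z) * k z)); last first.
    by apply/funext => z; rewrite mulrA.
  rewrite I_D; [|by apply: niceZ; exact: nice_mul|exact: niceZ].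
  rewrite !I_Z//; [|exact: nice_mul|exact: nice_mul].
  by rewrite I_Hs ?mulr0 ?addr0; [rewrite H// mulrCA|exact: ker_Cc].
Qed.
End bridge.

(** * Hysteresis and free boundary *)

Section columns.
Context {R : realType} {n : nat}.
Local Notation V := ('rV[R]_n * R)%type.
Local Notation mV := ('rV[R]_n * measurableTypeR R)%type.
Local Notation mu := (@spacetime_measure R n).
Implicit Types (z w h : V).

(* [col_loc] encodes the absence of vertical parts: where [v > 0], the phase cannot switch. *)
Record col (G : set V) (v f : V -> R) (A : set V) : Prop := Col {
  col_wsol : wsol G v (fun z => 2 * f z - 1);
  col_mf : mfun f;
  col_f : forall z, 0 <= f z <= 1;
  col_ae : {ae mu, forall z, G z -> (A z -> f z = 1) /\ (~ A z -> f z = 0)};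
  col_open : forall z, G z -> exists2 d, 0 < d & forall w, `|w - z| < d -> G w;
  col_cont : forall z, G z -> ccont v z;
  col_out : forall z, G z -> v z <= 0 -> ~ A z;
  col_loc : forall z, G z -> 0 < v z -> exists2 d, 0 < d &
    (forall w, `|w - z| < d -> A w) \/ (forall w, `|w - z| < d -> ~ A w);
  col_back : forall x (s t : R), s < t -> (forall c, s <= c <= t -> G (x, c)) -> A (x, t) -> A (x, s) }.

Definition edge (A : set V) z := forall d, 0 < d ->
  (exists2 w, `|w - z| < d & A w) /\ (exists2 w, `|w - z| < d & ~ A w).

Lemma aff_dist r p (z w : V) : 0 < r -> r <= 1 ->
  `|affV r (r ^+ 2) p w - affV r (r ^+ 2) p z| <= `|w - z|.
Proof.
move=> r0 r1; have r20 : 0 < r ^+ 2 by rewrite exprn_gt0.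
have r21 : r ^+ 2 <= 1 by rewrite exprn_ile1// ltW.
have -> : affV r (r ^+ 2) p w - affV r (r ^+ 2) p z = (r *: (w.1 - z.1), r ^+ 2 * (w.2 - z.2)).
  by apply: injective_projections => /=; rewrite opprD addrACA subrr addr0 ?scalerBr ?mulrBr.
rewrite normV ge_max /= normrZ normrM (gtr0_norm r0) (gtr0_norm r20).
have := normV1 (w - z); have := normV2 (w - z) => /= h1 h2; apply/andP; split.
  by apply: le_trans h2; rewrite ler_piMl.
by apply: le_trans h1; rewrite ler_piMl.
Qed.

Lemma ccont_zm r p (v : V -> R) t : 0 < r -> r <= 1 -> ccont v (affV r (r ^+ 2) p t) -> ccont (zm r p v) t.
Proof.
move=> r0 r1 cv e e0; have r20 : 0 < r ^+ 2 by rewrite exprn_gt0.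
have er : 0 < r ^+ 2 * e by rewrite mulr_gt0.
have [d d0 Hd] := cv _ er; exists d => // h hd.
rewrite /zm -mulrBr normrM [`|_ ^- 2|]gtr0_norm ?invr_gt0// ler_pdivrMl//.
have := Hd (affV r (r ^+ 2) p (t + h) - affV r (r ^+ 2) p t); rewrite [_ + (_ - _)]addrC subrK; apply.
by apply: le_lt_trans hd; have := aff_dist p t (t + h) r0 r1; rewrite [t + h - t]addrC addKr.
Qed.

Lemma ccont_lcont (v : V -> R) z : ccont v z -> lcont v z.
Proof. by move=> H e e0; have [d d0 Hd] := H e e0; exists d => // h hd _; exact: Hd. Qed.

(** Where [v] is positive [A] cannot switch, by [col_loc]; where [v] is negative, it is so nearby,
    and [A] is absent. *)
Lemma edge_zero G v f A z : col G v f A -> G z -> edge A z -> v z = 0.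
Proof.
move=> C Gz E; apply/le_anti/andP; split.
- rewrite leNgt; apply/negP => /(col_loc C Gz)[d d0 [] H].
    by have [_ [w /H]] := E d d0.
  by have [[w /H]] := E d d0.
- rewrite leNgt; apply/negP => v0.
  have [|d d0 Hd] := col_cont C Gz (e := - v z / 2); first by lra.
  have [d' d'0 HG] := col_open C Gz.
  have [[w]] := E (Num.min d d') ltac:(by rewrite lt_min d0).
  rewrite lt_min => /andP[w1 w2] Aw _; apply: (col_out C (HG _ w2)) Aw.
  have := Hd (w - z) w1; rewrite [z + _]addrC subrK ler_norml; lra.
Qed.

Lemma dens_aff G (f : V -> R) (A : set V) z r : bm f -> 0 < r ->
  {ae mu, forall z, G z -> A z -> f z = 0} -> (forall t, Bx 8 t -> G (affV r (r ^+ 2) z t)) ->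
  (forall z, 0 <= f z) ->
  dens (fun t => f (affV r (r ^+ 2) z t)) (~` (fun t => A (affV r (r ^+ 2) z t))).
Proof.
move=> bf r0 ae BG f0 k nk kout kpos; have [k' [nk' k'1 k'2 k'I]] := pullback z r0 nk.
rewrite k'I//; apply: mulr_ge0; first by rewrite mulr_ge0// ?invr_ge0 ?exprn_ge0// ltW// ?invr_gt0.
rewrite -(@I_0 R n); apply: I_le_ae; [exact: nice0|exact: nice_mul|].
apply: ae_S ae => y Hy; have [->|/k'2[t kt yE]] := eqVneq (k' y) 0; first by rewrite mulr0.
have Bt : Bx 8 t by apply: contrapT => /kout/eqP; rewrite (negbTE kt).
have [Ay|nAy] := pselect (A y).
  by rewrite Hy ?mul0r// yE; exact: BG.
by rewrite mulr_ge0// yE k'1; apply: kpos => //=; rewrite -yE.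
Qed.

(** [col_loc] gives both that [A] is open where [v > 0] and that [v <= 0] at limits of [A] outside
    [A]. *)
Lemma prob_of_col G v f A z r : col G v f A -> G z -> edge A z -> 0 < r -> r <= 1 ->
  (forall t, Bx 8 t -> G (affV r (r ^+ 2) z t)) ->
  prob (zm r z v) (fun t => f (affV r (r ^+ 2) z t)) [set t | A (affV r (r ^+ 2) z t)].
Proof.
move=> C Gz E r0 r1 BG; have bf := bm01 (col_mf C) (col_f C).
have cl t : Bx 8 t -> 0 < zm r z v t -> exists2 d, 0 < d &
    (forall w, `|w - t| < d -> A (affV r (r ^+ 2) z w)) \/ (forall w, `|w - t| < d -> ~ A (affV r (r ^+ 2) z w)).
  move=> /BG Gt; rewrite pmulr_rgt0 ?invr_gt0 ?exprn_gt0// => /(col_loc C Gt)[d d0 H].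
  have ad w : `|w - t| < d -> `|affV r (r ^+ 2) z w - affV r (r ^+ 2) z t| < d.
    by apply: le_lt_trans; exact: aff_dist.
  by exists d => //; case: H => H; [left|right] => w /ad/H.
have vpos t : Bx 8 t -> A (affV r (r ^+ 2) z t) -> 0 < zm r z v t.
  move=> Bt At; rewrite pmulr_rgt0 ?invr_gt0 ?exprn_gt0// ltNge; apply/negP => h.
  exact: (col_out C (BG _ Bt) h).
have vc t : Bx 8 t -> ccont (zm r z v) t by move=> Bt; apply: ccont_zm => //; apply: (col_cont C); exact: BG.
have a0 : affV r (r ^+ 2) z 0 = z :> V by apply: injective_projections; rewrite /= ?scaler0 ?mulr0 add0r.
split.
- by apply: wsolW (wsol_zm z r0 (col_wsol C)) => t /BG.
- by have [] := bm_affV r (r ^+ 2) z bf.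
- by move=> t; exact: (col_f C).
- have := @dens_aff G f (~` A) z r bf r0; rewrite /dens /setC /=; move=> H k nk k0 kp; apply: H => //.
  + by apply: ae_S (col_ae C) => y Hy Gy; exact: (Hy Gy).2.
  + by move=> y; have /andP[] := col_f C y.
  + by move=> y yB /contrapT; exact: kp.
- apply: (@dens_aff G (fun t => 1 - f t) A z r) => //.
  + have := bmD (bm_cst 1) (bmM (bm_cst (-1)) bf); congr bm; apply/funext => y; ring.
  + by apply: ae_S (col_ae C) => y Hy Gy Ay; rewrite (Hy Gy).1// subrr.
  + by move=> y; rewrite subr_ge0; have /andP[] := col_f C y.
- move=> t Bt At; have [d d0 [H|H]] := cl t Bt (vpos t Bt At); first by exists d.
  by have := H t; rewrite subrr normr0 => /(_ d0).
- exact: vpos.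
- move=> t Bt nAt H; rewrite leNgt; apply/negP => /(cl t Bt)[d d0 [K|K]].
    by have := K t; rewrite subrr normr0 => /(_ d0).
  by have [w [_ Aw wt]] := H d d0; exact: (K w wt).
- exact: vc.
- by apply: lcont_zm => //; rewrite a0; apply: ccont_lcont; exact: (col_cont C).
- by rewrite /zm a0 (edge_zero C Gz E) mulr0.
(* Points of [A] near [z] may be later than [z]; [col_back] moves them along their column to the
   time [z.2 - e]. *)
- move=> d d0; have [p p0 HG] := col_open C Gz.
  have r20 : 0 < r ^+ 2 by rewrite exprn_gt0.
  pose e := Num.min (r * d) (Num.min (r ^+ 2 * d ^+ 2 / 2) (p / 2)).
  have e0 : 0 < e by rewrite !lt_min !mulr_gt0//= exprn_gt0.
  have e1 : e <= r * d by rewrite ge_min lexx.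
  have e2 : e <= r ^+ 2 * d ^+ 2 / 2 by rewrite !ge_min lexx orbT.
  have e3 : e <= p / 2 by rewrite !ge_min lexx !orbT.
  have [[w we Aw] _] := E e e0.
  have h1 := le_lt_trans (normV1 (w - z)) we; have := le_lt_trans (normV2 (w - z)) we.
  rewrite /= ltr_norml => h2; rewrite /= in h1.
  exists (r^-1 *: (w.1 - z.1), - (e / r ^+ 2)); split.
    split => /=; first by rewrite normrZ gtr0_norm ?invr_gt0// ltr_pdivrMl//; fast_lra.
    have : 0 < e / r ^+ 2 by rewrite divr_gt0.
    have : e / r ^+ 2 < d ^+ 2.
      by rewrite ltr_pdivrMr//; move: e2 (exprn_gt0 2 d0); move: (d ^+ 2) (r ^+ 2) r20 e0 => a b; clear; nra.
    by move=> a b; apply/andP; split; fast_lra.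
  rewrite /= /affV /= scalerA divff ?gt_eqF// scale1r subrK mulrN mulrC divfK ?gt_eqF//.
  apply: (@col_back G v f A C _ _ w.2); first by fast_lra.
    move=> c hc; apply: HG; rewrite normV gt_max /=; apply/andP; split; first fast_lra.
    by rewrite ltr_norml; fast_lra.
  by case: w Aw {we h1 h2}.
Qed.
End columns.

(** * The relay along vertical lines *)

Section hysteresis_columns.
Context {R : realType} {n : nat}.
Local Notation V := ('rV[R]_n * R)%type.
Local Notation mV := ('rV[R]_n * measurableTypeR R)%type.
Local Notation mu := (@spacetime_measure R n).
Implicit Types (z w h : V).

Lemma sup_max (S : set R) m : S m -> (forall s, S s -> s <= m) -> sup S = m.
Proof.
move=> Sm ub; apply/le_anti/andP; split; first by apply: sup_le_ub => //; exists m.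
by apply: sup_upper_bound => //; split; exists m.
Qed.

(** Two facts about vertical lines suffice: membership in [A] is constant while [v > 0], and after a
    time with [v <= 0] it is false as long as [v] stays positive. *)
Lemma col_intro (G : set V) v f A Gamma : wsol G v (fun z => 2 * f z - 1) -> mfun f ->
  (forall z, 0 <= f z <= 1) -> {ae mu, forall z, G z -> (A z -> f z = 1) /\ (~ A z -> f z = 0)} ->
  (forall z, G z -> exists2 d, 0 < d & forall w, `|w - z| < d -> G w) ->
  (forall z, G z -> ccont v z) -> (forall z, G z -> v z <= 0 -> ~ A z) ->
  (forall x (s t : R), s < t -> (forall c, s <= c <= t -> G (x, c) /\ 0 < v (x, c)) -> A (x, s) <-> A (x, t)) ->
  (forall x (s t : R), s < t -> (forall c, s <= c <= t -> G (x, c)) -> v (x, s) <= 0 ->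
     (forall c, s < c <= t -> 0 < v (x, c)) -> ~ A (x, t)) ->
  (forall z, G z -> edge A z -> Gamma z) -> (forall z, G z -> ~ vertical_part Gamma z) -> col G v f A.
Proof.
move=> W mf f01 ae oG vc out const hit bdry nvert; split => //.
- move=> z Gz v0; have [d1 d10 H1] := oG z Gz.
  have [|d2 d20 H2] := vc z Gz (v z / 2); first by rewrite divr_gt0.
  pose d := Num.min d1 d2; have d0 : 0 < d by rewrite lt_min d10.
  have B w : `|w - z| < d -> G w /\ 0 < v w.
    rewrite lt_min => /andP[w1 w2]; split; first exact: H1.
    by have := H2 _ w2; rewrite [z + _]addrC subrK ler_norml; fast_lra.
  have col1 x s t : `|x - z.1| < d -> `|s - z.2| < d -> `|t - z.2| < d -> s < t -> A (x, s) <-> A (x, t).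
    rewrite !ltr_norml => hx hs ht st; apply: const => // c hc; apply: B.
    by rewrite normV gt_max ltr_norml /=; apply/andP; split; fast_lra.
  have cold x s t : `|x - z.1| < d -> `|s - z.2| < d -> `|t - z.2| < d -> A (x, s) -> A (x, t).
    move=> hx hs ht; have [st|ts|<-//] := ltgtP s t; first by move/(col1 x s t hx hs ht st).
    by move/(col1 x t s hx ht hs ts).
  (* If both [A] and its complement accumulate at [z], constancy along the columns spreads this to
     all points of a vertical segment through [z], which then lies in [Gamma]. *)
  apply: contrapT => nloc; apply: (nvert z Gz).
  exists (z.2 - d / 2), (z.2 + d / 2); split; [fast_lra|by apply/andP; split; fast_lra|].
  move=> c hc; have cz : `|c - z.2| < d by rewrite ltr_norml; fast_lra.
  have zc : G (z.1, c).
    by apply: (B _ _).1; rewrite normV gt_max /= subrr normr0 d0.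
  apply: bdry => // e e0; pose m := Num.min d e.
  have m0 : 0 < m by rewrite lt_min d0.
  have hit' (P : set V) : (forall x s t, `|x - z.1| < d -> `|s - z.2| < d -> `|t - z.2| < d -> P (x, s) -> P (x, t)) ->
      (exists2 w, `|w - z| < m & P w) -> exists2 w, `|w - (z.1, c)| < e & P w.
    move=> PP [[x s]]; rewrite normV gt_max /= ![_ < m]lt_min => /andP[/andP[x1 x2] /andP[s1 s2]] Pw.
    by exists (x, c); [rewrite normV gt_max /= subrr normr0 x2 e0|exact: (PP x s)].
  split; apply: hit' => //.
  - apply: contrapT => h; apply: nloc; exists m => //; right => w wm Aw; apply: h; by exists w.
  - by move=> x s t hx hs ht nA At; apply: nA; exact: (cold x t s).
  - apply: contrapT => h; apply: nloc; exists m => //; left => w wm.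
    by apply: contrapT => nA; apply: h; exists w.
- move=> x s t st GG At; apply: contrapT => nAs.
  have Gt : G (x, t) by apply: GG; rewrite lexx ltW.
  have vt : 0 < v (x, t) by rewrite ltNge; apply/negP => /(out _ Gt).
  pose S := [set c | s <= c <= t /\ v (x, c) <= 0].
  have [S0|/set0P[c0 Sc0]] := eqVneq S set0.
    apply: nAs; apply/(const x s t st) => // c hc; split; first exact: GG.
    by rewrite ltNge; apply/negP => h; have : S c by []; rewrite S0.
  have ubS : has_sup S by split; [exists c0|exists t => c [/andP[]]].
  (* The last time up to [t] with [v <= 0]; it is attained by continuity. After it the column is
     outside [A], contradicting membership at [t]. *)
  pose tau := sup S.
  have ub c : S c -> c <= tau by move=> Sc; exact: (sup_upper_bound ubS).
  have t1 : s <= tau by apply: le_trans (ub _ Sc0); have [/andP[]] := Sc0.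
  have t2 : tau <= t by apply: sup_le_ub; [exists c0|move=> c [/andP[]]].
  have Gtau : G (x, tau) by apply: GG; rewrite t1.
  have vtau : v (x, tau) <= 0.
    rewrite leNgt; apply/negP => h; have [|d d0 Hd] := vc _ Gtau (v (x, tau) / 2); first by rewrite divr_gt0.
    have [c Sc ct] := sup_adherent d0 ubS; have cs := ub _ Sc.
    have [_ vc0] := Sc; have := Hd ((x, c) - (x, tau)); rewrite [_ + (_ - _)]addrC subrK normV gt_max /= subrr normr0 d0 /=.
    by rewrite ltr_norml ler_norml -/tau in ct *; fast_lra.
  have tt : tau < t by rewrite lt_neqAle t2 andbT; apply: contraTneq vt => <-; rewrite -leNgt.
  apply: (hit x tau t tt _ vtau _ At) => c /andP[c1 c2].
    by apply: GG; rewrite c2 (le_trans t1).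
  rewrite ltNge; apply/negP => h; have : c <= tau; last by fast_lra.
  by apply: ub; split => //; apply/andP; split => //; fast_lra.
Qed.

Section relay_columns.
Variables (U : set 'rV[R]_n) (T alpha beta : R) (h0 : 'rV[R]_n -> R) (u : V -> R).
Local Notation Q := (cylinder U T).
Local Notation H := (hysteresis U T alpha beta h0 u).
Local Notation Gamma := (free_boundary U T alpha beta h0 u).
Hypothesis ab : alpha < beta.

Lemma relay_low w : Q w -> u w <= alpha -> H w = -1.
Proof.
move=> Qw ua; rewrite /hysteresis asboolT; last by left; left.
by have [_ /andP[w0 _]] := Qw; rewrite gt_eqF//= ua.
Qed.

Lemma relay_high w : Q w -> beta <= u w -> H w = 1.
Proof.
move=> Qw ub; rewrite /hysteresis asboolT; last by left; right.
by have [_ /andP[w0 _]] := Qw; rewrite gt_eqF//= leNgt (lt_le_trans ab ub).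
Qed.

Lemma not_switching x c : 0 < c -> alpha < u (x, c) < beta -> ~ switching_set U T alpha beta u (x, c).
Proof. by move=> c0 /andP[a b] [[[_ /= h]|[_ /= h]]|[_ /= h]]; lra. Qed.

Lemma relay_const x (s t : R) : 0 < s -> s < t -> (forall c, s <= c <= t -> alpha < u (x, c) < beta) ->
  H (x, s) = H (x, t).
Proof.
move=> s0 st C; have nE c : s <= c <= t -> ~ switching_set U T alpha beta u (x, c).
  by move=> /andP[c1 c2]; apply: not_switching; [exact: lt_le_trans c1|apply: C; rewrite c1].
rewrite /hysteresis !asboolF; [|by apply: nE; rewrite lexx ltW..].
suff -> : switching_time (switching_set U T alpha beta u) (x, s) = switching_time (switching_set U T alpha beta u) (x, t) by [].
congr sup; apply/seteqP; split => c /= [cs Ec]; split => //; first by lra.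
by rewrite leNgt; apply/negP => sc; apply: (nE c) => //; apply/andP; split; lra.
Qed.

(** After [s] the column stays strictly between the thresholds, so the last switching time before
    [t] is [s], where the value is that of the threshold. *)
Lemma relay_hit x (s t : R) : Q (x, s) -> s < t -> u (x, s) <= alpha \/ beta <= u (x, s) ->
  (forall c, s < c <= t -> alpha < u (x, c) < beta) -> H (x, t) = H (x, s).
Proof.
move=> Qs st us C; have [_ /andP[s0 _]] := Qs; rewrite /= in s0.
have Es : switching_set U T alpha beta u (x, s) by left; case: us; [left|right].
rewrite /hysteresis asboolF; last by apply: not_switching; [lra|apply: C; rewrite st lexx].
rewrite (asboolT Es) /=.
suff -> : switching_time (switching_set U T alpha beta u) (x, t) = s by [].
apply: sup_max; first by split => //=; lra.
move=> c [/= ct Ec]; rewrite leNgt; apply/negP => sc.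
by apply: (@not_switching x c) Ec; [lra|apply: C; rewrite sc].
Qed.

Hypothesis h0P : forall x, U x -> relay alpha beta (u (x, 0)) (h0 x).

Lemma edge_Gamma (c : R) (G : set V) z : c = 1 \/ c = -1 -> (forall w, G w -> exists2 d, 0 < d & forall w', `|w' - w| < d -> G w') ->
  G `<=` Q -> G z -> edge [set w | Q w /\ H w = c] z -> Gamma z.
Proof.
move=> c1 oG GQ Gz E; have [p p0 HG] := oG z Gz.
have ex (b : R) : b = 1 \/ b = -1 -> forall e, 0 < e -> exists2 w, `|w - z| < e & Q w /\ H w = b.
  move=> b1 e e0; have [|[w1 a1 b1'] [w2 a2 b2]] := E (Num.min e p); first by rewrite lt_min e0.
  move: a1 a2; rewrite !lt_min => /andP[a1 _] /andP[a2 a2'].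
  have [bc|bc] := eqVneq b c; first by exists w1; rewrite // bc.
  exists w2 => //; have Q2 := GQ _ (HG _ a2'); split => //.
  move: (hysteresis_pm h0P Q2) b2 bc => /=; case: b1 => ->; case: c1 => -> [] -> h /eqP bc //; by [case: bc|case: h].
have bd (b : R) : b = 1 \/ b = -1 -> boundary (phase U T alpha beta h0 u b) z.
  move=> b1; split.
    by move=> B /nbhs_ballP[e /= e0 eB]; have [w we Pw] := ex b b1 e e0; exists w; split => //; apply: eB; rewrite -ball_normE /= distrC.
  move=> /nbhs_ballP[e /= e0 eB]; have [|w we [Qw Hw]] := ex (- b) _ e e0; first by case: b1 => ->; [right|left; rewrite opprK].
  have [_ ] : phase U T alpha beta h0 u b w by apply: eB; rewrite -ball_normE /= distrC.
  by rewrite Hw; case: b1 => ->; fast_lra.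
by split; apply: bd; [left|right].
Qed.

End relay_columns.
End hysteresis_columns.

Section relay_col.
Context {R : realType} {n : nat}.
Local Notation V := ('rV[R]_n * R)%type.
Local Notation mV := ('rV[R]_n * measurableTypeR R)%type.
Local Notation mu := (@spacetime_measure R n).
Implicit Types (z w h : V).

Lemma ccont_affine (v : V -> R) s c z : `|s| <= 1 -> ccont v z -> ccont (fun z => s * v z + c) z.
Proof.
move=> s1 H e e0; have [d d0 Hd] := H e e0; exists d => // h /Hd.
rewrite opprD addrACA subrr addr0 -mulrBr normrM; apply: le_trans.
by rewrite ler_piMl.
Qed.

(** If [u] stays below [beta], the active threshold is [alpha], with [v = u - alpha] and the phase
    of value 1. If it stays above [alpha], the roles are reversed: [v = beta - u] and the phase of
    value -1. The sign [s] unifies the two cases. *)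
Lemma relay_col (U : set 'rV[R]_n) (T alpha beta : R) (h0 : 'rV[R]_n -> R) (u ut g : V -> R) (G : set V) :
  alpha < beta -> (forall x, U x -> relay alpha beta (u (x, 0)) (h0 x)) ->
  (forall z, cylinder U T z -> ut z = u z) ->
  wsol G ut g -> {ae mu, forall z, cylinder U T z -> g z = hysteresis U T alpha beta h0 u z} ->
  (forall w, G w -> exists2 d, 0 < d & forall w', `|w' - w| < d -> G w') -> G `<=` cylinder U T ->
  (forall w, G w -> ccont ut w) ->
  (forall w, G w -> ~ vertical_part (free_boundary U T alpha beta h0 u) w) ->
  (forall w, G w -> u w < beta) \/ (forall w, G w -> alpha < u w) ->
  exists s c, (s = 1 \/ s = -1) /\ col G (fun z => s * ut z + c) (fun z => 2^-1 * (1 + s * g z))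
    [set w | cylinder U T w /\ hysteresis U T alpha beta h0 u w = s].
Proof.
move=> ab h0P utE W ae oG GQ uc nv side.
have gen s c : s = 1 \/ s = -1 ->
   (forall w, G w -> s * ut w + c <= 0 -> (u w <= alpha \/ beta <= u w) /\ hysteresis U T alpha beta h0 u w <> s) ->
   (forall w, G w -> 0 < s * ut w + c -> alpha < u w < beta) ->
   col G (fun z => s * ut z + c) (fun z => 2^-1 * (1 + s * g z))
    [set w | cylinder U T w /\ hysteresis U T alpha beta h0 u w = s].
  move=> s1 out inn; have sn : `|s| <= 1 by case: s1 => ->; rewrite ?normrN normr1.
  have ss : s * s = 1 by case: s1 => ->; ring.
  have [bv mg g1 _] := W.
  apply: (@col_intro _ _ _ _ _ _ (free_boundary U T alpha beta h0 u)) => //.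
  - have := wsol_add c W sn; congr wsol; apply/funext => z; lra.
  - by apply: mfunM; [exact: measurable_cst|apply: mfunD; [exact: measurable_cst|apply: mfunM => //; exact: measurable_cst]].
  - move=> z; have : `|s * g z| <= 1 by rewrite normrM mulr_ile1.
    by rewrite ler_norml; lra.
  - apply: ae_S ae => z E Gz; rewrite E; last exact: GQ.
    have := hysteresis_pm h0P (GQ _ Gz); rewrite /=; move: (hysteresis _ _ _ _ _ _ _) => H H1; split.
      by move=> [_ ->]; rewrite ss; lra.
    move=> nH; have -> : H = - s; last by rewrite mulrN ss subrr mulr0.
    have Qz := GQ _ Gz; move: nH => /=; case: H1 => ->; case: s1 => -> nH; rewrite ?opprK//; by case: nH.
  - by move=> z Gz; apply: ccont_affine => //; exact: uc.
  - by move=> z Gz v0 [_ Hs]; apply: (out z Gz v0).2.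
  - move=> x a b hab C.
    have Ga : G (x, a) by apply: (C _ _).1; rewrite lexx ltW.
    have Gb : G (x, b) by apply: (C _ _).1; rewrite lexx ltW.
    rewrite /=; have -> : hysteresis U T alpha beta h0 u (x, a) = hysteresis U T alpha beta h0 u (x, b).
      have [_ /andP[a0 _]] := GQ _ Ga; apply: relay_const => // c0 /C[Gc]; exact: inn.
    by split => -[_ ->]; split => //; exact: GQ.
  - move=> x a b hab C va vc; have Ga : G (x, a) by apply: C; rewrite lexx ltW.
    have [p1 p2] := out _ Ga va; rewrite /= (@relay_hit _ _ _ _ _ _ _ _ _ a)//; first by case.
      exact: GQ.
    by move=> c0 hc; apply: inn; [apply: C; case/andP: hc => c1 ->; rewrite ltW|exact: vc].
  - by move=> z Gz; apply: (edge_Gamma h0P s1 oG GQ Gz).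
case: side => side.
- exists 1, (- alpha); split; [by left|apply: gen; first by left].
  + move=> w Gw; have Qw := GQ _ Gw; rewrite utE// => h; have ua : u w <= alpha by lra.
    by split; [left|rewrite (relay_low beta h0 Qw ua); lra].
  + by move=> w Gw; rewrite utE; [have := side _ Gw; lra|exact: GQ].
- exists (-1), beta; split; [by right|apply: gen; first by right].
  + move=> w Gw; have Qw := GQ _ Gw; rewrite utE// => h; have ua : beta <= u w by lra.
    by split; [right|rewrite (relay_high h0 ab Qw ua); lra].
  + by move=> w Gw; rewrite utE; [have := side _ Gw; lra|exact: GQ].
Qed.
End relay_col.

(** * Points off the free boundary *)

Section transfer.
Context {R : realType} {n : nat}.
Local Notation V := ('rV[R]_n * R)%type.
Implicit Types (z w e : V).

Lemma pol_second (c : R) (b : 'I_n -> R) d P (y e : V) (t : R) : e.2 = 0 ->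
  pol c b d P (y + t *: e) + pol c b d P (y + (- t) *: e) - 2 * pol c b d P y = t ^+ 2 * bil P e e.
Proof.
move=> e2.
have L s : \sum_i (y + s *: e).1 ord0 i * b i = \sum_i y.1 ord0 i * b i + s * \sum_i e.1 ord0 i * b i.
  by rewrite mulr_sumr -big_split /=; apply: eq_bigr => i _; rewrite !mxE; ring.
have E s : pol c b d P (y + s *: e) = c + (\sum_i (y + s *: e).1 ord0 i * b i + y.2 * d)
     + 2^-1 * bil P (y + s *: e) (y + s *: e).
  by rewrite /pol /bil /= e2 scaler0 addr0.
rewrite !E !L !bil_line.
have -> : pol c b d P y = c + (\sum_i y.1 ord0 i * b i + y.2 * d) + 2^-1 * bil P y y by [].
move: (\sum_i _) (\sum_i _) (bil _ _ _) (bil _ _ _) (bil _ _ _) (bil _ _ _) => a1 a2 a3 a4 a5 a6.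
by move: (y.2) => a7; field.
Qed.

Lemma bil_sub (P P' : 'I_n -> 'I_n -> R) s (e : V) :
  bil (fun i j => P i j - s * P' i j) e e = bil P e e - s * bil P' e e.
Proof.
rewrite /bil mulr_sumr -sumrB; apply: eq_bigr => i _; rewrite mulr_sumr -sumrB; apply: eq_bigr => j _; ring.
Qed.

(** Up to sign, constant and translation the two functions coincide, and each is within [B] of a
    quadratic polynomial. A second difference of step 1/2 along a direction of [bil_dir] eliminates
    constant and linear terms; the factors 4, 8 and 4 from direction, four errors of size [2 B] and
    step make 128. *)
Lemma compare_PP (w0 g0 w1 g1 : V -> R) T s c (y0 : V) : base w0 g0 -> base w1 g1 -> RmB w0 T -> RmB w1 T ->
  `|s| <= 1 -> Bx 1 y0 -> (forall y, w1 y = s * w0 (y + y0) + c) ->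
  forall i j, `|PP kap w1 i j - s * PP kap w0 i j| <= 128 * (8 * T + 4 / 3 * I (@psi R n)).
Proof.
move=> B0 B1 R0 R1 s1 [y1 /andP[y2 y3]] E i j; set B := 8 * T + _.
pose D i j := PP kap w1 i j - s * PP kap w0 i j.
have sk (v : V -> R) k l : PP kap v k l = PP kap v l k by apply: PP_sym; exact: ker_Cc ker_kap.
have Ds k l : D k l = D l k by rewrite /D !(sk _ k l).
rewrite -/(D i j); have [->|Dn] := eqVneq (D i j) 0.
  rewrite normr0 mulr_ge0// /B; have := approx (z := (0, -1)) B0 R0; rewrite /= normr0.
  by move=> H; apply: le_trans (normr_ge0 _) (H _ _ _); fast_lra.
have [e [e1 e2]] := bil_dir Ds (m := `|D i j|) ltac:(by rewrite normr_gt0) (lexx _).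
rewrite /D bil_sub -/(D i j) => He.
(* Time -2 keeps the points, with and without the translation by [y0], in the range of [approx]. *)
have A1 t : `|t| <= 2^-1 -> `|w1 ((0, -2) + t *: e) - qq kap w1 ((0, -2) + t *: e)| <= B.
  move=> t1; apply: (approx B1 R1); rewrite /= ?e2 ?scaler0 ?add0r ?addr0; [|fast_lra..].
  rewrite normrZ; apply: (@le_trans _ _ (2^-1 * 1)); last by fast_lra.
  by apply: ler_pM => //; apply: le_trans e1; exact: normV1.
have A0 t : `|t| <= 2^-1 -> `|w0 (y0 + (0, -2) + t *: e) - qq kap w0 (y0 + (0, -2) + t *: e)| <= B.
  move=> t1; apply: (approx B0 R0); rewrite /= ?e2 ?scaler0 ?addr0; rewrite expr1n in y2; [|fast_lra..].
  apply: (le_trans (ler_normD _ _)); rewrite normrZ; have : `|t| * `|e.1| <= 2^-1 * 1.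
    by apply: ler_pM => //; apply: le_trans e1; exact: normV1.
  by fast_lra.
have cmp t : `|t| <= 2^-1 ->
    `|qq kap w1 ((0, -2) + t *: e) - s * qq kap w0 (y0 + (0, -2) + t *: e) - c| <= 2 * B.
  move=> t1; have := A1 t t1; have := A0 t t1; rewrite E.
  have -> : (0, -2) + t *: e + y0 = y0 + (0, -2) + t *: e :> V by rewrite addrC addrA.
  move: (w0 _) (qq _ _ _) (qq _ _ _) => a q1 q2 h1 h2.
  have -> : q1 - s * q2 - c = s * (a - q2) - (s * a + c - q1) by ring.
  apply: (le_trans (ler_normB _ _)); rewrite normrM.
  have : `|s| * `|a - q2| <= 1 * B by apply: ler_pM.
  by fast_lra.
have t0 : `|0 : R| <= 2^-1 by rewrite normr0; fast_lra.
have t1 : `|2^-1 : R| <= 2^-1 by rewrite ger0_norm; fast_lra.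
have t2 : `|- 2^-1 : R| <= 2^-1 by rewrite normrN.
have := pol_second (cc kap w1) (bb kap w1) (dtk kap w1) (PP kap w1) (0, -2) 2^-1 e2.
have := pol_second (cc kap w0) (bb kap w0) (dtk kap w0) (PP kap w0) (y0 + (0, -2)) 2^-1 e2.
have := cmp _ t0; have := cmp _ t1; have := cmp _ t2; rewrite scale0r !addr0 -!/(qq kap _ _).
have num (q1 q2 q3 r1 r2 r3 b1 b2 d : R) : `|d| / 4 <= `|b2 - s * b1| -> `|q3 - s * r3 - c| <= 2 * B ->
    `|q2 - s * r2 - c| <= 2 * B -> `|q1 - s * r1 - c| <= 2 * B ->
    r2 + r3 - 2 * r1 = 2^-1 ^+ 2 * b1 -> q2 + q3 - 2 * q1 = 2^-1 ^+ 2 * b2 -> `|d| <= 128 * B.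
  move=> h h3 h2 h1 e1' e2'.
  have eq : b2 - s * b1 = 4 * ((q2 - s * r2 - c) + (q3 - s * r3 - c) - 2 * (q1 - s * r1 - c)).
    have -> : b2 = 4 * (q2 + q3 - 2 * q1) by rewrite e2'; field.
    by have -> : b1 = 4 * (r2 + r3 - 2 * r1); [rewrite e1'; field|ring].
  move: h; rewrite eq; move: (q1 - s * r1 - c) (q2 - s * r2 - c) (q3 - s * r3 - c) h1 h2 h3 => x1 x2 x3.
  clearbody B; clear => h1 h2 h3; have : `|4 * (x2 + x3 - 2 * x1)| <= 32 * B; last by lra.
  by move: h1 h2 h3; rewrite !ler_norml => /andP[? ?] /andP[? ?] /andP[? ?]; apply/andP; split; fast_lra.
by move=> h3 h2 h1 e1' e2'; exact: num He h3 h2 h1 e1' e2'.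
Qed.

Lemma iter_zmv k (v : V -> R) : iter k zmv v = zm (rj k) 0 v.
Proof.
elim: k => [|k IH].
  by apply/funext => z; rewrite /rj expr0 /zm affV1 addr0 expr1n invr1 mul1r.
apply/funext => z; rewrite iterS IH /zmv /zm rjS affV_half mulrA; congr (_ * _).
by move: (rj k) (@rj_gt0 R k) => r r0; field; rewrite gt_eqF.
Qed.

Lemma iter_zmg k (g : V -> R) : iter k zmg g = fun z => g (affV (rj k) (rj k ^+ 2) 0 z).
Proof.
elim: k => [|k IH]; first by apply/funext => z; rewrite /= /rj expr0 affV1 addr0.
by apply/funext => z; rewrite iterS IH /zmg rjS affV_half.
Qed.

Definition KPsi : R := \sum_(i < n) \sum_(j < n) Kabs (Dx i (Dx j (@psi R n))).
Definition KKap : R := \sum_(i < n) \sum_(j < n) Kabs (Dx i (Dx j (@kap R n))).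

Lemma Kabs_le_sum (k : 'I_n -> 'I_n -> V -> R) i j : Kabs (k i j) <= \sum_(i < n) \sum_(j < n) Kabs (k i j).
Proof.
rewrite (bigD1 i)//= (bigD1 j)//= -addrA lerDl addr_ge0//.
  by apply: sumr_ge0 => l _; exact: Kabs_ge0.
by apply: sumr_ge0 => l _; apply: sumr_ge0 => m _; exact: Kabs_ge0.
Qed.

Lemma ker_Dxx i j (k : V -> R) : ker k -> ker (Dx i (Dx j k)).
Proof. by move=> kk; apply: ker_D; exact: ker_D. Qed.

Lemma PP_le (k w : V -> R) M i j : ker k -> mfun w -> (forall z, `|w z| <= M) ->
  `|PP k w i j| <= M * Kabs (Dx i (Dx j k)).
Proof. by move=> kk mw wM; apply: I_wle => //; apply: Cc_nice; apply: ker_Cc; exact: ker_Dxx. Qed.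

Lemma PP_step (v g : V -> R) i j : wsol (@Bx R n 8) v g -> `|PP kap (zmv v) i j - PP kap v i j| <= KPsi.
Proof.
move=> W; rewrite (PP_zm W (@KB4_Bx R n)) addrC addKr normrN; have [_ mg g1 _] := W.
by apply: le_trans (PP_le i j (@ker_psi R n) mg g1) _; rewrite mul1r; exact: (Kabs_le_sum (fun i j => Dx i (Dx j psi))).
Qed.

Lemma PP_iter (v g : V -> R) i j m : base v g -> `|PP kap (iter m zmv v) i j - PP kap v i j| <= m%:R * KPsi.
Proof.
move=> B; elim: m => [|m IH]; first by rewrite subrr normr0 mul0r.
have [Bm _] : base (iter m zmv v) (iter m zmg g).
  by elim: {IH} m => [|m IH] //; exact: base_zmv.
rewrite -natr1 mulrDl mul1r; have := PP_step i j Bm; rewrite -iterS.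
move: (PP _ _ _ _) (PP _ _ _ _) (PP _ _ _ _) IH => a b c; move: (_ * _) => d h1 h2.
by have := ler_normD (a - c) (c - b); rewrite addrA subrK; lra.
Qed.

(** The second derivatives of [psi] have integral 0, so a constant right-hand side leaves the
    Hessian unchanged. *)
Lemma PP_const (v g : V -> R) c i j : wsol (@Bx R n 8) v g -> constg g c -> PP kap (zmv v) i j = PP kap v i j.
Proof.
move=> W cg; rewrite (PP_zm W (@KB4_Bx R n)).
have kk := ker_Dxx i j (@ker_psi R n).
have -> : PP psi g i j = c * I (Dx i (Dx j (@psi R n))).
  rewrite /PP cg//; first by apply: Cc_nice; exact: ker_Cc.
  by move=> z nz; apply/eqP; apply: contrapT => /negP/(kk.2)/KB_Bx8.
by rewrite ibp ?mulr0 ?subr0//; apply: Cc_D; apply: ker_Cc; exact: ker_psi.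
Qed.

Lemma PP_const_iter (v g : V -> R) c K i j : base v g -> (forall k, (K <= k)%N -> constg (iter k zmg g) c) ->
  forall k, (K <= k)%N -> PP kap (iter k zmv v) i j = PP kap (iter K zmv v) i j.
Proof.
move=> B H k Kk; rewrite -(subnK Kk); elim: (k - K)%N => [|m IH] //.
have [Bm _] : base (iter (m + K) zmv v) (iter (m + K) zmg g).
  by elim: (m + K)%N => [|l IHl] //; exact: base_zmv.
by rewrite addSn iterS (PP_const i j Bm (c := c))//; apply: H; rewrite leq_addl.
Qed.

(** At scale [j] the displacement [y0] becomes a point of [Bx 1], and [compare_PP] carries the bound
    over from the free boundary point. Up to four further zooms cost at most [KPsi] each; they lead
    to boxes with a single phase. *)
Lemma transfer (M0 : R) : exists C : R, forall (w g v1 f1 : V -> R) A1 s c (y0 : V) j,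
  base w g -> (forall z, `|w z| <= M0) -> prob v1 f1 A1 -> (forall z, `|v1 z| <= 2 * M0) ->
  s = 1 \/ s = -1 -> Bx (rj j) y0 -> (forall y, v1 y = s * w (y + y0) + c) ->
  forall m i l, (m <= 4)%N -> `|PP kap (iter (m + j) zmv w) i l| <= C.
Proof.
have [C HC] := @abstract_bound R n (2 * M0).
pose T := @Ckap R n * (2 * M0) + @Cpsi R n.
exists (C + 128 * (8 * T + 4 / 3 * I (@psi R n)) + 4 * KPsi) => w g v1 f1 A1 s c y0 j Bw wM P1 v1M s1 y0B E m i l m4.
have M00 : 0 <= M0 by apply: le_trans (wM 0).
have [Bwj Rw] := iterate_zmv j Bw (M := 2 * M0) ltac:(by move=> z; have := wM z; lra).
have [B1j R1] := iterate_zmv j (prob_base P1) v1M.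
have [r0 r20] : 0 < rj j :> R /\ 0 < rj j ^+ 2 :> R by split; [|apply: exprn_gt0]; exact: rj_gt0.
pose y1 : V := ((rj j)^-1 *: y0.1, (rj j ^+ 2)^-1 * y0.2).
have y1B : Bx 1 y1.
  have [h1 /andP[h2 h3]] := y0B; split; rewrite /= ?expr1n.
    by rewrite normrZ gtr0_norm ?invr_gt0// ltr_pdivrMl// mulr1.
  by rewrite ltr_pdivlMl// mulrN1 h2 pmulr_rlt0 ?invr_gt0.
have E' y : iter j zmv v1 y = s * iter j zmv w (y + y1) + (rj j ^+ 2)^-1 * c.
  rewrite !iter_zmv /zm E mulrDr mulrCA; congr (s * (_ * w _) + _).
  apply: injective_projections; rewrite /= addr0 ?scalerDr ?mulrDr ?addr0.
    by rewrite scalerA divff ?gt_eqF// scale1r.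
  by rewrite mulrA divff ?gt_eqF// mul1r.
have sn : `|s| <= 1 by case: s1 => ->; rewrite ?normrN normr1.
have := compare_PP Bwj B1j Rw R1 sn y1B E' i l; rewrite -/T.
have := HC _ _ _ P1 v1M j i l; have := PP_iter i l m Bwj; rewrite iterD.
have : m%:R * KPsi <= 4 * KPsi.
  rewrite ler_wpM2r ?ler_nat//; apply: sumr_ge0 => ? _; apply: sumr_ge0 => ? _; exact: Kabs_ge0.
move: (m%:R * KPsi) => mK; move: (PP _ _ _ _) (PP _ _ _ _) (PP _ _ _ _) => a b d h1 h2 h3 h4.
have b1 : `|b| <= C + 128 * (8 * T + 4 / 3 * I (@psi R n)).
  have -> : `|b| = `|s * b| by case: s1 => ->; rewrite ?mul1r// mulN1r normrN.
  by have := ler_normB a (a - s * b); rewrite opprB addrC subrK; fast_lra.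
by have := ler_normD (d - b) b; rewrite subrK; fast_lra.
Qed.
End transfer.

(** * A modulus of continuity *)

Section modulus.
Context {R : realType} {n : nat}.
Local Notation V := ('rV[R]_n * R)%type.
Implicit Types (z w : V).

Lemma doubling (x : nat -> R) K : 0 <= K -> (forall k, x k.+1 <= 2 * (x k + K)) ->
  forall k, x k <= 2 ^+ k * (x 0%N + 2 * K).
Proof.
move=> K0 H k; suff : x k + 2 * K <= 2 ^+ k * (x 0%N + 2 * K) by lra.
by elim: k => [|k IH]; [rewrite expr0 mul1r|rewrite exprS -mulrA; have := H k; lra].
Qed.

Lemma pol_bound (c : R) (b : 'I_n -> R) d P L (y : V) : (forall i, `|b i| <= L) -> `|d| <= L ->
  (forall i j, `|P i j| <= L) -> `|y.1| <= 2 -> `|y.2| <= 4 ->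
  `|pol c b d P y - c| <= (2 * n%:R + 4 + 2 * n%:R ^+ 2) * L.
Proof.
move=> bL dL PL y1 y2; have yi i : `|y.1 ord0 i| <= 2 by apply: le_trans y1; exact: rV_coord_le.
have L0 : 0 <= L by apply: le_trans dL.
have s1 : `|\sum_i y.1 ord0 i * b i| <= n%:R * (2 * L).
  apply: (le_trans (ler_norm_sum _ _ _)); apply: (@le_trans _ _ (\sum_(i < n) (2 * L))).
    by apply: ler_sum => i _; rewrite normrM; apply: ler_pM.
  by rewrite sumr_const card_ord -[leLHS]mulr_natl.
have s2 : `|y.2 * d| <= 4 * L by rewrite normrM; apply: ler_pM.
have s3 : `|\sum_i \sum_j y.1 ord0 i * y.1 ord0 j * P i j| <= n%:R * (n%:R * (4 * L)).
  apply: (le_trans (ler_norm_sum _ _ _)); apply: (@le_trans _ _ (\sum_(i < n) (n%:R * (4 * L)))).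
    apply: ler_sum => i _; apply: (le_trans (ler_norm_sum _ _ _)); apply: (@le_trans _ _ (\sum_(j < n) (4 * L))).
      apply: ler_sum => j _; rewrite !normrM; apply: ler_pM => //.
      have -> : (4 : R) = 2 * 2 by ring.
      exact: ler_pM.
    by rewrite sumr_const card_ord -[leLHS]mulr_natl.
  by rewrite sumr_const card_ord -[leLHS]mulr_natl.
rewrite /pol; move: (\sum_i _) (y.2 * d) (\sum_i _) s1 s2 s3 => a1 a2 a3.
have -> : c + (a1 + a2) + 2^-1 * a3 - c = a1 + a2 + 2^-1 * a3 by ring.
have := ler_normD (a1 + a2) (2^-1 * a3); have := ler_normD a1 a2; rewrite [`|2^-1 * a3|]normrM (@ger0_norm _ 2^-1)//.
rewrite expr2; move: n%:R => N; nra.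
Qed.

(** Except for the constant, each Taylor coefficient at most doubles per zoom, up to a bounded
    error. As [k] zooms multiply by [4^k], the oscillation of [w] on the box of scale [2^-k] is at
    most [2^-k E]. *)
Lemma modulus (M0 : R) : exists2 E, 0 <= E & forall w g : V -> R, base w g -> (forall z, `|w z| <= M0) ->
  forall k (y y' : V), Bx 2 y -> Bx 2 y' -> `|iter k zmv w y - iter k zmv w y'| <= 2 ^+ k * E.
Proof.
pose kb (k : V -> R) := \sum_(i < n) Kabs (Dx i k) + Kabs (Dt k) + \sum_(i < n) \sum_(j < n) Kabs (Dx i (Dx j k)).
have kb0 (k : V -> R) : [/\ 0 <= \sum_(i < n) Kabs (Dx i k), 0 <= Kabs (Dt k) & 0 <= \sum_(i < n) \sum_(j < n) Kabs (Dx i (Dx j k))].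
  split; [|exact: Kabs_ge0|]; apply: sumr_ge0 => i _; first exact: Kabs_ge0.
  by apply: sumr_ge0 => j _; exact: Kabs_ge0.
have s3 (a b c : R) : 0 <= a -> 0 <= b -> 0 <= c -> [/\ a <= a + b + c, b <= a + b + c, c <= a + b + c & 0 <= a + b + c].
  by move=> a0 b0 c0; split; lra.
have kbS (k : V -> R) : [/\ \sum_(i < n) Kabs (Dx i k) <= kb k, Kabs (Dt k) <= kb k,
    \sum_(i < n) \sum_(j < n) Kabs (Dx i (Dx j k)) <= kb k & 0 <= kb k].
  by have [h1 h2 h3] := kb0 k; exact: s3.
have kbx (k : V -> R) i : Kabs (Dx i k) <= kb k.
  have [h1 _ _ _] := kbS k; apply: le_trans h1.
  by rewrite (bigD1 i)//= lerDl; apply: sumr_ge0 => j _; exact: Kabs_ge0.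
have kbt (k : V -> R) : Kabs (Dt k) <= kb k by have [] := kbS k.
have kbxx (k : V -> R) i j : Kabs (Dx i (Dx j k)) <= kb k.
  by have [_ _ h _] := kbS k; apply: le_trans h; exact: (Kabs_le_sum (fun i j => Dx i (Dx j k))).
have kbg (k : V -> R) : 0 <= kb k by have [] := kbS k.
clearbody kb; pose L := `|M0| * kb (@kap R n) + 2 * kb (@psi R n).
pose T := @Ckap R n * `|M0| + @Cpsi R n.
pose B := 8 * T + 4 / 3 * I (@psi R n).
have L0 : 0 <= L by rewrite addr_ge0// mulr_ge0.
have B0 : 0 <= B.
  by rewrite addr_ge0// mulr_ge0//; [rewrite addr_ge0 ?Cpsi_ge0// mulr_ge0// Ckap_ge0|apply: I_ge0; exact: psi_ge0].
pose D := (2 * n%:R + 4 + 2 * n%:R ^+ 2) * L : R.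
have D0 : 0 <= D by rewrite mulr_ge0// !addr_ge0// mulr_ge0// exprn_ge0.
exists (2 * B + 2 * D); first lra.
move=> w g Bw wM k y y' yB yB'.
have wM' z : `|w z| <= `|M0| by apply: le_trans (wM z) (ler_norm _).
have [mw _] : bm w := let: And4 a _ _ _ := Bw.1 in a.
have Bk m : base (iter m zmv w) (iter m zmg g) by elim: m => [|m IH] //; exact: base_zmv.
have gen (F : (V -> R) -> (V -> R) -> R) (k1 k2 : V -> R) : Cc k1 -> Cc k2 ->
    (forall v, `|F kap v| = `|I (fun y => v y * k1 y)|) -> (forall v, `|F psi v| = `|I (fun y => v y * k2 y)|) ->
    (forall v g, wsol (Bx 8) v g -> `|F kap (zmv v)| <= 2 * (`|F kap v| + `|F psi g|)) ->
    Kabs k1 <= kb kap -> Kabs k2 <= kb psi -> forall m, `|F kap (iter m zmv w)| <= 2 ^+ m * L.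
  move=> C1 C2 F1 F2 H h1 h2 m.
  have step l : `|F kap (iter l.+1 zmv w)| <= 2 * (`|F kap (iter l zmv w)| + kb psi).
    have [Wl _] := Bk l; apply: (le_trans (H _ _ Wl)); rewrite ler_wpM2l// lerD2l F2.
    by have [_ mg g1 _] := Wl; apply: le_trans (I_wle mg g1 (Cc_nice C2)) _; rewrite mul1r.
  have st := @doubling (fun m => `|F kap (iter m zmv w)|) (kb psi) (kbg psi) step m.
  apply: (le_trans st); rewrite ler_wpM2l ?exprn_ge0// lerD2r /= F1.
  by apply: le_trans (I_wle mw wM' (Cc_nice C1)) _; rewrite ler_wpM2l.
have nb (a b : R) : `|a - b| <= 2 * (`|a| + `|b|).
  by have := ler_normB a b; have := normr_ge0 a; have := normr_ge0 b; fast_lra.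
have Cx i : Cc (Dx i (@kap R n)) by apply: Cc_D; exact: ker_Cc ker_kap.
have Cx' i : Cc (Dx i (@psi R n)) by apply: Cc_D; exact: ker_Cc ker_psi.
have hb i m : `|bb kap (iter m zmv w) i| <= 2 ^+ m * L.
  apply: (gen (fun k v => bb k v i) (Dx i kap) (Dx i psi)) => //.
  - by move=> v; rewrite normrN.
  - by move=> v; rewrite normrN.
  - by move=> v g' W; rewrite (bb_zm W (@KB4_Bx R n)) normrM gtr0_norm// ler_wpM2l// ler_normB.
have hd m : `|dtk kap (iter m zmv w)| <= 2 ^+ m * L.
  apply: (gen (fun k v => dtk k v) (Dt kap) (Dt psi)) => //.
  - by apply: Cc_D; exact: ker_Cc ker_kap.
  - by apply: Cc_D; exact: ker_Cc ker_psi.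
  - by move=> v; rewrite normrN.
  - by move=> v; rewrite normrN.
  - by move=> v g' W; rewrite (dt_zm W (@KB4_Bx R n)).
have hP i j m : `|PP kap (iter m zmv w) i j| <= 2 ^+ m * L.
  apply: (gen (fun k v => PP k v i j) (Dx i (Dx j kap)) (Dx i (Dx j psi))) => //.
  - exact: Cc_D.
  - exact: Cc_D.
  - by move=> v g' W; rewrite (PP_zm W (@KB4_Bx R n)).
have [Bwk Rk] := iterate_zmv k Bw wM'.
have bxB (z : V) : Bx 2 z -> [/\ `|z.1| <= 2, -4 <= z.2, z.2 < 0 & `|z.2| <= 4].
  move=> [/ltW h1 /andP[h2 h3]]; have -> : (4 : R) = 2 ^+ 2 by ring.
  by split => //; [exact: ltW|rewrite ler_norml; fast_lra].
have near z : Bx 2 z -> `|iter k zmv w z - cc kap (iter k zmv w)| <= B + 2 ^+ k * D.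
  move=> /bxB[z1 z2 z3 z4]; have := approx Bwk Rk z1 z2 z3.
  have := pol_bound (cc kap (iter k zmv w)) (fun i => hb i k) (hd k) (fun i j => hP i j k) z1 z4.
  rewrite -/(qq kap _ z) -/T -/B mulrCA -/D.
  move: (qq _ _ _) (cc _ _) (iter _ _ _ _) (2 ^+ k * D) => a b c d h1 h2.
  by have := ler_normD (c - a) (a - b); rewrite addrA subrK; fast_lra.
clearbody B D; have := near _ yB; have := near _ yB'; have p1 : 1 <= 2 ^+ k :> R by rewrite exprn_ege1// ler1n.
have : B <= 2 ^+ k * B by rewrite ler_peMl.
rewrite mulrDr ![2 ^+ k * (2 * _)]mulrCA; move: (cc _ _) (iter _ _ _ _) (iter _ _ _ _) (2 ^+ k * D) (2 ^+ k * B) => b c c' d e.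
move=> h0 h1 h2; rewrite (distrC c c'); have := ler_normB (c' - b) (c - b); rewrite opprB addrA subrK.
by move: h0 h1 h2; clear; lra.
Qed.
End modulus.

(** * The Hessian bound at a point off the free boundary *)

Section main_estimate.
Context {R : realType} {n : nat}.
Local Notation V := ('rV[R]_n * R)%type.
Local Notation mu := (@spacetime_measure R n).
Implicit Types (z w y t : V).

Lemma zm_zm s r p (v : V -> R) : zm s 0 (zm r p v) = zm (r * s) p v.
Proof.
apply/funext => z; rewrite /zm affV_comp mulrA -invfM -exprMn [s * r]mulrC; congr (_ * v (affV _ _ _ _)).
by apply: injective_projections; rewrite /= ?scaler0 ?mulr0 add0r.
Qed.

Lemma iter_zm k r p (v : V -> R) : iter k zmv (zm r p v) = zm (r * rj k) p v.
Proof. by rewrite iter_zmv zm_zm. Qed.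

Lemma Bx_seg rr (t1 t2 : V) s : Bx rr t1 -> Bx rr t2 -> 0 <= s <= 1 -> Bx rr (t1 + s *: (t2 - t1)).
Proof.
move=> B1 B2 /andP[s0 s1]; have [a1 /andP[a2 a3]] := B1; have [b1 /andP[b2 b3]] := B2; split => /=.
  have -> : t1.1 + s *: (t2.1 - t1.1) = (1 - s) *: t1.1 + s *: t2.1.
    by rewrite scalerBr scalerBl scale1r [RHS]addrAC -addrA [X in _ + X]addrC.
  apply: (le_lt_trans (ler_normD _ _)); rewrite !normrZ ger0_norm ?subr_ge0// [`|s|]ger0_norm//.
  by apply: conv_lt => //; rewrite s0.
have hs : 0 <= s <= 1 by rewrite s0.
have -> : t1.2 + s *: (t2.2 - t1.2) = (1 - s) * t1.2 + s * t2.2 by rewrite /GRing.scale /=; ring.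
rewrite (conv_lt a3 b3 hs) andbT.
have := conv_lt (_ : - t1.2 < rr ^+ 2) (_ : - t2.2 < rr ^+ 2) hs; rewrite !mulrN -opprD ltrNl; apply; lra.
Qed.

(** Without an edge point in the convex box, [A] would be open and closed along the segment from
    [t1] to [t2]. *)
Lemma edge_exists (A : set V) r z rr (t1 t2 : V) : 0 < r -> r <= 1 ->
  Bx rr t1 -> Bx rr t2 -> A (affV r (r ^+ 2) z t1) -> ~ A (affV r (r ^+ 2) z t2) ->
  exists2 y, Bx rr y & edge A (affV r (r ^+ 2) z y).
Proof.
move=> r0 r1 B1 B2 A1 A2; apply: contrapT => nE.
have loc y : Bx rr y -> exists2 d, 0 < d &
    (forall w, `|w - y| < d -> A (affV r (r ^+ 2) z w)) \/ (forall w, `|w - y| < d -> ~ A (affV r (r ^+ 2) z w)).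
  move=> By; apply: contrapT => nl; apply: nE; exists y => // d d0.
  have ad w : `|w - y| < d -> `|affV r (r ^+ 2) z w - affV r (r ^+ 2) z y| < d.
    by apply: le_lt_trans; exact: aff_dist.
  split; apply: contrapT => h; apply: nl; exists d => //.
    by right => w /ad wd Aw; apply: h; exists (affV r (r ^+ 2) z w).
  by left => w /ad wd; apply: contrapT => nA; apply: h; exists (affV r (r ^+ 2) z w).
have seg s : 0 <= s <= 1 -> Bx rr (t1 + s *: (t2 - t1)) by move=> hs; exact: Bx_seg.
pose c := `|t2 - t1| + 1; have c0 : 0 < c by rewrite ltr_wpDl.
have line s s' d : 0 < d -> `|s' - s| < d / c -> `|t1 + s' *: (t2 - t1) - (t1 + s *: (t2 - t1))| < d.
  move=> d0; rewrite ltr_pdivlMr// opprD addrACA subrr add0r -scalerBl normrZ; apply: le_lt_trans.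
  by rewrite ler_wpM2l// /c lerDl.
have := @seg_clopen R (fun s => A (affV r (r ^+ 2) z (t1 + s *: (t2 - t1)))).
have E1 : t1 + 1 *: (t2 - t1) = t2 by rewrite scale1r addrC subrK.
rewrite E1 scale0r addr0 => H; apply/A2/H => // s hs.
- move=> As; have [d d0 [h|h]] := loc _ (seg _ hs); last by case: (h _ _ As); rewrite subrr normr0.
  by exists (d / c) => [|s' _ /(line _ _ _ d0)/h //]; rewrite divr_gt0.
- move=> hd; have [d d0 [h|h]] := loc _ (seg _ hs); first by apply: h; rewrite subrr normr0.
  by have [|s' [_ /(line _ _ _ d0)/h nA /nA]] := hd (d / c); first by rewrite divr_gt0.
Qed.

Lemma constg_ae (g H : V -> R) (Q : set V) c r z : bm g -> 0 < r -> {ae mu, forall z, Q z -> g z = H z} ->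
  (forall t, Bx 8 t -> Q (affV r (r ^+ 2) z t) /\ H (affV r (r ^+ 2) z t) = c) ->
  constg (fun t => g (affV r (r ^+ 2) z t)) c.
Proof.
move=> bg r0 ae HQ k nk k0; have [k' [nk' k'1 k'2 k'I]] := pullback z r0 nk.
rewrite k'I// -(I_Z c nk) (k'I _ (bm_cst c)); congr (_ * _); apply: I_ae; [exact: nice_mul|exact: niceZ|].
apply: ae_S ae => y Hy; have [->|/k'2[t kt yE]] := eqVneq (k' y) 0; first by rewrite !mulr0.
have [Qt Ht] : Q y /\ H y = c.
  by rewrite yE; apply: HQ; apply: contrapT => /k0/eqP; rewrite (negbTE kt).
by rewrite Hy// Ht.
Qed.

(** The size [r] of the working box depends on [r1], [M] and [D] only, hence so does the constant.
    The starting index [K] may depend on the solution: from there on the Hessian no longer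
    changes. *)
Lemma main_estimate (r1 M D : R) : 0 < r1 -> r1 <= 1 -> 0 <= M -> 0 < D -> exists C,
  forall (U : set 'rV[R]_n) (T alpha beta : R) (h0 : 'rV[R]_n -> R) (u ut g : V -> R) (z0 : V) c0 e0,
  beta - alpha = D -> (forall x, U x -> relay alpha beta (u (x, 0)) (h0 x)) ->
  (forall z, cylinder U T z -> ut z = u z) -> (forall z, `|ut z| <= M) ->
  wsol [set z | U z.1 /\ 0 < z.2 < T] ut g ->
  {ae mu, forall z, cylinder U T z -> g z = hysteresis U T alpha beta h0 u z} ->
  (forall w : V, U w.1 /\ 0 < w.2 < T -> ccont ut w) ->
  (forall t : V, Bx 8 t -> U (affV r1 (r1 ^+ 2) z0 t).1 /\ 0 < (affV r1 (r1 ^+ 2) z0 t).2 < T) ->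
  (forall t : V, Bx 8 t -> ~ vertical_part (free_boundary U T alpha beta h0 u) (affV r1 (r1 ^+ 2) z0 t)) ->
  0 < e0 -> (forall w, cylinder U T w -> `|w - z0| < e0 -> hysteresis U T alpha beta h0 u w = c0) ->
  exists K, forall k, (K <= k)%N -> forall i j, `|PP kap (zm (r1 * rj k) z0 ut) i j| <= C.
Proof.
move=> r10 r11 M0 D0; have r12 : 0 < r1 ^+ 2 by rewrite exprn_gt0.
pose M1 := M / r1 ^+ 2; have M10 : 0 <= M1 by rewrite divr_ge0// ltW.
have [E E0 HE] := @modulus R n M1.
have [kk Hkk] := @rj_small R (D / (2 * (r1 ^+ 2 * E + 1))) ltac:(by rewrite divr_gt0// mulr_gt0// ltr_wpDl// mulr_ge0// ltW).
pose s0 := r1 * rj kk; pose r := r1 * rj (kk + 3).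
have s00 : 0 < s0 by rewrite mulr_gt0// rj_gt0.
have rs : r = s0 / 8.
  rewrite /r /s0 /rj exprD; have -> : 2^-1 ^+ 3 = 8^-1 :> R by field.
  by rewrite mulrA.
have rE : r = r1 * rj (kk + 3) by []; clearbody r.
have r0 : 0 < r by rewrite rs divr_gt0.
have s01 : s0 <= r1 by rewrite ger_pMr// rj_le1.
have rr1 : r <= 1 by rewrite rs; lra.
have r20 : 0 < r ^+ 2 by rewrite exprn_gt0.
pose M2 := M / r ^+ 2; have M20 : 0 <= M2 by rewrite divr_ge0// ltW.
have [C2 HC2] := @transfer R n M2.
exists (`|C2| + M2 * KKap (R := R) (n := n) + 3 * KPsi (R := R) (n := n)).
move=> U T alpha beta h0 u ut g z0 c0 e0 abD h0P utE utM W ae uc rD rv e00 Hc.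
set Q := cylinder U T in utE ae Hc; set H := hysteresis U T alpha beta h0 u in ae Hc.
set Gam := free_boundary _ _ _ _ _ _ in rv.
pose G : set V := [set w | Bx (16 * r) (w - z0)].
have GE w : G w -> exists2 t : V, Bx 2 t & w = affV s0 (s0 ^+ 2) z0 t.
  move=> [w1 /andP[w2 w3]]; have s020 : 0 < s0 ^+ 2 by rewrite exprn_gt0.
  exists (s0^-1 *: (w.1 - z0.1), (s0 ^+ 2)^-1 * (w.2 - z0.2)).
    split => /=; first by rewrite normrZ gtr0_norm ?invr_gt0// ltr_pdivrMl//; move: w1; rewrite /= rs; clear; lra.
    rewrite ltr_pdivlMl// pmulr_rlt0 ?invr_gt0// w3 andbT; move: w2; rewrite /= rs; apply: le_lt_trans.
    by rewrite le_eqVlt; apply/orP; left; apply/eqP; field.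
  by apply: injective_projections; rewrite /= ?scalerA ?mulrA divff ?gt_eqF// ?scale1r ?mul1r subrK.
have GE1 w : G w -> exists2 t : V, Bx 8 t & w = affV r1 (r1 ^+ 2) z0 t.
  move=> /GE[t [t1 /andP[t2 t3]] ->]; exists (rj kk *: t.1, rj kk ^+ 2 * t.2).
    have a0 := @rj_gt0 R kk; have a1 := @rj_le1 R kk.
    have b0 : 0 < rj kk ^+ 2 :> R by rewrite exprn_gt0. 
    have b1 : rj kk ^+ 2 <= 1 :> R by rewrite exprn_ile1// ltW.
    split; rewrite /= ?normrZ ?gtr0_norm//; first by move: `|t.1| (rj kk) (normr_ge0 t.1) t1 a0 a1; clear => a c *; nra.
    have e4 : (2 : R) ^+ 2 = 4 by ring. have e8 : (8 : R) ^+ 2 = 64 by ring.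
    rewrite e4 in t2; rewrite e8; move: (rj kk ^+ 2) (t.2) b0 b1 t2 t3; clear => b x b0 b1 t2 t3; apply/andP; split; nra.
  by apply: injective_projections; rewrite /= ?scalerA /s0 ?exprMn ?mulrA.
have GD w : G w -> U w.1 /\ 0 < w.2 < T by move=> /GE1[t tB ->]; exact: rD.
have GQ : G `<=` Q by move=> w /GD[Uw /andP[w0 /ltW wT]]; split => //; rewrite w0.
have oG w : G w -> exists2 d, 0 < d & forall w', `|w' - w| < d -> G w'.
  move=> /Bx_open[d d0 Hd]; exists d => // w' ww; apply: Hd.
  by rewrite opprB addrA subrK.
have nv w : G w -> ~ vertical_part Gam w by move=> /GE1[t tB ->]; exact: rv.
have WV : wsol (Bx 8) (zm r1 z0 ut) (fun z => g (affV r1 (r1 ^+ 2) z0 z)).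
  by apply: wsolW (wsol_zm z0 r10 W) => t /rD.
have baseV : base (zm r1 z0 ut) (fun z => g (affV r1 (r1 ^+ 2) z0 z)).
  by split => // t tB; apply: lcont_zm => //; apply: ccont_lcont; apply: uc; exact: rD.
have zmM s p : 0 < s -> forall z, `|zm s p ut z| <= M / s ^+ 2.
  move=> sp z; rewrite /zm normrM gtr0_norm ?invr_gt0 ?exprn_gt0// mulrC ler_wpM2r// invr_ge0 exprn_ge0// ltW//.
have osc w w' : G w -> G w' -> `|ut w - ut w'| < D.
  move=> /GE[t tB ->] /GE[t' t'B ->]; have := HE _ _ baseV (zmM r1 z0 r10) kk t t' tB t'B.
  rewrite iter_zm -/s0 /zm -mulrBr normrM gtr0_norm ?invr_gt0 ?exprn_gt0// ler_pdivrMl ?exprn_gt0// => h.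
  apply: (le_lt_trans h); rewrite /s0 exprMn.
  have p2 : rj kk * 2 ^+ kk = 1 :> R by rewrite /rj -exprMn mulVf// expr1n.
  have -> : r1 ^+ 2 * rj kk ^+ 2 * (2 ^+ kk * E) = rj kk * (r1 ^+ 2 * E) * (rj kk * 2 ^+ kk) by ring.
  rewrite p2 mulr1; have F0 : 0 <= r1 ^+ 2 * E by rewrite mulr_ge0// ltW.
  have := Hkk kk (leqnn _); rewrite ler_pdivlMr; last by clear -F0; lra.
  by have := @rj_gt0 R kk; move: (rj kk) (r1 ^+ 2 * E) F0; clear => a b; nra.
have side : (forall w, G w -> u w < beta) \/ (forall w, G w -> alpha < u w).
  have [?|/existsNP[w1 /not_implyP[Gw /negP]]] := pselect (forall w, G w -> u w < beta); first by left.
  rewrite -leNgt => bw; right => w Gw'; have := osc _ _ Gw Gw'; rewrite !utE; [|exact: GQ..].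
  by have := ler_norm (u w1 - u w); clear -bw abD; lra.
have ab : alpha < beta by clear -abD D0; lra.
have [s [c [s1 CO]]] := relay_col ab h0P utE (wsolW GD W) ae oG GQ (fun w Gw => uc w (GD w Gw)) nv side.
set v := fun z => s * ut z + c in CO; set f := fun z => _ in CO; set A := [set w | _] in CO.
have BG a t : Bx a t -> a <= 16 -> G (affV r (r ^+ 2) z0 t).
  move=> [t1 /andP[t2 t3]] a16; split; rewrite /= addrK; first by rewrite normrZ gtr0_norm//; clear -t1 a16 r0; nra.
  rewrite pmulr_rlt0// t3 andbT exprMn; have a0 : 0 <= a := ltW (le_lt_trans (normr_ge0 _) t1).
  have : a ^+ 2 <= 16 ^+ 2 by rewrite ler_pXn2r ?nnegrE.
  by move=> h; rewrite [16 ^+ 2 * _]mulrC -mulrN ltr_pM2l//; apply: le_lt_trans t2; rewrite lerN2.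
have affr t p0 : `|t.1| <= 16 -> `|t.2| <= 256 -> 0 < p0 -> p0 <= 1 -> p0 <= e0 / 512 ->
    `|affV r (r ^+ 2) z0 (p0 *: t.1, p0 ^+ 2 * t.2) - z0| < e0.
  move=> t1 t2 p00 p01 pe; have p2 : p0 ^+ 2 <= p0 by rewrite expr2 ler_piMr// ltW.
  have p20 : 0 < p0 ^+ 2 by rewrite exprn_gt0.
  have r21 : r ^+ 2 <= 1 by rewrite exprn_ile1// ltW.
  have -> : affV r (r ^+ 2) z0 (p0 *: t.1, p0 ^+ 2 * t.2) - z0 = ((r * p0) *: t.1, (r ^+ 2 * p0 ^+ 2) * t.2).
    by apply: injective_projections; rewrite /= addrK ?scalerA ?mulrA.
  rewrite normV gt_max /= normrZ [X in _ && (X < _)]normrM (gtr0_norm (mulr_gt0 r0 p00)) (gtr0_norm (mulr_gt0 r20 p20)).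
  move: (normr_ge0 t.1) (normr_ge0 t.2); move: `|t.1| `|t.2| (r ^+ 2) (p0 ^+ 2) t1 t2 r20 r21 p2 p20 => b1 b2 b3 b4 h1 h2 h3 h4 h5 h6 h7 h8.
  apply/andP; split.
    have : r * p0 * b1 <= 1 * p0 * 16 by apply: ler_pM => //; [rewrite mulr_ge0// ltW|apply: ler_pM => //; exact: ltW].
    by clear -pe e00; lra.
  have : b3 * b4 * b2 <= 1 * b4 * 256 by apply: ler_pM => //; [rewrite mulr_ge0// ltW|apply: ler_pM => //; exact: ltW].
  by clear -pe e00 h5; lra.
(* The box of scale [k] contains a single phase. This holds for large [k], as the relay is constant
   near [z0]. *)
pose cst k := (forall t : V, Bx (rj k) t -> A (affV r (r ^+ 2) z0 t)) \/
              (forall t : V, Bx (rj k) t -> ~ A (affV r (r ^+ 2) z0 t)).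
have rj16 k : rj k <= 16 :> R by apply: le_trans (@rj_le1 R k) _; rewrite ler1n.
have ex : exists k, `[< cst k >].
  have [k Hk] := @rj_small R (e0 / 512) (divr_gt0 e00 (ltr0Sn _ _)).
  exists k; apply/asboolP.
  have near t : Bx (rj k) t -> H (affV r (r ^+ 2) z0 t) = c0.
    move=> tB; apply: Hc; first by apply: GQ; exact: BG tB (rj16 k).
    have a0 := @rj_gt0 R k; have a20 : 0 < rj k ^+ 2 :> R by rewrite exprn_gt0.
    have [t1 /andP[t2 t3]] := tB.
    have := affr ((rj k)^-1 *: t.1, (rj k ^+ 2)^-1 * t.2) (rj k) _ _ a0 (rj_le1 k) (Hk k (leqnn _)).
    rewrite /= scalerA divff ?gt_eqF// scale1r mulrA divff ?gt_eqF// mul1r.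
    have i1 : 0 < (rj k)^-1 :> R by rewrite invr_gt0.
    have i2 : 0 < (rj k ^+ 2)^-1 :> R by rewrite invr_gt0.
    rewrite normrZ normrM (gtr0_norm i1) (gtr0_norm i2) !ler_pdivrMl//.
    have -> : ((t.1, t.2) : V) = t by case: (t).
    apply; first by apply: le_trans (ltW t1) _; rewrite ler_peMr ?ler1n// ltW.
    by rewrite ler_norml; move: (rj k ^+ 2) (t.2) t2 t3 a20; clear => *; apply/andP; split; lra.
  have [cs|cs] := eqVneq c0 s.
    by left => t tB; split; [apply: GQ; exact: BG tB (rj16 k)|rewrite -/H near].
  by right => t tB [_]; rewrite -/H near// => /eqP; rewrite (negbTE cs).
have WG : wsol (Bx 8) (zm r z0 ut) (fun z => g (affV r (r ^+ 2) z0 z)).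
  by apply: wsolW (wsol_zm z0 r0 W) => t tB; apply: GD; apply: BG tB _; clear; lra.
have base0 : base (zm r z0 ut) (fun z => g (affV r (r ^+ 2) z0 z)).
  split => // t tB; apply: lcont_zm => //; apply: ccont_lcont; apply: uc; apply: GD; apply: BG tB _; clear; lra.
have bg : bm g by have [_ mg g1 _] := W; split => //; exists 1.
pose k0 := ex_minn ex; have [/asboolP cst0 min0] : `[< cst k0 >] /\ forall k, `[< cst k >] -> (k0 <= k)%N.
  by rewrite /k0; case: ex_minnP.
have [c' Hc'] : exists c', forall t, Bx (rj k0) t -> H (affV r (r ^+ 2) z0 t) = c'.
  case: cst0 => h; first by exists s => t /h[].
  exists (- s) => t tB; have Qt : Q (affV r (r ^+ 2) z0 t) by apply: GQ; exact: BG tB (rj16 k0).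
  have := hysteresis_pm h0P Qt; have := h t tB; rewrite /A /= -/H; move: (H _) => x nx.
  by case: s1 nx => -> nx [xE|xE]; rewrite ?opprK//; case: nx.
have cg k : (k0 + 3 <= k)%N -> constg (iter k zmg (fun z => g (affV r (r ^+ 2) z0 z))) c'.
  move=> kl; rewrite iter_zmg.
  rewrite (_ : (fun z => _) = fun z => g (affV (r * rj k) ((r * rj k) ^+ 2) z0 z)); last first.
    apply/funext => z; rewrite affV_comp; congr (g (affV _ _ _ _)).
    by apply: injective_projections; rewrite /= ?scaler0 ?mulr0 add0r.
  apply: (constg_ae bg (H := H) (Q := Q)) => //; first by rewrite mulr_gt0// rj_gt0.
  move=> t [t1 /andP[t2 t3]].
  have -> : affV (r * rj k) ((r * rj k) ^+ 2) z0 t = affV r (r ^+ 2) z0 (rj k *: t.1, rj k ^+ 2 * t.2).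
    by apply: injective_projections; rewrite /= ?scalerA ?exprMn ?mulrA.
  have a0 := @rj_gt0 R k; have a20 : 0 < rj k ^+ 2 :> R by rewrite exprn_gt0.
  (* Three more zooms make [Bx 8] fit into the box with a single phase. *)
  have k8 : 8 * rj k <= rj k0 :> R.
    have := @rj_anti R _ _ kl; rewrite {2}/rj exprD.
    have -> : 2^-1 ^+ 3 = 8^-1 :> R by field.
    by rewrite -[2^-1 ^+ k0]/(rj k0); move: (rj k0) (rj k); clear => x y; lra.
  have tB : Bx (rj k0) (rj k *: t.1, rj k ^+ 2 * t.2).
    split => /=; first by rewrite normrZ gtr0_norm//; move: (rj k) (rj k0) a0 k8 => b1 b2; clear -t1; nra.
    rewrite pmulr_rlt0// t3 andbT.
    have n0 : 0 <= 8 * rj k :> R by move: (rj k) a0 => x; clear; lra.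
    have : (8 * rj k) ^+ 2 <= rj k0 ^+ 2 :> R by rewrite ler_pXn2r ?nnegrE// (le_trans n0).
    by rewrite exprMn; move: (rj k ^+ 2) (rj k0 ^+ 2) (8 ^+ 2) t2 a20 => b1 b2 b3; clear; nra.
  by split; [apply: GQ; exact: BG tB (rj16 k0)|exact: Hc'].
exists (kk + 3 + (k0 + 3))%N => k kl i j.
have kE : k = (kk + 3 + (k - (kk + 3)))%N by rewrite subnKC//; apply: leq_trans kl; exact: leq_addr.
have -> : zm (r1 * rj k) z0 ut = iter (k - (kk + 3)) zmv (zm r z0 ut).
  by rewrite iter_zm rE -mulrA /rj -exprD -kE.
rewrite (PP_const_iter i j base0 cg); last by rewrite leq_subRL// (leq_trans _ kl)// leq_addr.
have KK0 : 0 <= KKap (R := R) (n := n) by apply: sumr_ge0 => ? _; apply: sumr_ge0 => ? _; exact: Kabs_ge0.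
have KP0 : 0 <= KPsi (R := R) (n := n) by apply: sumr_ge0 => ? _; apply: sumr_ge0 => ? _; exact: Kabs_ge0.
have MK0 : 0 <= M2 * KKap (R := R) (n := n) := mulr_ge0 M20 KK0.
(* If the initial box already has a single phase, three zooms and the bound on [u] are enough. *)
have [k00|k0p] := posnP k0.
  have := PP_iter i j 3 base0; rewrite k00.
  have [mw _] : bm (zm r z0 ut) := let: And4 a _ _ _ := WG in a.
  have := PP_le i j (@ker_kap R n) mw (zmM r z0 r0); rewrite -/M2 => h1.
  have h2 : M2 * Kabs (Dx i (Dx j (@kap R n))) <= M2 * KKap (R := R) (n := n).
    exact: (ler_wpM2l M20 (Kabs_le_sum (fun i j => Dx i (Dx j (@kap R n))) i j)).
  move: (PP _ _ _ _) (PP _ _ _ _) h1 => a b h1; have := normr_ge0 C2.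
  have := ler_normD (a - b) b; rewrite subrK; move: h1 h2.
  by move: (M2 * Kabs _) (M2 * KKap) (3 * KPsi) `|C2|; clear => x1 x2 x3 x4; lra.
(* By minimality the box one scale up meets both phases, so it contains a point of the free
   boundary. *)
have : ~ cst k0.-1 by move=> /asboolP/min0; rewrite leqNgt ltn_predL k0p.
move=> ncst; have jE : k0 = k0.-1.+1 by rewrite prednK.
move: ncst jE; move: (k0.-1) => jj ncst jE.
have [t1 B1 A1] : exists2 t1, Bx (rj jj) t1 & A (affV r (r ^+ 2) z0 t1).
  by apply: contrapT => h; apply: ncst; right => t tB At; apply: h; exists t.
have [t2 B2 A2] : exists2 t2, Bx (rj jj) t2 & ~ A (affV r (r ^+ 2) z0 t2).
  by apply: contrapT => h; apply: ncst; left => t tB; apply: contrapT => nAt; apply: h; exists t.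
have [y0 y0B Ey] := edge_exists r0 rr1 B1 B2 A1 A2.
set z1 := affV r _ z0 y0 in Ey; have Gz1 : G z1 by exact: BG y0B (rj16 jj).
have z1G t : Bx 8 t -> G (affV r (r ^+ 2) z1 t).
  move=> [tt1 /andP[tt2 tt3]].
  have -> : affV r (r ^+ 2) z1 t = affV r (r ^+ 2) z0 (t + y0).
    by apply: injective_projections; rewrite /= ?scalerDr ?mulrDr addrA.
  apply: (BG 16) => //; have [a1 /andP[a2 a3]] := y0B; have b1 := @rj_le1 R jj.
  have b2 : rj jj ^+ 2 <= 1 :> R by rewrite exprn_ile1// ltW// rj_gt0.
  have e1 : (16 : R) ^+ 2 = 256 by ring. have e2 : (8 : R) ^+ 2 = 64 by ring.
  split; rewrite /= ?e1; first by apply: (le_lt_trans (ler_normD _ _)); apply: lt_le_trans (ltrD tt1 (lt_le_trans a1 b1)) _; clear; lra.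
  rewrite e2 in tt2; move: (rj jj ^+ 2) (t.2) (y0.2) b2 a2 a3 tt2 tt3; clear => x1 x2 x3 *; apply/andP; split; lra.
have P1 := prob_of_col CO Gz1 Ey r0 rr1 z1G.
(* As [v] vanishes at [z1], the constant is bounded by [M], although it stems from a threshold. *)
have cE : c = - (s * ut z1) by have := edge_zero CO Gz1 Ey; rewrite /v; clear; lra.
have vE y : zm r z1 v y = s * zm r z0 ut (y + y0) + c / r ^+ 2.
  rewrite /zm /v mulrDr [_ * c]mulrC mulrCA; congr (s * (_ * ut _) + _).
  by apply: injective_projections; rewrite /= ?scalerDr ?mulrDr addrA.
have sn : `|s| = 1 by case: s1 => ->; rewrite ?normrN normr1.
have vM y : `|zm r z1 v y| <= 2 * M2.
  rewrite vE; apply: (le_trans (ler_normD _ _)); rewrite normrM sn mul1r.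
  have := zmM r z0 r0 (y + y0); rewrite -/M2.
  have : `|c / r ^+ 2| <= M2.
    have cM : `|c| <= M by rewrite cE normrN normrM sn mul1r.
    have ri : 0 <= (r ^+ 2)^-1 by rewrite invr_ge0 ltW.
    by rewrite normrM normfV (gtr0_norm r20); exact: ler_wpM2r ri _ _ cM.
  by clear; lra.
have := HC2 _ _ _ _ _ s (c / r ^+ 2) y0 jj base0 (zmM r z0 r0) P1 vM s1 y0B vE 4%N i j isT.
have -> : (k0 + 3 = 4 + jj)%N by rewrite jE addSn addnC.
have := ler_norm C2; move: (PP _ _ _ _) (M2 * KKap) MK0 (KPsi) KP0 `|C2| => a x x0 y yy0 c2; clear -x0 yy0; lra.
Qed.
End main_estimate.

(** * Classical derivatives *)

Section derivatives.
Context {R : realType} {n : nat}.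
Local Notation V := ('rV[R]_n * R)%type.
Local Notation mu := (@spacetime_measure R n).
Implicit Types (z w y t : V).

Lemma D_bound (G : V -> R) z : differentiable G z ->
  exists2 C, 0 <= C & forall h : V, `|'d G z h| <= C * `|h|.
Proof.
move=> dG; exists (\sum_(j : option 'I_n) `|'D_(dirs j) G z|) => [|h]; first exact: sumr_ge0.
rewrite -deriveE// (D_dirs dG) mulr_suml; apply: (le_trans (ler_norm_sum _ _ _)); apply: ler_sum => j _.
by rewrite normrM mulrC ler_wpM2l// coef_le.
Qed.

Lemma diff_section (G : V -> R) l (b x : 'rV[R]_n) s : differentiable G (l *: x + b, s) ->
  differentiable (fun x => G (l *: x + b, s)) x /\
  forall v, 'D_v (fun x => G (l *: x + b, s)) x = l * 'D_((v, 0) : V) G (l *: x + b, s).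
Proof.
move=> dG; have [C C0 HC] := D_bound dG.
pose L (v : 'rV[R]_n) : R := 'd G (l *: x + b, s) ((l *: v, 0) : V).
have pn (v : 'rV[R]_n) : `|(l *: v, 0) : V| <= `|l| * `|v|.
  by rewrite normV ge_max /= normrZ lexx normr0 mulr_ge0.
have Ll : linear (L : 'rV[R]_n -> R^o).
  move=> k v v'; rewrite /L -linearP; congr ('d G _ _).
  by apply: injective_projections; rewrite /= ?scalerDr ?scalerA ?[l * k]mulrC// scaler0 addr0.
have [d D] : differentiable (fun x => G (l *: x + b, s)) x /\ forall v, 'D_v (fun x => G (l *: x + b, s)) x = L v.
  apply: (eps_diff (C := C * `|l|) Ll) => [v|e e0].
    by apply: (le_trans (HC _)); rewrite -mulrA; apply: ler_wpM2l.
  have l1 : 0 < `|l| + 1 by rewrite ltr_wpDl.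
  have [|d d0 Hd] := diff_eps dG (e := e / (`|l| + 1)); first by rewrite divr_gt0.
  exists (d / (`|l| + 1)); first by rewrite divr_gt0.
  move=> v; rewrite ltr_pdivlMr// => vd.
  have lv : `|(l *: v, 0) : V| <= (`|l| + 1) * `|v| by apply: (le_trans (pn v)); rewrite ler_wpM2r// lerDl.
  have := Hd ((l *: v, 0) : V) (le_lt_trans lv _); rewrite mulrC => /(_ vd).
  have -> : (l *: x + b, s) + (l *: v, 0) = (l *: (x + v) + b, s) :> V.
    by apply: injective_projections; rewrite /= ?addr0// scalerDr addrAC.
  move=> /le_trans; apply; rewrite [e / _]mulrC -mulrA ler_pdivrMl// mulrCA ler_wpM2l// ltW//.
split => // v; rewrite D /L -(deriveE _ dG) -(D_scale_dir _ _ dG); congr ('D_ _ _ _).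
by apply: injective_projections => //=; rewrite scaler0.
Qed.

Lemma norm2_le m (A : 'M[R]_m) C : 0 <= C -> (forall i j, `|A i j| <= C) -> norm2 A <= m%:R * C.
Proof.
move=> C0 H; rewrite /norm2 -(@ger0_norm _ (m%:R * C)) ?mulr_ge0// -sqrtr_sqr ler_wsqrtr//.
apply: (@le_trans _ _ (\sum_(i < m) \sum_(j < m) C ^+ 2)).
  apply: ler_sum => i _; apply: ler_sum => j _.
  by rewrite -real_normK ?num_real// ler_pXn2r ?nnegrE.
by rewrite !sumr_const !card_ord -mulrnA -[leLHS]mulr_natl natrM exprMn expr2.
Qed.

(** Near [z0] the relay is constant, so [loc] writes [u] through the smooth function [cv kap w]. The
    classical Hessian and time derivative exist, and are exactly the Taylor coefficients [PP] and
    [dtk] at a small scale; [dt_trace] bounds the latter by the former. *)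
Lemma local_derivatives (U : set 'rV[R]_n) (T : R) (u ut g H : V -> R) (z0 : V) c0 e0 l C :
  cylinder U T z0 -> (forall z, cylinder U T z -> ut z = u z) ->
  wsol [set z | U z.1 /\ 0 < z.2 < T] ut g -> {ae mu, forall z, cylinder U T z -> g z = H z} ->
  (forall w : V, cylinder U T w -> lcont ut w) ->
  (forall w, cylinder U T w -> `|w - z0| < e0 -> H w = c0) ->
  0 < l -> l <= 1 -> (forall x, `|x - z0.1| <= 8 * l -> U x) -> 64 * l ^+ 2 < z0.2 ->
  (z0.2 < T -> z0.2 + l ^+ 2 < T) -> 8 * l < e0 -> 64 * l ^+ 2 < e0 ->
  (forall i j, `|PP kap (zm l z0 ut) i j| <= C) -> 0 <= C ->
  has_dt_hessian (cylinder U T) u z0 /\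
  `|dt (cylinder U T) u z0| + norm2 (hessian u z0) <= 2 * (n%:R * C) + Kabs (@kap R n).
Proof.
move=> Qz0 utE W ae lc Hc l0 l1 hU ht hT he1 he2 PC C0; set Q := cylinder U T in Qz0 utE ae lc Hc *.
have l20 : 0 < l ^+ 2 by rewrite exprn_gt0.
have [Uz0 /andP[t00 t0T]] := Qz0.
(* [loc] covers past points only. Below the top, the base point is placed [l^2] later than [z0], so
   that a full neighbourhood is covered; on the top it is [z0] itself, and the time derivative is
   one-sided. *)
have [b [b1 b0 bT bs]] : exists b : R, [/\ -1 <= b, b <= 0, z0.2 - l ^+ 2 * b <= T &
    forall s, s <= T -> `|s - z0.2| < l ^+ 2 -> s <= z0.2 - l ^+ 2 * b].
  move: t0T; rewrite le_eqVlt => /orP[/eqP tT|tT].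
    by exists 0; rewrite mulr0 subr0 tT; split => //; lra.
  exists (-1); rewrite mulrN1 opprK; split; [|exact: lerN10|exact: ltW (hT tT)|] => //.
  by move=> s _ /ltW; rewrite ler_norml; clear; lra.
pose p : V := (z0.1, z0.2 - l ^+ 2 * b); pose y0 : V := (0, b).
pose w := zm l p ut; pose gw z := g (affV l (l ^+ 2) p z).
have inD t : Bx 8 t -> U (affV l (l ^+ 2) p t).1 /\ 0 < (affV l (l ^+ 2) p t).2 < T.
  move=> [t1 /andP[t2 t3]]; split => /=.
    by apply: hU; rewrite addrK normrZ gtr0_norm// mulrC ler_wpM2r// ltW.
  have e8 : (8 : R) ^+ 2 = 64 by ring.
  rewrite e8 in t2; move: (l ^+ 2) (t.2) (z0.2) l20 t2 t3 ht bT => L s r L0 s1 s2 r1 r2.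
  by clear -L0 s1 s2 r1 r2 b0 b1; apply/andP; split; nra.
have Ww : wsol (Bx 8) w gw by apply: wsolW (wsol_zm p l0 W) => t /inD.
have bw : bm w by have [] := Ww.
have bg : bm g by have [_ mg g1 _] := W; split => //; exists 1.
have cg : constg gw c0.
  apply: (constg_ae bg l0 ae) => t tB; have [Ut /andP[s0 /ltW sT]] := inD t tB.
  have Qt : Q (affV l (l ^+ 2) p t) by split => //; rewrite s0.
  split => //; apply: Hc => //; have [t1 /andP[t2 t3]] := tB.
  rewrite normV gt_max /= addrK normrZ (gtr0_norm l0); apply/andP; split.
    by apply: le_lt_trans he1; rewrite mulrC ler_wpM2r// ltW.
  apply: le_lt_trans he2; have e8 : (8 : R) ^+ 2 = 64 by ring.
  rewrite e8 in t2; move: (l ^+ 2) (t.2) (z0.2) l20 t2 t3 => L s r L0 s1 s2.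
  by clear -L0 s1 s2 b0 b1; rewrite ler_norml; apply/andP; split; nra.
have loc_w y : `|y.1| <= 2 -> -4 <= y.2 -> y.2 <= 0 -> w y = cv kap w y - 4 / 3 * c0 * I (@psi R n).
  move=> h1 h2 h3; apply: (loc Ww cg) => //; apply: lcont_zm => //; apply: lc; split => /=.
    by apply: hU; rewrite addrK normrZ gtr0_norm// mulrC ler_wpM2r ?ltW//; apply: le_lt_trans h1 _; fast_lra.
  move: (l ^+ 2) (y.2) (z0.2) l20 h2 h3 ht bT => L s r L0 s1 s2 r1 r2.
  by clear -L0 s1 s2 r1 r2 b0 b1; apply/andP; split; nra.
pose F := cv kap w; pose K := 4 / 3 * c0 * I (@psi R n).
have uF x s : Q (x, s) -> `|x - z0.1| < l -> `|s - z0.2| < l ^+ 2 ->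
    u (x, s) = l ^+ 2 * (F (l^-1 *: x + - (l^-1 *: z0.1), (s - z0.2) / l ^+ 2 + b) - K).
  move=> Qs xl sl; rewrite -utE// /F /K -loc_w /=.
  - rewrite /w /zm mulrA divff ?gt_eqF// mul1r; congr ut.
    apply: injective_projections => /=.
      by rewrite scalerDr scalerN !scalerA divff ?gt_eqF// !scale1r subrK.
    by move: (l ^+ 2) l20 => L L0; field; rewrite gt_eqF.
  - rewrite -scalerBr normrZ gtr0_norm ?invr_gt0// ler_pdivrMl//; clear -xl l0; lra.
  - move: sl; rewrite ltr_norml => /andP[sl _].
    have : -1 <= (s - z0.2) / l ^+ 2 by rewrite ler_pdivlMr// mulN1r ltW.
    by clear -b1; lra.
  - have [_ /andP[_ sT]] := Qs; have := bs s sT sl => h.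
    have : (s - z0.2) / l ^+ 2 <= - b by rewrite ler_pdivrMr// mulNr mulrC; clear -h; lra.
    by clear; lra.
have dF (k : V -> R) z : ker k -> differentiable (cv k w) z /\ forall h : V, 'D_h (cv k w) z = - cv ('D_h k) w z.
  by move=> kk; exact: cv_diff.
pose q : 'rV[R]_n := - (l^-1 *: z0.1).
have y0E : (l^-1 *: z0.1 + q, (z0.2 - z0.2) / l ^+ 2 + b) = y0 :> V by rewrite /q !subrr mul0r add0r.
have sec (k : V -> R) x : ker k -> differentiable (fun x : 'rV[R]_n => cv k w ((l^-1 *: x + q, b) : V)) x /\
    forall j, 'D_(delta_mx ord0 j) (fun x : 'rV[R]_n => cv k w ((l^-1 *: x + q, b) : V)) x =
       - (l^-1 * cv (Dx j k) w ((l^-1 *: x + q, b) : V)).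
  move=> kk; have [d1 d2] := dF k (l^-1 *: x + q, b) kk; have [d3 d4] := diff_section d1.
  by split => // j; rewrite d4 d2 mulrN.
have kx j : ker (Dx j (@kap R n)) by exact: ker_D ker_kap.
pose f (x : 'rV[R]_n) := u (x, z0.2).
pose Phi (x : 'rV[R]_n) : R := l ^+ 2 * (F ((l^-1 *: x + q, b) : V) - K).
have near_f x : `|x - z0.1| < l -> f x = Phi x.
  move=> xl; rewrite /f uF ?subrr ?mul0r ?add0r// ?normr0//.
  by split => /=; [apply: hU; clear -l0 xl; lra|rewrite t00].
have DPhi x : differentiable Phi x /\ forall j, 'D_(delta_mx ord0 j) Phi x = - (l * cv (Dx j kap) w ((l^-1 *: x + q, b) : V)).
  have [d1 d2] := sec _ x (@ker_kap R n).
  have dB : differentiable (fun x : 'rV[R]_n => F ((l^-1 *: x + q, b) : V) - K) x by exact: differentiableB.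
  have vd j : derivable (fun x : 'rV[R]_n => F ((l^-1 *: x + q, b) : V)) x (delta_mx ord0 j) by exact: diff_derivable.
  split; first exact: (differentiableZ (l ^+ 2) dB).
  move=> j; rewrite /Phi (@deriveZ _ _ _ (fun x : 'rV[R]_n => F ((l^-1 *: x + q, b) : V) - K)) //; last exact: diff_derivable.
  rewrite deriveB// derive_cst subr0 d2 /GRing.scale /= mulrN mulrA expr2 mulfK// gt_eqF//.
have Df x : `|x - z0.1| < l -> differentiable f x /\ forall j, 'D_(delta_mx ord0 j) f x = - (l * cv (Dx j kap) w ((l^-1 *: x + q, b) : V)).
  move=> xl; have [d1 d2] := DPhi x; have [|d3 d4] := near_diff (f := f) _ d1.
    exists (l - `|x - z0.1|) => [|h hl]; first by rewrite subr_gt0.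
    by apply: near_f; rewrite addrAC; have := ler_normD (x - z0.1) h; clear -hl; lra.
  by split => // j; rewrite d4.
have Df2 j : differentiable ('D_(delta_mx ord0 j) f) z0.1 /\
    forall i, 'D_(delta_mx ord0 i) ('D_(delta_mx ord0 j) f) z0.1 = cv (Dx i (Dx j kap)) w y0.
  have [d1 d2] := sec _ z0.1 (kx j).
  have dZ : differentiable (fun x : 'rV[R]_n => - l * cv (Dx j kap) w ((l^-1 *: x + q, b) : V)) z0.1.
    exact: (differentiableZ (- l) d1).
  have [|d3 d4] := near_diff (f := 'D_(delta_mx ord0 j) f) _ dZ.
    exists l => // h hl; rewrite mulNr; apply: (Df _ _).2; by rewrite addrAC subrr add0r.
  split => // i; rewrite d4 (@deriveZ _ _ _ (fun x : 'rV[R]_n => cv (Dx j kap) w ((l^-1 *: x + q, b) : V))); last exact: diff_derivable.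
  rewrite d2 /GRing.scale /= mulrNN mulrA divff ?gt_eqF// mul1r; congr (cv _ _ _).
  by congr (_, _); exact: subrr.
have wy0 y : w (y + y0) = zm l z0 ut y.
  rewrite /w /zm; congr (_ * ut _); apply: injective_projections => /=; first by rewrite addr0.
  by ring.
have HE i j : hessian u z0 i j = PP kap (zm l z0 ut) i j.
  rewrite mxE (Df2 j).2 /cv /PP; congr I; apply/funext => y; by rewrite wy0.
pose d : R := - cv (Dt kap) w y0.
have dq : tquotient u z0 @ tpunctured Q z0 --> d.
  have [F1 F2] := dF _ y0 (@ker_kap R n).
  apply/cvgrPdist_le => e ep; have [r r0 Hr] := diff_eps F1 ep.
  rewrite /tpunctured /within /=; apply/nbhs_ballP; exists (Num.min (l ^+ 2) (r * l ^+ 2)) => /=.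
    by rewrite lt_min l20 mulr_gt0.
  move=> s; rewrite -ball_normE /= distrC => sl sn Qs.
  move: sl; rewrite lt_min => /andP[s1 s2].
  have sd : s - z0.2 != 0 by rewrite subr_eq0.
  pose h : V := (0, (s - z0.2) / l ^+ 2).
  have hn : `|h| = `|s - z0.2| / l ^+ 2.
    by rewrite normV /= normr0 normrM normfV (gtr0_norm l20); apply/max_idPr; rewrite mulr_ge0// invr_ge0 ltW.
  have dh : 'd F y0 h = (s - z0.2) / l ^+ 2 * d.
    rewrite -deriveE// (_ : h = ((s - z0.2) / l ^+ 2) *: tdir); last first.
      by apply: injective_projections; rewrite /= ?scaler0// /GRing.scale /= mulr1.
    by rewrite D_scale_dir// F2.
  have := Hr h; rewrite hn ltr_pdivrMr// => /(_ s2); rewrite dh => H1.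
  have u1 : u (z0.1, s) = l ^+ 2 * (F (y0 + h) - K).
    rewrite uF// ?subrr ?normr0//; congr (_ * (F _ - _)).
    by apply: injective_projections; rewrite /= ?addr0 ?subrr// addrC.
  have u2 : u z0 = l ^+ 2 * (F y0 - K).
    by have := @uF z0.1 z0.2; rewrite -/q y0E !subrr !normr0 -surjective_pairing; exact.
  rewrite /tquotient u1 u2 distrC.
  have -> : (l ^+ 2 * (F (y0 + h) - K) - l ^+ 2 * (F y0 - K)) / (s - z0.2) - d =
      (F (y0 + h) - F y0 - (s - z0.2) / l ^+ 2 * d) / ((s - z0.2) / l ^+ 2).
    move: (F _) (F _) (s - z0.2) sd (l ^+ 2) l20 => a1 a2 a3 a4 L L0; field.
    by rewrite a4 gt_eqF.
  have hp : 0 < `|(s - z0.2) / l ^+ 2| by rewrite normr_gt0 mulf_neq0// invr_neq0// gt_eqF.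
  by rewrite normrM normfV ler_pdivrMr// normrM normfV (gtr0_norm l20).
have dtE : dt Q u z0 = d.
  (* Times slightly before [z0.2] are positive, so they always belong to the cylinder, and the limit
     is unique. *)
  have P : ProperFilter (tpunctured Q z0).
    constructor; last exact: within_filter.
    rewrite /tpunctured /within /= => /nbhs_ballP[e /= e0' He].
    pose m := Num.min e z0.2 / 2; have m0 : 0 < m by rewrite divr_gt0// lt_min e0'.
    have me : m < e by rewrite ltr_pdivrMr// mulr_natr mulr2n; have : Num.min e z0.2 <= e by [rewrite ge_min lexx]; clear -e0'; lra.
    have mz : m < z0.2 by rewrite ltr_pdivrMr// mulr_natr mulr2n; have : Num.min e z0.2 <= z0.2 by [rewrite ge_min lexx orbT]; clear -t00; lra.
    apply: (He (z0.2 - m)) => /=.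
    - by rewrite -ball_normE /= opprB addrC subrK gtr0_norm.
    - by rewrite lt_eqF// ltrBlDr ltrDl.
    - by split => //=; clear -m0 mz t0T; apply/andP; split; lra.
  exact: cvg_lim dq.
split.
  split; [by apply/cvg_ex; exists d| |by move=> j; exact: (Df2 j).1].
  by apply: filterS (nbhsx_ballx z0.1 l l0) => x; rewrite -ball_normE /= distrC => /Df[].
have WV : wsol (Bx 8) (zm l z0 ut) (fun z => g (affV l (l ^+ 2) z0 z)).
  apply: wsolW (wsol_zm z0 l0 W) => t [t1 /andP[t2 t3]]; split => /=.
    by apply: hU; rewrite addrK normrZ gtr0_norm// mulrC ler_wpM2r// ltW.
  have e8 : (8 : R) ^+ 2 = 64 by ring.
  rewrite e8 in t2; move: (l ^+ 2) (t.2) (z0.2) l20 t2 t3 ht t0T => L s r L0 s1 s2 r1 r2.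
  by clear -L0 s1 s2 r1 r2; apply/andP; split; nra.
have dE : d = dtk kap (zm l z0 ut).
  by rewrite /d /dtk /cv; congr (- I _); apply/funext => y; rewrite wy0.
have d1 : `|d| <= n%:R * C + Kabs (@kap R n).
  rewrite dE (dt_trace WV (@KB4_Bx R n)); apply: (le_trans (ler_normB _ _)); apply: lerD.
    apply: (le_trans (ler_norm_sum _ _ _)); apply: (@le_trans _ _ (\sum_(i < n) C)); first exact: ler_sum.
    by rewrite sumr_const card_ord -[leLHS]mulr_natl.
  have [_ mg g1 _] := WV; have := I_wle mg g1 (@nice_kap R n); by rewrite mul1r.
have d2 : norm2 (hessian u z0) <= n%:R * C by apply: norm2_le => // i j; rewrite HE.
by rewrite dtE; move: d1 d2; move: (n%:R * C) `|d|; clear => a c; lra.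
Qed.
End derivatives.

(** * Parabolic distances and the final estimate *)

Section assembly.
Context {R : realType} {n : nat}.
Local Notation V := ('rV[R]_n * R)%type.
Implicit Types (z w y t : V).

Lemma norm2_sup (x : 'rV[R]_n) r : 0 <= r -> (0 < n)%N -> `|x| < r / n%:R -> norm2 x < r.
Proof.
move=> r0 n0 xr; have N0 : 0 < n%:R :> R by rewrite ltr0n.
rewrite ltr_pdivlMr// in xr; apply: le_lt_trans xr; rewrite /norm2 big_ord1.
rewrite -(@ger0_norm _ (`|x| * n%:R)) ?mulr_ge0// -sqrtr_sqr ler_wsqrtr//.
apply: (@le_trans _ _ (\sum_(j < n) `|x| ^+ 2)).
  by apply: ler_sum => j _; rewrite -real_normK ?num_real// ler_pXn2r ?nnegrE// rV_coord_le.
rewrite sumr_const card_ord -[leLHS]mulr_natl exprMn mulrC ler_wpM2l ?sqr_ge0//.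
by rewrite expr2 ler_peMr// ler1n.
Qed.

Lemma sup_norm2 (x : 'rV[R]_n) : `|x| <= norm2 x.
Proof.
apply/rV_norm_leP => [|i]; first exact: sqrtr_ge0.
rewrite /norm2 big_ord1 -sqrtr_sqr ler_wsqrtr// (bigD1 i)//= lerDl.
by apply: sumr_ge0 => j _; exact: sqr_ge0.
Qed.

Lemma cylinder_ball r d (z w : V) : 0 < r -> r <= 1 -> r <= d -> backward_cylinder r z w ->
  `|w - z| < d /\ w.2 < z.2.
Proof.
move=> r0 r1 rd [w1 /andP[w2 w3]]; split => //.
have r2 : r ^+ 2 <= r by rewrite expr2 ler_piMr// ltW.
rewrite normV gt_max /=; apply/andP; split; first exact: lt_le_trans (le_lt_trans (sup_norm2 _) w1) rd.
by rewrite ltr_norml; lra.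
Qed.

Lemma dist_p_gt0 (z : V) (D : set V) d : 0 < d ->
  (forall w, `|w - z| < d -> w.2 < z.2 -> ~ D w) -> (0 < dist_p z D)%E.
Proof.
move=> d0 H; pose r := Num.min d 1; have r0 : 0 < r by rewrite lt_min d0 ltr01.
apply: (@lt_le_trans _ _ r%:E); first by rewrite lte_fin.
apply: ereal_sup_ubound; exists r => //; split => //; apply/seteqP; split => // w [].
move=> /(@cylinder_ball r d z w r0); rewrite !ge_min !lexx orbT => /(_ isT isT)[h1 h2] Dw.
exact: (H w h1 h2 Dw).
Qed.

Lemma dist_p_disjoint (z : V) (D : set V) r : 0 < r -> (r%:E < dist_p z D)%E ->
  forall w, backward_cylinder r z w -> ~ D w.
Proof.
move=> r0 /ereal_sup_gt[_ [s [s0 sD] <-]]; rewrite lte_fin => rs w [w1 /andP[w2 w3]] Dw.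
have : (backward_cylinder s z `&` D) w; last by rewrite sD.
split => //; split; first exact: lt_trans w1 rs.
have : r ^+ 2 <= s ^+ 2 by rewrite ler_pXn2r ?nnegrE ?ltW.
by move=> h; apply/andP; split => //; lra.
Qed.

(** A radius strictly below the distance. The distance to an empty vertical part is infinite, hence
    the default 1. *)
Definition half_radius (x : \bar R) : R := if x is r%:E then r / 2 else 1.

Lemma half_radiusP (x : \bar R) : (0 < x)%E -> 0 < half_radius x /\ ((half_radius x)%:E < x)%E.
Proof. by case: x => [r|//|//]; rewrite ?lte_fin //= ?ltry ?ltr01// ?lte_fin => r0; split => //; lra. Qed.

Section problem_data.
Variables (U : set 'rV[R]_n) (T : R).
Local Notation Q := (cylinder U T).

(** A segment from a point just below [z] to [y + z] can leave the open cylinder only through a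
    point of the parabolic boundary, since it stays below the top. *)
Lemma box_inside r (z : V) : open U -> Q z -> 0 < r ->
  (forall y, Bx r y -> ~ parabolic_boundary U T (y + z)) ->
  forall y, Bx r y -> U (y + z).1 /\ 0 < (y + z).2 < T.
Proof.
move=> oU [Uz /andP[z0 zT]] r0 H y yB.
have oD (w : V) : U w.1 /\ 0 < w.2 < T -> exists2 d, 0 < d & forall w' : V, `|w' - w| < d -> U w'.1 /\ 0 < w'.2 < T.
  move=> [Uw /andP[w0 wT]]; have /nbhs_ballP[d /= d0 dU] := open_nbhs_nbhs (conj oU Uw).
  exists (Num.min d (Num.min w.2 (T - w.2))); first by rewrite !lt_min d0 w0 subr_gt0.
  move=> w'; rewrite !lt_min => /and3P[h1 h2 h3]; split.
    by apply: dU; rewrite -ball_normE /= distrC; apply: le_lt_trans h1; exact: (normV1 (w' - w)).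
  have := normV2 (w' - w); rewrite /= => h4; have := le_lt_trans h4 h2; have := le_lt_trans h4 h3.
  by rewrite !ltr_norml => /andP[? ?] /andP[? ?]; apply/andP; split; fast_lra.
pose t0 : V := (0, - (Num.min (r ^+ 2) z.2 / 2)).
have m0 : 0 < Num.min (r ^+ 2) z.2 by rewrite lt_min exprn_gt0.
have m1 : Num.min (r ^+ 2) z.2 <= r ^+ 2 by rewrite ge_min lexx.
have m2 : Num.min (r ^+ 2) z.2 <= z.2 by rewrite ge_min lexx orbT.
have t0B : Bx r t0.
  by split => /=; [rewrite normr0|move: (Num.min _ _) m0 m1 => m; lra].
pose P s := U (t0 + s *: (y - t0) + z).1 /\ 0 < (t0 + s *: (y - t0) + z).2 < T.
have line s s' : `|t0 + s' *: (y - t0) + z - (t0 + s *: (y - t0) + z)| = `|s' - s| * `|y - t0|.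
  by rewrite opprD addrACA subrr addr0 opprD addrACA subrr add0r -scalerBl normrZ.
have c0 : 0 < `|y - t0| + 1 by rewrite ltr_wpDl.
have close s s' d : 0 < d -> `|s' - s| < d / (`|y - t0| + 1) ->
    `|t0 + s' *: (y - t0) + z - (t0 + s *: (y - t0) + z)| < d.
  by move=> d0; rewrite line ltr_pdivlMr//; apply: le_lt_trans; rewrite ler_wpM2l// lerDl.
have : P 1; last by rewrite /P scale1r [t0 + _]addrC subrK.
apply: (@seg_clopen R P).
- rewrite /P scale0r addr0 /= add0r; split => //; move: (Num.min _ _) m0 m2 => m h1 h2; apply/andP; split; fast_lra.
- move=> s hs /oD[d d0 Hd]; exists (d / (`|y - t0| + 1)); first by rewrite divr_gt0.
  by move=> s' _ /(close _ _ _ d0)/Hd.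
- move=> s hs Hs; apply: contrapT => nP.
  have sB := Bx_seg t0B yB hs; apply: (H _ sB).
  have sT : (t0 + s *: (y - t0) + z).2 < T by have [_ /andP[_ h]] := sB; apply: lt_le_trans zT; rewrite -[ltRHS]add0r ltrD2r.
  split; last by move=> [_ h]; rewrite h ltxx in sT.
  split.
    move=> B /nbhs_ballP[d /= d0 dB].
    have [|s' [_ /(close _ _ _ d0) h [h1 /andP[h2 h3]]]] := Hs (d / (`|y - t0| + 1)); first by rewrite divr_gt0.
    exists (t0 + s' *: (y - t0) + z); split; first by split => //; rewrite h2 ltW.
    by apply: dB; rewrite -ball_normE /= distrC.
  move=> /interior_subset[h1 /andP[h2 _]]; apply: nP; split => //; by rewrite h2 sT.
Qed.

Lemma within_cont (u : V -> R) w e : {within closure Q, continuous u} -> Q w -> 0 < e ->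
  exists2 d, 0 < d & forall w', Q w' -> `|w' - w| < d -> `|u w' - u w| <= e.
Proof.
move=> /subspace_continuousP H Qw e0; have /cvgrPdist_le/(_ e e0) := H w (subset_closure Qw).
rewrite /within /= => /nbhs_ballP[d /= d0 Hd]; exists d => // w' Qw' ww.
rewrite distrC; apply: Hd; last exact: subset_closure.
by rewrite -ball_normE /= distrC.
Qed.

(** A point off the boundary of one phase is interior to it, or has a neighbourhood missing it,
    where the relay takes the other value. *)
Lemma near_phase alpha beta (h0 : 'rV[R]_n -> R) u (z : V) :
  (forall x, U x -> relay alpha beta (u (x, 0)) (h0 x)) -> ~ free_boundary U T alpha beta h0 u z ->
  exists c e, 0 < e /\ forall w, Q w -> `|w - z| < e -> hysteresis U T alpha beta h0 u w = c.
Proof.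
move=> h0P nG.
have nb c : c = 1 \/ c = -1 -> ~ boundary (phase U T alpha beta h0 u c) z ->
    exists c e, 0 < e /\ forall w, Q w -> `|w - z| < e -> hysteresis U T alpha beta h0 u w = c.
  move=> c1 nB; have [/nbhs_ballP[e /= e0 He]|nI] := pselect ((phase U T alpha beta h0 u c)° z).
    exists c, e; split => // w Qw wz; have := He w; rewrite -ball_normE /= distrC => /(_ wz)[].
    by [].
  exists (- c); apply: contrapT => nE; apply: nB; split => // B /nbhs_ballP[e /= e0 eB].
  apply: contrapT => nM; apply: nE; exists e; split => // w Qw wz.
  have := hysteresis_pm h0P Qw; have : hysteresis U T alpha beta h0 u w <> c.
    by move=> Hw; apply: nM; exists w; split => //; apply: eB; rewrite -ball_normE /= distrC.
  by move: (hysteresis _ _ _ _ _ _ _) => x; case: c1 => -> nx [] xE; rewrite ?opprK//; case: nx.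
have [b1|] := pselect (boundary (phase U T alpha beta h0 u 1) z); last by apply: nb; left.
have [b2|] := pselect (boundary (phase U T alpha beta h0 u (-1)) z); last by apply: nb; right.
by case: nG.
Qed.
End problem_data.

End assembly.

Theorem theorem2p3 (R : realType) (n : nat) : (1 <= n)%N ->
  exists C : \bar R -> \bar R -> R -> R -> R,
  forall (U : set 'rV[R]_n) (T alpha beta M q : R)
    (h0 : 'rV[R]_n -> R) (u : 'rV[R]_n * R -> R),
  domain U -> 0 < T -> alpha < beta -> 1 < M -> n.+2%:R < q ->
  strong_solution U T alpha beta q h0 u ->
  (forall z, cylinder U T z -> `|u z| <= M) ->
  let Gamma := free_boundary U T alpha beta h0 u in
  forall z, cylinder U T z -> ~ Gamma z ->
  let rho0 := dist_p z (vertical_part Gamma) in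
  let eps := dist_p z (parabolic_boundary U T) in
  has_dt_hessian (cylinder U T) u z /\
  `|dt (cylinder U T) u z| + norm2 (hessian u z) <=
    C rho0 eps M (beta - alpha).
Proof.
move=> n0.
have N0 : 0 < n%:R :> R by rewrite ltr0n.
(* Division by [n] passes from the sup norm to the Euclidean norm, division by 8 makes [Bx 8] at
   this scale fit. *)
pose radius (a b : \bar R) : R := Num.min (Num.min (half_radius a) (half_radius b)) 1 / n%:R / 8.
(* The side conditions stand under the existential, so that a constant can be chosen for all real
   arguments before the solution is given. *)
have ME (r M D : R) : exists C, 0 < r -> r <= 1 -> 0 <= M -> 0 < D ->
  forall (U : set 'rV[R]_n) (T alpha beta : R) (h0 : 'rV[R]_n -> R) (u ut g : 'rV[R]_n * R -> R) (z0 : 'rV[R]_n * R) c0 e0,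
  beta - alpha = D -> (forall x, U x -> relay alpha beta (u (x, 0)) (h0 x)) ->
  (forall z, cylinder U T z -> ut z = u z) -> (forall z, `|ut z| <= M) ->
  wsol [set z | U z.1 /\ 0 < z.2 < T] ut g ->
  {ae @spacetime_measure R n, forall z, cylinder U T z -> g z = hysteresis U T alpha beta h0 u z} ->
  (forall w : 'rV[R]_n * R, U w.1 /\ 0 < w.2 < T -> ccont ut w) ->
  (forall t : 'rV[R]_n * R, Bx 8 t -> U (affV r (r ^+ 2) z0 t).1 /\ 0 < (affV r (r ^+ 2) z0 t).2 < T) ->
  (forall t : 'rV[R]_n * R, Bx 8 t -> ~ vertical_part (free_boundary U T alpha beta h0 u) (affV r (r ^+ 2) z0 t)) ->
  0 < e0 -> (forall w, cylinder U T w -> `|w - z0| < e0 -> hysteresis U T alpha beta h0 u w = c0) ->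
  exists K, forall k, (K <= k)%N -> forall i j, `|PP kap (zm (r * rj k) z0 ut) i j| <= C.
  have [[r0 [r1 [M0 D0]]]|nP] := pselect (0 < r /\ r <= 1 /\ 0 <= M /\ 0 < D).
    by have [C HC] := @main_estimate R n r M D r0 r1 M0 D0; exists C.
  by exists 0 => r0 r1 M0 D0; case: nP.
exists (fun a b M D => 2 * (n%:R * `|sval (cid (ME (radius a b) M D))|) + Kabs (@kap R n)).
move=> U T alpha beta M q h0 u [_ oU _] T0 ab M1 nq sol uM Gamma z0 Qz0 nG rho0 eps.
have [uc h0P _] := sol; have M0 : 0 <= M by fast_lra.
have q1 : 1 <= q by apply: le_trans (ltW nq); rewrite ler1n.
set Q := cylinder U T in uc uM Qz0 *; have [Uz0 /andP[t00 t0T]] := Qz0.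
have [g W ae] := bridge oU q1 sol uM M0; set ut := u \_ _ in W.
have utE z : Q z -> ut z = u z by move=> Qz; rewrite /ut patchT ?inE.
have utM z : `|ut z| <= M.
  by rewrite /ut patchE; case: ifPn => [/set_mem/uM//|_]; rewrite normr0.
have [c0 [e0 [e00 Hc]]] := near_phase h0P nG.
have [eU eU0 HU] : exists2 e, 0 < e & forall x, `|x - z0.1| < e -> U x.
  have /nbhs_ballP[e /= e1 He] := open_nbhs_nbhs (conj oU Uz0); exists e => // x xe.
  by apply: He; rewrite -ball_normE /= distrC.
(* Near [z0] the relay has one value, so the two phases cannot both accumulate at a point there. *)
have rho_gt0 : (0 < rho0)%E.
  apply: (dist_p_gt0 e00) => w wz _ [s1 [s2 [_ hs HG]]].
  have [[cl1 _] [cl2 _]] : Gamma w by rewrite [w]surjective_pairing; exact: HG.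
  have d0 : 0 < e0 - `|w - z0| by rewrite subr_gt0.
  have in_ball w' : ball w (e0 - `|w - z0|) w' -> `|w' - z0| < e0.
    by rewrite -ball_normE /= distrC => h; have := ler_normD (w' - w) (w - z0); rewrite addrA subrK; clear -h; lra.
  have [w1 [[Q1 E1] B1]] := cl1 _ (nbhsx_ballx w _ d0).
  have [w2 [[Q2 E2] B2]] := cl2 _ (nbhsx_ballx w _ d0).
  by move: E1 E2; rewrite (Hc _ Q1 (in_ball _ B1)) (Hc _ Q2 (in_ball _ B2)) => ->; clear; lra.
have eps_gt0 : (0 < eps)%E.
  apply: (@dist_p_gt0 _ _ _ _ (Num.min eU z0.2)); first by rewrite lt_min eU0.
  move=> w; rewrite lt_min => /andP[w1 w2] wt [[_ nI] _]; apply: nI.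
  have dw1 := le_lt_trans (normV1 (w - z0)) w1; have := le_lt_trans (normV2 (w - z0)) w2.
  rewrite /= ltr_norml => /andP[w3 _].
  have d0 : 0 < Num.min (eU - `|w.1 - z0.1|) (Num.min w.2 (z0.2 - w.2)) by rewrite !lt_min !subr_gt0 dw1 wt andbT /=; clear -w3; lra.
  apply/nbhs_ballP; exists (Num.min (eU - `|w.1 - z0.1|) (Num.min w.2 (z0.2 - w.2))) => // w'.
  rewrite -ball_normE /= distrC !lt_min => /and3P[a1 a2 a3].
  have := le_lt_trans (normV1 (w' - w)) a1; have := le_lt_trans (normV2 (w' - w)) a2; have := le_lt_trans (normV2 (w' - w)) a3.
  rewrite /= !ltr_norml => /andP[x1 x2] /andP[x3 x4] h; split; last by clear -x1 x2 x3 x4 t0T; apply/andP; split; lra.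
  by apply: HU; have := ler_normD (w'.1 - w.1) (w.1 - z0.1); rewrite addrA subrK; clear -h; lra.
have [hr1 hr2] := half_radiusP rho_gt0; have [he1 he2] := half_radiusP eps_gt0.
pose m := Num.min (Num.min (half_radius rho0) (half_radius eps)) 1.
have m0 : 0 < m by rewrite !lt_min hr1 he1 ltr01.
have m1 : m <= 1 by rewrite ge_min lexx orbT.
have mrho : (m%:E < rho0)%E by apply: le_lt_trans hr2; rewrite lee_fin !ge_min lexx.
have meps : (m%:E < eps)%E by apply: le_lt_trans he2; rewrite lee_fin !ge_min lexx orbT.
pose r := radius rho0 eps; have r8 : 8 * r = m / n%:R by rewrite /r /radius -/m; field; rewrite gt_eqF.
have mn : m / n%:R <= m by rewrite ler_pdivrMr// ler_peMr ?ler1n// ltW.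
have mn0 : 0 < m / n%:R by rewrite divr_gt0.
have r0 : 0 < r by clear -r8 mn0; lra.
have r1 : r <= 1 by clear -r8 mn m1 r0; lra.
have boxc y : Bx (m / n%:R) y -> backward_cylinder m z0 (y + z0).
  move=> [y1 /andP[y2 y3]]; split; first by rewrite /= addrK; apply: norm2_sup => //; exact: ltW.
  have mm : (m / n%:R) ^+ 2 <= m ^+ 2 by rewrite ler_pXn2r ?nnegrE//; exact: ltW.
  by rewrite /=; move: (m ^+ 2) ((m / n%:R) ^+ 2) mm y2 y3; clear => a b ab' y2 y3; apply/andP; split; lra.
have boxD := box_inside oU Qz0 mn0 (fun y yB => dist_p_disjoint m0 meps (boxc y yB)).
have toBx t : Bx 8 t -> exists2 y, Bx (m / n%:R) y & affV r (r ^+ 2) z0 t = y + z0.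
  move=> [t1 /andP[t2 t3]]; exists (r *: t.1, r ^+ 2 * t.2); last by apply: injective_projections.
  have r20 : 0 < r ^+ 2 by rewrite exprn_gt0.
  rewrite -r8; split => /=; first by rewrite normrZ gtr0_norm// mulrC ltr_pM2r.
  by rewrite pmulr_rlt0// t3 andbT exprMn mulrC -mulrN ltr_pM2l.
have ucont w e : Q w -> 0 < e -> exists2 d, 0 < d & forall w', Q w' -> `|w' - w| < d -> `|u w' - u w| <= e.
  exact: within_cont.
have cc (w : 'rV[R]_n * R) : U w.1 /\ 0 < w.2 < T -> ccont ut w.
  move=> [Uw /andP[w0 wT]] e ep; have Qw : Q w by split => //; rewrite w0 ltW.
  have [d d0 Hd] := ucont w e Qw ep; have /nbhs_ballP[d' /= d'0 dU] := open_nbhs_nbhs (conj oU Uw).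
  exists (Num.min (Num.min d d') (Num.min w.2 (T - w.2))); first by rewrite !lt_min d0 d'0 w0 subr_gt0.
  move=> h; rewrite !lt_min => /andP[/andP[h1 h2] /andP[h3 h4]].
  have Qh : Q (w + h).
    split; first by apply: dU; rewrite -ball_normE /= opprD addrA subrr add0r normrN; apply: le_lt_trans h2; exact: normV1.
    have := le_lt_trans (normV2 h) h3; have := le_lt_trans (normV2 h) h4.
    by rewrite /= !ltr_norml => /andP[x1 x2] /andP[x3 x4]; clear -x1 x2 x3 x4; apply/andP; split; lra.
  by rewrite !utE//; apply: Hd => //; rewrite addrAC subrr add0r.
have lc (w : 'rV[R]_n * R) : Q w -> lcont ut w.
  move=> Qw e ep; have [Uw /andP[w0 wT]] := Qw.
  have [d d0 Hd] := ucont w e Qw ep; have /nbhs_ballP[d' /= d'0 dU] := open_nbhs_nbhs (conj oU Uw).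
  exists (Num.min (Num.min d d') w.2); first by rewrite !lt_min d0 d'0 w0.
  move=> h; rewrite !lt_min => /andP[/andP[h1 h2] h3] h20.
  have Qh : Q (w + h).
    split; first by apply: dU; rewrite -ball_normE /= opprD addrA subrr add0r normrN; apply: le_lt_trans h2; exact: normV1.
    have := le_lt_trans (normV2 h) h3.
    by rewrite /= !ltr_norml => /andP[x1 x2]; clear -x1 x2 h20 wT; apply/andP; split; lra.
  by rewrite !utE//; apply: Hd => //; rewrite addrAC subrr add0r.
case: (cid _) => C HC; rewrite [sval _]/=; have D0 : 0 < beta - alpha by rewrite subr_gt0.
have [||K HK] := HC r0 r1 M0 D0 U T alpha beta h0 u ut g z0 c0 e0 erefl h0P utE utM W ae cc _ _ e00 Hc.
- by move=> t /toBx[y yB ->]; exact: boxD.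
- by move=> t /toBx[y yB ->]; apply: (dist_p_disjoint m0 mrho); exact: boxc.
(* On the top the distance to [T] is no constraint, hence the default 1. *)
pose b := Num.min (Num.min eU e0) (Num.min z0.2 (if z0.2 < T then T - z0.2 else 1)).
have b0 : 0 < b by rewrite !lt_min eU0 e00 t00 /=; case: ifPn => [|_]; rewrite ?subr_gt0 ?ltr01.
have [bU be bt bT] : [/\ b <= eU, b <= e0, b <= z0.2 & z0.2 < T -> b <= T - z0.2].
  by split; rewrite /b ?ge_min ?lexx ?orbT// => ->; rewrite lexx !orbT.
(* One more than [64 = 8^2], the time extent of [Bx 8], so that the inequalities are strict. *)
have [K' HK'] := @rj_small R (b / 65) ltac:(by rewrite divr_gt0).
pose k := maxn K K'; pose l := r * rj k; have rk0 := @rj_gt0 R k; have rk1 := @rj_le1 R k.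
have l0 : 0 < l by rewrite mulr_gt0.
have lb : 65 * l <= b.
  have h := HK' k (leq_maxr _ _); have lk : l <= 1 * rj k := ler_wpM2r (ltW rk0) r1.
  by move: h; rewrite ler_pdivlMr//; clear -lk; lra.
have l1 : l <= 1 := mulr_ile1 (ltW r0) (ltW rk0) r1 rk1.
have l2 : l ^+ 2 <= l by rewrite expr2 ler_piMr// ltW.
have HPP i j : `|PP kap (zm l z0 ut) i j| <= `|C|.
  by apply: le_trans (ler_norm C); apply: HK; exact: leq_maxl.
apply: (local_derivatives (e0 := e0) (l := l) Qz0 utE W ae lc Hc) => //.
- by move=> x xl; apply: HU; apply: le_lt_trans xl _; clear -lb bU l0; lra.
- by clear -lb bt l0 l2; lra.
- by move=> /bT; clear -lb l0 l2; lra.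
- by clear -lb be l0; lra.
- by clear -lb be l0 l2; lra.
Qed.
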